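(* Let $\mu$ be the normalized volume measure on the torus $\mathbb T^2$. For all $k=(i,j)\in\mathbb Z^2$ with sufficiently large $|i|,|j|$, $$\mathsf{Ric}_\mu(e_k,e_k):=\|e_k\|^2_{H^1(\mu)}\cdot\lim_{L\to\infty}\sum_{\ell\in\mathbb Z^2,\ |\ell|\le L,\ \ell\ne k}\mathsf{Sec}_\mu(e_k,e_\ell)=+\infty.$$
   Context: $M=\mathbb T^2=(\mathbb R/2\pi\mathbb Z)^2$ with the flat metric and distance $d$, $d\mu=(2\pi)^{-2}dx$. Fourier basis: $e_k(x)=e_{k_1}(x_1)e_{k_2}(x_2)$ for $k\in\mathbb Z^2$, where for $j\in\mathbb Z$: $e_j(y)=\sqrt2\cos(jy)$ if $j>0$, $\sqrt2\sin(jy)$ if $j<0$, $1$ if $j=0$. $|\ell|$ is the Euclidean norm. $\mathcal M_0(M)$ is the set of finite Borel measures on $M$. Cone: $C=(M\times[0,\infty))/\!\sim$, where $(x,r)\sim(x',r')$ iff they are equal or $r=r'=0$, with metric $d_C((x,r),(x',r'))^2=r^2+r'^2-2rr'\cos(\min(d(x,x'),\pi))$. $\mathcal M_2(C)$ (resp. $\mathcal M_2(C\times C)$) is the set of Borel measures integrating $1+$ squared distance to a fixed point. For $\nu\in\mathcal M_2(C)$: $\Pr(\nu)(A)=\int_{A\times[0,\infty)}r^2\,d\nu(x,r)$. With $\pi_0,\pi_1$ the projections of $C\times C$, $\mathsf{HK}(\mu_0,\mu_1)=\inf\{\int d_C^2\,dq: q\in\mathcal M_2(C\times C),\ \Pr((\pi_i)_*q)=\mu_i,\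 i=0,1\}^{1/2}$. For $r>0$, $s>-r$, $|v|<(1+s/r)\pi/2$: $\exp^C_{(x,r)}(v,s)=\big(\exp^M_x(\arctan(\tfrac{r|v|}{r+s})\tfrac{v}{|v|}),\sqrt{(r+s)^2+r^2|v|^2}\big)$ (first component $x$ if $v=0$). $r_\mu=\sqrt{\mu(M)}$, $\hat\mu=\frac1{r_\mu^2}\mu\otimes\delta_{r_\mu}$, $\exp_\mu(\varphi)=\Pr(\exp^C((\nabla\varphi,2r\varphi))_*\hat\mu)$. $\|\varphi\|^2_{H^1(\mu)}=\int(|\nabla\varphi|^2+4\varphi^2)d\mu$ with corresponding inner product; $\Lambda=\|\varphi\|^2_{H^1(\mu)}\|\psi\|^2_{H^1(\mu)}-\langle\varphi,\psi\rangle^2_{H^1(\mu)}$. $\lim^{*}_{s,t\to0}G(s,t)=a$ means $G(s_j,t_j)\to a$ whenever $s_j,t_j\to0$ in $(0,\infty)$ with $\sup_j(s_j/t_j+t_j/s_j)<\infty$. $$\mathsf{Sec}_\mu(\varphi,\psi)=\lim^{*}_{s,t\to0}\tfrac{3}{\Lambda s^2t^2}\big[\|s\varphi-t\psi\|^2_{H^1(\mu)}-\mathsf{HK}^2(\exp_\mu(s\varphi),\exp_\mu(t\psi))\big].$$ *)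

(* Defs.v *)
From HB Require Import structures.
From mathcomp Require Import all_boot all_order all_algebra.
From mathcomp Require Import generic_quotient ring_quotient archimedean.
From mathcomp Require Import all_classical all_reals all_analysis.
From mathcomp Require Import measurable_realfun.

Set Implicit Arguments.
Unset Strict Implicit.
Unset Printing Implicit Defensive.
Import Order.TTheory GRing.Theory Num.Theory.
Import numFieldNormedType.Exports.

Local Open Scope classical_set_scope.
Local Open Scope ring_scope.
Local Open Scope quotient_scope.

Definition enorm (R : realType) (v : R * R) : R :=
  Num.sqrt (v.1 ^+ 2 + v.2 ^+ 2).

Definition edot (R : realType) (v w : R * R) : R := v.1 * w.1 + v.2 * w.2.

Definition metric_open (R : realType) (T : Type) (dist : T -> T -> R) :
    set (set T) :=
  [set U | forall x, U x ->
     exists2 e : R, 0 < e & forall y, dist x y < e -> U y].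

Definition lattice (R : realType) : {pred R} :=
  fun x => x / (2 * pi) \is a Num.int.

Fact lattice_zmod_closed (R : realType) : zmod_closed (@lattice R).
Proof.
have E x : (x \in @lattice R) = (x / (2 * pi) \is a Num.int) by [].
split=> [|x y]; rewrite !E ?mul0r ?rpred0// mulrBl => xZ yZ.
exact: rpredB.
Qed.

HB.instance Definition _ (R : realType) :=
  GRing.isZmodClosed.Build R (@lattice R) (lattice_zmod_closed R).

Definition circle (R : realType) : Type := Quotient.quot (@lattice R).

HB.instance Definition _ (R : realType) := GRing.Zmodule.on (circle R).
HB.instance Definition _ (R : realType) := isPointed.Build (circle R) 0.

Definition to_circle {R : realType} (t : R) : circle R :=
  \pi_(Quotient.quot (@lattice R)) t.

Definition circle_rep {R : realType} (x : circle R) : R :=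
  @repr _ (Quotient.quot (@lattice R)) x.

Definition dist_circle {R : realType} (x y : circle R) : R :=
  inf [set `|t| | t in [set t : R | to_circle t = x - y]].

HB.instance Definition _ (R : realType) :=
  @isMeasurable.Build (sigma_display (metric_open (@dist_circle R)))
    (circle R) <<s metric_open (@dist_circle R) >>
    (@sigma_algebra0 _ setT _) (@sigma_algebraC _ _)
    (@sigma_algebra_bigcup _ setT _).

Fact dist_to_circle_le (R : realType) (s t : R) :
  dist_circle (to_circle s) (to_circle t) <= `|s - t|.
Proof.
apply: ge_inf; first by exists 0 => _ [u _ <-].
exists (s - t) => //; rewrite /= /to_circle.
exact: (raddfB (\pi_(Quotient.quot (@lattice R)))).
Qed.

Fact measurable_to_circle (R : realType) :
  measurable_fun [set: R] (@to_circle R).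
Proof.
apply: measurability; first by reflexivity.
move=> _ [U oU <-]; rewrite setTI; apply: open_measurable.
rewrite openE => s /oU[e e0 eU]; exists e => //= t /= st.
by apply: eU; exact: le_lt_trans (dist_to_circle_le _ _) st.
Qed.

Definition circle_vol (R : realType) : set (circle R) -> \bar R :=
  fun A => (((2 * pi)^-1)%:E *
    lebesgue_measure (to_circle @^-1` A `&` `[0%R, (2 * pi)%R[))%E.

Section circle_vol_probability.
Variable R : realType.

Let c_ge0 : 0 <= (2 * pi)^-1 :> R.
Proof. by rewrite invr_ge0 mulr_ge0// pi_ge0. Qed.

Let mI : measurable (`[0%R, (2 * pi)%R[ : set R).
Proof. exact: measurable_itv. Qed.

Let m : {measure set (measurableTypeR R) -> \bar R} :=
  mscale (NngNum c_ge0) (mrestr lebesgue_measure mI).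

Let mpre (A : set (circle R)) : measurable A -> measurable (to_circle @^-1` A).
Proof. by move=> mA; rewrite -[X in measurable X]setTI; exact: measurable_to_circle. Qed.

Let vol0 : @circle_vol R set0 = 0%E.
Proof. exact: (measure0 m). Qed.

Let vol_ge0 A : (0 <= @circle_vol R A)%E.
Proof. exact: (measure_ge0 m (to_circle @^-1` A)). Qed.

Let vol_sigma_additive : semi_sigma_additive (@circle_vol R).
Proof.
move=> F mF tF mUF.
have tG : trivIset setT (fun n => to_circle @^-1` F n).
  apply/trivIsetP => i j _ _ ij; rewrite -preimage_setI.
  by move/trivIsetP : tF => /(_ _ _ I I ij) ->; rewrite preimage_set0.
have mU : measurable (\bigcup_n to_circle @^-1` F n).
  by rewrite -preimage_bigcup; exact: mpre.
have := measure_semi_sigma_additive (s := m) _ (fun n => mpre (mF n)) tG mU.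
by rewrite -preimage_bigcup.
Qed.

HB.instance Definition _ := isMeasure.Build _ _ _ (@circle_vol R)
  vol0 vol_ge0 vol_sigma_additive.

Let volT : circle_vol [set: circle R] = 1%E.
Proof.
rewrite /circle_vol preimage_setT setTI lebesgue_measure_itv/= lte_fin.
rewrite mulr_gt0// ?pi_gt0// -EFinB subr0 -EFinM mulVf//.
by rewrite gt_eqF// mulr_gt0// pi_gt0.
Qed.

HB.instance Definition _ :=
  Measure_isProbability.Build _ _ _ (@circle_vol R) volT.

End circle_vol_probability.

(* Since the circle is separable, the product sigma-algebra carried by this
   type is the Borel sigma-algebra of [dist_torus]. *)
Notation torus R := (circle R * circle R)%type.

Definition torus_vol (R : realType) : probability (torus R) R :=
  (@circle_vol R \x @circle_vol R)%E.

Definition dist_torus {R : realType} (x y : torus R) : R :=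
  enorm (dist_circle x.1 y.1, dist_circle x.2 y.2).

(* exp^M; all tangent spaces of the flat torus are identified with R^2. *)
Definition exp_torus {R : realType} (x : torus R) (v : R * R) : torus R :=
  (x.1 + to_circle v.1, x.2 + to_circle v.2).

Definition grad {R : realType} (phi : torus R -> R) (x : torus R) : R * R :=
  (derive1 (fun h : R => phi (exp_torus x (h, 0))) 0,
   derive1 (fun h : R => phi (exp_torus x (0, h))) 0).

Definition fourier1 (R : realType) (j : int) (y : circle R) : R :=
  if 0 < j then Num.sqrt 2 * cos (j%:~R * circle_rep y)
  else if j < 0 then Num.sqrt 2 * sin (j%:~R * circle_rep y)
  else 1.

Definition fourier (R : realType) (k : int * int) (x : torus R) : R :=
  fourier1 k.1 x.1 * fourier1 k.2 x.2.

Definition cone_rel {R : realType} (p q : torus R * {nonneg R}) : bool :=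
  (p == q) || (p.2%:num == 0) && (q.2%:num == 0).

Fact cone_rel_equiv (R : realType) : equiv_class_of (@cone_rel R).
Proof.
rewrite /cone_rel; split=> [p|p q|q p s]; first by rewrite eqxx.
- by rewrite eq_sym andbC.
- case: (eqVneq p q) => [->//|_] /= /andP[p0 q0].
  by case: (eqVneq q s) => [<-|_] /=; rewrite p0 ?q0 ?orbT//= => ->; rewrite orbT.
Qed.

Canonical cone_equiv (R : realType) := EquivRelPack (cone_rel_equiv R).

Definition cone (R : realType) : Type := {eq_quot (@cone_rel R)}.

HB.instance Definition _ (R : realType) := Choice.on (cone R).

Definition to_cone {R : realType} (p : torus R * {nonneg R}) : cone R :=
  \pi_({eq_quot (@cone_rel R)}) p.

Definition cone_rep {R : realType} (c : cone R) : torus R * {nonneg R} :=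
  @repr _ {eq_quot (@cone_rel R)} c.

Definition apex (R : realType) : cone R := to_cone (0, 0%:nng).

HB.instance Definition _ (R : realType) := isPointed.Build (cone R) (apex R).

(* The class of (x, r); only meaningful for 0 <= r. *)
Definition cone_pt {R : realType} (x : torus R) (r : R) : cone R :=
  to_cone (x, `|r|%:nng).

(* At the apex, [cone_base] is an arbitrary point. *)
Definition cone_base {R : realType} (c : cone R) : torus R := (cone_rep c).1.

Definition cone_radius {R : realType} (c : cone R) : R := (cone_rep c).2%:num.

Definition dist_cone {R : realType} (c c' : cone R) : R :=
  Num.sqrt (cone_radius c ^+ 2 + cone_radius c' ^+ 2
    - 2 * cone_radius c * cone_radius c' * cos (Num.min (dist_torus (cone_base c) (cone_base c')) pi)).

HB.instance Definition _ (R : realType) :=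
  @isMeasurable.Build (sigma_display (metric_open (@dist_cone R)))
    (cone R) <<s metric_open (@dist_cone R) >>
    (@sigma_algebra0 _ setT _) (@sigma_algebraC _ _)
    (@sigma_algebra_bigcup _ setT _).

(* The product sigma-algebra of [cone R * cone R] is the Borel one, since the
   cone is separable. *)
Definition dist_cone2 {R : realType} (p q : cone R * cone R) : R :=
  enorm (dist_cone p.1 q.1, dist_cone p.2 q.2).

(* Total extension of exp^C, whose domain is 0 < cone_radius c, - cone_radius c < s and
   enorm v < (1 + s / cone_radius c) * pi / 2.  For v = 0 the point of the torus is
   unchanged, since the coefficient of v is 0 / 0 = 0. *)
Definition exp_cone {R : realType} (c : cone R) (v : R * R) (s : R) : cone R :=
  let r := cone_radius c in
  let n := enorm v in
  cone_pt (exp_torus (cone_base c) ((atan (r * n / (r + s)) / n) *: v))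
          (Num.sqrt ((r + s) ^+ 2 + r ^+ 2 * n ^+ 2)).

Definition second_moment {R : realType} {d : measure_display}
    {T : measurableType d} (dist : T -> T -> R) (m : set T -> \bar R) : Prop :=
  exists o : T, (\int[m]_x (1 + dist x o ^+ 2)%:E < +oo)%E.

(* Measures on the cone and on the torus are passed as bare set functions: only
   their values on Borel sets matter, and no measurability proof is then needed
   to form the push-forwards below. *)
Definition Pr {R : realType} (nu : set (cone R) -> \bar R) :
    set (torus R) -> \bar R :=
  fun A => (\int[nu]_(c in [set to_cone p | p in [set p | A p.1]])
              (cone_radius c ^+ 2)%:E)%E.

Definition HK_plan {R : realType} (mu0 mu1 : set (torus R) -> \bar R)
    (q : {measure set (cone R * cone R) -> \bar R}) : Prop :=
  [/\ second_moment dist_cone2 q,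
      forall A, measurable A -> Pr (pushforward q fst) A = mu0 A
    & forall A, measurable A -> Pr (pushforward q snd) A = mu1 A].

Definition HK {R : realType} (mu0 mu1 : set (torus R) -> \bar R) : \bar R :=
  (ereal_inf [set \int[q]_p (dist_cone p.1 p.2 ^+ 2)%:E
             | q in [set q | HK_plan mu0 mu1 q]] `^ 2^-1)%E.

Definition mass_radius {R : realType}
    (mu : {finite_measure set (torus R) -> \bar R}) : R :=
  Num.sqrt (fine (mu setT)).

(* The image on the cone of the measure r_mu^-2 mu (x) delta_(r_mu). *)
Definition mu_hat {R : realType}
    (mu : {finite_measure set (torus R) -> \bar R}) : set (cone R) -> \bar R :=
  fun B => ((mass_radius mu ^- 2)%:E *
    pushforward (mu \x \d_(mass_radius mu)) (fun p : torus R * R => cone_pt p.1 p.2) B)%E.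

Definition exp_mu {R : realType}
    (mu : {finite_measure set (torus R) -> \bar R}) (phi : torus R -> R) :
    set (torus R) -> \bar R :=
  Pr (pushforward (mu_hat mu) (fun c =>
        exp_cone c (grad phi (cone_base c)) (2 * cone_radius c * phi (cone_base c)))).

Definition H1_dot {R : realType}
    (mu : {finite_measure set (torus R) -> \bar R}) (phi psi : torus R -> R) : R :=
  \int[mu]_x (edot (grad phi x) (grad psi x) + 4 * phi x * psi x).

Definition H1_normsq {R : realType}
    (mu : {finite_measure set (torus R) -> \bar R}) (phi : torus R -> R) : R :=
  \int[mu]_x (enorm (grad phi x) ^+ 2 + 4 * phi x ^+ 2).

Definition Gram {R : realType}
    (mu : {finite_measure set (torus R) -> \bar R}) (phi psi : torus R -> R) : R :=
  H1_normsq mu phi * H1_normsq mu psi - H1_dot mu phi psi ^+ 2.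

Definition lim_star {R : realType} (G : R -> R -> \bar R) (a : R) : Prop :=
  forall s t : R^nat,
    (forall j, 0 < s j) -> (forall j, 0 < t j) ->
    s @ \oo --> 0 -> t @ \oo --> 0 ->
    (exists B : R, forall j, s j / t j + t j / s j <= B) ->
    G (s j) (t j) @[j --> \oo] --> a%:E.

Definition Sec_quotient {R : realType}
    (mu : {finite_measure set (torus R) -> \bar R}) (phi psi : torus R -> R)
    (s t : R) : \bar R :=
  ((3 / (Gram mu phi psi * s ^+ 2 * t ^+ 2))%:E *
   ((H1_normsq mu (fun x => s * phi x - t * psi x)%R)%:E
    - HK (exp_mu mu (fun x => s * phi x)%R) (exp_mu mu (fun x => t * psi x)%R) ^+ 2))%E.

Definition Sec_exists {R : realType}
    (mu : {finite_measure set (torus R) -> \bar R}) (phi psi : torus R -> R) : Prop :=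
  exists a : R, lim_star (Sec_quotient mu phi psi) a.

(* The junk value 0 when [Sec_exists] fails. *)
Definition Sec {R : realType}
    (mu : {finite_measure set (torus R) -> \bar R}) (phi psi : torus R -> R) : R :=
  xget 0 [set a : R | lim_star (Sec_quotient mu phi psi) a].

Definition Sec_sum {R : realType}
    (mu : {finite_measure set (torus R) -> \bar R}) (k : int * int) (L : R) : R :=
  \sum_(l \in [set l : int * int |
                enorm (l.1%:~R, l.2%:~R) <= L /\ l != k])
     Sec mu (@fourier R k) (@fourier R l).

Definition Ric {R : realType}
    (mu : {finite_measure set (torus R) -> \bar R}) (k : int * int) : \bar R :=
  ((H1_normsq mu (@fourier R k))%:E *
   lim ((Sec_sum mu k L)%:E @[L --> +oo%R]))%E.

(* Main.v *)
Require Import Defs.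
From HB Require Import structures.
From mathcomp Require Import all_boot all_order all_algebra.
From mathcomp Require Import generic_quotient ring_quotient archimedean.
From mathcomp Require Import all_classical all_reals all_analysis.
From mathcomp Require Import measurable_realfun zify ring lra.

Import Order.TTheory GRing.Theory Num.Theory.
Import numFieldNormedType.Exports.
Local Open Scope classical_set_scope.
Local Open Scope ring_scope.

Set Implicit Arguments.
Unset Strict Implicit.
Unset Printing Implicit Defensive.

(* Let phi and psi be trigonometric polynomials, D^2 the Hessian, <.> the mean
   over the torus, and Z = D^2 psi (grad phi) - D^2 phi (grad psi).  Coupling
   the mass that exp(s phi) moves from x with the mass that exp(t psi) moves
   from x + s t W(x), where W - grad (div W) / 4 = Z / 2, bounds HK^2 from above
   (the displacement is realized by two shears, so that its Jacobian is
   explicit).  The dual pair (exp A, exp b), with A a polynomial in s and t and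
   - b an approximation of the c-transform of A, bounds it from below, and the
   two bounds differ by O((s + t)^5).  This gives
     Gram * Sec = (3 / 2) <W.Z> - <(grad phi /\ grad psi)^2>.
   As W minimizes a quadratic functional, test fields bound <W.Z> from below:
   the rotated gradient of curl Z, or, when |p^2 - q^2| and |i^2 - j^2| are
   small compared with |l|^2 and |k|^2 (l = (p, q)), the gradient of
   grad phi . grad psi.  For |i|, |j| >= 10 the outcome is Sec(e_k, e_l) >= 1/32
   as soon as |l| is large, so that the sum diverges. *)

(** The quotient divides by s^2 t^2, so HK^2 is needed up to fifth order, uniformly on the torus.
    Trigonometric polynomials make this symbolic: they are stable under products, derivatives and
    the inverse of 1 - Laplacian / 4, and their mean is a coefficient. The plan must have exactly
    the prescribed marginals; thanks to the explicit Jacobian, the low-order terms at the displaced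
    point are integrated exactly, by a change of variables, and not expanded. The potentials are
    needed to second order only, because the duality gap is the square of a defect of order three
    plus a term of order six. Optimality along the plan means two balances: that of mass gives the
    coefficient div W / 2 - grad phi . grad psi of s t in A, and then that of displacement gives the
    equation for W. The bound 10 yields i^2 j^2 >= 50 (i^2 + j^2) and i^2 + j^2 >= 200, with which
    the curl term beats the negative term whenever |p^2 - q^2| or |i^2 - j^2| is not small. *)

(** * Elementary Taylor inequalities for sine, cosine, tangent and the exponential *)

Lemma nonneg_of_derive (R : realType) (f f' : R -> R) (c : R) :
  (forall x : R, is_derive x (1 : R) f (f' x)) -> 0 <= f 0 ->
  (forall x, 0 <= x <= c -> 0 <= f' x) -> forall x, 0 <= x <= c -> 0 <= f x.
Proof.
move=> df f0 f'0 x /andP[x0 xc].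
have [y] := @MVT_segment R f f' 0 x x0 (fun y _ => df y)
  (derivable_within_continuous (fun y _ => @ex_derive _ _ _ _ _ _ _ (df y))).
rewrite in_itv/= subr0 => /andP[y0 yx] E.
rewrite -(subrK (f 0) (f x)) E addr_ge0// mulr_ge0// f'0// y0/=.
exact: le_trans yx xc.
Qed.

Section sin_cos_taylor.
Variable R : realType.
Implicit Types x y : R.

(** Bounds on the whole half line take c = x; the tangent bounds stop at c = pi / 2, which is why
    [nonneg_of_derive] works on a segment. *)
Let all_c (P : R -> Prop) :
  (forall c x, 0 <= x <= c -> P x) -> forall x, 0 <= x -> P x.
Proof. by move=> H x x0; apply: (H x); rewrite x0 lexx. Qed.

(** Each bound of this alternating chain, up to [cos_ge6], follows from the previous one by
    integration from 0. *)
Lemma sin_le x : 0 <= x -> sin x <= x.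
Proof.
move: x; apply: all_c => c x xc; rewrite -subr_ge0.
move: x xc; apply: (@nonneg_of_derive R _ (fun x => 1 - cos x)) => [|x _].
- by rewrite sin0; lra.
- by rewrite subr_ge0 cos_le1.
Qed.

Lemma cos_ge2 x : 0 <= x -> 1 - x ^+ 2 / 2 <= cos x.
Proof.
move: x; apply: all_c => c x xc; rewrite -subr_ge0.
move: x xc.
apply: (@nonneg_of_derive R _ (fun x => x - sin x)) => [x||x /andP[x0 _]].
- by apply: is_derive_eq; rewrite /GRing.scale/=; lra.
- by rewrite cos0; lra.
- by rewrite subr_ge0 sin_le.
Qed.

Lemma sin_ge3 x : 0 <= x -> x - x ^+ 3 / 6 <= sin x.
Proof.
move: x; apply: all_c => c x xc; rewrite -subr_ge0.
move: x xc.
apply: (@nonneg_of_derive R _ (fun x => cos x - (1 - x ^+ 2 / 2)))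
  => [x||x /andP[x0 _]].
- by apply: is_derive_eq; rewrite /GRing.scale/=; lra.
- by rewrite sin0; lra.
- by rewrite subr_ge0 cos_ge2.
Qed.

Lemma cos_le4 x : 0 <= x -> cos x <= 1 - x ^+ 2 / 2 + x ^+ 4 / 24.
Proof.
move: x; apply: all_c => c x xc; rewrite -subr_ge0.
move: x xc.
apply: (@nonneg_of_derive R _ (fun x => sin x - (x - x ^+ 3 / 6)))
  => [x||x /andP[x0 _]].
- by apply: is_derive_eq; rewrite /GRing.scale/=; lra.
- by rewrite cos0; lra.
- by rewrite subr_ge0 sin_ge3.
Qed.

Lemma sin_le5 x : 0 <= x -> sin x <= x - x ^+ 3 / 6 + x ^+ 5.
Proof.
move: x; apply: all_c => c x xc; rewrite -subr_ge0.
move: x xc.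
apply: (@nonneg_of_derive R _ (fun x => 1 - x ^+ 2 / 2 + 5 * x ^+ 4 - cos x))
  => [x||x /andP[x0 _]].
- by apply: is_derive_eq; rewrite /GRing.scale/=; lra.
- by rewrite sin0; lra.
- by have := cos_le4 x0; have := exprn_ge0 4 x0; lra.
Qed.

Lemma cos_ge6 x :
  0 <= x -> 1 - x ^+ 2 / 2 + x ^+ 4 / 24 - x ^+ 6 <= cos x.
Proof.
move: x; apply: all_c => c x xc; rewrite -subr_ge0.
move: x xc.
apply: (@nonneg_of_derive R _ (fun x => x - x ^+ 3 / 6 + 6 * x ^+ 5 - sin x))
  => [x||x /andP[x0 _]].
- by apply: is_derive_eq; rewrite /GRing.scale/=; lra.
- by rewrite cos0; lra.
- by have := sin_le5 x0; have := exprn_ge0 5 x0; lra.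
Qed.

(** Squared distances are polynomial in the displacements while distances are not, so the cosine is
    expanded as a smooth function of q = d^2. *)
Lemma cos_sqrt_taylor q : 0 <= q :> R ->
  `|cos (Num.sqrt q) - (1 - q / 2 + q ^+ 2 / 24)| <= q ^+ 3.
Proof.
move=> q0; set x := Num.sqrt q.
have x0 : 0 <= x by exact: sqrtr_ge0.
have -> : q = x ^+ 2 by rewrite sqr_sqrtr.
have := cos_le4 x0; have := cos_ge6 x0; rewrite -!exprM !muln2/=.
have : 0 <= x ^+ 6 by rewrite exprn_ge0.
by rewrite ler_norml => *; apply/andP; split; lra.
Qed.

Lemma abs_sin_le x : `|sin x| <= `|x|.
Proof.
wlog x0 : x / 0 <= x => [H|].
  have [/H//|x0] := leP 0 x.
  by rewrite -normrN -sinN -(normrN x); apply: H; rewrite oppr_ge0 ltW.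
rewrite (ger0_norm x0) ler_norml sin_le// andbT.
have [x1|x1] := leP x 1; last by apply: le_trans (sin_geN1 x); rewrite lerN2 ltW.
apply: le_trans (sin_ge3 x0); rewrite -subr_ge0 exprS.
have : x * x ^+ 2 <= x by apply: ler_piMr => //; rewrite expr_le1.
by lra.
Qed.

Lemma cos_taylor2 x h : `|cos (x + h) - cos x + sin x * h| <= h ^+ 2.
Proof.
have E y : `|cos y - 1| <= y ^+ 2 / 2.
  wlog y0 : y / 0 <= y => [H|].
    have [/H//|y0] := leP 0 y.
    by rewrite -cosN -sqrrN; apply: H; rewrite oppr_ge0 ltW.
  have := cos_ge2 y0; have := cos_le1 y; have := sqr_ge0 y.
  by rewrite ler_norml => *; apply/andP; split; lra.
have F y : `|y - sin y| <= y ^+ 2 / 2.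
  wlog y0 : y / 0 <= y => [H|].
    have [/H//|y0] := leP 0 y.
    rewrite -normrN opprB -[X in X <= _](_ : `|- y - sin (- y)| = _).
      by rewrite -sqrrN; apply: H; rewrite oppr_ge0 ltW.
    by rewrite sinN opprK addrC.
  rewrite ger0_norm ?subr_ge0 ?sin_le//.
  have [y3|y3] := leP y 3.
    have := sin_ge3 y0; rewrite exprS => A.
    have : y * y ^+ 2 <= 3 * y ^+ 2 by rewrite ler_wpM2r// sqr_ge0.
    by lra.
  have := sin_geN1 y; have : 3 * y <= y ^+ 2 by rewrite expr2 ler_wpM2r// ltW.
  by lra.
rewrite cosD.
have -> : cos x * cos h - sin x * sin h - cos x + sin x * h =
  cos x * (cos h - 1) + sin x * (h - sin h) by ring.
apply: le_trans (ler_normD _ _) _; rewrite !normrM (splitr (h ^+ 2)).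
have c1 : `|cos x| <= 1 by rewrite ler_norml cos_geN1 cos_le1.
have s1 : `|sin x| <= 1 by rewrite ler_norml sin_geN1 sin_le1.
by rewrite lerD// -[leRHS]mul1r ler_pM.
Qed.

Lemma cos_lipschitz x h : `|cos (x + h) - cos x| <= `|h|.
Proof.
have -> : cos (x + h) - cos x = (- 2 * sin (h / 2)) * sin (x + h / 2).
  have E1 : x + h = (x + h / 2) + h / 2 by lra.
  have E2 : x = (x + h / 2) - h / 2 by lra.
  by rewrite {1}E1 {2}E2 cosD cosB; lra.
rewrite normrM -[leRHS]mulr1 ler_pM//; last by rewrite ler_norml sin_geN1 sin_le1.
rewrite normrM normrN (ger0_norm (ler0n _ 2)).
have := abs_sin_le (h / 2); rewrite normrM (@gtr0_norm _ (2^-1)) ?invr_gt0//.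
by lra.
Qed.

(* [(x + x^3/3) cos x <= sin x] is the bound [tan x >= x + x^3/3]. *)
Lemma tan_lower x : 0 <= x <= pi / 2 -> (x + x ^+ 3 / 3) * cos x <= sin x.
Proof.
have H1 y : 0 <= y <= pi / 2 -> 0 <= sin y - y * cos y.
  move: y; apply: (@nonneg_of_derive R _ (fun y => y * sin y)) => [y||y].
  - by apply: is_derive_eq; rewrite /GRing.scale/=; lra.
  - by rewrite sin0; lra.
  - move=> /andP[y0 yp]; rewrite mulr_ge0// sin_ge0_pi// y0/=.
    by apply: (le_trans yp); have := pi_ge0 R; lra.
move=> xp; rewrite -subr_ge0; move: x xp.
apply: (@nonneg_of_derive R _
  (fun x => x * ((sin x - x * cos x) + x ^+ 2 / 3 * sin x))) => [x||x xp].
- by apply: is_derive_eq; rewrite /GRing.scale/=; lra.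
- by rewrite sin0; lra.
- have := xp => /andP[x0 x2]; rewrite mulr_ge0// addr_ge0 ?H1//.
  rewrite mulr_ge0 ?divr_ge0 ?sqr_ge0// sin_ge0_pi// x0/=.
  by apply: (le_trans x2); have := pi_ge0 R; lra.
Qed.

(** The logarithmic derivative of cos is - tan, and tan x >= x + x^3 / 3. The exponent is half of
    [nq (x ^+ 2)]: this is the inequality that makes the dual pair admissible up to distance pi /
    2. *)
Lemma cos_le_gauss x : 0 <= x <= pi / 2 ->
  cos x <= expR (- (x ^+ 2 / 2 + x ^+ 4 / 12)).
Proof.
move=> xp; rewrite expRN -[leRHS]mul1r ler_pdivlMr ?expR_gt0// -subr_ge0.
move: x xp.
apply: (@nonneg_of_derive R _ (fun x => expR (x ^+ 2 / 2 + x ^+ 4 / 12) *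
  (sin x - (x + x ^+ 3 / 3) * cos x))) => [x||x xp].
- by apply: is_derive_eq; rewrite /GRing.scale/=; lra.
- by rewrite cos0 !expr0n/= !mul0r addr0 expR0; lra.
- by rewrite mulr_ge0 ?expR_ge0// subr_ge0 tan_lower.
Qed.

Lemma expRN_le2 y : 0 <= y -> expR (- y) <= 1 - y + y ^+ 2 / 2.
Proof.
move: y; apply: all_c => c x xc; rewrite -subr_ge0.
move: x xc.
apply: (@nonneg_of_derive R _ (fun x => expR (- x) - (1 - x)))
  => [x||x /andP[x0 _]].
- by apply: is_derive_eq; rewrite /GRing.scale/=; lra.
- by rewrite oppr0 expR0; lra.
- by have := expR_ge1Dx (- x); lra.
Qed.

Lemma expRN_ge3 y : 0 <= y -> 1 - y + y ^+ 2 / 2 - y ^+ 3 / 6 <= expR (- y).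
Proof.
move: y; apply: all_c => c x xc; rewrite -subr_ge0.
move: x xc.
apply: (@nonneg_of_derive R _ (fun x => (1 - x + x ^+ 2 / 2) - expR (- x)))
  => [x||x /andP[x0 _]].
- by apply: is_derive_eq; rewrite /GRing.scale/=; lra.
- by rewrite oppr0 expR0; lra.
- by rewrite subr_ge0 expRN_le2.
Qed.

Lemma expR_ge2 y : 0 <= y -> 1 + y + y ^+ 2 / 2 <= expR y.
Proof.
move: y; apply: all_c => c x xc; rewrite -subr_ge0.
move: x xc.
apply: (@nonneg_of_derive R _ (fun x => expR x - (1 + x)))
  => [x||x /andP[x0 _]].
- by apply: is_derive_eq; rewrite /GRing.scale/=; lra.
- by rewrite expR0; lra.
- by rewrite subr_ge0 expR_ge1Dx.
Qed.

Lemma expR_taylor2 y : `|y| <= 1 ->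
  `|expR y - (1 + y + y ^+ 2 / 2)| <= `|y| ^+ 3.
Proof.
move=> y1; have [y0|y0] := leP y 0.
  have A := expRN_le2 (y := - y); have B := expRN_ge3 (y := - y).
  rewrite oppr_ge0 y0 opprK sqrrN in A B.
  move: (A isT) (B isT); rewrite ler_norml ler0_norm// => {}A {}B.
  have : 0 <= (- y) ^+ 3 by rewrite exprn_ge0// oppr_ge0.
  by move=> C; apply/andP; split; lra.
rewrite (gtr0_norm y0) in y1 *.
have e1 := expRN_ge3 (ltW y0); have e2 := expRN_le2 (ltW y0).
have E : expR y * expR (- y) = 1 by rewrite -expRD subrr expR0.
have p := expR_gt0 y.
rewrite ler_norml; apply/andP; split.
  by have := expR_ge2 (ltW y0); have := exprn_ge0 3 (ltW y0); lra.
(* For 0 < y <= 1 the cubic upper bound comes from inverting the lower bound for exp (- y). *)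
have : expR y * (1 - y + y ^+ 2 / 2 - y ^+ 3 / 6) <= 1.
  by rewrite -[leRHS]E ler_wpM2l ?(ltW p).
set D := (_ - _ + _ - _) => HD.
have D0 : 0 < D by rewrite /D; nra.
have : expR y <= D^-1 by rewrite -[leRHS]mul1r ler_pdivlMr.
suff : D^-1 <= 1 + y + y ^+ 2 / 2 + y ^+ 3 by lra.
rewrite -[leLHS]mul1r ler_pdivrMr// /D -subr_ge0.
have -> : (1 + y + y ^+ 2 / 2 + y ^+ 3) * (1 - y + y ^+ 2 / 2 - y ^+ 3 / 6) - 1
  = y ^+ 3 * (5/6 - 11/12 * y + 5/12 * y ^+ 2 - y ^+ 3 / 6) by field.
by rewrite mulr_ge0 ?exprn_ge0 ?(ltW y0)//; nra.
Qed.
End sin_cos_taylor.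

(** * Trigonometric polynomials on R^2 *)

(* The list entry (c, m, n, a) stands for c * cos (m x + n y + a). *)
Definition tpoly (R : realType) : Type := seq (R * int * int * R).

Section tpoly.
Variable R : realType.
Implicit Types (p q : tpoly R) (u : R * int * int * R) (x y h k : R).

Definition tang u x y : R := u.1.1.2%:~R * x + u.1.2%:~R * y + u.2.
Definition tev p x y : R := \sum_(u <- p) u.1.1.1 * cos (tang u x y).

Definition tconst (c : R) : tpoly R := [:: (c, 0, 0, 0)].
Definition tadd p q : tpoly R := p ++ q.
Definition tscale (a : R) p : tpoly R :=
  [seq (a * u.1.1.1, u.1.1.2, u.1.2, u.2) | u <- p].
Definition tsub p q := tadd p (tscale (-1) q).
(** Product to sum: 2 cos a cos b = cos (a + b) + cos (a - b). *)
Definition tmul p q : tpoly R :=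
  [seq (u.1.1.1 * v.1.1.1 / 2, u.1.1.2 + v.1.1.2, u.1.2 + v.1.2, u.2 + v.2)
     | u <- p, v <- q] ++
  [seq (u.1.1.1 * v.1.1.1 / 2, u.1.1.2 - v.1.1.2, u.1.2 - v.1.2, u.2 - v.2)
     | u <- p, v <- q].
(** A quarter turn added to the phase turns cos into - sin, so no separate sine terms are needed. *)
Definition tD1 p : tpoly R :=
  [seq (u.1.1.1 * u.1.1.2%:~R, u.1.1.2, u.1.2, u.2 + pi / 2) | u <- p].
Definition tD2 p : tpoly R :=
  [seq (u.1.1.1 * u.1.2%:~R, u.1.1.2, u.1.2, u.2 + pi / 2) | u <- p].
(* The solution of (1 - Laplacian / 4) q = p. *)
Definition tsolve p : tpoly R :=
  [seq (u.1.1.1 / (1 + (u.1.1.2%:~R ^+ 2 + u.1.2%:~R ^+ 2) / 4),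
        u.1.1.2, u.1.2, u.2) | u <- p].
(** The constant Fourier coefficient; [torus_tmean] identifies it with the integral over the
    torus. *)
Definition tmean p : R :=
  \sum_(u <- p | (u.1.1.2 == 0) && (u.1.2 == 0)) u.1.1.1 * cos u.2.

Lemma tev_cons u p x y :
  tev (u :: p) x y = u.1.1.1 * cos (tang u x y) + tev p x y.
Proof. by rewrite /tev big_cons. Qed.

Lemma tev_const c x y : tev (tconst c) x y = c.
Proof. by rewrite /tev big_seq1/= /tang/= !mul0r !addr0 cos0 mulr1. Qed.

Lemma tev_add p q x y : tev (tadd p q) x y = tev p x y + tev q x y.
Proof. by rewrite /tev big_cat. Qed.

Lemma tev_scale a p x y : tev (tscale a p) x y = a * tev p x y.
Proof.
by rewrite /tev big_map mulr_sumr; apply: eq_bigr => u _; rewrite mulrA.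
Qed.

Lemma tev_sub p q x y : tev (tsub p q) x y = tev p x y - tev q x y.
Proof. by rewrite tev_add tev_scale mulN1r. Qed.

Lemma tev_mul p q x y : tev (tmul p q) x y = tev p x y * tev q x y.
Proof.
rewrite /tev/tmul big_cat !big_allpairs_dep/= -big_split/= mulr_suml.
apply: eq_bigr => u _; rewrite -big_split/= mulr_sumr.
apply: eq_bigr => v _; rewrite /tang/= !intrD !mulrNz.
set A := tang u x y; set B := tang v x y.
rewrite [X in cos X](_ : _ = A + B); last by rewrite /A /B /tang; ring.
rewrite [X in _ + _ * cos X](_ : _ = A - B); last by rewrite /A /B /tang; ring.
rewrite cosD cosB -/A -/B; set a := cos A; set b := cos B; set c := sin A * _.
rewrite -/(tang u x y) -/(tang v x y) -/A -/B -/a -/b; lra.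
Qed.

Let cos_quarter x : cos (x + pi / 2) = - sin x.
Proof. by rewrite cosD cos_pihalf sin_pihalf mulr0 sub0r mulr1. Qed.

Lemma is_derive_tev1 p x y :
  is_derive x (1 : R) (fun x => tev p x y) (tev (tD1 p) x y).
Proof.
elim: p => [|u p IH].
  rewrite /tev big_nil.
  by under eq_fun do rewrite big_nil; exact: is_derive_cst.
rewrite /= tev_cons (_ : (fun _ => _) = (fun z : R =>
  u.1.1.1 * cos (u.1.1.2%:~R * z + (u.1.2%:~R * y + u.2))) \+
  (fun z => tev p z y)).
  apply: is_deriveD => //; apply: is_derive_eq.
  rewrite /tang/= [X in cos X](_ : _ =
    (u.1.1.2%:~R * x + (u.1.2%:~R * y + u.2)) + pi / 2); last by ring.
  by rewrite cos_quarter /GRing.scale/=; ring.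
by apply/funext => z; rewrite tev_cons /tang /= !addrA.
Qed.

Lemma is_derive_tev2 p x y :
  is_derive y (1 : R) (fun y => tev p x y) (tev (tD2 p) x y).
Proof.
elim: p => [|u p IH].
  rewrite /tev big_nil.
  by under eq_fun do rewrite big_nil; exact: is_derive_cst.
rewrite /= tev_cons (_ : (fun _ => _) = (fun z : R =>
  u.1.1.1 * cos (u.1.2%:~R * z + (u.1.1.2%:~R * x + u.2))) \+
  (fun z => tev p x z)).
  apply: is_deriveD => //; apply: is_derive_eq.
  rewrite /tang/= [X in cos X](_ : _ =
    (u.1.2%:~R * y + (u.1.1.2%:~R * x + u.2)) + pi / 2); last by ring.
  by rewrite cos_quarter /GRing.scale/=; ring.
by apply/funext => z; rewrite tev_cons /tang /= addrCA addrA.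
Qed.

(** Different lists may represent the same function. The formal derivative depends on the function
    only, because it computes the analytic one. *)
Lemma tD1_ext p q : (forall x y, tev p x y = tev q x y) ->
  forall x y, tev (tD1 p) x y = tev (tD1 q) x y.
Proof.
move=> pq x y; have E : (fun x => tev p x y) = (fun x => tev q x y).
  by apply/funext => z; rewrite pq.
have dp := is_derive_tev1 p x y; have dq := is_derive_tev1 q x y.
rewrite E in dp.
by rewrite -(@derive_val _ _ _ _ _ _ _ dp) (@derive_val _ _ _ _ _ _ _ dq).
Qed.

Lemma tD2_ext p q : (forall x y, tev p x y = tev q x y) ->
  forall x y, tev (tD2 p) x y = tev (tD2 q) x y.
Proof.
move=> pq x y; have E : (fun y => tev p x y) = (fun y => tev q x y).
  by apply/funext => z; rewrite pq.
have dp := is_derive_tev2 p x y; have dq := is_derive_tev2 q x y.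
rewrite E in dp.
by rewrite -(@derive_val _ _ _ _ _ _ _ dp) (@derive_val _ _ _ _ _ _ _ dq).
Qed.

Lemma tD1_const c x y : tev (tD1 (tconst c)) x y = 0.
Proof. by rewrite /tev big_seq1/= mulr0 mul0r. Qed.

Lemma tD2_const c x y : tev (tD2 (tconst c)) x y = 0.
Proof. by rewrite /tev big_seq1/= mulr0 mul0r. Qed.

Lemma tD1_add p q x y :
  tev (tD1 (tadd p q)) x y = tev (tD1 p) x y + tev (tD1 q) x y.
Proof. by rewrite /tD1 map_cat tev_add. Qed.

Lemma tD2_add p q x y :
  tev (tD2 (tadd p q)) x y = tev (tD2 p) x y + tev (tD2 q) x y.
Proof. by rewrite /tD2 map_cat tev_add. Qed.

Lemma tD1_scale a p x y : tev (tD1 (tscale a p)) x y = a * tev (tD1 p) x y.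
Proof.
rewrite /tev !big_map mulr_sumr; apply: eq_bigr => u _ /=.
by rewrite !mulrA.
Qed.

Lemma tD2_scale a p x y : tev (tD2 (tscale a p)) x y = a * tev (tD2 p) x y.
Proof.
rewrite /tev !big_map mulr_sumr; apply: eq_bigr => u _ /=.
by rewrite !mulrA.
Qed.

Lemma tD1_sub p q x y :
  tev (tD1 (tsub p q)) x y = tev (tD1 p) x y - tev (tD1 q) x y.
Proof. by rewrite tD1_add tD1_scale mulN1r. Qed.

Lemma tD2_sub p q x y :
  tev (tD2 (tsub p q)) x y = tev (tD2 p) x y - tev (tD2 q) x y.
Proof. by rewrite tD2_add tD2_scale mulN1r. Qed.

Lemma tD1_mul p q x y : tev (tD1 (tmul p q)) x y =
  tev (tD1 p) x y * tev q x y + tev p x y * tev (tD1 q) x y.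
Proof.
rewrite -(@derive_val _ _ _ _ _ _ _ (is_derive_tev1 (tmul p q) x y)).
have -> : (fun x => tev (tmul p q) x y) =
    (fun x => tev p x y) * (fun x => tev q x y).
  by apply/funext => z; rewrite tev_mul.
have d := is_deriveM (is_derive_tev1 p x y) (is_derive_tev1 q x y).
by rewrite (@derive_val _ _ _ _ _ _ _ d) /GRing.scale/= addrC mulrC.
Qed.

Lemma tD2_mul p q x y : tev (tD2 (tmul p q)) x y =
  tev (tD2 p) x y * tev q x y + tev p x y * tev (tD2 q) x y.
Proof.
rewrite -(@derive_val _ _ _ _ _ _ _ (is_derive_tev2 (tmul p q) x y)).
have -> : (fun y => tev (tmul p q) x y) =
    (fun y => tev p x y) * (fun y => tev q x y).
  by apply/funext => z; rewrite tev_mul.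
have d := is_deriveM (is_derive_tev2 p x y) (is_derive_tev2 q x y).
by rewrite (@derive_val _ _ _ _ _ _ _ d) /GRing.scale/= addrC mulrC.
Qed.

Definition tevE := (tev_add, tev_sub, tev_scale, tev_mul, tev_const,
  tD1_add, tD1_sub, tD1_scale, tD1_mul, tD1_const,
  tD2_add, tD2_sub, tD2_scale, tD2_mul, tD2_const).

Lemma tD12 p : tD1 (tD2 p) = tD2 (tD1 p).
Proof. by rewrite /tD1/tD2 -!map_comp; apply: eq_map => u /=; rewrite mulrAC. Qed.

(** The mode (m, n) is multiplied by 1 + (m^2 + n^2) / 4 >= 1, so the operator is inverted mode by
    mode. *)
Lemma tsolveP p x y : tev (tsolve p) x y - (tev (tD1 (tD1 (tsolve p))) x y
  + tev (tD2 (tD2 (tsolve p))) x y) / 4 = tev p x y.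
Proof.
rewrite /tev !big_map -big_split/= mulr_suml -sumrB; apply: eq_bigr => u _.
rewrite /tang/=; set a := u.1.1.2%:~R; set b := u.1.2%:~R.
have -> : a * x + b * y + (u.2 + pi / 2 + pi / 2) = (a * x + b * y + u.2) + pi.
  by field.
rewrite cosDpi; field.
have := sqr_ge0 a; have := sqr_ge0 b; lra.
Qed.

Lemma tev_periodic p x y (m n : int) :
  tev p (x + m%:~R * (2 * pi)) (y + n%:~R * (2 * pi)) = tev p x y.
Proof.
apply: eq_bigr => u _; congr (_ * _).
have -> : tang u (x + m%:~R * (2 * pi)) (y + n%:~R * (2 * pi)) =
  tang u x y + (u.1.1.2 * m + u.1.2 * n)%:~R * (2 * pi).
  by rewrite /tang intrD !intrM; ring.
have H (z : R) (i : nat) : cos (z + i%:R * (2 * pi)) = cos z.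
  elim: i => [|i IH]; first by rewrite mul0r addr0.
  by rewrite -natr1 mulrDl mul1r addrA (mulr_natl pi 2) cosD2pi -(mulr_natl pi 2) IH.
case: (u.1.1.2 * m + u.1.2 * n)%R => i; first exact: H.
by rewrite NegzE mulrNz mulNr -[LHS](H _ i.+1) subrK.
Qed.

Lemma tev_bound p : exists2 B, 0 <= B & forall x y, `|tev p x y| <= B.
Proof.
exists (\sum_(u <- p) `|u.1.1.1|) => [|x y]; first exact: sumr_ge0.
apply: le_trans (ler_norm_sum _ _ _) _; apply: ler_sum => u _.
rewrite normrM -[leRHS]mulr1 ler_wpM2l//.
by rewrite ler_norml cos_geN1 cos_le1.
Qed.

Lemma tev_lipschitz p : exists2 B, 0 <= B & forall x y h k,
  `|tev p (x + h) (y + k) - tev p x y| <= B * (`|h| + `|k|).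
Proof.
exists (\sum_(u <- p) `|u.1.1.1| * (`|u.1.1.2%:~R| + `|u.1.2%:~R|)).
  by apply: sumr_ge0 => u _; rewrite mulr_ge0.
move=> x y h k; rewrite /tev -sumrB mulr_suml.
apply: le_trans (ler_norm_sum _ _ _) _; apply: ler_sum => u _.
rewrite -mulrBr normrM -mulrA ler_wpM2l//.
have -> : tang u (x + h) (y + k) =
  tang u x y + (u.1.1.2%:~R * h + u.1.2%:~R * k) by rewrite /tang; ring.
apply: le_trans (cos_lipschitz _ _) _; apply: le_trans (ler_normD _ _) _.
rewrite !normrM mulrDl !mulrDr.
have := mulr_ge0 (normr_ge0 (u.1.1.2%:~R : R)) (normr_ge0 k).
have := mulr_ge0 (normr_ge0 (u.1.2%:~R : R)) (normr_ge0 h).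
lra.
Qed.

Lemma tev_taylor2 p : exists2 B, 0 <= B & forall x y h k,
  `|tev p (x + h) (y + k) - tev p x y
    - (tev (tD1 p) x y * h + tev (tD2 p) x y * k)| <= B * (h ^+ 2 + k ^+ 2).
Proof.
exists (\sum_(u <- p) `|u.1.1.1| * (u.1.1.2%:~R ^+ 2 + u.1.2%:~R ^+ 2)).
  by apply: sumr_ge0 => u _; rewrite mulr_ge0// addr_ge0 ?sqr_ge0.
move=> x y h k; rewrite /tev !big_map !mulr_suml -!sumrB -big_split/= -sumrB.
apply: le_trans (ler_norm_sum _ _ _) _; apply: ler_sum => u _ /=.
set a := u.1.1.2%:~R; set b := u.1.2%:~R.
have -> : tang u (x + h) (y + k) = tang u x y + (a * h + b * k).
  by rewrite /tang; ring.
set z := tang u x y.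
have Z c : tang (c, u.1.1.2, u.1.2, u.2 + pi / 2) x y = z + pi / 2.
  by rewrite /z /tang/= addrA.
rewrite !Z cos_quarter -/a -/b.
have -> : u.1.1.1 * cos (z + (a * h + b * k)) - u.1.1.1 * cos z -
  (u.1.1.1 * a * - sin z * h + u.1.1.1 * b * - sin z * k) =
  u.1.1.1 * (cos (z + (a * h + b * k)) - cos z + sin z * (a * h + b * k)).
  by ring.
rewrite normrM -mulrA ler_wpM2l//; apply: le_trans (cos_taylor2 _ _) _.
rewrite -subr_ge0 (_ : _ - _ = (a * k - b * h) ^+ 2) ?sqr_ge0//; ring.
Qed.

Lemma tmean_add p q : tmean (tadd p q) = tmean p + tmean q.
Proof. by rewrite /tmean big_cat. Qed.

Lemma tmean_scale a p : tmean (tscale a p) = a * tmean p.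
Proof.
by rewrite /tmean big_map mulr_sumr; apply: eq_bigr => u _; rewrite mulrA.
Qed.

Lemma tmean_sub p q : tmean (tsub p q) = tmean p - tmean q.
Proof. by rewrite tmean_add tmean_scale mulN1r. Qed.

Lemma tmean_const c : tmean (tconst c) = c.
Proof. by rewrite /tmean big_cons big_nil/= cos0 mulr1 addr0. Qed.

Lemma tmeanD1 p : tmean (tD1 p) = 0.
Proof.
rewrite /tmean big_map big1// => u /andP[/= /eqP -> _].
by rewrite mulr0 mul0r.
Qed.

Lemma tmeanD2 p : tmean (tD2 p) = 0.
Proof.
rewrite /tmean big_map big1// => u /andP[_ /= /eqP ->].
by rewrite mulr0 mul0r.
Qed.

Definition tmeanE := (tmean_add, tmean_sub, tmean_scale, tmean_const,
  tmeanD1, tmeanD2).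

End tpoly.

(** * Orders of magnitude, uniformly over an index set *)

(** In the application the index is (s, t, x, y) and [seps] is s + t, so that [ordO n] means O((s +
    t)^n) uniformly in the point of the torus. Values in [0, 1] make a higher order imply the lower
    ones. *)
Record scale (R : realType) := Scale {
  sidx : Type;
  sdom : set sidx;
  seps : sidx -> R;
  seps01 : forall i, sdom i -> 0 <= seps i <= 1 }.

Definition ordO (R : realType) (S : scale R) (n : nat) (F : sidx S -> R) :=
  exists C, forall i, sdom i -> `|F i| <= C * seps i ^+ n.

Section ordO.
Variables (R : realType) (S : scale R).
Implicit Types (F G H K : sidx S -> R) (n m : nat).

Lemma ord_ge0 n F : ordO n F -> exists2 C, 0 <= C &
  forall i, sdom i -> `|F i| <= C * seps i ^+ n.
Proof.
move=> [C HC]; exists `|C| => // i Di; apply: le_trans (HC _ Di) _.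
have /andP[e0 _] := seps01 Di.
by rewrite ler_wpM2r ?exprn_ge0// ler_norm.
Qed.

Lemma ord_dom n F G : (forall i, sdom i -> `|F i| <= `|G i|) ->
  ordO n G -> ordO n F.
Proof.
by move=> FG [C HC]; exists C => i Di; apply: le_trans (FG _ Di) (HC _ Di).
Qed.

Lemma ord_eq n F G : (forall i, sdom i -> F i = G i) -> ordO n G -> ordO n F.
Proof. by move=> FG; apply: ord_dom => i /FG ->. Qed.

Lemma ord_le m n F : ordO m F -> (n <= m)%N -> ordO n F.
Proof.
move=> /ord_ge0[C C0 HC] nm; exists C => i Di; apply: le_trans (HC _ Di) _.
have /andP[e0 e1] := seps01 Di.
by rewrite ler_wpM2l// ler_wiXn2l.
Qed.

Lemma ord_cst c : ordO 0 (fun _ : sidx S => c).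
Proof. by exists `|c| => i _; rewrite expr0 mulr1. Qed.

Lemma ord_opp n F : ordO n F -> ordO n (fun i => - F i).
Proof. by apply: ord_dom => i _; rewrite normrN. Qed.

Lemma ord_add_same n F G : ordO n F -> ordO n G -> ordO n (fun i => F i + G i).
Proof.
move=> [C HC] [B HB]; exists (C + B) => i Di.
by rewrite mulrDl; apply: le_trans (ler_normD _ _) _; rewrite lerD ?HC ?HB.
Qed.

Lemma ord_add n m F G : ordO n F -> ordO m G ->
  ordO (minn n m) (fun i => F i + G i).
Proof.
move=> HF HG; apply: ord_add_same.
- by apply: (ord_le HF); rewrite geq_minl.
- by apply: (ord_le HG); rewrite geq_minr.
Qed.

Lemma ord_mul n m F G : ordO n F -> ordO m G ->
  ordO (n + m) (fun i => F i * G i).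
Proof.
move=> /ord_ge0[C C0 HC] /ord_ge0[B B0 HB]; exists (C * B) => i Di.
rewrite normrM exprD mulrACA.
by have /andP[e0 e1] := seps01 Di; rewrite ler_pM ?HC ?HB.
Qed.

Lemma ord_exp n k F : ordO n F -> ordO (k * n) (fun i => F i ^+ k).
Proof.
move=> HF; elim: k => [|k IH].
  by apply: (ord_eq _ (ord_cst 1)) => i _; rewrite expr0.
rewrite mulSn; apply: (ord_eq _ (ord_mul HF IH)) => i _.
by rewrite exprS.
Qed.

Lemma ord_tev (p : tpoly R) F G : ordO 0 (fun i => tev p (F i) (G i)).
Proof.
by have [B B0 HB] := tev_bound p; exists B => i _; rewrite expr0 mulr1.
Qed.

Lemma ord_tev_lip n (p : tpoly R) F G H K : ordO n H -> ordO n K ->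
  ordO n (fun i => tev p (F i + H i) (G i + K i) - tev p (F i) (G i)).
Proof.
move=> [C HC] [C' HC']; have [B B0 HB] := tev_lipschitz p.
exists (B * (C + C')) => i Di; apply: le_trans (HB _ _ _ _) _.
by rewrite -mulrA ler_wpM2l// mulrDl lerD ?HC ?HC'.
Qed.

Lemma ord_tev_taylor n (p : tpoly R) F G H K : ordO n H -> ordO n K ->
  ordO (n + n) (fun i => tev p (F i + H i) (G i + K i) - tev p (F i) (G i) -
    (tev (tD1 p) (F i) (G i) * H i + tev (tD2 p) (F i) (G i) * K i)).
Proof.
move=> oH oK; have [B B0 HB] := tev_taylor2 p.
have := ord_mul (ord_cst B) (ord_add_same (ord_mul oH oH) (ord_mul oK oK)).
rewrite add0n; apply: ord_dom => i Di.
by apply: le_trans (HB _ _ _ _) _; rewrite -!expr2 ler_norm.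
Qed.

Lemma ord_expR n F : ordO n F ->
  ordO (n + n + n) (fun i => expR (F i) - (1 + F i + F i ^+ 2 / 2)).
Proof.
move=> oF; have [C C0 HC] := ord_ge0 oF.
have o3 := ord_mul (ord_mul oF oF) oF.
have := ord_mul (ord_cst (expR C + 1 + C + C ^+ 2)) o3.
rewrite add0n; apply: ord_dom => i Di.
have FC : `|F i| <= C.
  apply: le_trans (HC _ Di) _; rewrite ler_piMr// exprn_ile1//;
  by have /andP[] := seps01 Di.
have e1 : 1 <= expR C by have := expR_ge1Dx C; lra.
have K0 : 1 <= expR C + 1 + C + C ^+ 2 by have := sqr_ge0 C; lra.
rewrite normrM (ger0_norm (le_trans ler01 K0)) !normrM -expr2 -exprSr.
have [F1|F1] := leP `|F i| 1.
  apply: le_trans (expR_taylor2 F1) _.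
  by rewrite -[leLHS]mul1r ler_wpM2r// exprn_ge0.
apply: (@le_trans _ _ (expR C + 1 + C + C ^+ 2)); last first.
  by rewrite ler_peMr ?exprn_ege1 ?(le_trans ler01)// ltW.
apply: le_trans (ler_normB _ _) _; rewrite gtr0_norm ?expR_gt0//.
rewrite -!addrA; apply: lerD.
  by rewrite ler_expR; apply: le_trans FC; exact: ler_norm.
apply: le_trans (ler_normD _ _) _; rewrite normr1 lerD2l.
apply: le_trans (ler_normD _ _) _; apply: lerD => //.
have : `|F i| ^+ 2 <= C ^+ 2 by rewrite lerXn2r ?nnegrE.
rewrite normrM normrX (@gtr0_norm _ 2^-1) ?invr_gt0//.
by have := sqr_ge0 `|F i|; lra.
Qed.

Lemma ord_cos_sqrt n F : (forall i, sdom i -> 0 <= F i) -> ordO n F ->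
  ordO (n + n + n) (fun i => cos (Num.sqrt (F i)) -
    (1 - F i / 2 + F i ^+ 2 / 24)).
Proof.
move=> F0 oF; have := ord_mul (ord_mul oF oF) oF; apply: ord_dom => i Di.
apply: le_trans (cos_sqrt_taylor (F0 _ Di)) _.
by rewrite !exprS expr0 mulr1 mulrA ler_norm.
Qed.

Lemma ord_expRN n F : (forall i, sdom i -> 0 <= F i) -> ordO n F ->
  ordO (n + n + n) (fun i => expR (- F i) - (1 - F i + F i ^+ 2 / 2)).
Proof.
move=> F0 oF; have := ord_mul (ord_mul oF oF) oF; apply: ord_dom => i Di.
have := expRN_le2 (F0 _ Di); have := expRN_ge3 (F0 _ Di).
rewrite (_ : F i * _ * _ = F i ^+ 3); last by ring.
have := exprn_ge0 3 (F0 _ Di) => F3; rewrite (ger0_norm F3) ler_norml => *.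
by apply/andP; split; lra.
Qed.

Lemma ord_inv F c : 0 < c -> (forall i, sdom i -> c <= F i) ->
  ordO 0 (fun i => (F i)^-1).
Proof.
move=> c0 cF; exists c^-1 => i Di; rewrite expr0 mulr1.
have F0 := lt_le_trans c0 (cF _ Di).
by rewrite gtr0_norm ?invr_gt0// lef_pV2 ?posrE ?cF.
Qed.

End ordO.

(* Reads an order off the syntax of the function; the atoms are looked up in
   the context. *)
Ltac ord_step :=
  match goal with
  | H : @ordO _ ?S _ ?F |- @ordO _ ?S _ ?F => exact H
  | |- @ordO _ _ _ (fun i => tev ?p (@?F i) (@?G i)) =>
      exact (@ord_tev _ _ p F G)
  | |- @ordO _ _ _ (fun i => @?F i + @?G i) => eapply (@ord_add _ _ _ _ F G)
  | |- @ordO _ _ _ (fun i => @?F i * @?G i) => eapply (@ord_mul _ _ _ _ F G)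
  | |- @ordO _ _ _ (fun i => - @?F i) => eapply (@ord_opp _ _ _ F)
  | |- @ordO _ _ _ (fun i => @?F i ^+ ?k) => eapply (@ord_exp _ _ _ k F)
  | |- @ordO _ _ _ (fun i => ?c) => eapply (@ord_cst _ _ c)
  end.
Ltac ord := eapply ord_le; [repeat ord_step | by []].

(** * Polar coordinates on the cone *)

Section polar.
Variable R : realType.
Implicit Types f n : R.

(* The factor by which the exponential map of the cone scales its horizontal
   argument, at a point of radius 1; its value at n = 0 is the limit. *)
Definition pkap f n : R := if n == 0 then (1 + f)^-1 else atan (n / (1 + f)) / n.
Definition prho f n : R := Num.sqrt ((1 + f) ^+ 2 + n ^+ 2).
(** The cardinal sine of the displacement [pkap f n * n]; with it, the relation
    [prho f n * psg f n * pkap f n = 1] also covers n = 0. *)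
Definition psg f n : R :=
  if n == 0 then 1 else sin (pkap f n * n) / (pkap f n * n).

Lemma cos_sin_atan (y : R) :
  cos (atan y) = (Num.sqrt (1 + y ^+ 2))^-1 /\
  sin (atan y) = y * (Num.sqrt (1 + y ^+ 2))^-1.
Proof.
have [p1 p2] : - (pi / 2) < atan y /\ atan y < pi / 2.
  by rewrite atan_gtNpi2 atan_ltpi2.
have c0 : 0 < cos (atan y) by rewrite cos_gt0_pihalf// p1.
have T : sin (atan y) = y * cos (atan y).
  have := atanK y; rewrite /tan => E.
  by rewrite -[X in X * _]E divfK// gt_eqF.
suff E : cos (atan y) = (Num.sqrt (1 + y ^+ 2))^-1 by rewrite T E.
have y1 : 0 < 1 + y ^+ 2 by have := sqr_ge0 y; lra.
have := cos2Dsin2 (atan y); rewrite T exprMn => E.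
have {}E : cos (atan y) ^+ 2 = (1 + y ^+ 2)^-1.
  by apply: (@mulIf _ (1 + y ^+ 2)); rewrite ?gt_eqF// mulVf ?gt_eqF// -[RHS]E; ring.
by rewrite -sqrtrV ?ltW// -E sqrtr_sqr ger0_norm// ltW.
Qed.

(** The cone over a geodesic is locally a plane, in which the exponential map reaches the point with
    Cartesian coordinates (1 + f, n); [prho] and [pkap * n] are its polar coordinates. *)
Lemma polar_cos_sin f n : 0 < 1 + f ->
  prho f n * cos (pkap f n * n) = 1 + f /\ prho f n * sin (pkap f n * n) = n.
Proof.
move=> f0; have [->|n0] := eqVneq n 0.
  rewrite mulr0 cos0 sin0 !(mulr1, mulr0) /prho expr0n/= addr0 sqrtr_sqr.
  by rewrite gtr0_norm.
rewrite /pkap (negbTE n0) divfK//; set y := n / (1 + f).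
have [-> ->] := cos_sin_atan y.
have -> : prho f n = (1 + f) * Num.sqrt (1 + y ^+ 2).
  rewrite /prho -[X in X * Num.sqrt _](ger0_norm (ltW f0)) -sqrtr_sqr.
  rewrite -sqrtrM ?sqr_ge0//.
  congr Num.sqrt; rewrite /y exprMn exprVn mulrDr mulr1 mulrCA mulfV ?mulr1//.
  by rewrite expf_neq0// gt_eqF.
have s0 : Num.sqrt (1 + y ^+ 2) != 0.
  by rewrite gt_eqF// sqrtr_gt0; have := sqr_ge0 y; lra.
have f1 : 1 + f != 0 by rewrite gt_eqF.
split; first by field.
by rewrite mulrACA mulfV// mulr1 /y mulrC divfK.
Qed.

Lemma pkap_bounds f n : 2^-1 <= 1 + f -> 0 <= n ->
  0 <= pkap f n <= 2 /\ pkap f n * n < pi / 2.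
Proof.
move=> f2 n0; have f0 : 0 < 1 + f by lra.
have i2 : (1 + f)^-1 <= 2 by rewrite -[leRHS]invrK lef_pV2 ?posrE ?invr_gt0.
rewrite /pkap; case: eqVneq => [->|n1].
  by rewrite mulr0 invr_ge0 (ltW f0) i2 divr_gt0// pi_gt0.
have {n1} n0' : 0 < n by rewrite lt_neqAle eq_sym n1.
rewrite divfK ?gt_eqF// atan_ltpi2; split=> //.
set y := n / (1 + f); have y0 : 0 < y by rewrite divr_gt0.
have a0 : 0 < atan y by rewrite -atan0 lt_atan.
rewrite (divr_ge0 (ltW a0) n0) ler_pdivrMr//=.
apply: (@le_trans _ _ y); last by rewrite /y mulrC ler_wpM2r.
have pa : 0 <= atan y <= pi / 2 by rewrite (ltW a0) (ltW (atan_ltpi2 y)).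
have := tan_lower pa; have [-> ->] := cos_sin_atan y.
rewrite ler_pM2r ?invr_gt0 ?sqrtr_gt0; last by have := sqr_ge0 y; lra.
by have := exprn_ge0 3 (ltW a0); lra.
Qed.

Lemma psg_spec f n : 2^-1 <= 1 + f -> 0 <= n ->
  prho f n * psg f n * pkap f n = 1 /\
  `|psg f n - (1 - (pkap f n * n) ^+ 2 / 6)| <= (pkap f n * n) ^+ 4.
Proof.
move=> f2 n0; have f0 : 0 < 1 + f by lra.
have [_ S] := polar_cos_sin n f0; have [/andP[k0 _] _] := pkap_bounds f2 n0.
rewrite /psg; move: S; case: (eqVneq n 0) => [->|n1] S.
  rewrite mulr1 mulr0 !expr0n/= mul0r subr0 subrr normr0 lexx; split=> //.
  rewrite /pkap eqxx /prho expr0n/= addr0 sqrtr_sqr gtr0_norm// mulfV//.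
  by rewrite gt_eqF.
have k1 : pkap f n != 0.
  by apply/eqP => k0'; move: S n1; rewrite k0' mul0r sin0 mulr0 => <-; rewrite eqxx.
split.
  rewrite mulrA S invfM; field; by rewrite ?k1 ?n1.
set y := pkap f n * n; have y0 : 0 < y.
  by rewrite mulr_gt0// lt_neqAle eq_sym ?k1 ?n1.
have A := sin_ge3 (ltW y0); have B := sin_le5 (ltW y0).
have -> : sin y / y - (1 - y ^+ 2 / 6) = (sin y - (y - y ^+ 3 / 6)) / y.
  by field; rewrite gt_eqF.
rewrite normrM (@gtr0_norm _ y^-1) ?invr_gt0// ler_pdivrMr// -exprSr.
by rewrite ler_norml; have := exprn_gt0 5 y0 => *; apply/andP; split; lra.
Qed.

Lemma prho_bound f n : 2^-1 <= 1 + f -> `|prho f n - (1 + f)| <= n ^+ 2.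
Proof.
move=> f2; have f0 : 0 < 1 + f by lra.
have A : 1 + f <= prho f n.
  by rewrite -[leLHS](gtr0_norm f0) -sqrtr_sqr ler_wsqrtr// lerDl sqr_ge0.
rewrite ger0_norm ?subr_ge0//.
have E : prho f n ^+ 2 = (1 + f) ^+ 2 + n ^+ 2.
  by rewrite sqr_sqrtr// addr_ge0 ?sqr_ge0.
have -> : n ^+ 2 = (prho f n - (1 + f)) * (prho f n + (1 + f)).
  by rewrite -subr_sqr E; ring.
by rewrite ler_peMr ?subr_ge0//; lra.
Qed.

End polar.

Section polar_order.
Variables (R : realType) (S : scale R) (f v1 v2 : sidx S -> R).
Hypotheses (f_ge : forall i, sdom i -> 2^-1 <= 1 + f i)
  (of1 : ordO 1 f) (ov1 : ordO 1 v1) (ov2 : ordO 1 v2).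

Let n i := enorm (v1 i, v2 i).
Let kap i := pkap (f i) (n i).
Let rho i := prho (f i) (n i).
Let sg i := psg (f i) (n i).

Let n0 i : 0 <= n i. Proof. exact: sqrtr_ge0. Qed.

Let n2 i : n i ^+ 2 = v1 i ^+ 2 + v2 i ^+ 2.
Proof. by rewrite sqr_sqrtr// addr_ge0 ?sqr_ge0. Qed.

(** All that the expansion of the cosine needs about one tangent vector. The displacement appears as
    the root of its square, the form in which [ord_cos_sqrt] applies. *)
Lemma ord_polar :
  [/\ forall i, sdom i ->
        rho i * cos (Num.sqrt (kap i ^+ 2 * (v1 i ^+ 2 + v2 i ^+ 2))) = 1 + f i,
      forall i, sdom i -> rho i * sg i * kap i = 1,
      ordO 4 (fun i => sg i - (1 - kap i ^+ 2 * (v1 i ^+ 2 + v2 i ^+ 2) / 6)),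
      ordO 0 kap
    & ordO 2 (fun i => rho i - (1 + f i))].
Proof.
have ok : ordO 0 kap.
  exists 2 => i Di; rewrite expr0 mulr1.
  have [/andP[k0 k2] _] := pkap_bounds (f_ge Di) (n0 i).
  by rewrite ger0_norm.
split => //.
- move=> i Di; have [k0 _] := pkap_bounds (f_ge Di) (n0 i).
  rewrite -n2 -exprMn sqrtr_sqr ger0_norm; last first.
    by rewrite mulr_ge0//; case/andP: k0.
  have f0 : 0 < 1 + f i by have := f_ge Di; lra.
  by have [] := polar_cos_sin (n i) f0.
- by move=> i Di; have [] := psg_spec (f_ge Di) (n0 i).
- have : ordO 4 (fun i => (kap i ^+ 2 * (v1 i ^+ 2 + v2 i ^+ 2)) ^+ 2) by ord.
  apply: ord_dom => i Di; have [_] := psg_spec (f_ge Di) (n0 i).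
  rewrite -n2 -exprMn => H; rewrite [leRHS]ger0_norm ?sqr_ge0//.
  by rewrite -exprM.
- have : ordO 2 (fun i => v1 i ^+ 2 + v2 i ^+ 2) by ord.
  apply: ord_dom => i Di; rewrite -n2 (ger0_norm (sqr_ge0 _)).
  exact: prho_bound (f_ge Di).
Qed.

End polar_order.

Section cos_expansion.
Variables (R : realType) (S : scale R).
Variables (f v1 v2 rho0 kap0 sg0 g w1 w2 rho1 kap1 sg1 z1 z2 : sidx S -> R).
Hypotheses (of1 : ordO 1 f) (ov1 : ordO 1 v1) (ov2 : ordO 1 v2)
  (og1 : ordO 1 g) (ow1 : ordO 1 w1) (ow2 : ordO 1 w2)
  (oz1 : ordO 2 z1) (oz2 : ordO 2 z2).
Hypotheses
  (p0 : [/\ forall i, sdom i ->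
     rho0 i * cos (Num.sqrt (kap0 i ^+ 2 * (v1 i ^+ 2 + v2 i ^+ 2))) = 1 + f i,
      forall i, sdom i -> rho0 i * sg0 i * kap0 i = 1,
      ordO 4 (fun i => sg0 i - (1 - kap0 i ^+ 2 * (v1 i ^+ 2 + v2 i ^+ 2) / 6)),
      ordO 0 kap0
    & ordO 2 (fun i => rho0 i - (1 + f i))])
  (p1 : [/\ forall i, sdom i ->
     rho1 i * cos (Num.sqrt (kap1 i ^+ 2 * (w1 i ^+ 2 + w2 i ^+ 2))) = 1 + g i,
      forall i, sdom i -> rho1 i * sg1 i * kap1 i = 1,
      ordO 4 (fun i => sg1 i - (1 - kap1 i ^+ 2 * (w1 i ^+ 2 + w2 i ^+ 2) / 6)),
      ordO 0 kap1
    & ordO 2 (fun i => rho1 i - (1 + g i))]).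

Let q i := (kap1 i * w1 i + z1 i - kap0 i * v1 i) ^+ 2 +
           (kap1 i * w2 i + z2 i - kap0 i * v2 i) ^+ 2.

(** Over a unit sphere the cone would be Euclidean and, for z = 0, the product would be exactly (1 +
    f)(1 + g) + v . w. The flatness of the base costs the squared wedge product over 6, the only
    curvature term; the remaining terms come from the displacement z of the base point. *)
Lemma ord_cos_expansion : ordO 5 (fun i => rho0 i * rho1 i * cos (Num.sqrt (q i))
  - ((1 + f i) * (1 + g i) + (v1 i * w1 i + v2 i * w2 i)
     - (v1 i * w2 i - v2 i * w1 i) ^+ 2 / 6
     - (1 + f i) * (z1 i * w1 i + z2 i * w2 i)
     + (1 + g i) * (z1 i * v1 i + z2 i * v2 i)
     - (z1 i ^+ 2 + z2 i ^+ 2) / 2)).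
Proof.
case: p0 => c0E s0E os0 ok0 or0; case: p1 => c1E s1E os1 ok1 or1.
pose A i := kap0 i ^+ 2 * (v1 i ^+ 2 + v2 i ^+ 2).
pose B i := kap1 i ^+ 2 * (w1 i ^+ 2 + w2 i ^+ 2).
pose c i := kap0 i * kap1 i * (v1 i * w1 i + v2 i * w2 i).
pose m i := z1 i * (kap1 i * w1 i - kap0 i * v1 i) +
            z2 i * (kap1 i * w2 i - kap0 i * v2 i).
pose Z i := z1 i ^+ 2 + z2 i ^+ 2.
have oA : ordO 2 A by rewrite /A; ord.
have oB : ordO 2 B by rewrite /B; ord.
have oc : ordO 2 c by rewrite /c; ord.
have om : ordO 3 m by rewrite /m; ord.
have oZ : ordO 4 Z by rewrite /Z; ord.
have A0 i : 0 <= A i by rewrite mulr_ge0 ?sqr_ge0// addr_ge0 ?sqr_ge0.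
have B0 i : 0 <= B i by rewrite mulr_ge0 ?sqr_ge0// addr_ge0 ?sqr_ge0.
have q0 i : 0 <= q i by rewrite addr_ge0 ?sqr_ge0.
have qE i : q i = A i + B i - 2 * c i + 2 * m i + Z i.
  by rewrite /q /A /B /c /m /Z; ring.
have oq : ordO 2 q by rewrite /q; ord.
have orA := ord_cos_sqrt (fun i _ => A0 i) oA.
have orB := ord_cos_sqrt (fun i _ => B0 i) oB.
have orq := ord_cos_sqrt (fun i _ => q0 i) oq.
set rA := (fun i => _) in orA; set rB := (fun i => _) in orB.
set rq := (fun i => _) in orq.
set t0 := (fun i => _) in os0; set t1 := (fun i => _) in os1.
set d0 := (fun i => _) in or0; set d1 := (fun i => _) in or1.
have or0' : ordO 0 rho0.
  by apply: (@ord_eq _ _ _ _ (fun i => d0 i + (1 + f i))) => [i _|];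
    [rewrite /d0; ring | ord].
have or1' : ordO 0 rho1.
  by apply: (@ord_eq _ _ _ _ (fun i => d1 i + (1 + g i))) => [i _|];
    [rewrite /d1; ring | ord].
pose e0 i := rho0 i * kap0 i - 1; pose e1 i := rho1 i * kap1 i - 1.
have oe0 : ordO 2 e0.
  apply: (@ord_eq _ _ _ _ (fun i => rho0 i * kap0 i * (A i / 6 - t0 i))).
    by move=> i Di; rewrite /e0 -[1 in LHS](s0E _ Di) /t0 /A; ring.
  by ord.
have oe1 : ordO 2 e1.
  apply: (@ord_eq _ _ _ _ (fun i => rho1 i * kap1 i * (B i / 6 - t1 i))).
    by move=> i Di; rewrite /e1 -[1 in LHS](s1E _ Di) /t1 /B; ring.
  by ord.
have ok0' : ordO 1 (fun i => kap0 i - 1).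
  apply: (@ord_eq _ _ _ _ (fun i => e0 i - kap0 i * d0 i - kap0 i * f i)).
    by move=> i _; rewrite /e0 /d0; ring.
  by ord.
have ok1' : ordO 1 (fun i => kap1 i - 1).
  apply: (@ord_eq _ _ _ _ (fun i => e1 i - kap1 i * d1 i - kap1 i * g i)).
    by move=> i _; rewrite /e1 /d1; ring.
  by ord.
pose C0 i := cos (Num.sqrt (A i)); pose C1 i := cos (Num.sqrt (B i)).
have C0E i : C0 i = 1 - A i / 2 + A i ^+ 2 / 24 + rA i by rewrite /rA /C0; ring.
have C1E i : C1 i = 1 - B i / 2 + B i ^+ 2 / 24 + rB i by rewrite /rB /C1; ring.
have S0E i : sg0 i = 1 - A i / 6 + t0 i by rewrite /t0 /A; ring.
have S1E i : sg1 i = 1 - B i / 6 + t1 i by rewrite /t1 /B; ring.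
(* [C0 i * C1 i + sg0 i * sg1 i * c i] is the cosine of a spherical distance; at fourth order it
   exceeds its flat counterpart by (A B - c^2) / 6. *)
have o1 : ordO 5 (fun i => cos (Num.sqrt (q i)) - (C0 i * C1 i +
    sg0 i * sg1 i * c i - (A i * B i - c i ^+ 2) / 6 - m i - Z i / 2)).
  pose D0 i := A i + B i - 2 * c i.
  have oD0 : ordO 2 D0 by rewrite /D0; ord.
  apply: (@ord_eq _ _ _ _ (fun i =>
    (2 * m i + Z i) * (2 * D0 i + 2 * m i + Z i) / 24 + rq i
    - (rA i * (1 - B i / 2 + B i ^+ 2 / 24 + rB i)
       + (1 - A i / 2 + A i ^+ 2 / 24) * rB i)
    - (- (A i * B i ^+ 2 / 48) - A i ^+ 2 * B i / 48 + A i ^+ 2 * B i ^+ 2 / 576)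
    - (A i * B i * c i / 36 + t0 i * (1 - B i / 6 + t1 i) * c i
       + (1 - A i / 6) * t1 i * c i))); last by ord.
  move=> i _; rewrite C0E C1E S0E S1E.
  have -> : cos (Num.sqrt (q i)) = 1 - q i / 2 + q i ^+ 2 / 24 + rq i.
    by rewrite /rq; ring.
  by rewrite qE /D0; field.
set r1 := (fun i => _) in o1.
pose W i := v1 i * w2 i - v2 i * w1 i.
have oW : ordO 2 W by rewrite /W; ord.
(* The factors rho turn the spherical part into (1 + f)(1 + g) + v . w exactly. In the other,
   smaller terms rho and kap are replaced by their leading parts. *)
apply: (@ord_eq _ _ _ _ (fun i => rho0 i * rho1 i * r1 i
  - (e0 i * kap0 i * (e1 i + 1) * kap1 i + (kap0 i - 1) * (e1 i + 1) * kap1 i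
     + e1 i * kap1 i + (kap1 i - 1)) * W i ^+ 2 / 6
  - (rho0 i * e1 i + d0 i) * (z1 i * w1 i + z2 i * w2 i)
  + (rho1 i * e0 i + d1 i) * (z1 i * v1 i + z2 i * v2 i)
  - ((d0 i + f i) * rho1 i + (d1 i + g i)) * Z i / 2)); last by ord.
move=> i Di.
have -> : cos (Num.sqrt (q i)) = r1 i + (C0 i * C1 i +
    sg0 i * sg1 i * c i - (A i * B i - c i ^+ 2) / 6 - m i - Z i / 2).
  by rewrite /r1; ring.
have -> : (1 + f i) * (1 + g i) = rho0 i * C0 i * (rho1 i * C1 i).
  by rewrite /C0 /C1 c0E ?c1E.
have -> : v1 i * w1 i + v2 i * w2 i = rho0 i * sg0 i * kap0 i *
    (rho1 i * sg1 i * kap1 i) * (v1 i * w1 i + v2 i * w2 i).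
  by rewrite s0E// s1E// !mul1r.
by rewrite /W /e0 /e1 /d0 /d1 /c /A /B /m /Z; field.
Qed.

End cos_expansion.

(** * The local expansion along a transport plan *)

Section fields.
Variables (R : realType) (phi psi : tpoly R).

Definition pZ1 : tpoly R :=
  tsub (tadd (tmul (tD1 (tD1 psi)) (tD1 phi)) (tmul (tD2 (tD1 psi)) (tD2 phi)))
       (tadd (tmul (tD1 (tD1 phi)) (tD1 psi)) (tmul (tD2 (tD1 phi)) (tD2 psi))).
Definition pZ2 : tpoly R :=
  tsub (tadd (tmul (tD2 (tD1 psi)) (tD1 phi)) (tmul (tD2 (tD2 psi)) (tD2 phi)))
       (tadd (tmul (tD2 (tD1 phi)) (tD1 psi)) (tmul (tD2 (tD2 phi)) (tD2 psi))).
(** The divergence of the equation for W reads (1 - Laplacian / 4) D = div Z / 2, which is solved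
    mode by mode. *)
Definition pD : tpoly R := tsolve (tscale 2^-1 (tadd (tD1 pZ1) (tD2 pZ2))).
(* W solves W - grad (div W) / 4 = Z / 2, and pD is its divergence. *)
Definition pW1 : tpoly R := tadd (tscale 2^-1 pZ1) (tscale 4^-1 (tD1 pD)).
Definition pW2 : tpoly R := tadd (tscale 2^-1 pZ2) (tscale 4^-1 (tD2 pD)).
Definition pwedge : tpoly R :=
  tsub (tmul (tD1 phi) (tD2 psi)) (tmul (tD2 phi) (tD1 psi)).
Definition pdot : tpoly R :=
  tadd (tmul (tD1 phi) (tD1 psi)) (tmul (tD2 phi) (tD2 psi)).

Lemma pW_div x y : tev (tD1 pW1) x y + tev (tD2 pW2) x y = tev pD x y.
Proof.
rewrite -[RHS](subrK ((tev (tD1 (tD1 pD)) x y + tev (tD2 (tD2 pD)) x y) / 4)).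
rewrite tsolveP /pW1 /pW2 !tevE; ring.
Qed.

(* The logarithm of the first Kantorovich potential, to second order. *)
Definition pA (s t : R) : tpoly R :=
  tadd (tadd (tscale (- (2 * s)) phi) (tscale (2 * t) psi))
  (tadd (tscale (s ^+ 2) (tadd (tscale 2 (tmul phi phi))
      (tadd (tmul (tD1 phi) (tD1 phi)) (tmul (tD2 phi) (tD2 phi)))))
  (tadd (tscale (t ^+ 2) (tscale (-2) (tmul psi psi)))
        (tscale (s * t) (tsub (tscale 2^-1 pD) pdot)))).

End fields.

Section tangent.
Variables (R : realType) (phi : tpoly R).
Definition tf (s x y : R) : R := 2 * s * tev phi x y.
Definition tv1 (s x y : R) : R := s * tev (tD1 phi) x y.
Definition tv2 (s x y : R) : R := s * tev (tD2 phi) x y.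
Definition tkap (s x y : R) : R :=
  pkap (tf s x y) (enorm (tv1 s x y, tv2 s x y)).
Definition trho (s x y : R) : R :=
  prho (tf s x y) (enorm (tv1 s x y, tv2 s x y)).
Definition tsg (s x y : R) : R :=
  psg (tf s x y) (enorm (tv1 s x y, tv2 s x y)).
End tangent.

Section plan.
Variables (R : realType) (phi psi : tpoly R).
Implicit Types s t x y : R.

Local Notation W1 := (pW1 phi psi).
Local Notation W2 := (pW2 phi psi).

Definition Tz1 s t x y : R := s * t * tev W1 x y.
Definition Tz2 s t x y : R := s * t * tev W2 (x + Tz1 s t x y) y.
(* The Jacobian of x |-> x + Tz, a composition of two shears. *)
Definition Tlam2 s t x y : R :=
  (1 + s * t * tev (tD1 W1) x y) *
  (1 + s * t * tev (tD2 W2) (x + Tz1 s t x y) y).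
Definition Tlam s t x y : R := Num.sqrt (Tlam2 s t x y).

(** ([hx], [hy]) leads, in the universal cover, from the point reached by the mass of exp(s phi) to
    the one reached by the mass of exp(t psi). Hence [hq] bounds the squared distance on the torus
    from above. *)
Definition hx s t x y : R := tkap psi t (x + Tz1 s t x y) (y + Tz2 s t x y) *
  tv1 psi t (x + Tz1 s t x y) (y + Tz2 s t x y) + Tz1 s t x y
  - tkap phi s x y * tv1 phi s x y.
Definition hy s t x y : R := tkap psi t (x + Tz1 s t x y) (y + Tz2 s t x y) *
  tv2 psi t (x + Tz1 s t x y) (y + Tz2 s t x y) + Tz2 s t x y
  - tkap phi s x y * tv2 phi s x y.
Definition hq s t x y : R := hx s t x y ^+ 2 + hy s t x y ^+ 2.
Definition Tcos s t x y : R := Tlam s t x y * trho phi s x y *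
  trho psi t (x + Tz1 s t x y) (y + Tz2 s t x y) * cos (Num.sqrt (hq s t x y)).

(** The Taylor polynomial of [Tcos] of order four, apart from a constant and two terms that carry
    the Jacobian [Tlam2]. *)
Definition Tpoly s t x y : R :=
  let D := tev (pD phi psi) x y in
  let w1 := tev W1 x y in let w2 := tev W2 x y in
  let p := tev phi x y in let p1 := tev (tD1 phi) x y in
  let p2 := tev (tD2 phi) x y in
  let q := tev psi x y in let q1 := tev (tD1 psi) x y in
  let q2 := tev (tD2 psi) x y in
  let q11 := tev (tD1 (tD1 psi)) x y in let q12 := tev (tD2 (tD1 psi)) x y in
  let q22 := tev (tD2 (tD2 psi)) x y in
  2 * s * p + s * t * (4 * p * q + (p1 * q1 + p2 * q2))
  + s ^+ 2 * t * (D * p + (w1 * p1 + w2 * p2))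
  - s * t ^+ 2 * (D * q + (w1 * q1 + w2 * q2))
  + s ^+ 2 * t ^+ 2 * (2 * (D * p * q + p * (w1 * q1 + w2 * q2)
      + q * (w1 * p1 + w2 * p2))
    + (p1 * (q11 * w1 + q12 * w2) + p2 * (q12 * w1 + q22 * w2)
       + D * (p1 * q1 + p2 * q2) / 2)
    - D ^+ 2 / 8 - (w1 ^+ 2 + w2 ^+ 2) / 2 - (p1 * q2 - p2 * q1) ^+ 2 / 6).

Variables (S : scale R) (s t x y : sidx S -> R).
Hypotheses (os : ordO 1 s) (ot : ordO 1 t).
Hypothesis f_ge : forall i X Y, sdom i -> 2^-1 <= 1 + tf phi (s i) X Y.
Hypothesis g_ge : forall i X Y, sdom i -> 2^-1 <= 1 + tf psi (t i) X Y.
Hypothesis lam1_ge : forall i X Y, sdom i ->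
  2^-1 <= 1 + s i * t i * tev (tD1 W1) X Y.
Hypothesis lam2_ge : forall i X Y, sdom i ->
  2^-1 <= 1 + s i * t i * tev (tD2 W2) X Y.

Let f i := tf phi (s i) (x i) (y i).
Let v1 i := tv1 phi (s i) (x i) (y i).
Let v2 i := tv2 phi (s i) (x i) (y i).
Let z1 i := Tz1 (s i) (t i) (x i) (y i).
Let z2 i := Tz2 (s i) (t i) (x i) (y i).
Let g i := tf psi (t i) (x i) (y i).
Let w1 i := tv1 psi (t i) (x i) (y i).
Let w2 i := tv2 psi (t i) (x i) (y i).
Let gT i := tf psi (t i) (x i + z1 i) (y i + z2 i).
Let wT1 i := tv1 psi (t i) (x i + z1 i) (y i + z2 i).
Let wT2 i := tv2 psi (t i) (x i + z1 i) (y i + z2 i).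
Let D i := tev (pD phi psi) (x i) (y i).
Let sW1 i := s i * t i * tev W1 (x i) (y i).
Let sW2 i := s i * t i * tev W2 (x i) (y i).
Let mu i := Tlam (s i) (t i) (x i) (y i) - 1.
Let lam2 i := Tlam2 (s i) (t i) (x i) (y i).

Lemma ord_f : ordO 1 f. Proof. by rewrite /f /tf; ord. Qed.
Lemma ord_v1 : ordO 1 v1. Proof. by rewrite /v1 /tv1; ord. Qed.
Lemma ord_v2 : ordO 1 v2. Proof. by rewrite /v2 /tv2; ord. Qed.
Lemma ord_g : ordO 1 g. Proof. by rewrite /g /tf; ord. Qed.
Lemma ord_w1 : ordO 1 w1. Proof. by rewrite /w1 /tv1; ord. Qed.
Lemma ord_w2 : ordO 1 w2. Proof. by rewrite /w2 /tv2; ord. Qed.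
Lemma ord_gT : ordO 1 gT. Proof. by rewrite /gT /tf; ord. Qed.
Lemma ord_wT1 : ordO 1 wT1. Proof. by rewrite /wT1 /tv1; ord. Qed.
Lemma ord_wT2 : ordO 1 wT2. Proof. by rewrite /wT2 /tv2; ord. Qed.
Lemma ord_z1 : ordO 2 z1. Proof. by rewrite /z1 /Tz1; ord. Qed.
Lemma ord_z2 : ordO 2 z2. Proof. by rewrite /z2 /Tz2; ord. Qed.

Let of1 := ord_f. Let ov1 := ord_v1. Let ov2 := ord_v2.
Let og1 := ord_g. Let ow1 := ord_w1. Let ow2 := ord_w2.
Let ogT := ord_gT. Let owT1 := ord_wT1. Let owT2 := ord_wT2.
Let oz1 := ord_z1. Let oz2 := ord_z2.

Let lam2_gt0 i : sdom i -> 0 < lam2 i.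
Proof.
move=> Di; rewrite mulr_gt0//.
- by have := lam1_ge (x i) (y i) Di; lra.
- by have := lam2_ge (x i + Tz1 (s i) (t i) (x i) (y i)) (y i) Di; lra.
Qed.

Let lam_sqr i : sdom i -> lam2 i = (1 + mu i) ^+ 2.
Proof.
by move=> Di; rewrite /mu addrC subrK sqr_sqrtr// ltW// lam2_gt0.
Qed.

Lemma ord_lam2 : ordO 4 (fun i => lam2 i - 1 - s i * t i * D i).
Proof.
have o2 : ordO 2 (fun i => tev (tD2 W2) (x i + z1 i) (y i + 0) -
    tev (tD2 W2) (x i) (y i)).
  by apply: ord_tev_lip => //; apply: (ord_le (m := 2)) => //;
    exists 0 => i _; rewrite normr0 mul0r.
apply: (@ord_eq _ _ _ _ (fun i => s i * t i * (tev (tD2 W2) (x i + z1 i) (y i + 0)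
    - tev (tD2 W2) (x i) (y i)) + (s i * t i) ^+ 2 * tev (tD1 W1) (x i) (y i) *
    tev (tD2 W2) (x i + z1 i) (y i))); last by ord.
by move=> i _; rewrite /lam2 /Tlam2 /D -pW_div -/(z1 i) addr0; ring.
Qed.

Let om4 := ord_lam2.

Lemma ord_mu : ordO 2 mu.
Proof.
have : ordO 2 (fun i => (lam2 i - 1 - s i * t i * D i) + s i * t i * D i).
  by rewrite /D; ord.
apply: ord_dom => i Di; rewrite subrK lam_sqr//.
rewrite (_ : _ - 1 = mu i * (2 + mu i)); last by ring.
rewrite normrM ler_peMr// ger0_norm.
  by have := sqrtr_ge0 (lam2 i); rewrite /mu /Tlam -/(lam2 i); lra.
by have := sqrtr_ge0 (lam2 i); rewrite /mu /Tlam -/(lam2 i); lra.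
Qed.

Let omu := ord_mu.

Lemma ord_mu4 : ordO 4 (fun i => mu i - s i * t i * D i / 2).
Proof.
apply: (@ord_eq _ _ _ _ (fun i => (lam2 i - 1 - s i * t i * D i) / 2
  - mu i ^+ 2 / 2)); last by ord.
by move=> i Di; rewrite lam_sqr//; field.
Qed.

Let omu4 := ord_mu4.

Lemma ord_rz : ordO 4 (fun i => z2 i - sW2 i).
Proof.
have o2 : ordO 2 (fun i => tev W2 (x i + z1 i) (y i + 0) - tev W2 (x i) (y i)).
  by apply: ord_tev_lip => //; exists 0 => i _; rewrite normr0 mul0r.
apply: (@ord_eq _ _ _ _ (fun i => s i * t i * (tev W2 (x i + z1 i) (y i + 0)
    - tev W2 (x i) (y i)))); last by ord.
by move=> i _; rewrite /z2 /Tz2 /sW2 -/(z1 i) addr0; ring.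
Qed.

Let orz := ord_rz.

Let shift_lip (p : tpoly R) : ordO 3 (fun i => t i * tev p (x i + z1 i) (y i + z2 i)
  - t i * tev p (x i) (y i)).
Proof.
have o := ord_tev_lip p x y oz1 oz2.
apply: (@ord_eq _ _ _ _ (fun i => t i * (tev p (x i + z1 i) (y i + z2 i)
  - tev p (x i) (y i)))); last by ord.
by move=> i _; ring.
Qed.

Let shift_taylor (p : tpoly R) :
  ordO 5 (fun i => t i * tev p (x i + z1 i) (y i + z2 i) - t i * tev p (x i) (y i)
  - t i * (tev (tD1 p) (x i) (y i) * sW1 i + tev (tD2 p) (x i) (y i) * sW2 i)).
Proof.
have o := ord_tev_taylor p x y oz1 oz2.
set r := (fun i => _) in o.
apply: (@ord_eq _ _ _ _ (fun i => t i * (r i + tev (tD2 p) (x i) (y i) *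
  (z2 i - sW2 i)))); last by ord.
by move=> i _; rewrite /r /z1 /sW1 /Tz1; ring.
Qed.

Lemma ord_dg : ordO 3 (fun i => gT i - g i).
Proof.
have o := shift_lip psi.
apply: (@ord_eq _ _ _ _ (fun i => 2 * (t i * tev psi (x i + z1 i) (y i + z2 i)
  - t i * tev psi (x i) (y i)))); last by ord.
by move=> i _; rewrite /gT /g /tf; ring.
Qed.
Lemma ord_dw1 : ordO 3 (fun i => wT1 i - w1 i).
Proof. exact: shift_lip. Qed.
Lemma ord_dw2 : ordO 3 (fun i => wT2 i - w2 i).
Proof. exact: shift_lip. Qed.

Let odg := ord_dg. Let odw1 := ord_dw1. Let odw2 := ord_dw2.

Let odgl : ordO 5 (fun i => gT i - g i - 2 * (w1 i * sW1 i + w2 i * sW2 i)).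
Proof.
have o := shift_taylor psi; set r := (fun i => _) in o.
apply: (@ord_eq _ _ _ _ (fun i => 2 * r i)); last by ord.
by move=> i _; rewrite /r /gT /g /tf /w1 /w2 /tv1 /tv2; ring.
Qed.

Let odwl1 : ordO 5 (fun i => wT1 i - w1 i - t i *
  (tev (tD1 (tD1 psi)) (x i) (y i) * sW1 i +
   tev (tD2 (tD1 psi)) (x i) (y i) * sW2 i)).
Proof. exact: shift_taylor. Qed.

Let odwl2 : ordO 5 (fun i => wT2 i - w2 i - t i *
  (tev (tD2 (tD1 psi)) (x i) (y i) * sW1 i +
   tev (tD2 (tD2 psi)) (x i) (y i) * sW2 i)).
Proof. by have := shift_taylor (tD2 psi); rewrite tD12. Qed.

Let ord_polar0 := ord_polar (fun i Di => f_ge (x i) (y i) Di) ov1 ov2.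
Let ord_polarT :=
  ord_polar (fun i Di => g_ge (x i + z1 i) (y i + z2 i) Di) owT1 owT2.

(** From lam2 = (1 + mu)^2 one gets lam = (1 + lam2 - mu^2) / 2. The terms lam2 / 2 and lam2 gT are
    left unexpanded on purpose: in [cost_integral] they cancel against the mass of the displaced
    measure. *)
Lemma ord_Tcos : ordO 5 (fun i => Tcos (s i) (t i) (x i) (y i) -
  (2^-1 + lam2 i / 2 + lam2 i * gT i + Tpoly (s i) (t i) (x i) (y i))).
Proof.
have o := @ord_cos_expansion R S f v1 v2
  (fun i => trho phi (s i) (x i) (y i)) (fun i => tkap phi (s i) (x i) (y i))
  (fun i => tsg phi (s i) (x i) (y i)) gT wT1 wT2
  (fun i => trho psi (t i) (x i + z1 i) (y i + z2 i))
  (fun i => tkap psi (t i) (x i + z1 i) (y i + z2 i))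
  (fun i => tsg psi (t i) (x i + z1 i) (y i + z2 i)) z1 z2
  of1 ov1 ov2 ogT owT1 owT2 oz1 oz2 ord_polar0 ord_polarT.
set r := (fun i => _) in o.
have odgl' := odgl; set dgl := (fun i => _) in odgl'.
have odwl1' := odwl1; set dwl1 := (fun i => _) in odwl1'.
have odwl2' := odwl2; set dwl2 := (fun i => _) in odwl2'.
have odg' := odg; set dg := (fun i => _) in odg'.
have odw1' := odw1; set dw1 := (fun i => _) in odw1'.
have odw2' := odw2; set dw2 := (fun i => _) in odw2'.
have omu4' := omu4; set mu4 := (fun i => _) in omu4'.
have orz' := orz; set rz := (fun i => _) in orz'.
have oD : ordO 0 D by rewrite /D; ord.
have osW1 : ordO 2 sW1 by rewrite /sW1; ord.
have osW2 : ordO 2 sW2 by rewrite /sW2; ord.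
apply: (@ord_eq _ _ _ _ (fun i => (1 + mu i) * r i
  - mu4 i * (mu i + s i * t i * D i / 2) / 2 + mu4 i * f i
  - (mu4 i * gT i + s i * t i * D i / 2 * dg i + mu i ^+ 2 * gT i)
  + f i * dgl i + s i * t i * D i / 2 * f i * dg i + mu4 i * f i * gT i
  + (v1 i * dwl1 i + v2 i * dwl2 i) + mu4 i * (v1 i * wT1 i + v2 i * wT2 i)
  + s i * t i * D i / 2 * (v1 i * dw1 i + v2 i * dw2 i)
  - mu i * (v1 i * wT2 i - v2 i * wT1 i) ^+ 2 / 6
  - (v1 i * dw2 i - v2 i * dw1 i) * ((v1 i * wT2 i - v2 i * wT1 i)
     + (v1 i * w2 i - v2 i * w1 i)) / 6
  - mu i * (1 + f i) * (z1 i * wT1 i + z2 i * wT2 i)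
  - (1 + f i) * (z1 i * dw1 i + z2 i * dw2 i + rz i * w2 i)
  + mu i * (1 + gT i) * (z1 i * v1 i + z2 i * v2 i)
  + dg i * (z1 i * v1 i + z2 i * v2 i) + (1 + g i) * rz i * v2 i
  - mu i * (z1 i ^+ 2 + z2 i ^+ 2) / 2 - rz i * (z2 i + sW2 i) / 2)); last by ord.
move=> i Di.
have -> : Tcos (s i) (t i) (x i) (y i) = (1 + mu i) *
  (r i + ((1 + f i) * (1 + gT i) + (v1 i * wT1 i + v2 i * wT2 i)
     - (v1 i * wT2 i - v2 i * wT1 i) ^+ 2 / 6
     - (1 + f i) * (z1 i * wT1 i + z2 i * wT2 i)
     + (1 + gT i) * (z1 i * v1 i + z2 i * v2 i)
     - (z1 i ^+ 2 + z2 i ^+ 2) / 2)).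
  rewrite /r subrK /mu addrC subrK /Tcos /trho -/(f i) -/(v1 i) -/(v2 i).
  by rewrite -/(z1 i) -/(z2 i) -!mulrA.
rewrite lam_sqr//.
have z1E : z1 i = sW1 i by [].
rewrite /mu4 /dgl /dwl1 /dwl2 /dg /dw1 /dw2 /rz z1E.
rewrite /Tpoly -/(D i) /sW1 /sW2 /g /w1 /w2 /f /v1 /v2 /tf /tv1 /tv2.
by field.
Qed.

End plan.

(** * Kantorovich potentials *)

Section potentials.
Variables (R : realType) (phi psi : tpoly R).
Implicit Types s t x y k : R.

Local Notation A s t := (pA phi psi s t).

(* A lower bound for - ln (cos^2 d), as a function of q = d^2. *)
Definition nq (q : R) : R := q + q ^+ 2 / 6.

Definition Sm1 s t x y : R := x - tev (tD1 (A s t)) x y / 2.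
Definition Sm2 s t x y : R := y - tev (tD2 (A s t)) x y / 2.
(* An approximate minimizer u of A(u) + nq(|u - (x, y)|^2). *)
Definition Sp1 s t x y : R :=
  x - tev (tD1 (A s t)) (Sm1 s t x y) (Sm2 s t x y) / 2.
Definition Sp2 s t x y : R :=
  y - tev (tD2 (A s t)) (Sm1 s t x y) (Sm2 s t x y) / 2.

Definition cpot s t (ux uy x y : R) : R :=
  tev (A s t) ux uy + nq ((ux - x) ^+ 2 + (uy - y) ^+ 2).
(** Minus the c-transform of A would be minus the infimum of [cpot] over its first point. Here the
    approximate minimizer [Sp1], [Sp2] takes the place of the minimizer, and the constant k pays for
    it, so that admissibility holds exactly. *)
Definition bpot s t k x y : R :=
  - cpot s t (Sp1 s t x y) (Sp2 s t x y) x y + k.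

Definition cG1 s t (ux uy x y : R) : R := tev (tD1 (A s t)) ux uy
  + (2 + ((ux - x) ^+ 2 + (uy - y) ^+ 2) * 2 / 3) * (ux - x).
Definition cG2 s t (ux uy x y : R) : R := tev (tD2 (A s t)) ux uy
  + (2 + ((ux - x) ^+ 2 + (uy - y) ^+ 2) * 2 / 3) * (uy - y).

Definition A_semiconvex s t := forall x y h k,
  tev (A s t) x y + (tev (tD1 (A s t)) x y * h + tev (tD2 (A s t)) x y * k)
    - (h ^+ 2 + k ^+ 2) / 2 <= tev (A s t) (x + h) (y + k).

Lemma cpot_convex s t ux uy px py x y : A_semiconvex s t ->
  cpot s t px py x y - (cG1 s t px py x y ^+ 2 + cG2 s t px py x y ^+ 2) / 2
  <= cpot s t ux uy x y.
Proof.
move=> Ac; have := Ac px py (ux - px) (uy - py).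
rewrite ![_ + (_ - _)]addrC !subrK /cpot /cG1 /cG2.
set a1 := tev (tD1 _) px py; set a2 := tev (tD2 _) px py.
set h := ux - px; set k := uy - py.
have -> : ux = px + h by rewrite /h; ring.
have -> : uy = py + k by rewrite /k; ring.
set qp := (px - x) ^+ 2 + (py - y) ^+ 2.
have -> : (px + h - x) ^+ 2 + (py + k - y) ^+ 2 = qp +
    (2 * ((px - x) * h + (py - y) * k) + (h ^+ 2 + k ^+ 2)).
  by rewrite /qp; ring.
set m := (px - x) * h + (py - y) * k; set r := h ^+ 2 + k ^+ 2.
have r0 : 0 <= r by rewrite addr_ge0 ?sqr_ge0.
have qp0 : 0 <= qp by rewrite addr_ge0 ?sqr_ge0.
set c := 2 + qp * 2 / 3 => H; rewrite /nq.
have N : qp + qp ^+ 2 / 6 + c * m + r <=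
    qp + (2 * m + r) + (qp + (2 * m + r)) ^+ 2 / 6.
  rewrite -subr_ge0 (_ : _ - _ = (2 * m + r) ^+ 2 / 6 + qp * r / 3).
    by rewrite addr_ge0// divr_ge0// ?sqr_ge0// mulr_ge0.
  by rewrite /c; field.
have G : - ((a1 + c * (px - x)) ^+ 2 + (a2 + c * (py - y)) ^+ 2) / 2 <=
    (a1 * h + a2 * k) + c * m + r / 2.
  rewrite -subr_ge0 (_ : _ - _ = ((a1 + c * (px - x) + h) ^+ 2
    + (a2 + c * (py - y) + k) ^+ 2) / 2).
    by rewrite divr_ge0// addr_ge0 ?sqr_ge0.
  by rewrite /m /r; field.
lra.
Qed.

Lemma bpot_le s t k ux uy x y : A_semiconvex s t ->
  (cG1 s t (Sp1 s t x y) (Sp2 s t x y) x y ^+ 2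
   + cG2 s t (Sp1 s t x y) (Sp2 s t x y) x y ^+ 2) / 2 <= k ->
  - cpot s t ux uy x y <= bpot s t k x y.
Proof.
move=> Ac Hk; have := cpot_convex ux uy (Sp1 s t x y) (Sp2 s t x y) x y Ac.
by rewrite /bpot; lra.
Qed.

(* The constraint on a dual pair for the Hellinger-Kantorovich problem. *)
Lemma potentials_admissible s t k ux uy x y d : A_semiconvex s t ->
  (cG1 s t (Sp1 s t x y) (Sp2 s t x y) x y ^+ 2
   + cG2 s t (Sp1 s t x y) (Sp2 s t x y) x y ^+ 2) / 2 <= k ->
  d ^+ 2 = (ux - x) ^+ 2 + (uy - y) ^+ 2 -> 0 <= d <= pi / 2 ->
  cos d ^+ 2 <= expR (tev (A s t) ux uy) * expR (bpot s t k x y).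
Proof.
move=> Ac Hk dE dp; have B := bpot_le ux uy Ac Hk.
rewrite -expRD; apply: (@le_trans _ _ (expR (- nq (d ^+ 2)))); last first.
  by rewrite ler_expR; move: B; rewrite /cpot -dE; lra.
have c0 : 0 <= cos d.
  have p0 := pi_gt0 R; case/andP: dp => d0 dp.
  by rewrite cos_ge0_pihalf// dp andbT; lra.
have -> : - nq (d ^+ 2) = - (d ^+ 2 / 2 + d ^+ 4 / 12) + - (d ^+ 2 / 2 + d ^+ 4 / 12).
  by rewrite /nq; field.
by rewrite expRD expr2 ler_pM ?cos_le_gauss.
Qed.

End potentials.

(** * Second-order jets and the duality gap along the plan *)

Section jets.
Variables (R : realType) (S : scale R).
Implicit Types F G p q y : sidx S -> R.

Definition jet p1 p2 F := [/\ ordO 1 p1, ordO 2 p2 &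
  ordO 3 (fun i => F i - (1 + p1 i + p2 i))].

Lemma jet_mul p1 p2 q1 q2 F G : jet p1 p2 F -> jet q1 q2 G ->
  jet (fun i => p1 i + q1 i) (fun i => p2 i + q2 i + p1 i * q1 i)
      (fun i => F i * G i).
Proof.
move=> [a1 a2 a3] [b1 b2 b3]; split; [ord | ord | ].
set r := (fun i => _) in a3; set r' := (fun i => _) in b3.
apply: (@ord_eq _ _ _ _ (fun i => r i * (1 + q1 i + q2 i + r' i)
  + (1 + p1 i + p2 i) * r' i + p1 i * q2 i + p2 i * q1 i + p2 i * q2 i)).
  by move=> i _; rewrite /r /r'; ring.
by ord.
Qed.

Lemma jet_exp p1 p2 y : ordO 1 p1 -> ordO 2 p2 ->
  ordO 3 (fun i => y i - (p1 i + p2 i)) ->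
  jet p1 (fun i => p2 i + p1 i ^+ 2 / 2) (fun i => expR (y i)).
Proof.
move=> o1 o2 o3; split; [ord | ord | ].
set r := (fun i => _) in o3.
have oy : ordO 1 y.
  apply: (@ord_eq _ _ _ _ (fun i => r i + p1 i + p2 i)); last by ord.
  by move=> i _; rewrite /r; ring.
have := ord_expR oy => oe; set e := (fun i => _) in oe.
apply: (@ord_eq _ _ _ _ (fun i => e i + r i + (r i + p2 i)
  * (y i + p1 i) / 2)); last by ord.
by move=> i _; rewrite /e /r; field.
Qed.

Lemma jet_ext p1 p2 q1 q2 F : (forall i, sdom i -> p1 i = q1 i) ->
  (forall i, sdom i -> p2 i = q2 i) -> jet p1 p2 F -> jet q1 q2 F.
Proof.
move=> E1 E2 [a1 a2 a3]; split.
- by apply: ord_eq a1 => i Di; rewrite E1.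
- by apply: ord_eq a2 => i Di; rewrite E2.
- by apply: ord_eq a3 => i Di; rewrite E1 ?E2.
Qed.

Lemma jet_sub p1 p2 F G : jet p1 p2 F -> jet p1 p2 G ->
  ordO 3 (fun i => F i - G i).
Proof.
move=> [_ _ o] [_ _ o']; set r := (fun i => _) in o; set r' := (fun i => _) in o'.
apply: (@ord_eq _ _ _ _ (fun i => r i - r' i)); last by ord.
by move=> i _; rewrite /r /r'; ring.
Qed.

Lemma ord_kap (f v1 v2 rho kap sg : sidx S -> R) :
  ordO 1 f -> ordO 1 v1 -> ordO 1 v2 ->
  [/\ forall i, sdom i ->
     rho i * cos (Num.sqrt (kap i ^+ 2 * (v1 i ^+ 2 + v2 i ^+ 2))) = 1 + f i,
      forall i, sdom i -> rho i * sg i * kap i = 1,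
      ordO 4 (fun i => sg i - (1 - kap i ^+ 2 * (v1 i ^+ 2 + v2 i ^+ 2) / 6)),
      ordO 0 kap
    & ordO 2 (fun i => rho i - (1 + f i))] ->
  ordO 1 (fun i => kap i - 1) /\ ordO 2 (fun i => kap i - (1 - f i)).
Proof.
move=> of1 ov1 ov2 [_ sE os ok od].
set r := (fun i => _) in os; set d := (fun i => _) in od.
have oc : ordO 2 (fun i => kap i * (1 + f i) - 1).
  apply: (@ord_eq _ _ _ _ (fun i => (d i + (1 + f i)) * kap i *
    (kap i ^+ 2 * (v1 i ^+ 2 + v2 i ^+ 2) / 6 - r i) - kap i * d i)); last by ord.
  move=> i Di; transitivity (kap i * (1 + f i) - rho i * sg i * kap i).
    by rewrite sE.
  by rewrite /r /d; ring.
set c := (fun i => _) in oc.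
have o1 : ordO 1 (fun i => kap i - 1).
  apply: (@ord_eq _ _ _ _ (fun i => c i - kap i * f i)); last by ord.
  by move=> i _; rewrite /c; ring.
split=> //; apply: (@ord_eq _ _ _ _ (fun i => c i - (kap i - 1) * f i)).
  by move=> i _; rewrite /c; ring.
by ord.
Qed.

End jets.

Section gap.
Variables (R : realType) (phi psi : tpoly R).
Variables (S : scale R) (s t x y : sidx S -> R).
Hypotheses (os : ordO 1 s) (ot : ordO 1 t).

Local Notation A i := (pA phi psi (s i) (t i)).

Let P20 := tadd (tscale 2 (tmul phi phi))
      (tadd (tmul (tD1 phi) (tD1 phi)) (tmul (tD2 phi) (tD2 phi))).
Let P02 := tscale (-2) (tmul psi psi).
Let P11 := tsub (tscale 2^-1 (pD phi psi)) (pdot phi psi).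

Let comb (a b c d e : R) (p1 p2 p3 p4 p5 : tpoly R) :=
  tadd (tadd (tscale a p1) (tscale b p2))
    (tadd (tscale c p3) (tadd (tscale d p4) (tscale e p5))).
Let lin a b c d e p1 p2 p3 p4 p5 X Y : tev (comb a b c d e p1 p2 p3 p4 p5) X Y =
  a * tev p1 X Y + b * tev p2 X Y + c * tev p3 X Y + d * tev p4 X Y
  + e * tev p5 X Y.
Proof. by rewrite !(tev_add, tev_scale) !addrA. Qed.
Let linD1 a b c d e p1 p2 p3 p4 p5 X Y :
  tev (tD1 (comb a b c d e p1 p2 p3 p4 p5)) X Y = a * tev (tD1 p1) X Y
  + b * tev (tD1 p2) X Y + c * tev (tD1 p3) X Y + d * tev (tD1 p4) X Y
  + e * tev (tD1 p5) X Y.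
Proof. by rewrite !(tD1_add, tD1_scale) !addrA. Qed.
Let linD2 a b c d e p1 p2 p3 p4 p5 X Y :
  tev (tD2 (comb a b c d e p1 p2 p3 p4 p5)) X Y = a * tev (tD2 p1) X Y
  + b * tev (tD2 p2) X Y + c * tev (tD2 p3) X Y + d * tev (tD2 p4) X Y
  + e * tev (tD2 p5) X Y.
Proof. by rewrite !(tD2_add, tD2_scale) !addrA. Qed.

Let AE i X Y : tev (A i) X Y = - (2 * s i) * tev phi X Y + 2 * t i * tev psi X Y
  + s i ^+ 2 * tev P20 X Y + t i ^+ 2 * tev P02 X Y + s i * t i * tev P11 X Y.
Proof. exact: lin. Qed.
Let D1AE i X Y : tev (tD1 (A i)) X Y = - (2 * s i) * tev (tD1 phi) X Y
  + 2 * t i * tev (tD1 psi) X Y + s i ^+ 2 * tev (tD1 P20) X Y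
  + t i ^+ 2 * tev (tD1 P02) X Y + s i * t i * tev (tD1 P11) X Y.
Proof. exact: linD1. Qed.
Let D2AE i X Y : tev (tD2 (A i)) X Y = - (2 * s i) * tev (tD2 phi) X Y
  + 2 * t i * tev (tD2 psi) X Y + s i ^+ 2 * tev (tD2 P20) X Y
  + t i ^+ 2 * tev (tD2 P02) X Y + s i * t i * tev (tD2 P11) X Y.
Proof. exact: linD2. Qed.

Section critical.
Variables (X Y : sidx S -> R).

Let ordA1 (F G : sidx S -> R) : ordO 1 (fun i => tev (tD1 (A i)) (F i) (G i)).
Proof. by apply: (ord_eq (fun i _ => D1AE i (F i) (G i))); ord. Qed.
Let ordA2 (F G : sidx S -> R) : ordO 1 (fun i => tev (tD2 (A i)) (F i) (G i)).
Proof. by apply: (ord_eq (fun i _ => D2AE i (F i) (G i))); ord. Qed.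

(** The gradient of A is itself of order one, so a displacement of order n changes it by order n + 1
    only. *)
Let lipA1 n (F G H K : sidx S -> R) : ordO n H -> ordO n K ->
  ordO n.+1 (fun i => tev (tD1 (A i)) (F i + H i) (G i + K i)
    - tev (tD1 (A i)) (F i) (G i)).
Proof.
move=> oH oK; pose d p i := tev p (F i + H i) (G i + K i) - tev p (F i) (G i).
have o p : ordO n (d p) by exact: ord_tev_lip.
have sx : ordO 1 (fun i => - (2 * s i)) by ord.
have tx : ordO 1 (fun i => 2 * t i) by ord.
have s2 : ordO 1 (fun i => s i ^+ 2) by ord.
have t2 : ordO 1 (fun i => t i ^+ 2) by ord.
have st : ordO 1 (fun i => s i * t i) by ord.
have := ord_add_same (ord_mul sx (o (tD1 phi))) (ord_mul tx (o (tD1 psi))).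
move/ord_add_same/(_ (ord_mul s2 (o (tD1 P20)))).
move/ord_add_same/(_ (ord_mul t2 (o (tD1 P02)))).
move/ord_add_same/(_ (ord_mul st (o (tD1 P11)))).
by apply: ord_eq => i _; rewrite !D1AE /d; ring.
Qed.
Let lipA2 n (F G H K : sidx S -> R) : ordO n H -> ordO n K ->
  ordO n.+1 (fun i => tev (tD2 (A i)) (F i + H i) (G i + K i)
    - tev (tD2 (A i)) (F i) (G i)).
Proof.
move=> oH oK; pose d p i := tev p (F i + H i) (G i + K i) - tev p (F i) (G i).
have o p : ordO n (d p) by exact: ord_tev_lip.
have sx : ordO 1 (fun i => - (2 * s i)) by ord.
have tx : ordO 1 (fun i => 2 * t i) by ord.
have s2 : ordO 1 (fun i => s i ^+ 2) by ord.
have t2 : ordO 1 (fun i => t i ^+ 2) by ord.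
have st : ordO 1 (fun i => s i * t i) by ord.
have := ord_add_same (ord_mul sx (o (tD2 phi))) (ord_mul tx (o (tD2 psi))).
move/ord_add_same/(_ (ord_mul s2 (o (tD2 P20)))).
move/ord_add_same/(_ (ord_mul t2 (o (tD2 P02)))).
move/ord_add_same/(_ (ord_mul st (o (tD2 P11)))).
by apply: ord_eq => i _; rewrite !D2AE /d; ring.
Qed.

Let m1 i := Sm1 phi psi (s i) (t i) (X i) (Y i).
Let m2 i := Sm2 phi psi (s i) (t i) (X i) (Y i).
Let p1 i := Sp1 phi psi (s i) (t i) (X i) (Y i).
Let p2 i := Sp2 phi psi (s i) (t i) (X i) (Y i).
Let a1 i := tev (tD1 (A i)) (m1 i) (m2 i).
Let a2 i := tev (tD2 (A i)) (m1 i) (m2 i).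
Let oa1 : ordO 1 a1. Proof. exact: ordA1. Qed.
Let oa2 : ordO 1 a2. Proof. exact: ordA2. Qed.

Let pm1 : ordO 2 (fun i => p1 i - m1 i).
Proof.
pose h i := - tev (tD1 (A i)) (X i) (Y i) / 2.
pose k i := - tev (tD2 (A i)) (X i) (Y i) / 2.
have ox := ordA1 X Y; have oy := ordA2 X Y.
have oh : ordO 1 h by rewrite /h; ord.
have ok : ordO 1 k by rewrite /k; ord.
have := lipA1 X Y oh ok; set d := (fun i => _) => od.
apply: (@ord_eq _ _ _ _ (fun i => - d i / 2)); last by ord.
move=> i _; rewrite /d /p1 /Sp1 /m1 /Sm1 /Sm2 /h /k !mulNr; ring.
Qed.

Let pm2 : ordO 2 (fun i => p2 i - m2 i).
Proof.
pose h i := - tev (tD1 (A i)) (X i) (Y i) / 2.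
pose k i := - tev (tD2 (A i)) (X i) (Y i) / 2.
have ox := ordA1 X Y; have oy := ordA2 X Y.
have oh : ordO 1 h by rewrite /h; ord.
have ok : ordO 1 k by rewrite /k; ord.
have := lipA2 X Y oh ok; set d := (fun i => _) => od.
apply: (@ord_eq _ _ _ _ (fun i => - d i / 2)); last by ord.
move=> i _; rewrite /d /p2 /Sp2 /m2 /Sm1 /Sm2 /h /k !mulNr; ring.
Qed.

(** [Sm] and [Sp] are two steps of the iteration u -> x - grad A (u) / 2 started at x. Each step
    gains one order, and the correction to the gradient from the quadratic part of [nq] is cubic, so
    the critical equation holds at [Sp] up to order three. *)
Lemma ord_cG_Sp :
  ordO 6 (fun i => (cG1 phi psi (s i) (t i) (p1 i) (p2 i) (X i) (Y i) ^+ 2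
    + cG2 phi psi (s i) (t i) (p1 i) (p2 i) (X i) (Y i) ^+ 2) / 2).
Proof.
have d1 := lipA1 m1 m2 pm1 pm2; have d2 := lipA2 m1 m2 pm1 pm2.
set e1 := (fun i => _) in d1; set e2 := (fun i => _) in d2.
pose q i := (a1 i ^+ 2 + a2 i ^+ 2) / 4.
have oq : ordO 2 q by rewrite /q; ord.
have o1 : ordO 3 (fun i => cG1 phi psi (s i) (t i) (p1 i) (p2 i) (X i) (Y i)).
  apply: (@ord_eq _ _ _ _ (fun i => e1 i - q i * a1 i / 3)); last by ord.
  move=> i _; rewrite /e1 !(addrC (m1 i)) !(addrC (m2 i)) !subrK /cG1.
  have -> : p1 i - X i = - a1 i / 2 by rewrite /p1 /Sp1 /a1 /m1 /m2; ring.
  have -> : p2 i - Y i = - a2 i / 2 by rewrite /p2 /Sp2 /a2 /m1 /m2; ring.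
  by rewrite /q /a1; field.
have o2 : ordO 3 (fun i => cG2 phi psi (s i) (t i) (p1 i) (p2 i) (X i) (Y i)).
  apply: (@ord_eq _ _ _ _ (fun i => e2 i - q i * a2 i / 3)); last by ord.
  move=> i _; rewrite /e2 !(addrC (m1 i)) !(addrC (m2 i)) !subrK /cG2.
  have -> : p1 i - X i = - a1 i / 2 by rewrite /p1 /Sp1 /a1 /m1 /m2; ring.
  have -> : p2 i - Y i = - a2 i / 2 by rewrite /p2 /Sp2 /a2 /m1 /m2; ring.
  by rewrite /q /a2; field.
by ord.
Qed.

End critical.

Hypothesis f_ge : forall i X Y, sdom i -> 2^-1 <= 1 + tf phi (s i) X Y.
Hypothesis g_ge : forall i X Y, sdom i -> 2^-1 <= 1 + tf psi (t i) X Y.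
Hypothesis lam1_ge : forall i X Y, sdom i ->
  2^-1 <= 1 + s i * t i * tev (tD1 (pW1 phi psi)) X Y.
Hypothesis lam2_ge : forall i X Y, sdom i ->
  2^-1 <= 1 + s i * t i * tev (tD2 (pW2 phi psi)) X Y.

Let f i := tf phi (s i) (x i) (y i).
Let v1 i := tv1 phi (s i) (x i) (y i).
Let v2 i := tv2 phi (s i) (x i) (y i).
Let z1 i := Tz1 phi psi (s i) (t i) (x i) (y i).
Let z2 i := Tz2 phi psi (s i) (t i) (x i) (y i).
Let g i := tf psi (t i) (x i) (y i).
Let w1 i := tv1 psi (t i) (x i) (y i).
Let w2 i := tv2 psi (t i) (x i) (y i).
Let gT i := tf psi (t i) (x i + z1 i) (y i + z2 i).
Let wT1 i := tv1 psi (t i) (x i + z1 i) (y i + z2 i).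
Let wT2 i := tv2 psi (t i) (x i + z1 i) (y i + z2 i).
Let k0 i := tkap phi (s i) (x i) (y i).
Let kT i := tkap psi (t i) (x i + z1 i) (y i + z2 i).
Let r0 i := trho phi (s i) (x i) (y i).
Let rT i := trho psi (t i) (x i + z1 i) (y i + z2 i).
Let D i := tev (pD phi psi) (x i) (y i).
Let lam2 i := Tlam2 phi psi (s i) (t i) (x i) (y i).
Let h1 i := hx phi psi (s i) (t i) (x i) (y i).
Let h2 i := hy phi psi (s i) (t i) (x i) (y i).
Let q i := hq phi psi (s i) (t i) (x i) (y i).
Let a1 i := k0 i * v1 i.
Let a2 i := k0 i * v2 i.
Let A0 i := tev (A i) (x i + a1 i) (y i + a2 i).

Let of1 : ordO 1 f. Proof. exact: ord_f. Qed.
Let ov1 : ordO 1 v1. Proof. exact: ord_v1. Qed.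
Let ov2 : ordO 1 v2. Proof. exact: ord_v2. Qed.
Let og1 : ordO 1 g. Proof. exact: ord_g. Qed.
Let ow1 : ordO 1 w1. Proof. exact: ord_w1. Qed.
Let ow2 : ordO 1 w2. Proof. exact: ord_w2. Qed.
Let oz1 : ordO 2 z1. Proof. exact: ord_z1. Qed.
Let oz2 : ordO 2 z2. Proof. exact: ord_z2. Qed.
Let ogT : ordO 1 gT. Proof. exact: ord_gT. Qed.
Let owT1 : ordO 1 wT1. Proof. exact: ord_wT1. Qed.
Let owT2 : ordO 1 wT2. Proof. exact: ord_wT2. Qed.
Let odg : ordO 3 (fun i => gT i - g i). Proof. exact: ord_dg. Qed.
Let odw1 : ordO 3 (fun i => wT1 i - w1 i). Proof. exact: ord_dw1. Qed.
Let odw2 : ordO 3 (fun i => wT2 i - w2 i). Proof. exact: ord_dw2. Qed.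
Let olam2 : ordO 4 (fun i => lam2 i - 1 - s i * t i * D i). Proof. exact: ord_lam2. Qed.

Let ok0 : ordO 1 (fun i => k0 i - 1) /\ ordO 2 (fun i => k0 i - (1 - f i)).
Proof.
exact: (ord_kap of1 ov1 ov2
  (ord_polar (fun i Di => f_ge (x i) (y i) Di) ov1 ov2)).
Qed.
Let okT : ordO 1 (fun i => kT i - 1) /\ ordO 2 (fun i => kT i - (1 - gT i)).
Proof.
exact: (ord_kap ogT owT1 owT2
  (ord_polar (fun i Di => g_ge (x i + z1 i) (y i + z2 i) Di) owT1 owT2)).
Qed.

Let oa1 : ordO 3 (fun i => a1 i - (v1 i - f i * v1 i)).
Proof.
have [_] := ok0; set d := (fun i => _) => od.
apply: (@ord_eq _ _ _ _ (fun i => d i * v1 i)); last by ord.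
by move=> i _; rewrite /d /a1; ring.
Qed.
Let oa2 : ordO 3 (fun i => a2 i - (v2 i - f i * v2 i)).
Proof.
have [_] := ok0; set d := (fun i => _) => od.
apply: (@ord_eq _ _ _ _ (fun i => d i * v2 i)); last by ord.
by move=> i _; rewrite /d /a2; ring.
Qed.

Let sW1 i := s i * t i * tev (pW1 phi psi) (x i) (y i).
Let sW2 i := s i * t i * tev (pW2 phi psi) (x i) (y i).
Let orz : ordO 4 (fun i => z2 i - sW2 i). Proof. exact: ord_rz. Qed.
Let osW1 : ordO 2 sW1. Proof. by rewrite /sW1; ord. Qed.
Let osW2 : ordO 2 sW2. Proof. by rewrite /sW2; ord. Qed.

Let oh1 : ordO 3 (fun i => h1 i
  - (w1 i - g i * w1 i + sW1 i - v1 i + f i * v1 i)).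
Proof.
have oa := oa1; set ra := (fun i => _) in oa.
have [_] := okT; set d := (fun i => _) => od.
have dg := odg; set e := (fun i => _) in dg.
have dw := odw1; set e1 := (fun i => _) in dw.
apply: (@ord_eq _ _ _ _ (fun i => d i * wT1 i + e1 i - gT i * e1 i
  - e i * w1 i - ra i)); last by ord.
move=> i _; rewrite /d /e1 /e /ra /h1 /hx -/(z1 i) -/(z2 i) -/(kT i) -/(wT1 i).
by rewrite -/(k0 i) -/(v1 i) -/(a1 i) /z1 /Tz1 -/(sW1 i); ring.
Qed.
Let oh2 : ordO 3 (fun i => h2 i
  - (w2 i - g i * w2 i + sW2 i - v2 i + f i * v2 i)).
Proof.
have oa := oa2; set ra := (fun i => _) in oa.
have [_] := okT; set d := (fun i => _) => od.
have dg := odg; set e := (fun i => _) in dg.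
have dw := odw2; set e1 := (fun i => _) in dw.
have oz := orz; set rz := (fun i => _) in oz.
apply: (@ord_eq _ _ _ _ (fun i => d i * wT2 i + e1 i - gT i * e1 i
  - e i * w2 i - ra i + rz i)); last by ord.
move=> i _; rewrite /d /e1 /e /ra /h2 /hy -/(z1 i) -/(z2 i) -/(kT i) -/(wT2 i).
by rewrite -/(k0 i) -/(v2 i) -/(a2 i) /rz; ring.
Qed.

Let oh1' : ordO 2 (fun i => h1 i - (w1 i - v1 i)).
Proof.
have o := oh1; set r := (fun i => _) in o.
apply: (@ord_eq _ _ _ _ (fun i => r i + (- (g i * w1 i) + sW1 i + f i * v1 i)));
  last by ord.
by move=> i _; rewrite /r; ring.
Qed.
Let oh2' : ordO 2 (fun i => h2 i - (w2 i - v2 i)).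
Proof.
have o := oh2; set r := (fun i => _) in o.
apply: (@ord_eq _ _ _ _ (fun i => r i + (- (g i * w2 i) + sW2 i + f i * v2 i)));
  last by ord.
by move=> i _; rewrite /r; ring.
Qed.

Let oh11 : ordO 1 h1.
Proof.
have o := oh1'; set r := (fun i => _) in o.
apply: (@ord_eq _ _ _ _ (fun i => r i + (w1 i - v1 i))); last by ord.
by move=> i _; rewrite /r; ring.
Qed.
Let oh21 : ordO 1 h2.
Proof.
have o := oh2'; set r := (fun i => _) in o.
apply: (@ord_eq _ _ _ _ (fun i => r i + (w2 i - v2 i))); last by ord.
by move=> i _; rewrite /r; ring.
Qed.

Lemma ord_hq : ordO 2 q. Proof. by rewrite /q /hq -/h1 -/h2; ord. Qed.
Let oq := ord_hq.

Let oq3 : ordO 3 (fun i => q i - ((w1 i - v1 i) ^+ 2 + (w2 i - v2 i) ^+ 2)).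
Proof.
have o1 := oh1'; set r1 := (fun i => _) in o1.
have o2 := oh2'; set r2 := (fun i => _) in o2.
apply: (@ord_eq _ _ _ _ (fun i => r1 i * (h1 i + (w1 i - v1 i))
  + r2 i * (h2 i + (w2 i - v2 i)))); last by ord.
by move=> i _; rewrite /r1 /r2 /q /hq -/(h1 i) -/(h2 i); ring.
Qed.

Let oa11 : ordO 1 a1. Proof. by have [ok _] := ok0; rewrite /a1; set r := (fun i => _) in ok; apply: (@ord_eq _ _ _ _ (fun i => r i * v1 i + v1 i)) => [i _|]; [rewrite /r; ring | ord]. Qed.
Let oa21 : ordO 1 a2. Proof. by have [ok _] := ok0; rewrite /a2; set r := (fun i => _) in ok; apply: (@ord_eq _ _ _ _ (fun i => r i * v2 i + v2 i)) => [i _|]; [rewrite /r; ring | ord]. Qed.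


Let lip0 p : ordO 1 (fun i => tev p (x i + a1 i) (y i + a2 i) - tev p (x i) (y i)).
Proof. exact: ord_tev_lip. Qed.
Let tay0 p : ordO 2 (fun i => tev p (x i + a1 i) (y i + a2 i) - tev p (x i) (y i)
  - (tev (tD1 p) (x i) (y i) * a1 i + tev (tD2 p) (x i) (y i) * a2 i)).
Proof. exact: (@ord_tev_taylor _ _ 1). Qed.

(** The balance of displacement: the first endpoint of the plan is nearly critical for [cpot] at the
    second one. The terms in s t cancel precisely because W - grad (div W) / 4 = Z / 2. *)
Lemma ord_cG0 : ordO 6 (fun i =>
  (cG1 phi psi (s i) (t i) (x i + a1 i) (y i + a2 i)
     (x i + a1 i + h1 i) (y i + a2 i + h2 i) ^+ 2 +
   cG2 phi psi (s i) (t i) (x i + a1 i) (y i + a2 i)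
     (x i + a1 i + h1 i) (y i + a2 i + h2 i) ^+ 2) / 2).
Proof.
have b1 := oa1; set ra1 := (fun i => _) in b1.
have b2 := oa2; set ra2 := (fun i => _) in b2.
have b3 := oh1; set rh1 := (fun i => _) in b3.
have b4 := oh2; set rh2 := (fun i => _) in b4.
have E (i : sidx S) : (x i + a1 i - (x i + a1 i + h1 i)) ^+ 2 +
    (y i + a2 i - (y i + a2 i + h2 i)) ^+ 2 = q i.
  by rewrite /q /hq -/(h1 i) -/(h2 i); ring.
have o1 : ordO 3 (fun i => cG1 phi psi (s i) (t i) (x i + a1 i) (y i + a2 i)
     (x i + a1 i + h1 i) (y i + a2 i + h2 i)).
  have c1 := tay0 (tD1 phi); set t1 := (fun i => _) in c1.
  have c2 := tay0 (tD1 psi); set t2 := (fun i => _) in c2.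
  have c3 := lip0 (tD1 P20); set t3 := (fun i => _) in c3.
  have c4 := lip0 (tD1 P02); set t4 := (fun i => _) in c4.
  have c5 := lip0 (tD1 P11); set t5 := (fun i => _) in c5.
  apply: (@ord_eq _ _ _ _ (fun i => - (2 * s i) * t1 i + 2 * t i * t2 i
    + s i ^+ 2 * t3 i + t i ^+ 2 * t4 i + s i * t i * t5 i
    + (- (2 * s i) * tev (tD1 (tD1 phi)) (x i) (y i)
       + 2 * t i * tev (tD1 (tD1 psi)) (x i) (y i)) * (ra1 i - f i * v1 i)
    + (- (2 * s i) * tev (tD2 (tD1 phi)) (x i) (y i)
       + 2 * t i * tev (tD2 (tD1 psi)) (x i) (y i)) * (ra2 i - f i * v2 i)
    - 2 * rh1 i - q i * (2 / 3) * h1 i)); last by ord.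
  move=> i _; rewrite /cG1 E.
  rewrite [X in (2 + _) * X](_ : _ = - h1 i); last by ring.
  rewrite D1AE.
  have -> : tev (tD1 phi) (x i + a1 i) (y i + a2 i) = t1 i + tev (tD1 phi) (x i) (y i)
    + (tev (tD1 (tD1 phi)) (x i) (y i) * (ra1 i + (v1 i - f i * v1 i)) +
       tev (tD2 (tD1 phi)) (x i) (y i) * (ra2 i + (v2 i - f i * v2 i))).
    by rewrite /t1 /ra1 /ra2; ring.
  have -> : tev (tD1 psi) (x i + a1 i) (y i + a2 i) = t2 i + tev (tD1 psi) (x i) (y i)
    + (tev (tD1 (tD1 psi)) (x i) (y i) * (ra1 i + (v1 i - f i * v1 i)) +
       tev (tD2 (tD1 psi)) (x i) (y i) * (ra2 i + (v2 i - f i * v2 i))).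
    by rewrite /t2 /ra1 /ra2; ring.
  have -> : tev (tD1 P20) (x i + a1 i) (y i + a2 i) = t3 i + tev (tD1 P20) (x i) (y i).
    by rewrite /t3 subrK.
  have -> : tev (tD1 P02) (x i + a1 i) (y i + a2 i) = t4 i + tev (tD1 P02) (x i) (y i).
    by rewrite /t4 subrK.
  have -> : tev (tD1 P11) (x i + a1 i) (y i + a2 i) = t5 i + tev (tD1 P11) (x i) (y i).
    by rewrite /t5 subrK.
  have -> : h1 i = rh1 i + (w1 i - g i * w1 i + sW1 i - v1 i + f i * v1 i).
    by rewrite /rh1; ring.
  move: (t1 i) (t2 i) (t3 i) (t4 i) (t5 i) (ra1 i) (ra2 i) (rh1 i) (q i).
  move=> *; rewrite /P20 /P02 /P11 /pdot /f /v1 /v2 /g /w1 /w2 /sW1 /pW1 /pZ1.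
  by rewrite /tf /tv1 /tv2 !tevE !tD12; field.
have o2 : ordO 3 (fun i => cG2 phi psi (s i) (t i) (x i + a1 i) (y i + a2 i)
     (x i + a1 i + h1 i) (y i + a2 i + h2 i)).
  have c1 := tay0 (tD2 phi); set t1 := (fun i => _) in c1.
  have c2 := tay0 (tD2 psi); set t2 := (fun i => _) in c2.
  have c3 := lip0 (tD2 P20); set t3 := (fun i => _) in c3.
  have c4 := lip0 (tD2 P02); set t4 := (fun i => _) in c4.
  have c5 := lip0 (tD2 P11); set t5 := (fun i => _) in c5.
  apply: (@ord_eq _ _ _ _ (fun i => - (2 * s i) * t1 i + 2 * t i * t2 i
    + s i ^+ 2 * t3 i + t i ^+ 2 * t4 i + s i * t i * t5 i
    + (- (2 * s i) * tev (tD1 (tD2 phi)) (x i) (y i)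
       + 2 * t i * tev (tD1 (tD2 psi)) (x i) (y i)) * (ra1 i - f i * v1 i)
    + (- (2 * s i) * tev (tD2 (tD2 phi)) (x i) (y i)
       + 2 * t i * tev (tD2 (tD2 psi)) (x i) (y i)) * (ra2 i - f i * v2 i)
    - 2 * rh2 i - q i * (2 / 3) * h2 i)); last by ord.
  move=> i _; rewrite /cG2 E.
  rewrite [X in (2 + _) * X](_ : _ = - h2 i); last by ring.
  rewrite D2AE.
  have -> : tev (tD2 phi) (x i + a1 i) (y i + a2 i) = t1 i + tev (tD2 phi) (x i) (y i)
    + (tev (tD1 (tD2 phi)) (x i) (y i) * (ra1 i + (v1 i - f i * v1 i)) +
       tev (tD2 (tD2 phi)) (x i) (y i) * (ra2 i + (v2 i - f i * v2 i))).
    by rewrite /t1 /ra1 /ra2; ring.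
  have -> : tev (tD2 psi) (x i + a1 i) (y i + a2 i) = t2 i + tev (tD2 psi) (x i) (y i)
    + (tev (tD1 (tD2 psi)) (x i) (y i) * (ra1 i + (v1 i - f i * v1 i)) +
       tev (tD2 (tD2 psi)) (x i) (y i) * (ra2 i + (v2 i - f i * v2 i))).
    by rewrite /t2 /ra1 /ra2; ring.
  have -> : tev (tD2 P20) (x i + a1 i) (y i + a2 i) = t3 i + tev (tD2 P20) (x i) (y i).
    by rewrite /t3 subrK.
  have -> : tev (tD2 P02) (x i + a1 i) (y i + a2 i) = t4 i + tev (tD2 P02) (x i) (y i).
    by rewrite /t4 subrK.
  have -> : tev (tD2 P11) (x i + a1 i) (y i + a2 i) = t5 i + tev (tD2 P11) (x i) (y i).
    by rewrite /t5 subrK.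
  have -> : h2 i = rh2 i + (w2 i - g i * w2 i + sW2 i - v2 i + f i * v2 i).
    by rewrite /rh2; ring.
  move: (t1 i) (t2 i) (t3 i) (t4 i) (t5 i) (ra1 i) (ra2 i) (rh2 i) (q i).
  move=> *; rewrite /P20 /P02 /P11 /pdot /f /v1 /v2 /g /w1 /w2 /sW2 /pW2 /pZ2.
  by rewrite /tf /tv1 /tv2 !tevE !tD12; field.
by ord.
Qed.

(** The second-order part of A at the first endpoint. Its term s t D / 2 is half of the leading part
    of the Jacobian minus 1, as the balance of mass in [ord_gap] requires. *)
Let B2 i := f i ^+ 2 / 2 - g i ^+ 2 / 2 - (v1 i ^+ 2 + v2 i ^+ 2)
  + (v1 i * w1 i + v2 i * w2 i) + s i * t i * D i / 2.
Let oB2 : ordO 2 B2. Proof. by rewrite /B2 /D; ord. Qed.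

Let oA0 : ordO 3 (fun i => A0 i - ((g i - f i) + B2 i)).
Proof.
have b1 := oa1; set ra1 := (fun i => _) in b1.
have b2 := oa2; set ra2 := (fun i => _) in b2.
have c1 := tay0 phi; set t1 := (fun i => _) in c1.
have c2 := tay0 psi; set t2 := (fun i => _) in c2.
have c3 := lip0 P20; set t3 := (fun i => _) in c3.
have c4 := lip0 P02; set t4 := (fun i => _) in c4.
have c5 := lip0 P11; set t5 := (fun i => _) in c5.
apply: (@ord_eq _ _ _ _ (fun i => - (2 * s i) * t1 i + 2 * t i * t2 i
    + s i ^+ 2 * t3 i + t i ^+ 2 * t4 i + s i * t i * t5 i
    + 2 * (w1 i - v1 i) * (ra1 i - f i * v1 i)
    + 2 * (w2 i - v2 i) * (ra2 i - f i * v2 i))); last by ord.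
move=> i _; rewrite /A0 AE.
have -> : tev phi (x i + a1 i) (y i + a2 i) = t1 i + tev phi (x i) (y i)
    + (tev (tD1 phi) (x i) (y i) * (ra1 i + (v1 i - f i * v1 i)) +
       tev (tD2 phi) (x i) (y i) * (ra2 i + (v2 i - f i * v2 i))).
  by rewrite /t1 /ra1 /ra2; ring.
have -> : tev psi (x i + a1 i) (y i + a2 i) = t2 i + tev psi (x i) (y i)
    + (tev (tD1 psi) (x i) (y i) * (ra1 i + (v1 i - f i * v1 i)) +
       tev (tD2 psi) (x i) (y i) * (ra2 i + (v2 i - f i * v2 i))).
  by rewrite /t2 /ra1 /ra2; ring.
have -> : tev P20 (x i + a1 i) (y i + a2 i) = t3 i + tev P20 (x i) (y i).
  by rewrite /t3 subrK.
have -> : tev P02 (x i + a1 i) (y i + a2 i) = t4 i + tev P02 (x i) (y i).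
  by rewrite /t4 subrK.
have -> : tev P11 (x i + a1 i) (y i + a2 i) = t5 i + tev P11 (x i) (y i).
  by rewrite /t5 subrK.
move: (t1 i) (t2 i) (t3 i) (t4 i) (t5 i) (ra1 i) (ra2 i) => *.
rewrite /B2 /D /P20 /P02 /P11 /pdot /f /v1 /v2 /g /w1 /w2 /tf /tv1 /tv2 !tevE.
by field.
Qed.

(** With X^2 and Y^2 for the two weighted exponentials, the gap is (X - Y)^2 + 2 lam r0 rT (exp ((A0
    + b) / 2) - cos (sqrt q)). The jets of X^2 and Y^2 agree to second order (balance of mass), so
    the square is of order six. The last difference is of order six too, since exp (- nq (q) / 2)
    and cos (sqrt q) agree up to O(q^3). *)
Lemma ord_gap (b : sidx S -> R) :
  ordO 6 (fun i => b i + A0 i + nq (q i)) ->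
  ordO 5 (fun i => r0 i ^+ 2 * expR (A0 i) + lam2 i * rT i ^+ 2 * expR (b i)
    - 2 * Tcos phi psi (s i) (t i) (x i) (y i)).
Proof.
move=> ob; set rb := (fun i => _) in ob.
have c1 := oA0; set rA := (fun i => _) in c1.
have c2 := oq3; set rq := (fun i => _) in c2.
have c3 := olam2; set rl := (fun i => _) in c3.
have c4 := odg; set rg := (fun i => _) in c4.
have c5 := odw1; set rw1 := (fun i => _) in c5.
have c6 := odw2; set rw2 := (fun i => _) in c6.
have oD : ordO 0 D by rewrite /D; ord.
have q0 i : 0 <= q i by rewrite addr_ge0 ?sqr_ge0.
have rE f' a b' : prho f' (enorm (a, b')) ^+ 2 = (1 + f') ^+ 2 + (a ^+ 2 + b' ^+ 2).
  by rewrite !sqr_sqrtr// !addr_ge0 ?sqr_ge0// exprn_ge0 ?sqrtr_ge0.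
have o00 : ordO 1 (fun i => g i - f i) by ord.
have j1 : jet (fun i => 2 * f i) (fun i => f i ^+ 2 + (v1 i ^+ 2 + v2 i ^+ 2))
    (fun i => r0 i ^+ 2).
  split; [by ord | by ord|].
  apply: (@ord_eq _ _ _ _ (fun _ => 0)) => [i _|].
    by rewrite /r0 /trho rE -/(f i) -/(v1 i) -/(v2 i); ring.
  by exists 0 => i _; rewrite normr0 mul0r.
have j2 : jet (fun i => 2 * g i) (fun i => g i ^+ 2 + (w1 i ^+ 2 + w2 i ^+ 2))
    (fun i => rT i ^+ 2).
  split; [by ord | by ord|].
  apply: (@ord_eq _ _ _ _ (fun i => rg i * (2 + gT i + g i)
    + rw1 i * (wT1 i + w1 i) + rw2 i * (wT2 i + w2 i))); last by ord.
  by move=> i _; rewrite /rT /trho rE -/(gT i) -/(wT1 i) -/(wT2 i)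
    /rg /rw1 /rw2; ring.
have j3 : jet (fun _ => 0) (fun i => s i * t i * D i) lam2.
  split; [by exists 0 => i _; rewrite normr0 mul0r | by ord |].
  by apply: (@ord_eq _ _ _ _ rl) => [i _|]; [rewrite /rl; ring | ord].
have j4 := jet_exp o00 oB2 c1.
have o01 : ordO 1 (fun i => - (g i - f i)) by ord.
have o02 : ordO 2 (fun i => - B2 i - ((w1 i - v1 i) ^+ 2 + (w2 i - v2 i) ^+ 2)).
  by ord.
have o03 : ordO 3 (fun i => b i - (- (g i - f i) +
    (- B2 i - ((w1 i - v1 i) ^+ 2 + (w2 i - v2 i) ^+ 2)))).
  apply: (@ord_eq _ _ _ _ (fun i => rb i - rA i - rq i - q i ^+ 2 / 6)); last by ord.
  by move=> i _; rewrite /rb /rA /rq /nq; ring.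
have j5 := jet_exp o01 o02 o03.
have jX := jet_mul j1 j4; have jY := jet_mul (jet_mul j3 j2) j5.
have XY : ordO 3 (fun i => r0 i ^+ 2 * expR (A0 i) -
    lam2 i * rT i ^+ 2 * expR (b i)).
  apply: jet_sub jX _; apply: jet_ext jY => i _; first by ring.
  by rewrite /B2; field.
have r0_ge i : sdom i -> 2^-1 <= r0 i.
  move=> Di; have f0 := f_ge (x i) (y i) Di; apply: (le_trans f0).
  rewrite -/(f i) in f0 *; have f0' : 0 <= 1 + f i by lra.
  by rewrite -[leLHS](ger0_norm f0') -sqrtr_sqr ler_wsqrtr// lerDl sqr_ge0.
have oi : ordO 0 (fun i => (r0 i)^-1) by apply: (@ord_inv _ _ _ 2^-1); rewrite ?invr_gt0.
have oA00 : ordO 1 A0.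
  apply: (@ord_eq _ _ _ _ (fun i => rA i + ((g i - f i) + B2 i))); last by ord.
  by move=> i _; rewrite /rA; ring.
have oe : ordO 0 (fun i => expR (- (A0 i / 2))).
  have : ordO 1 (fun i => - (A0 i / 2)) by ord.
  move=> o; have := ord_expR o; set r := (fun i => _) => o'.
  apply: (@ord_eq _ _ _ _ (fun i => r i + (1 + - (A0 i / 2) + (- (A0 i / 2)) ^+ 2 / 2)));
    last by ord.
  by move=> i _; rewrite /r subrK.
pose lam i := Num.sqrt (lam2 i).
have lam_ge i : sdom i -> 0 <= lam2 i.
  move=> Di; rewrite mulr_ge0//.
  - by have := lam1_ge (x i) (y i) Di; lra.
  - by have := lam2_ge (x i + Tz1 phi psi (s i) (t i) (x i) (y i)) (y i) Di; lra.
have rT0 i : 0 <= rT i by exact: sqrtr_ge0.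
pose X2 i := r0 i * expR (A0 i / 2); pose Y2 i := lam i * rT i * expR (b i / 2).
(* X - Y is (X^2 - Y^2) / (X + Y), where X + Y >= X and 1 / X is bounded. *)
have oXY2 : ordO 3 (fun i => X2 i - Y2 i).
  have : ordO 3 (fun i => (r0 i ^+ 2 * expR (A0 i) -
    lam2 i * rT i ^+ 2 * expR (b i)) * ((r0 i)^-1 * expR (- (A0 i / 2)))) by ord.
  apply: ord_dom => i Di.
  have p1 : 0 < r0 i by have := r0_ge i Di; lra.
  have X0 : 0 < X2 i by rewrite mulr_gt0 ?expR_gt0.
  have Y0 : 0 <= Y2 i by rewrite !mulr_ge0 ?expR_ge0 ?sqrtr_ge0.
  have e2 (a : R) : expR a = expR (a / 2) ^+ 2.
    by rewrite expr2 -expRD; congr expR; field.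
  have -> : r0 i ^+ 2 * expR (A0 i) - lam2 i * rT i ^+ 2 * expR (b i) =
      (X2 i - Y2 i) * (X2 i + Y2 i).
    by rewrite -subr_sqr /X2 /Y2 !exprMn -!e2 (sqr_sqrtr (lam_ge i Di)).
  have -> : (r0 i)^-1 * expR (- (A0 i / 2)) = (X2 i)^-1.
    by rewrite /X2 invfM expRN.
  rewrite -mulrA normrM ler_peMr// ger0_norm.
    by rewrite ler_pdivlMr// mul1r lerDl.
  by rewrite divr_ge0 ?addr_ge0 ?(ltW X0).
have olam : ordO 0 (fun i => lam i * r0 i * rT i).
  have om : ordO 2 (fun i => lam i - 1) by exact: ord_mu.
  have oX : ordO 0 (fun i => r0 i ^+ 2).
    case: j1 => _ _; set r := (fun i => _) => o.
    apply: (@ord_eq _ _ _ _ (fun i => r i + (1 + 2 * f i +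
      (f i ^+ 2 + (v1 i ^+ 2 + v2 i ^+ 2))))); last by ord.
    by move=> i _; rewrite /r subrK.
  have oY : ordO 0 (fun i => rT i ^+ 2).
    case: j2 => _ _; set r := (fun i => _) => o.
    apply: (@ord_eq _ _ _ _ (fun i => r i + (1 + 2 * g i +
      (g i ^+ 2 + (w1 i ^+ 2 + w2 i ^+ 2))))); last by ord.
    by move=> i _; rewrite /r subrK.
  have oZ : ordO 0 (fun i => r0 i * rT i).
    have : ordO 0 (fun i => r0 i ^+ 2 + rT i ^+ 2) by ord.
    apply: ord_dom => i Di; have p1 := r0_ge i Di; have p2 := rT0 i.
    rewrite !ger0_norm ?addr_ge0 ?sqr_ge0 ?mulr_ge0//; last by lra.
    have := sqr_ge0 (r0 i - rT i); have := sqr_ge0 (r0 i + rT i); nra.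
  set m := (fun i => _) in om; set rz := (fun i => _) in oZ.
  apply: (@ord_eq _ _ _ _ (fun i => (m i + 1) * rz i)); last by ord.
  by move=> i _; rewrite /m /rz /lam subrK mulrA.
have oec : ordO 6 (fun i => expR ((A0 i + b i) / 2) - cos (Num.sqrt (q i))).
  have n0 i : 0 <= nq (q i) / 2.
    by rewrite divr_ge0// addr_ge0// divr_ge0// sqr_ge0.
  have on : ordO 2 (fun i => nq (q i) / 2) by rewrite /nq; ord.
  have e1 := ord_expRN (fun i _ => n0 i) on; set E1 := (fun i => _) in e1.
  have e2 := ord_cos_sqrt (fun i _ => q0 i) oq; set E2 := (fun i => _) in e2.
  have ob2 : ordO 6 (fun i => rb i / 2) by ord.
  have e3 := ord_expR ob2; set E3 := (fun i => _) in e3.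
  apply: (@ord_eq _ _ _ _ (fun i => (E1 i + (1 - nq (q i) / 2 + (nq (q i) / 2) ^+ 2 / 2))
    * (E3 i + rb i / 2 + (rb i / 2) ^+ 2 / 2)
    + E1 i - E2 i + q i ^+ 3 / 24 + q i ^+ 4 / 288)).
    move=> i _; have -> : (A0 i + b i) / 2 = - (nq (q i) / 2) + rb i / 2.
      by rewrite /rb; field.
    rewrite expRD.
    have -> : expR (- (nq (q i) / 2)) = E1 i + (1 - nq (q i) / 2 + (nq (q i) / 2) ^+ 2 / 2).
      by rewrite /E1 subrK.
    have -> : expR (rb i / 2) = E3 i + (1 + rb i / 2 + (rb i / 2) ^+ 2 / 2).
      by rewrite /E3 subrK.
    have -> : cos (Num.sqrt (q i)) = E2 i + (1 - q i / 2 + q i ^+ 2 / 24).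
      by rewrite /E2 subrK.
    by rewrite /nq; field.
  by rewrite /nq; ord.
set ec := (fun i => _) in oec; set XY2 := (fun i => _) in oXY2.
set lr := (fun i => _) in olam.
apply: (@ord_eq _ _ _ _ (fun i => XY2 i ^+ 2 + 2 * lr i * ec i)); last by ord.
move=> i Di; rewrite /XY2 /lr /ec /X2 /Y2 /Tcos /Tlam.
rewrite -/(lam2 i) -/(lam i) -/(r0 i) -/(z1 i) -/(z2 i) -/(rT i) -/(q i).
have e2 (a : R) : expR a = expR (a / 2) ^+ 2.
  by rewrite expr2 -expRD; congr expR; field.
have -> : expR ((A0 i + b i) / 2) = expR (A0 i / 2) * expR (b i / 2).
  by rewrite -expRD mulrDl.
have -> : lam2 i = lam i ^+ 2 by rewrite (sqr_sqrtr (lam_ge i Di)).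
rewrite (e2 (A0 i)) (e2 (b i)).
by ring.
Qed.

End gap.

(** * Densities and changes of variables *)

Definition pushm (d1 d2 : measure_display) (T1 : measurableType d1)
  (T2 : measurableType d2) (R : realType) (m : {measure set T1 -> \bar R})
  (f : T1 -> T2) (mf : measurable_fun setT f) : {measure set T2 -> \bar R} :=
  measure_function_pushforward__canonical__measure_function_Measure m mf.

Section density.
Context {d : measure_display} {T : measurableType d} {R : realType}.
Variables (mu : {measure set T -> \bar R}) (w : T -> R).
Hypotheses (mw : measurable_fun setT w) (w0 : forall x, 0 <= w x).
Local Open Scope ereal_scope.

Let dens (A : set T) : \bar R := \int[mu]_(x in A) (w x)%:E.

Let dens0 : dens set0 = 0.
Proof. exact: integral_set0. Qed.
Let dens_ge0 A : 0 <= dens A.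
Proof. by apply: integral_ge0 => x _; rewrite lee_fin. Qed.
Let dens_sigma : semi_sigma_additive dens.
Proof.
apply: semi_sigma_additive_nng_induced; first exact/measurable_EFinP.
by move=> x; rewrite lee_fin.
Qed.

Let dens_mixin := isMeasure.Build d T R dens dens0 dens_ge0 dens_sigma.

Lemma density_exists : exists m : {measure set T -> \bar R},
  forall A, m A = \int[mu]_(x in A) (w x)%:E.
Proof. by exists (HB.pack dens dens_mixin : {measure set T -> \bar R}). Qed.

Variable nu : {measure set T -> \bar R}.
Hypothesis nuE : forall A, nu A = \int[mu]_(x in A) (w x)%:E.

Import HBNNSimple.

Let dens_nnsfun (h : {nnsfun T >-> R}) :
  \int[nu]_x (h x)%:E = \int[mu]_x ((h x)%:E * (w x)%:E).
Proof.
have mw' : measurable_fun setT (EFin \o w) by exact/measurable_EFinP.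
under [LHS]eq_integral do rewrite fimfunE -fsumEFin//.
rewrite [LHS]ge0_integral_fsum//; last 2 first.
  - by move=> r; exact/measurable_EFinP/measurableT_comp.
  - by move=> n x _; rewrite EFinM nnfun_muleindic_ge0.
under [RHS]eq_integral.
  move=> x xD; rewrite fimfunE -fsumEFin// muleC ge0_mule_fsumr; last first.
    by move=> r; rewrite EFinM nnfun_muleindic_ge0.
  over.
rewrite [RHS]ge0_integral_fsum//; last 2 first.
  - move=> r; apply: emeasurable_funM => //.
    exact/measurable_EFinP/measurableT_comp.
  - move=> n x _; rewrite EFinM mule_ge0//; first by rewrite lee_fin.
    by rewrite nnfun_muleindic_ge0.
apply: eq_fsbigr => r _.
rewrite integralZl_indic_nnsfun// integral_indic// setIT.
under [RHS]eq_integral do rewrite EFinM muleCA.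
have [r0|r0] := leP 0%R r; last first.
  rewrite (_ : h @^-1` [set r] = set0); last first.
    apply/seteqP; split=> x //= hx; move: r0; rewrite -hx ltNge.
    by rewrite fun_ge0.
  rewrite measure0 mule0.
  by under eq_integral do rewrite indicE in_set0 !mule0; rewrite integral0.
rewrite ge0_integralZl//; last 2 first.
  - apply: emeasurable_funM => //; exact/measurable_EFinP.
  - by move=> x _; rewrite mule_ge0// lee_fin.
congr (_ * _); rewrite nuE integral_mkcond.
apply: eq_integral => x _; rewrite patchE indicE.
by case: (x \in _); rewrite ?mule1 ?mule0.
Qed.

Lemma density_integral (f : T -> \bar R) : measurable_fun setT f ->
  (forall x, 0 <= f x) -> \int[nu]_x f x = \int[mu]_x (f x * (w x)%:E).
Proof.
move=> mf f0.
have mw' : measurable_fun setT (EFin \o w) by exact/measurable_EFinP.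
pose f_ := nnsfun_approx measurableT mf.
have mf_ n : measurable_fun setT (fun x => (f_ n x)%:E).
  exact/measurable_EFinP/measurable_funTS.
have ndf_ x a b : (a <= b)%N -> (f_ a x)%:E <= (f_ b x)%:E.
  by move=> ab; rewrite lee_fin//; exact/lefP/nd_nnsfun_approx.
transitivity (limn (fun n => \int[nu]_x (f_ n x)%:E)).
  rewrite -monotone_convergence//=.
  - apply: eq_integral => x _; apply/esym/cvg_lim => //=.
    exact: cvg_nnsfun_approx.
  - by move=> n x _; rewrite lee_fin.
  - by move=> x _ a b ab; exact: ndf_.
transitivity (limn (fun n => \int[mu]_x ((f_ n x)%:E * (w x)%:E))).
  by congr (limn _); apply/funext => n; rewrite dens_nnsfun.
rewrite -monotone_convergence//=.
- apply: eq_integral => x _; apply/cvg_lim => //=.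
  by apply: cvgeZr => //; exact: cvg_nnsfun_approx.
- by move=> n; exact: emeasurable_funM.
- by move=> n x _; rewrite mule_ge0 ?lee_fin.
- by move=> x _ a b ab; apply: lee_wpmul2r; [rewrite lee_fin | exact: ndf_].
Qed.

End density.

(** Serves three times: for the uniform weight on [0, 2 pi[, for F' dx in the change of variables,
    and for the marginals of a plan weighted by the squared radius. *)
Lemma density_measure {d : measure_display} {T : measurableType d}
  {R : realType} (mu : {measure set T -> \bar R}) (w : T -> R) :
  measurable_fun setT w -> (forall x, 0 <= w x) ->
  exists m : {measure set T -> \bar R},
  (forall A, m A = \int[mu]_(x in A) (w x)%:E)%E /\
  (forall f : T -> \bar R, measurable_fun setT f -> (forall x, 0 <= f x)%E ->
     \int[m]_x f x = \int[mu]_x (f x * (w x)%:E))%E.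
Proof.
move=> mw w0; have [m mE] := density_exists mu mw w0.
by exists m; split=> // f mf f0; exact: density_integral mE f mf f0.
Qed.

(* A positive functional given by a weighted push-forward is determined by its
   values on sets. *)
Lemma eq_weighted_integral (R : realType) (d1 d2 d3 : measure_display)
  (T1 : measurableType d1) (T2 : measurableType d2) (T3 : measurableType d3)
  (m1 : {measure set T1 -> \bar R}) (m2 : {measure set T2 -> \bar R})
  (p1 : T1 -> T3) (p2 : T2 -> T3) (w1 : T1 -> R) (w2 : T2 -> R)
  (mp1 : measurable_fun setT p1) (mp2 : measurable_fun setT p2)
  (mw1 : measurable_fun setT w1) (mw2 : measurable_fun setT w2)
  (w10 : forall x, 0 <= w1 x) (w20 : forall x, 0 <= w2 x) :
  (forall A, measurable A -> (\int[m1]_(x in p1 @^-1` A) (w1 x)%:E =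
     \int[m2]_(x in p2 @^-1` A) (w2 x)%:E)%E) ->
  forall g : T3 -> \bar R, measurable_fun setT g -> (forall x, (0 <= g x)%E) ->
  (\int[m1]_x (g (p1 x) * (w1 x)%:E) = \int[m2]_x (g (p2 x) * (w2 x)%:E))%E.
Proof.
move=> H g mg g0.
have [n1 [n1E n1I]] := density_measure m1 mw1 w10.
have [n2 [n2E n2I]] := density_measure m2 mw2 w20.
have mg1 : measurable_fun setT (g \o p1) by exact: measurableT_comp.
have mg2 : measurable_fun setT (g \o p2) by exact: measurableT_comp.
transitivity (\int[n1]_x (g \o p1) x)%E; first by rewrite n1I// => x; exact: g0.
transitivity (\int[n2]_x (g \o p2) x)%E; last by rewrite n2I// => x; exact: g0.
rewrite -(@ge0_integral_pushforward _ _ _ _ _ _ mp1 n1 setT)//.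
rewrite -(@ge0_integral_pushforward _ _ _ _ _ _ mp2 n2 setT)//.
apply: (@eq_measure_integral _ _ _ setT (pushm n2 mp2) (pushm n1 mp1)).
move=> A mA _; transitivity (n1 (p1 @^-1` A)) => //.
transitivity (n2 (p2 @^-1` A)) => //.
by rewrite n1E n2E H.
Qed.

Section substitution.
Variables (R : realType) (F F' : R -> R).
Hypotheses (dF : forall x : R, is_derive x (1 : R) F (F' x))
  (cF' : continuous F') (F'0 : forall x, 2^-1 <= F' x).
Let mu := @lebesgue_measure R.

Let cF : continuous F.
Proof.
move=> x; apply: differentiable_continuous; apply/derivable1_diffP.
exact: (@ex_derive _ _ _ _ _ _ _ (dF x)).
Qed.

Let growth x y : x <= y -> (y - x) / 2 <= F y - F x.
Proof.
move=> xy.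
have [z _ ->] := @MVT_segment R F F' x y xy (fun z _ => dF z)
  (derivable_within_continuous (fun z _ => @ex_derive _ _ _ _ _ _ _ (dF z))).
by rewrite mulrC ler_wpM2r// subr_ge0.
Qed.

Let homoF x y : x < y -> F x < F y.
Proof. by move=> xy; have := growth (ltW xy); lra. Qed.

Lemma derive_ge_half_mono : {mono F : x y / x <= y}.
Proof. by apply: le_mono => x y; exact: homoF. Qed.

Let surjF y : exists x, F x = y.
Proof.
pose a := - (2 * `|y - F 0|); pose b := 2 * `|y - F 0|.
have n0 : 0 <= `|y - F 0| by [].
have Fa : F a <= y.
  have := @growth a 0; rewrite /a sub0r opprK oppr_le0 mulr_ge0// => /(_ isT).
  have := ler_norm (F 0 - y); rewrite distrC; lra.
have Fb : y <= F b.
  have := @growth 0 b; rewrite /b subr0 mulr_ge0// => /(_ isT).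
  have := ler_norm (y - F 0); lra.
have ab : a <= b by rewrite /a /b; lra.
have Fab : Num.min (F a) (F b) <= y <= Num.max (F a) (F b).
  by rewrite ge_min Fa le_max Fb orbT.
have [x _ Fx] := @IVT R F a b y ab (continuous_subspaceT cF) Fab.
by exists x.
Qed.

(** The push-forward by F of the measure with density F' gives ]a, b] the mass b - a, by the
    fundamental theorem of calculus, and Lebesgue measure is characterized by these values. The
    bound F' >= 1/2 makes F an increasing bijection of the line. *)
Lemma integral_substitution (g : R -> \bar R) :
  measurable_fun setT g -> (forall x, (0 <= g x)%E) ->
  (\int[mu]_x g x = \int[mu]_x (g (F x) * (F' x)%:E))%E.
Proof.
move=> mg g0.
have mF : measurable_fun setT F by exact: continuous_measurable_fun.
have mF' : measurable_fun setT F' by exact: continuous_measurable_fun.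
have F'ge0 x : 0 <= F' x by apply: le_trans (F'0 x); rewrite invr_ge0.
have [n [nE nI]] := density_measure mu mF' F'ge0.
pose N : {measure set (measurableTypeR R) -> \bar R} :=
  @pushm _ _ (measurableTypeR R) (measurableTypeR R) R n F mF.
have E : forall A : set (measurableTypeR R), measurable A ->
    lebesgue_measure A = N A.
  apply: (@lebesgue_measure_unique R N).
  move=> X /ocitvP[->|[[a b] /= ab ->]].
    by rewrite !measure0.
  have [a' a'E] := surjF a; have [b' b'E] := surjF b.
  have ab' : a' < b' by rewrite -(leW_mono derive_ge_half_mono) a'E b'E.
  rewrite lebesgue_measure_itv/= lte_fin ab.
  transitivity (n (F @^-1` `]a, b]%classic)) => //; rewrite nE.
  have -> : F @^-1` `]a, b] = `]a', b']%classic.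
    apply/seteqP; split=> x /=; rewrite !in_itv/= -a'E -b'E.
      by rewrite (leW_mono derive_ge_half_mono) derive_ge_half_mono.
    by rewrite (leW_mono derive_ge_half_mono) derive_ge_half_mono.
  rewrite integral_itv_obnd_cbnd; last first.
    by apply/measurable_EFinP; exact: measurable_funTS.
  rewrite (@continuous_FTC2 _ F' F)//.
  - by rewrite a'E b'E.
  - exact: continuous_subspaceT.
  - split; first by move=> x _; exact: (@ex_derive _ _ _ _ _ _ _ (dF x)).
    + by apply: cvg_at_right_filter; exact: cF.
    + by apply: cvg_at_left_filter; exact: cF.
  - by move=> x _; rewrite derive1E (@derive_val _ _ _ _ _ _ _ (dF x)).
have mg1 : measurable_fun setT (g \o F) by exact: measurableT_comp.
transitivity (\int[n]_x (g \o F) x)%E; last by rewrite nI// => x; exact: g0.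
rewrite -(@ge0_integral_pushforward _ _ (measurableTypeR R) (measurableTypeR R) R
  F mF n setT)//.
apply: (@eq_measure_integral _ _ _ setT N mu).
by move=> A mA _; exact: E.
Qed.

End substitution.

Section periodic.
Variables (R : realType) (P : R) (k : R -> \bar R).
Hypotheses (P0 : 0 < P) (mk : measurable_fun setT k) (k0 : forall x, (0 <= k x)%E)
  (kP : forall x, k (x + P) = k x).
Let mu := @lebesgue_measure R.
Local Open Scope ereal_scope.

Let shift (a b : R) : \int[mu]_(x in `[(a + P)%R, (b + P)%R[) k x =
  \int[mu]_(x in `[a, b[) k x.
Proof.
rewrite integral_mkcond [RHS]integral_mkcond.
have mp : measurable_fun setT (k \_ `[(a + P)%R, (b + P)%R[).
  by apply/(measurable_restrictT _ _).1 => //; exact: measurable_funTS.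
have D (x : R) : is_derive x (1 : R)%R (fun x => (x + P)%R : R) 1%R.
  by apply: is_derive_eq; rewrite addr0.
rewrite (@integral_substitution R (fun x => x + P)%R (fun=> 1%R) D _ _ _ mp).
- apply: eq_integral => x _; rewrite mule1 !patchE kP !mem_setE !in_itv/=.
  by rewrite lerD2r ltrD2r.
- by move=> x; exact: cst_continuous.
- by move=> x; lra.
- by move=> x; rewrite patchE; case: ifP.
Qed.

Let split_itv (a b c : R) : (a <= b)%R -> (b <= c)%R ->
  \int[mu]_(x in `[a, c[) k x =
  \int[mu]_(x in `[a, b[) k x + \int[mu]_(x in `[b, c[) k x.
Proof.
move=> ab bc; rewrite -ge0_integral_setU//.
- congr integral; apply/seteqP; split=> x /=; rewrite !in_itv/=.
    by case: (ltP x b) => xb; move=> /andP[-> ->]; [left|right].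
  move=> [/andP[-> xb]|/andP[bx ->]] /=; first exact: lt_le_trans bc.
  by rewrite andbT; exact: le_trans bx.
- by apply: measurable_funTS.
- apply/disj_setPS => x [/=]; rewrite !in_itv/= => /andP[_ xb] /andP[bx _].
  by move: xb; rewrite ltNge bx.
Qed.

(** Sliding the window from a to b removes [a, b[ and adds its translate by one period. *)
Lemma integral_period (c : R) : (`|c| <= P)%R ->
  \int[mu]_(x in `[c, (c + P)%R[) k x = \int[mu]_(x in `[0%R, P[) k x.
Proof.
suff H (a b : R) : (a <= b)%R -> (b <= a + P)%R ->
    \int[mu]_(x in `[a, (a + P)%R[) k x = \int[mu]_(x in `[b, (b + P)%R[) k x.
  rewrite ler_norml => /andP[c1 c2]; rewrite -[in RHS](add0r P).
  have [c0|/ltW c0] := leP c 0%R; first by apply: H => //; lra.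
  by apply/esym/H => //; lra.
move=> ab baP; have abP : (a + P <= b + P)%R by rewrite lerD2r.
by rewrite (split_itv ab baP) (split_itv baP abP) shift addeC.
Qed.

End periodic.

(** * The circle *)

Section circle_facts.
Variable R : realType.
Implicit Types (s t : R) (x y : circle R).

Let pi2 : R := 2 * pi.
Let pi2_gt0 : 0 < pi2. Proof. by rewrite mulr_gt0// pi_gt0. Qed.
Let pi2_neq0 : pi2 != 0. Proof. by rewrite gt_eqF. Qed.

Lemma to_circleD s t : to_circle (s + t) = to_circle s + to_circle t :> circle R.
Proof. exact: (raddfD (\pi_(Quotient.quot (@lattice R)))%qT). Qed.

Lemma to_circleB s t : to_circle (s - t) = to_circle s - to_circle t :> circle R.
Proof. exact: (raddfB (\pi_(Quotient.quot (@lattice R)))%qT). Qed.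

Lemma circle_repK x : to_circle (circle_rep x) = x.
Proof. exact: reprK. Qed.

Lemma to_circleP s t :
  to_circle s = to_circle t :> circle R <-> exists m : int, s = t + m%:~R * (2 * pi).
Proof.
split=> [/eqP|[m ->]].
  rewrite /to_circle -[X in is_true X](Quotient.idealrBE (@lattice R)).
  move=> /intrP[m mE]; exists m; rewrite -mE divfK//.
  by rewrite addrC subrK.
apply/eqP; rewrite /to_circle -[X in is_true X](Quotient.idealrBE (@lattice R)).
apply/intrP; exists m; rewrite [X in X / _](_ : _ = m%:~R * pi2) ?mulfK//.
by rewrite addrAC subrr add0r.
Qed.

(* The representative in [0, 2 pi[; unlike [circle_rep] it is measurable. *)
Definition csec x : R :=
  circle_rep x - (Num.floor (circle_rep x / (2 * pi)))%:~R * (2 * pi).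

Lemma csecK x : to_circle (csec x) = x.
Proof.
rewrite -[RHS]circle_repK; apply/to_circleP.
exists (- Num.floor (circle_rep x / (2 * pi))).
by rewrite mulrNz mulNr.
Qed.

Lemma csec_itv x : 0 <= csec x < 2 * pi.
Proof.
rewrite /csec; set r := circle_rep x.
have := floor_itv (r / pi2); rewrite -/pi2; set m := Num.floor _ => /andP[a b].
have a' : m%:~R * pi2 <= r by rewrite -ler_pdivlMr.
have b' : r < (m + 1)%:~R * pi2 by rewrite -ltr_pdivrMr.
by rewrite intrD mulrDl mul1r in b'; apply/andP; split; rewrite /pi2 in a' b' *; lra.
Qed.

Lemma to_circle_inj_itv s t : 0 <= s < 2 * pi -> 0 <= t < 2 * pi ->
  to_circle s = to_circle t :> circle R -> s = t.
Proof.
move=> /andP[s0 s1] /andP[t0 t1] /to_circleP[m E].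
have [m0|m0|m0] := ltgtP m 0.
- have : (m%:~R : R) <= (-1)%:~R by rewrite ler_int; lia.
  by rewrite -(ler_pM2r pi2_gt0) ?mulrNz /pi2; lra.
- have : 1%:~R <= (m%:~R : R) by rewrite ler_int; lia.
  by rewrite -(ler_pM2r pi2_gt0) ?mulrNz /pi2; lra.
- by rewrite E m0 mul0r addr0.
Qed.

Lemma csec_to_circle s : 0 <= s < 2 * pi -> csec (to_circle s) = s.
Proof.
by move=> s02; apply: to_circle_inj_itv; rewrite ?csec_itv ?csecK.
Qed.

Lemma csec_shift x s : to_circle s = x ->
  exists m : int, s = csec x + m%:~R * (2 * pi).
Proof. by move=> E; apply/to_circleP; rewrite csecK. Qed.

Lemma rep_shift x : exists m : int, circle_rep x = csec x + m%:~R * (2 * pi).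
Proof. exact/csec_shift/circle_repK. Qed.

Definition dist0 s : R := inf [set `|t| | t in [set t : R |
  to_circle t = to_circle s :> circle R]].

Lemma dist_circleE s t : dist_circle (to_circle s) (to_circle t) = dist0 (s - t).
Proof. by rewrite /dist_circle /dist0 to_circleB. Qed.

(** Rounding s / (2 pi) to a nearest integer leaves a representative in [- pi, pi]; any other one
    differs from it by at least 2 pi and is not closer to 0. *)
Lemma dist0_min s : exists t, [/\ to_circle t = to_circle s :> circle R,
  `|t| <= pi & dist0 s = `|t|].
Proof.
pose m := Num.floor (s / pi2 + 2^-1); pose t := s - m%:~R * pi2.
have tp : `|t| <= pi.
  have /andP[a b] := floor_itv (s / pi2 + 2^-1); rewrite -/m in a b.
  have E : s = s / pi2 * pi2 by rewrite divfK.
  have p0 := pi_gt0 R.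
  have a' : m%:~R * pi2 <= (s / pi2 + 2^-1) * pi2 by rewrite ler_pM2r.
  have b' : (s / pi2 + 2^-1) * pi2 < (m%:~R + 1) * pi2.
    by rewrite ltr_pM2r//; move: b; rewrite intrD.
  rewrite mulrDl -E in a' b'; move: a' b'; rewrite /t /pi2 => a' b'.
  by rewrite ler_norml; apply/andP; split; lra.
have tE : to_circle t = to_circle s :> circle R.
  by apply/to_circleP; exists (- m); rewrite mulrNz mulNr.
exists t; split=> //; apply/eqP; rewrite eq_le; apply/andP; split.
  by apply: ge_inf; [exists 0 => _ [u _ <-] | exists t].
apply: lb_le_inf; first by exists `|t|, t.
move=> _ [u uE <-]; have /to_circleP[k ->] : to_circle u = to_circle t :> circle R.
  by rewrite uE tE.
have [->|k0] := eqVneq k 0; first by rewrite mul0r addr0.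
have k1 : 1 <= `|k%:~R : R|.
  by rewrite -intr_norm (_ : 1 = 1%:~R)// ler_int; lia.
have := ler_normB (t + k%:~R * (2 * pi)) t.
rewrite addrAC subrr add0r normrM (gtr0_norm pi2_gt0).
have : pi2 <= `|k%:~R| * pi2 by rewrite ler_peMl// ltW.
rewrite /pi2; lra.
Qed.

Lemma dist0_ge0 s : 0 <= dist0 s.
Proof. by have [t [_ _ ->]] := dist0_min s. Qed.

Lemma dist0_le s : dist0 s <= `|s|.
Proof. by apply: ge_inf; [exists 0 => _ [u _ <-] | exists s]. Qed.

Lemma dist0_lip s t : dist0 s <= dist0 t + `|s - t|.
Proof.
have [u [uE _ ->]] := dist0_min t.
apply: (@le_trans _ _ `|u + (s - t)|); last exact: ler_normD.
apply: ge_inf; [by exists 0 => _ [v _ <-] | exists (u + (s - t)) => //].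
by rewrite /= to_circleD uE -to_circleD addrC subrK.
Qed.

Lemma continuous_dist0 : continuous dist0.
Proof.
move=> s; apply/cvgrPdist_lt => e e0; near=> t.
have st : `|s - t| < e by near: t; exact: cvgr_dist_lt.
apply: le_lt_trans st; rewrite ler_norml; apply/andP; split.
  by have := dist0_lip t s; rewrite distrC; lra.
by have := dist0_lip s t; lra.
Unshelve. all: by end_near. Qed.

Lemma dist_circleE_sec x y : dist_circle x y = dist0 (csec x - csec y).
Proof. by rewrite -dist_circleE !csecK. Qed.

Lemma measurable_metric_open (U : set (circle R)) :
  metric_open (@dist_circle R) U -> measurable U.
Proof. by move=> oU; exact: sub_sigma_algebra. Qed.

Lemma open_arc (a b : R) :
  metric_open (@dist_circle R) [set to_circle t | t in `]a, b[].
Proof.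
move=> _ [t /= /[!in_itv]/= /andP[at_ tb] <-].
exists (Num.min (t - a) (b - t)); first by rewrite lt_min !subr_gt0 at_.
move=> y; rewrite -(circle_repK y) dist_circleE.
have [u [uE _ ->]] := dist0_min (t - circle_rep y).
rewrite lt_min => /andP[ua ub]; exists (t - u).
  by rewrite /= in_itv/=; move: ua ub; rewrite !ltr_norml => /andP[_ ?] /andP[? _];
    apply/andP; split; lra.
by rewrite to_circleB uE -to_circleB opprB addrC subrK.
Qed.

(** [csec] jumps at 0, but its superlevel sets above a >= 0 are the open arcs ]a, 2 pi[. *)
Lemma measurable_csec : measurable_fun setT csec.
Proof.
apply: (measurability _ (RGenOInfty.measurableE R)).
move=> _ [_ [a ->] <-]; rewrite setTI.
have [a0|a0] := ltP a 0.
  rewrite (_ : _ @^-1` _ = setT)//; apply/seteqP; split=> // x _ /=.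
  rewrite in_itv/= andbT; apply: (lt_le_trans a0).
  by have /andP[] := csec_itv x.
suff -> : csec @^-1` `]a, +oo[ = [set to_circle t | t in `]a, (2 * pi)%R[].
  by apply: measurable_metric_open; exact: open_arc.
apply/seteqP; split=> x /=.
  rewrite in_itv/= andbT => ax; exists (csec x); last exact: csecK.
  by rewrite /= in_itv/= ax; have /andP[] := csec_itv x.
move=> [t /[!in_itv]/= /andP[at_ t2] <-]; rewrite andbT csec_to_circle//.
by rewrite t2 (le_trans a0) ?ltW.
Qed.

Lemma measurable_dist_circle (d : measure_display) (T : measurableType d)
  (f g : T -> circle R) : measurable_fun setT f -> measurable_fun setT g ->
  measurable_fun setT (fun z : T => dist_circle (f z) (g z)).
Proof.
move=> mf mg.
have -> : (fun z : T => dist_circle (f z) (g z)) =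
    dist0 \o (fun z : T => csec (f z) - csec (g z)).
  by apply/funext => z; rewrite /= dist_circleE_sec.
apply: measurableT_comp.
  by apply: continuous_measurable_fun; exact: continuous_dist0.
by apply: measurable_funB; apply: measurableT_comp => //; exact: measurable_csec.
Qed.

End circle_facts.

(** * The cone *)

Section cone_facts.
Variable R : realType.
Implicit Types (x y : torus R) (r s : R) (c : cone R).

Lemma cone_rep_pt x r : let p := cone_rep (cone_pt x r) in
  p.2%:num = `|r| /\ (r != 0 -> p.1 = x).
Proof.
rewrite /= /cone_rep; set p := repr _.
have : cone_rel p (x, `|r|%:nng).
  apply/(eqquotP (cone R)) => /=; rewrite reprK//.
rewrite /cone_rel => /orP[/eqP ->//|/= /andP[/eqP -> /eqP r0]].
by split; [rewrite r0 | rewrite -normr_eq0 r0 eqxx].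
Qed.

Lemma cone_radius_pt x r : cone_radius (cone_pt x r) = `|r|.
Proof. by have [] := cone_rep_pt x r. Qed.

Lemma cone_base_pt x r : r != 0 -> cone_base (cone_pt x r) = x.
Proof. by have [] := cone_rep_pt x r. Qed.

Lemma cone_radius_ge0 c : 0 <= cone_radius c.
Proof. by rewrite /cone_radius. Qed.

Lemma cone_ptK c : cone_pt (cone_base c) (cone_radius c) = c.
Proof.
rewrite /cone_pt /to_cone /cone_base /cone_radius.
rewrite (_ : (_, _) = cone_rep c) ?reprK//.
case: (cone_rep c) => p u /=; congr pair.
by apply/val_inj; rewrite /= ger0_norm.
Qed.

Lemma cone_apex x y : cone_pt x 0 = cone_pt y 0 :> cone R.
Proof.
apply/(eqquotP (cone R)); rewrite /cone_rel; apply/orP; right.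
by apply/andP; split; apply/eqP; exact: normr0.
Qed.

(** The squared cone distance, written so that its sign and its independence of d at radius 0 are
    visible. *)
Definition cone_gap r s d : R := (r - s) ^+ 2 + 2 * r * s * (1 - cos (Num.min d pi)).

Lemma cone_gap_ge0 r s d : 0 <= r -> 0 <= s -> 0 <= cone_gap r s d.
Proof.
by move=> r0 s0; rewrite addr_ge0 ?sqr_ge0// !mulr_ge0 ?subr_ge0 ?cos_le1.
Qed.

Lemma dist_coneE c c' : dist_cone c c' =
  Num.sqrt (cone_gap (cone_radius c) (cone_radius c')
    (dist_torus (cone_base c) (cone_base c'))).
Proof. by rewrite /dist_cone /cone_gap; congr Num.sqrt; ring. Qed.

Lemma dist_cone_sqr c c' : dist_cone c c' ^+ 2 =
  cone_gap (cone_radius c) (cone_radius c')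
    (dist_torus (cone_base c) (cone_base c')).
Proof. by rewrite dist_coneE sqr_sqrtr// cone_gap_ge0 ?cone_radius_ge0. Qed.

Lemma dist_cone_pt_sqr x y r s : 0 <= r -> 0 <= s ->
  dist_cone (cone_pt x r) (cone_pt y s) ^+ 2 = cone_gap r s (dist_torus x y).
Proof.
move=> r0 s0; rewrite dist_cone_sqr !cone_radius_pt !ger0_norm//.
have [->|r1] := eqVneq r 0; first by rewrite /cone_gap !(mulr0, mul0r).
have [->|s1] := eqVneq s 0; first by rewrite /cone_gap !(mulr0, mul0r).
by rewrite !cone_base_pt.
Qed.

Lemma dist_torusE (a b : R * R) :
  dist_torus (to_circle a.1, to_circle a.2) (to_circle b.1, to_circle b.2) =
  enorm (dist0 (a.1 - b.1), dist0 (a.2 - b.2)).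
Proof. by rewrite /dist_torus /= !dist_circleE. Qed.

Lemma dist_torus_ge0 x y : 0 <= dist_torus x y.
Proof. exact: sqrtr_ge0. Qed.

Lemma dist_torus_sqr_le (a b : R * R) :
  dist_torus (to_circle a.1, to_circle a.2) (to_circle b.1, to_circle b.2) ^+ 2
  <= (a.1 - b.1) ^+ 2 + (a.2 - b.2) ^+ 2.
Proof.
rewrite dist_torusE sqr_sqrtr ?addr_ge0 ?sqr_ge0//=.
by rewrite lerD// -(real_normK (num_real (_ - _))) lerXn2r ?nnegrE ?dist0_ge0 ?dist0_le.
Qed.

Lemma dist_cone_radius c c' : `|cone_radius c - cone_radius c'| <= dist_cone c c'.
Proof.
by rewrite -sqrtr_sqr dist_coneE ler_wsqrtr// lerDl !mulr_ge0 ?cone_radius_ge0 ?subr_ge0 ?cos_le1.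
Qed.

Lemma measurable_cone_open (U : set (cone R)) :
  metric_open (@dist_cone R) U -> measurable U.
Proof. by move=> oU; exact: sub_sigma_algebra. Qed.

Lemma measurable_cone_radius : measurable_fun setT (@cone_radius R).
Proof.
apply: (measurability _ (RGenOInfty.measurableE R)).
move=> _ [_ [a ->] <-]; rewrite setTI; apply: measurable_cone_open => c /=.
rewrite in_itv/= andbT => ac; exists (cone_radius c - a); first by rewrite subr_gt0.
move=> c' cc'; rewrite in_itv/= andbT.
have := le_lt_trans (dist_cone_radius c c') cc'.
by rewrite ltr_norml => /andP[_ ?]; lra.
Qed.

(** Away from the apex, a small cone distance forces a small base distance: within r / 2 the other
    radius exceeds r / 2, and a base distance of at least [e1] would make the squared cone distance
    at least r^2 (1 - cos e1). The cap e1 <= 1 keeps the cosine in its decreasing range. *)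
Let base_open (U : set (circle R)) (pr : torus R -> circle R) :
  (forall x y, dist_circle (pr x) (pr y) <= dist_torus x y) ->
  metric_open (@dist_circle R) U ->
  metric_open (@dist_cone R) [set c | 0 < cone_radius c /\ U (pr (cone_base c))].
Proof.
move=> lip oU c [r0 /oU[e e0 eU]]; set r := cone_radius c in r0 *.
pose e1 := Num.min e 1.
have e1_gt0 : 0 < e1 by rewrite lt_min e0 ltr01.
have e1p : e1 < pi.
  by apply: (@le_lt_trans _ _ 1); [rewrite ge_min lexx orbT | have := pi_ge2 R; lra].
pose k := 1 - cos e1.
have k0 : 0 < k.
  rewrite subr_gt0 -cos0 ltr_cos ?in_itv/= ?lexx ?pi_ge0//.
  by rewrite !ltW.
pose de := Num.min (r / 2) (r * Num.sqrt k).
have de0 : 0 < de by rewrite lt_min divr_gt0// mulr_gt0// sqrtr_gt0.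
exists de => // c' cc'; set r' := cone_radius c'.
have rr : r / 2 < r'.
  have := le_lt_trans (dist_cone_radius c c') cc'; rewrite -/r -/r' lt_min => /andP[+ _].
  by rewrite ltr_norml => /andP[_ ?]; lra.
split; first by apply: le_lt_trans rr; rewrite divr_ge0// ltW.
apply: eU; apply: le_lt_trans (lip _ _) _; rewrite ltNge; apply/negP => ed.
move: cc'; rewrite lt_min => /andP[_]; apply/negP; rewrite -leNgt.
have -> : r * Num.sqrt k = Num.sqrt (r ^+ 2 * k).
  by rewrite sqrtrM ?sqr_ge0// sqrtr_sqr gtr0_norm.
rewrite dist_coneE ler_wsqrtr// -/r -/r' /cone_gap.
set m := Num.min _ pi.
have mk : k <= 1 - cos m.
  have i1 : e1 \in `[0, pi] by rewrite in_itv/= (ltW e1_gt0) (ltW e1p).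
  have i2 : m \in `[0, pi].
    by rewrite in_itv/= /m le_min pi_ge0 dist_torus_ge0 /= ge_min lexx orbT.
  rewrite lerD2l lerN2 leNgt; apply/negP; rewrite ltr_cos//.
  apply/negP; rewrite -leNgt /m le_min (ltW e1p) andbT.
  by apply: le_trans ed; rewrite ge_min lexx.
apply: (@le_trans _ _ (2 * r * r' * k)).
  rewrite ler_wpM2r ?(ltW k0)// expr2 -mulrA mulrCA ler_wpM2l ?(ltW r0)//; lra.
have r'0 : 0 <= r' by exact: cone_radius_ge0.
rewrite -[leLHS]add0r lerD ?sqr_ge0// ler_wpM2l//.
by rewrite !mulr_ge0// ltW.
Qed.

(** The base point is discontinuous at the apex, where it is an arbitrary but fixed point: a
    preimage is an open set of positive radii, with the apex added or not. *)
Let measurable_pr_base (pr : torus R -> circle R) :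
  (forall x y, dist_circle (pr x) (pr y) <= dist_torus x y) ->
  measurable_fun setT (pr \o @cone_base R).
Proof.
move=> lip; apply: (measurability (metric_open (@dist_circle R))) => //.
move=> _ [U oU <-]; rewrite setTI.
have m0 : measurable [set c : cone R | cone_radius c = 0].
  rewrite (_ : [set _ | _] = @cone_radius R @^-1` [set 0])//.
  rewrite -[X in measurable X]setTI; exact: measurable_cone_radius.
have -> : (pr \o @cone_base R) @^-1` U =
    [set c | 0 < cone_radius c /\ U (pr (cone_base c))] `|`
    ([set c | cone_radius c = 0] `&` [set c | U (pr (cone_base (apex R)))]).
  apply/seteqP; split=> c /=.
    move=> Uc; have [r0|r0] := ltP 0 (cone_radius c); first by left.
    right; have r00 : cone_radius c = 0.
      by apply/eqP; rewrite eq_le r0 cone_radius_ge0.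
    split=> //; move: Uc; rewrite -[in X in X -> _](cone_ptK c) r00.
    by rewrite (cone_apex _ 0) /apex /cone_pt (_ : `|0|%:nng = 0%:nng)//; apply/val_inj; rewrite /= normr0.
  move=> [[]//|[r00 Ua]]; rewrite -(cone_ptK c) r00 (cone_apex _ 0).
  by rewrite /cone_pt (_ : `|0|%:nng = 0%:nng)//; apply/val_inj; rewrite /= normr0.
apply: measurableU; first by apply: measurable_cone_open; exact: (base_open lip oU).
apply: measurableI => //.
have [Ua|Ua] := pselect (U (pr (cone_base (apex R)))).
  by rewrite (_ : [set _ | _] = setT)//; apply/seteqP; split.
by rewrite (_ : [set _ | _] = set0)//; apply/seteqP; split.
Qed.

Lemma measurable_cone_base : measurable_fun setT (@cone_base R).
Proof.
have E (a b : R) : 0 <= a -> 0 <= b -> a <= enorm (a, b) /\ b <= enorm (a, b).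
  move=> a0 b0; rewrite /enorm /=; split.
    by rewrite -[leLHS](ger0_norm a0) -sqrtr_sqr ler_wsqrtr// lerDl sqr_ge0.
  by rewrite -[leLHS](ger0_norm b0) -sqrtr_sqr ler_wsqrtr// lerDr sqr_ge0.
have D (a b : circle R) : 0 <= dist_circle a b.
  by rewrite dist_circleE_sec dist0_ge0.
apply/measurable_fun_pairP; split; apply: measurable_pr_base => x y.
  by have [] := E _ _ (D x.1 y.1) (D x.2 y.2).
by have [] := E _ _ (D x.1 y.1) (D x.2 y.2).
Qed.

(** An open set is a countable union of rational boxes, hence belongs to the product
    sigma-algebra. *)
Lemma measurable_box_open (V : set (R * R * R)) :
  (forall v, V v -> exists2 e : R, 0 < e & forall v', `|v'.1.1 - v.1.1| < e ->
     `|v'.1.2 - v.1.2| < e -> `|v'.2 - v.2| < e -> V v') -> measurable V.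
Proof.
move=> oV; pose I := (rat * rat * rat * nat)%type.
pose B (i : I) : set (R * R * R) :=
  [set v | `|v.1.1 - ratr i.1.1.1| < i.2.+1%:R^-1 /\
     `|v.1.2 - ratr i.1.1.2| < i.2.+1%:R^-1 /\ `|v.2 - ratr i.1.2| < i.2.+1%:R^-1].
pose B' i : set (R * R * R) := if pselect (B i `<=` V) then B i else set0.
have -> : V = \bigcup_i B' i.
  apply/seteqP; split=> [v Vv|v [i _]]; last first.
    by rewrite /B'; case: pselect => // BV /BV.
  have [e e0 eV] := oV _ Vv.
  have [n ne] : exists n : nat, n.+1%:R^-1 < e / 2.
    exists (Num.truncn (e / 2)^-1); rewrite -[ltRHS]invrK ltf_pV2 ?posrE ?invr_gt0 ?divr_gt0//.
    by rewrite truncnS_gt.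
  pose h : R := n.+1%:R^-1; have h0 : 0 < h by rewrite invr_gt0.
  have Q (a : R) : exists q : rat, `|a - ratr q| < h.
    have /rat_in_itvoo[q] : a - h < a + h by lra.
    rewrite in_itv/= => /andP[q1 q2]; exists q.
    by rewrite ltr_norml; apply/andP; split; lra.
  have [q1 E1] := Q v.1.1; have [q2 E2] := Q v.1.2; have [q3 E3] := Q v.2.
  exists (q1, q2, q3, n) => //; rewrite /B'; case: pselect => [BV|nBV]; first by [].
  exfalso; apply: nBV => v' [F1 [F2 F3]]; apply: eV.
  - by apply: le_lt_trans (ler_distD (ratr q1) _ _) _; rewrite (distrC (ratr q1));
      move: E1 F1 ne; rewrite /= -/h; lra.
  - by apply: le_lt_trans (ler_distD (ratr q2) _ _) _; rewrite (distrC (ratr q2));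
      move: E2 F2 ne; rewrite /= -/h; lra.
  - by apply: le_lt_trans (ler_distD (ratr q3) _ _) _; rewrite (distrC (ratr q3));
      move: E3 F3 ne; rewrite /= -/h; lra.
apply: countable_bigcupT_measurable; first exact: countableP.
move=> i; rewrite /B'; case: pselect => BV; last exact: measurable0.
change (measurable (B i)).
have M (f : R * R * R -> R) (a h : R) : measurable_fun setT f ->
    measurable [set v | `|f v - a| < h].
  move=> mf; have mg : measurable_fun setT (fun v => `|f v - a|).
    apply: (measurableT_comp (f := @Num.norm R R)) => //.
    exact: measurable_funB.
  have := mg measurableT `]-oo, h[%classic (measurable_itv _); rewrite setTI.
  by congr measurable; apply/seteqP; split=> v /=; rewrite in_itv.
rewrite (_ : B i = [set v | `|v.1.1 - ratr i.1.1.1| < i.2.+1%:R^-1] `&`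
  ([set v | `|v.1.2 - ratr i.1.1.2| < i.2.+1%:R^-1] `&`
   [set v | `|v.2 - ratr i.1.2| < i.2.+1%:R^-1]))//.
apply: measurableI; last apply: measurableI; apply: M.
- exact: (measurableT_comp measurable_fst measurable_fst).
- exact: (measurableT_comp measurable_snd measurable_fst).
- exact: measurable_snd.
Qed.

Lemma measurable_cone_pt : measurable_fun setT
  (fun p : torus R * R => cone_pt p.1 p.2).
Proof.
apply: (measurability (metric_open (@dist_cone R))) => //.
move=> _ [U oU <-]; rewrite setTI.
(* Continuity is checked for the lift [Psi] to R^3, and the result is carried back to the torus by
   the measurable section [csec]. *)
pose Psi (v : R * R * R) := cone_pt (to_circle v.1.1, to_circle v.1.2) v.2.
have mV : measurable (Psi @^-1` U).
  apply: measurable_box_open => v /oU[e e0 eU].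
  (* As soon as the coordinates differ by less than [de], where de <= 1, the squared cone distance
     is at most de^2 M. *)
  pose M := 1 + 2 * `|v.2| * (`|v.2| + 1).
  have M1 : 1 <= M by rewrite lerDl !mulr_ge0.
  pose de := Num.min 1 (e / (M + 1)).
  have de0 : 0 < de by rewrite lt_min ltr01 divr_gt0//; lra.
  exists de => // v' d1 d2 d3; apply: eU.
  suff : dist_cone (Psi v) (Psi v') ^+ 2 < e ^+ 2.
    by rewrite ltr_pXn2r// nnegrE ?sqrtr_ge0 ?(ltW e0).
  have P (w : R * R * R) : Psi w = cone_pt (to_circle w.1.1, to_circle w.1.2) `|w.2|.
    by rewrite /Psi /cone_pt; congr to_cone; congr pair; apply/val_inj; rewrite /= normr_id.
  rewrite !P dist_cone_pt_sqr//.
  have dd := dist_torus_sqr_le v.1 v'.1; set d := dist_torus _ _ in dd *.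
  have d0 : 0 <= d by exact: dist_torus_ge0.
  have Dlt (a b : R) : `|a - b| < de -> (b - a) ^+ 2 <= de ^+ 2.
    move=> ab; rewrite -(real_normK (num_real (b - a))).
    by rewrite lerXn2r ?nnegrE ?(ltW de0)// distrC (ltW ab).
  have dd2 : d ^+ 2 <= 2 * de ^+ 2.
    by apply: (le_trans dd); have := Dlt _ _ d1; have := Dlt _ _ d2; lra.
  have c1 : 1 - cos (Num.min d pi) <= de ^+ 2.
    have m0 : 0 <= Num.min d pi by rewrite le_min d0 pi_ge0.
    have := cos_ge2 m0.
    have : Num.min d pi ^+ 2 <= d ^+ 2 by rewrite lerXn2r ?nnegrE// ge_min lexx.
    lra.
  have n1 : `|v'.2| <= `|v.2| + 1.
    have := ler_normD v.2 (v'.2 - v.2); rewrite addrC subrK.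
    have : de <= 1 by rewrite ge_min lexx.
    by move: d3; lra.
  have n2 : (`|v.2| - `|v'.2|) ^+ 2 <= de ^+ 2.
    apply: Dlt; apply: le_lt_trans d3; rewrite distrC [leRHS]distrC.
    exact: ler_dist_dist.
  apply: (@le_lt_trans _ _ (de ^+ 2 * M)).
    have -> : de ^+ 2 * M = de ^+ 2 + 2 * `|v.2| * (`|v.2| + 1) * de ^+ 2.
      by rewrite /M; ring.
    apply: lerD => //; apply: ler_pM.
    - by rewrite !mulr_ge0.
    - by rewrite subr_ge0 cos_le1.
    - by rewrite ler_wpM2l ?mulr_ge0.
    - exact: c1.
  apply: (@le_lt_trans _ _ ((e / (M + 1)) ^+ 2 * M)).
    rewrite ler_wpM2r ?(le_trans _ M1)// lerXn2r ?nnegrE ?(ltW de0)//.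
      by rewrite divr_ge0 ?(ltW e0)//; lra.
    by rewrite ge_min lexx orbT.
  rewrite expr_div_n mulrAC ltr_pdivrMr; last by rewrite exprn_gt0//; lra.
  rewrite ltr_pM2l ?exprn_gt0//; nra.
have -> : (fun p : torus R * R => cone_pt p.1 p.2) @^-1` U =
  (fun p : torus R * R => (csec p.1.1, csec p.1.2, p.2)) @^-1` (Psi @^-1` U).
  by apply/seteqP; split=> -[[x y] r] /=; rewrite /Psi/= !csecK.
rewrite -[X in measurable X]setTI.
have m1 : measurable_fun setT (fun p : torus R * R => csec p.1.1).
  apply: (measurableT_comp (f := @csec R)); first exact: measurable_csec.
  exact: (measurableT_comp measurable_fst measurable_fst).
have m2 : measurable_fun setT (fun p : torus R * R => csec p.1.2).
  apply: (measurableT_comp (f := @csec R)); first exact: measurable_csec.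
  exact: (measurableT_comp measurable_snd measurable_fst).
have : measurable_fun setT (fun p : torus R * R => (csec p.1.1, csec p.1.2, p.2)).
  apply: measurable_fun_pair; last exact: measurable_snd.
  exact: measurable_fun_pair.
by apply.
Qed.

Lemma measurable_dist_torus (d : measure_display) (T : measurableType d)
  (f g : T -> torus R) : measurable_fun setT f -> measurable_fun setT g ->
  measurable_fun setT (fun z : T => dist_torus (f z) (g z)).
Proof.
move=> /measurable_fun_pairP[f1 f2] /measurable_fun_pairP[g1 g2].
apply: (measurableT_comp (f := @Num.sqrt R)).
  by apply: continuous_measurable_fun; exact: sqrt_continuous.
by apply: measurable_funD; apply: measurable_funX; exact: measurable_dist_circle.
Qed.

Lemma measurable_dist_cone (d : measure_display) (T : measurableType d)
  (f g : T -> cone R) : measurable_fun setT f -> measurable_fun setT g ->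
  measurable_fun setT (fun z : T => dist_cone (f z) (g z)).
Proof.
move=> mf mg.
have rf := measurableT_comp measurable_cone_radius mf.
have rg := measurableT_comp measurable_cone_radius mg.
have bf := measurableT_comp measurable_cone_base mf.
have bg := measurableT_comp measurable_cone_base mg.
apply: (measurableT_comp (f := @Num.sqrt R)).
  by apply: continuous_measurable_fun; exact: sqrt_continuous.
apply: measurable_funB.
  by apply: measurable_funD; exact: measurable_funX.
apply: measurable_funM.
  by apply: measurable_funM => //; exact: measurable_funM.
apply: (measurableT_comp (f := @cos R)).
  by apply: continuous_measurable_fun; exact: continuous_cos.
by apply: measurable_minr => //; exact: measurable_dist_torus.
Qed.

End cone_facts.

(** * Integration on the torus *)

Lemma measurable_inv (R : realType) : measurable_fun setT (@GRing.inv R).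
Proof.
have -> : [set: R] = [set~ 0] `|` [set 0] by rewrite setUC setUv.
apply/measurable_funU => //; first exact: measurableC.
split; last exact: measurable_fun_set1.
apply: open_continuous_measurable_fun; first last.
  by move=> x; rewrite inE /= => /eqP x0; exact: inv_continuous.
apply: closed_openC; apply: accessible_closed_set1.
by apply: hausdorff_accessible; exact: Rhausdorff.
Qed.

Section measurable_functions.
Context {d : measure_display} {T : measurableType d} {R : realType}.
Variables (F G : T -> R).
Hypotheses (mF : measurable_fun setT F) (mG : measurable_fun setT G).

Lemma measurable_cosT : measurable_fun setT (fun z => cos (F z)).
Proof.
by apply: (measurableT_comp _ mF); apply: continuous_measurable_fun; exact: continuous_cos.
Qed.

Lemma measurable_sqrtT : measurable_fun setT (fun z => Num.sqrt (F z)).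
Proof.
by apply: (measurableT_comp _ mF); apply: continuous_measurable_fun; exact: sqrt_continuous.
Qed.

Lemma measurable_expT : measurable_fun setT (fun z => expR (F z)).
Proof. by apply: (measurableT_comp _ mF); exact: measurable_expR. Qed.

Lemma measurable_tev (p : tpoly R) : measurable_fun setT (fun z => tev p (F z) (G z)).
Proof.
elim: p => [|u p IH].
  by under eq_fun do rewrite /tev big_nil; exact: measurable_cst.
under eq_fun do rewrite tev_cons.
apply: measurable_funD => //; apply: measurable_funM => //.
apply: (measurableT_comp (f := @cos R)).
  by apply: continuous_measurable_fun; exact: continuous_cos.
by apply: measurable_funD => //; apply: measurable_funD; exact: measurable_funM.
Qed.

Lemma measurable_enormT : measurable_fun setT (fun z => enorm (F z, G z)).
Proof.
rewrite /enorm /=; apply: (measurableT_comp (f := @Num.sqrt R)).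
  by apply: continuous_measurable_fun; exact: sqrt_continuous.
by apply: measurable_funD; exact: measurable_funX.
Qed.

Lemma measurable_pkap : measurable_fun setT (fun z => pkap (F z) (G z)).
Proof.
rewrite /pkap; apply: measurable_fun_ifT.
- by apply: measurable_fun_eqr.
- apply: (measurableT_comp (@measurable_inv R)); exact: measurable_funD.
- apply: measurable_funM.
    apply: (measurableT_comp (f := @atan R)).
      by apply: continuous_measurable_fun; exact: continuous_atan.
    apply: measurable_funM => //.
    by apply: (measurableT_comp (@measurable_inv R)); exact: measurable_funD.
  exact: (measurableT_comp (@measurable_inv R)).
Qed.

Lemma measurable_prho : measurable_fun setT (fun z => prho (F z) (G z)).
Proof.
rewrite /prho; apply: (measurableT_comp (f := @Num.sqrt R)).
  by apply: continuous_measurable_fun; exact: sqrt_continuous.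
apply: measurable_funD; apply: measurable_funX => //; exact: measurable_funD.
Qed.

End measurable_functions.

Section circle_integral.
Variable R : realType.
Local Open Scope ereal_scope.
Let mu := @lebesgue_measure R.
Let pi2 : R := (2 * pi)%R.
Let pi2_gt0 : (0 < pi2)%R. Proof. by rewrite mulr_gt0// pi_gt0. Qed.
Let w (y : R) : R := (pi2^-1 * \1_(`[0%R, pi2[ : set R) y)%R.

Let mw : measurable_fun setT w.
Proof. by apply: measurable_funM => //; apply: measurable_indic. Qed.

Let w0 y : (0 <= w y)%R.
Proof. by rewrite mulr_ge0// invr_ge0 ltW. Qed.

Lemma circle_integral (h : circle R -> \bar R) : measurable_fun setT h ->
  (forall x, 0 <= h x) -> \int[@circle_vol R]_x h x =
  pi2^-1%:E * \int[mu]_(y in `[0%R, pi2[) h (to_circle y).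
Proof.
move=> mh h0; have [n [nE nI]] := density_measure mu mw w0.
have mtc := @measurable_to_circle R.
have mht : measurable_fun setT (h \o to_circle) by exact: measurableT_comp.
transitivity (\int[@pushm _ _ (measurableTypeR R) (circle R) R n _ mtc]_x h x).
  apply: (@eq_measure_integral _ _ _ setT
    (@pushm _ _ (measurableTypeR R) (circle R) R n _ mtc) (@circle_vol R)).
  move=> A mA _; transitivity (n (to_circle @^-1` A)) => //.
  have mA' : measurable (to_circle @^-1` A : set (measurableTypeR R)).
    by rewrite -[X in measurable X]setTI; exact: mtc.
  rewrite nE /circle_vol integral_mkcond.
  transitivity (\int[mu]_x (pi2^-1%:E * (\1_(to_circle @^-1` A `&` `[0%R, pi2[) x)%:E)).
    rewrite ge0_integralZl//.
    - by rewrite integral_indic//; [rewrite setIT | exact: measurableI].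
    - apply/measurable_EFinP; apply: measurable_indic; exact: measurableI.
    - by rewrite lee_fin invr_ge0 ltW.
  apply: eq_integral => x _; rewrite patchE /w -EFinM indicI/=.
  by case: ifPn => xA; rewrite !indicE ?xA ?(negbTE xA) ?mul1r ?mul0r ?mulr0.
rewrite (@ge0_integral_pushforward _ _ (measurableTypeR R) (circle R) R _ mtc n setT)//.
rewrite (nI (h \o to_circle))//; last by move=> x; exact: h0.
transitivity (\int[mu]_x (pi2^-1%:E * ((fun y => h (to_circle y)) \_ `[0%R, pi2[) x)).
  apply: eq_integral => x _; rewrite patchE /w /= EFinM muleCA indicE.
  by case: (x \in _); rewrite ?mule1 ?mule0.
rewrite ge0_integralZl//.
- by rewrite -integral_mkcond.
- apply/(measurable_restrictT _ _).1 => //; exact: measurable_funTS.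
- by move=> x _; rewrite patchE; case: ifP.
- by rewrite lee_fin invr_ge0 ltW.
Qed.

(** The map x + om x is increasing and commutes with the period, so it carries [0, 2 pi[ onto a
    window of one period starting at om 0, and the integral does not depend on the window. *)
Lemma circle_shear (om om' : R -> R) (g : circle R -> \bar R) :
  (forall x : R, is_derive x (1 : R)%R om (om' x)) -> continuous om' ->
  (forall x, (2^-1 <= 1 + om' x)%R) -> (forall x, om (x + pi2)%R = om x) ->
  (`|om 0%R| <= pi2)%R ->
  measurable_fun setT g -> (forall x, 0 <= g x) ->
  \int[@circle_vol R]_x (g (x + to_circle (om (csec x)))%R * (1 + om' (csec x))%:E)
  = \int[@circle_vol R]_x g x.
Proof.
move=> dom com om2 omP om0 mg g0.
pose F x := (x + om x)%R; pose F' x := (1 + om' x)%R.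
have dF (x : R) : is_derive x (1 : R)%R F (F' x) by exact: is_deriveD.
have cF' : continuous F'.
  by move=> x; apply: cvgD; [exact: cvg_cst | exact: com].
have com0 : continuous om.
  move=> x; apply: differentiable_continuous; apply/derivable1_diffP.
  exact: (@ex_derive _ _ _ _ _ _ _ (dom x)).
have mono := derive_ge_half_mono dF om2.
have monoS := leW_mono mono.
have mom : measurable_fun setT om by exact: continuous_measurable_fun.
have mF' : measurable_fun setT F' by exact: continuous_measurable_fun.
have F'0 x : (0 <= F' x)%R by apply: le_trans (om2 x); rewrite invr_ge0.
have mtc := @measurable_to_circle R.
have madd : measurable_fun setT (fun x : circle R => x + to_circle (om (csec x)))%R.
  have -> : (fun x : circle R => x + to_circle (om (csec x)))%R =
      to_circle \o (fun x => csec x + om (csec x))%R.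
    by apply/funext => x; rewrite /= to_circleD csecK.
  apply: measurableT_comp => //; apply: measurable_funD; first exact: measurable_csec.
  by apply: measurableT_comp => //; exact: measurable_csec.
have mcs := @measurable_csec R.
rewrite circle_integral; last 2 first.
- apply: emeasurable_funM; first exact: measurableT_comp.
  by apply/measurable_EFinP; exact: (measurableT_comp mF' mcs).
- by move=> x; apply: mule_ge0 => //; rewrite lee_fin; exact: F'0.
rewrite [RHS]circle_integral//; congr (_ * _).
pose k y := g (to_circle y).
have mk : measurable_fun setT k by exact: measurableT_comp.
have kP y : k (y + pi2)%R = k y.
  rewrite /k; congr g; apply/to_circleP; by exists 1%Z; rewrite mul1r.
rewrite -(integral_period mk (fun y => g0 _) kP om0).
rewrite [RHS]integral_mkcond.
rewrite (integral_substitution dF cF' om2); last 2 first.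
- by apply/(measurable_restrictT _ _).1 => //; exact: measurable_funTS.
- by move=> x; rewrite patchE; case: ifP => // _; exact: g0.
rewrite integral_mkcond; apply: eq_integral => y _; rewrite !patchE.
have F0 : F 0%R = om 0%R by rewrite /F add0r.
have Fp : F pi2 = (om 0 + pi2)%R by rewrite /F -(add0r pi2) omP add0r addrC.
rewrite (_ : (F y \in `[om 0%R, (om 0 + pi2)%R[%classic) = (y \in `[0%R, pi2[%classic)).
  case: ifPn => [|_]; last by rewrite mul0e.
  rewrite inE /= in_itv/= => y02; rewrite csec_to_circle//.
  by rewrite /k /F to_circleD.
by apply/idP/idP; rewrite !inE /= !in_itv/= -Fp -F0 mono monoS.
Qed.

End circle_integral.

Section torus_facts.
Variable R : realType.
Implicit Types (p q : tpoly R) (a b s t : R).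

Local Notation vol := (torus_vol R).

Definition lift2 (F : R -> R -> R) (x : torus R) : R := F (csec x.1) (csec x.2).

Lemma tev_csec p a b :
  tev p (csec (to_circle a)) (csec (to_circle b)) = tev p a b.
Proof.
have [m E1] := csec_shift (erefl (to_circle a)).
have [n E2] := csec_shift (erefl (to_circle b)).
by rewrite [in RHS]E1 [in RHS]E2 tev_periodic.
Qed.

Lemma lift2_tev p a b : lift2 (tev p) (to_circle a, to_circle b) = tev p a b.
Proof. exact: tev_csec. Qed.

Lemma measurable_csec1 : measurable_fun setT (fun x : torus R => csec x.1).
Proof. exact: (measurableT_comp (@measurable_csec R) measurable_fst). Qed.

Lemma measurable_csec2 : measurable_fun setT (fun x : torus R => csec x.2).
Proof. exact: (measurableT_comp (@measurable_csec R) measurable_snd). Qed.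

Lemma measurable_lift2_tev p : measurable_fun setT (lift2 (tev p)).
Proof. exact: (measurable_tev measurable_csec1 measurable_csec2). Qed.

Lemma measurable_to_torus (d : measure_display) (T : measurableType d)
  (F G : T -> R) : measurable_fun setT F -> measurable_fun setT G ->
  measurable_fun setT (fun z => (to_circle (F z), to_circle (G z)) : torus R).
Proof.
move=> mF mG; apply: measurable_fun_pair.
  exact: (measurableT_comp (@measurable_to_circle R) mF).
exact: (measurableT_comp (@measurable_to_circle R) mG).
Qed.

Lemma torus_vol_setT : vol setT = 1%E.
Proof. exact: probability_setT. Qed.

Lemma Rintegral_vol_cst (c : R) : \int[vol]_x c = c.
Proof.
transitivity (c * fine (vol setT)); first exact: Rintegral_cst.
by rewrite torus_vol_setT mulr1.
Qed.

Lemma torus_integrable (f : torus R -> R) B : measurable_fun setT f ->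
  (forall x, `|f x| <= B) -> vol.-integrable setT (EFin \o f).
Proof.
move=> mf fB; apply: measurable_bounded_integrable => //.
  by apply: (@le_lt_trans _ _ 1%E); [rewrite probability_le1 | rewrite ltry].
exists B; split; first exact: num_real.
by move=> M BM x _; apply: le_trans (fB x) (ltW BM).
Qed.

Lemma torus_integralE (f : torus R -> R) B : measurable_fun setT f ->
  (forall x, `|f x| <= B) ->
  (\int[vol]_x (f x)%:E)%E = (\int[vol]_x f x)%:E.
Proof.
move=> mf fB; rewrite /Rintegral fineK//.
by apply: integrable_fin_num => //; exact: torus_integrable fB.
Qed.

Lemma continuous_tev1 p y : continuous (fun x => tev p x y).
Proof.
move=> x; apply: differentiable_continuous; apply/derivable1_diffP.
exact: (@ex_derive _ _ _ _ _ _ _ (is_derive_tev1 p x y)).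
Qed.

Lemma continuous_tev2 p x : continuous (tev p x).
Proof.
move=> y; apply: differentiable_continuous; apply/derivable1_diffP.
exact: (@ex_derive _ _ _ _ _ _ _ (is_derive_tev2 p x y)).
Qed.

Local Open Scope ereal_scope.

Lemma torus_shear1 p a (G : torus R -> \bar R) :
  (forall x y, 2^-1 <= 1 + a * tev (tD1 p) x y)%R ->
  (forall y, `|a * tev p 0 y| <= 2 * pi)%R ->
  measurable_fun setT G -> (forall x, 0 <= G x) ->
  \int[vol]_x (G (x.1 + to_circle (a * lift2 (tev p) x), x.2)%R *
    (1 + a * lift2 (tev (tD1 p)) x)%:E) = \int[vol]_x G x.
Proof.
move=> J0 b0 mG G0.
have mL : measurable_fun setT (fun x : torus R =>
    G (x.1 + to_circle (a * lift2 (tev p) x), x.2)%R *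
    (1 + a * lift2 (tev (tD1 p)) x)%:E).
  apply: emeasurable_funM.
    apply: (measurableT_comp mG).
    have -> : (fun x : torus R => (x.1 + to_circle (a * lift2 (tev p) x), x.2)%R) =
      (fun x => (to_circle (csec x.1 + a * lift2 (tev p) x), to_circle (csec x.2))%R).
      by apply/funext => x; rewrite to_circleD !csecK.
    apply: measurable_to_torus; last exact: measurable_csec2.
    apply: measurable_funD; first exact: measurable_csec1.
    by apply: measurable_funM => //; exact: measurable_lift2_tev.
  apply/measurable_EFinP; apply: measurable_funD => //.
  by apply: measurable_funM => //; exact: measurable_lift2_tev.
rewrite fubini_tonelli2//; last first.
  by move=> x; apply: mule_ge0 => //; rewrite lee_fin; apply: le_trans (J0 _ _); rewrite invr_ge0.
rewrite [RHS]fubini_tonelli2//; apply: eq_integral => y _; rewrite /fubini_G /=.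
apply: (@circle_shear R (fun x => a * tev p x (csec y))%R
  (fun x => a * tev (tD1 p) x (csec y))%R (fun x => G (x, y))) => //.
- by move=> x; have d := is_derive_tev1 p x (csec y); exact: is_deriveZ.
- by move=> x; apply: cvgM; [exact: cvg_cst | exact: continuous_tev1].
- move=> x; congr (_ * _)%R; have := tev_periodic p x (csec y) 1 0.
  by rewrite mul1r mul0r addr0.
- by apply: (measurableT_comp mG); exact: measurable_fun_pair.
Qed.

Lemma torus_shear2 p a (G : torus R -> \bar R) :
  (forall x y, 2^-1 <= 1 + a * tev (tD2 p) x y)%R ->
  (forall x, `|a * tev p x 0| <= 2 * pi)%R ->
  measurable_fun setT G -> (forall x, 0 <= G x) ->
  \int[vol]_x (G (x.1, x.2 + to_circle (a * lift2 (tev p) x))%R *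
    (1 + a * lift2 (tev (tD2 p)) x)%:E) = \int[vol]_x G x.
Proof.
move=> J0 b0 mG G0.
have mL : measurable_fun setT (fun x : torus R =>
    G (x.1, x.2 + to_circle (a * lift2 (tev p) x))%R *
    (1 + a * lift2 (tev (tD2 p)) x)%:E).
  apply: emeasurable_funM.
    apply: (measurableT_comp mG).
    have -> : (fun x : torus R => (x.1, x.2 + to_circle (a * lift2 (tev p) x))%R) =
      (fun x => (to_circle (csec x.1), to_circle (csec x.2 + a * lift2 (tev p) x))%R).
      by apply/funext => x; rewrite to_circleD !csecK.
    apply: measurable_to_torus; first exact: measurable_csec1.
    apply: measurable_funD; first exact: measurable_csec2.
    by apply: measurable_funM => //; exact: measurable_lift2_tev.
  apply/measurable_EFinP; apply: measurable_funD => //.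
  by apply: measurable_funM => //; exact: measurable_lift2_tev.
rewrite fubini_tonelli1//; last first.
  by move=> x; apply: mule_ge0 => //; rewrite lee_fin; apply: le_trans (J0 _ _); rewrite invr_ge0.
rewrite [RHS]fubini_tonelli1//; apply: eq_integral => y _; rewrite /fubini_F /=.
apply: (@circle_shear R (fun x => a * tev p (csec y) x)%R
  (fun x => a * tev (tD2 p) (csec y) x)%R (fun x => G (y, x))) => //.
- by move=> x; have d := is_derive_tev2 p (csec y) x; exact: is_deriveZ.
- by move=> x; apply: cvgM; [exact: cvg_cst | exact: continuous_tev2].
- move=> x; congr (_ * _)%R; have := tev_periodic p (csec y) x 0 1.
  by rewrite mul1r mul0r addr0.
- by apply: (measurableT_comp mG); exact: measurable_fun_pair.
Qed.

Definition Tmap (phi psi : tpoly R) s t (x : torus R) : torus R :=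
  (to_circle (csec x.1 + lift2 (Tz1 phi psi s t) x),
   to_circle (csec x.2 + lift2 (Tz2 phi psi s t) x))%R.

(** [Tmap] is the horizontal shear followed by the vertical one. Each is a family of circle maps
    treated by Fubini, and the two Jacobian factors multiply to [Tlam2]. *)
Lemma torus_Tmap (phi psi : tpoly R) s t (G : torus R -> \bar R) :
  (forall x y, 2^-1 <= 1 + s * t * tev (tD1 (pW1 phi psi)) x y)%R ->
  (forall x y, 2^-1 <= 1 + s * t * tev (tD2 (pW2 phi psi)) x y)%R ->
  (forall x y, `|s * t * tev (pW1 phi psi) x y| <= 2 * pi)%R ->
  (forall x y, `|s * t * tev (pW2 phi psi) x y| <= 2 * pi)%R ->
  measurable_fun setT G -> (forall x, 0 <= G x) ->
  \int[vol]_x (G (Tmap phi psi s t x) * (lift2 (Tlam2 phi psi s t) x)%:E) =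
  \int[vol]_x G x.
Proof.
move=> J1 J2 B1 B2 mG G0.
pose W1 := pW1 phi psi; pose W2 := pW2 phi psi; pose a := (s * t)%R.
pose H (x : torus R) := G (x.1, x.2 + to_circle (a * lift2 (tev W2) x))%R *
    (1 + a * lift2 (tev (tD2 W2)) x)%:E.
have mH : measurable_fun setT H.
  apply: emeasurable_funM.
    apply: (measurableT_comp mG).
    have -> : (fun x : torus R => (x.1, x.2 + to_circle (a * lift2 (tev W2) x))%R) =
      (fun x => (to_circle (csec x.1), to_circle (csec x.2 + a * lift2 (tev W2) x))%R).
      by apply/funext => x; rewrite to_circleD !csecK.
    apply: measurable_to_torus; first exact: measurable_csec1.
    apply: measurable_funD; first exact: measurable_csec2.
    by apply: measurable_funM => //; exact: measurable_lift2_tev.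
  apply/measurable_EFinP; apply: measurable_funD => //.
  by apply: measurable_funM => //; exact: measurable_lift2_tev.
have H0 x : 0 <= H x.
  apply: mule_ge0 => //; rewrite lee_fin.
  by apply: le_trans (J2 _ _); rewrite invr_ge0.
rewrite -(torus_shear2 J2 (fun x => B2 x 0%R) mG G0) -/a -/W2.
rewrite -(torus_shear1 J1 (fun y => B1 0%R y) mH H0) -/a -/W1.
apply: eq_integral => x _.
have E (q : tpoly R) : lift2 (tev q) (x.1 + to_circle (a * lift2 (tev W1) x), x.2)%R =
    tev q (csec x.1 + lift2 (Tz1 phi psi s t) x)%R (csec x.2).
  by rewrite -lift2_tev to_circleD !csecK.
have TE : Tmap phi psi s t x = (x.1 + to_circle (lift2 (Tz1 phi psi s t) x),
    x.2 + to_circle (lift2 (Tz2 phi psi s t) x))%R.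
  by rewrite /Tmap (to_circleD (csec x.1)) (to_circleD (csec x.2)) !csecK.
rewrite /H /= !E -muleA -EFinM; congr (_ * _%:E); last by rewrite mulrC.
by rewrite TE.
Qed.

Local Close Scope ereal_scope.

Let shift_const a : (forall x y : R, 2^-1 <= 1 + a * tev (tD1 (tconst 1)) x y) /\
  (forall x y : R, 2^-1 <= 1 + a * tev (tD2 (tconst 1)) x y).
Proof. by split=> x y; rewrite ?tD1_const ?tD2_const; lra. Qed.

(** Translation by half a period, a shear with constant displacement, changes the sign of a
    nonconstant mode. The shear lemmas ask for nonnegative integrands, hence the detour through 1 +
    C and 1 - C. *)
Let mono_mean (m n : int) (th : R) :
  \int[vol]_x lift2 (tev [:: (1, m, n, th)]) x =
  if (m == 0) && (n == 0) then cos th else 0.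
Proof.
set p := [:: _]; pose C x := lift2 (tev p) x.
have pE x y : tev p x y = cos (m%:~R * x + n%:~R * y + th).
  by rewrite /tev big_seq1/= mul1r.
have C1 x : `|C x| <= 1.
  by rewrite /C /lift2 pE ler_norml cos_geN1 cos_le1.
have mC : measurable_fun setT C by exact: measurable_lift2_tev.
have iC := torus_integrable mC C1.
have i1 : vol.-integrable setT (EFin \o (fun=> 1 : R)).
  by apply: (@torus_integrable _ 1) => // x; rewrite normr1.
case: ifPn => [/andP[/eqP m0 /eqP n0]|mn].
  have -> : (fun x => lift2 (tev p) x) = (fun=> cos th).
    by apply/funext => x; rewrite /lift2 pE m0 n0 !mul0r !add0r.
  by rewrite Rintegral_vol_cst.
pose G x : \bar R := (1 + C x)%:E.
have mG : measurable_fun setT G by apply/measurable_EFinP; exact: measurable_funD.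
have G0 x : (0 <= G x)%E.
  by rewrite lee_fin; have := C1 x; rewrite ler_norml => /andP[? _]; lra.
have mGN : measurable_fun setT (fun x => 1 - C x) by exact: measurable_funB.
have GB x : `|1 + C x| <= 2.
  by have := C1 x; rewrite !ler_norml => /andP[? ?]; apply/andP; split; lra.
have GNB x : `|1 - C x| <= 2.
  by have := C1 x; rewrite !ler_norml => /andP[? ?]; apply/andP; split; lra.
suff E : (\int[vol]_x (1 - C x)%:E = \int[vol]_x (1 + C x)%:E)%E.
  move: E; rewrite (torus_integralE mGN GNB) (torus_integralE _ GB); last first.
    exact: measurable_funD.
  move=> [] ; rewrite RintegralB// RintegralD//.
  rewrite Rintegral_vol_cst -/C; lra.
have [m0|m0] := eqVneq m 0.
  move: mn; rewrite m0 /= => n0; pose a : R := pi / n%:~R.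
  have n1 : (n%:~R : R) != 0 by rewrite intr_eq0.
  have ab (x : R) : `|a * tev (tconst 1) x 0| <= 2 * pi.
    rewrite tev_const mulr1 normrM normfV (gtr0_norm (pi_gt0 R)).
    have n2 : 1 <= `|n%:~R : R|.
      by rewrite -intr_norm (_ : 1 = 1%:~R)// ler_int; lia.
    rewrite ler_pdivrMr ?(lt_le_trans ltr01)//.
    by rewrite mulrAC ler_peMl ?pi_ge0//; lra.
  rewrite -(torus_shear2 (shift_const a).2 ab mG G0); apply: eq_integral => x _.
  rewrite /lift2 tD2_const mulr0 addr0 mule1 tev_const mulr1 /G; congr EFin.
  congr (_ + _); rewrite /C /lift2 -[in RHS](csecK x.1) -[in RHS](csecK x.2).
  rewrite -to_circleD tev_csec !pE -cosDpi; congr cos.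
  have na : pi = n%:~R * a by rewrite /a mulrC divfK.
  by rewrite [X in _ + X = _]na; ring.
pose a : R := pi / m%:~R.
have n1 : (m%:~R : R) != 0 by rewrite intr_eq0.
have ab (y : R) : `|a * tev (tconst 1) 0 y| <= 2 * pi.
  rewrite tev_const mulr1 normrM normfV (gtr0_norm (pi_gt0 R)).
  have n2 : 1 <= `|m%:~R : R|.
    by rewrite -intr_norm (_ : 1 = 1%:~R)// ler_int; lia.
  rewrite ler_pdivrMr ?(lt_le_trans ltr01)//.
  by rewrite mulrAC ler_peMl ?pi_ge0//; lra.
rewrite -(torus_shear1 (shift_const a).1 ab mG G0); apply: eq_integral => x _.
rewrite /lift2 tD1_const mulr0 addr0 mule1 tev_const mulr1 /G; congr EFin.
congr (_ + _); rewrite /C /lift2 -[in RHS](csecK x.1) -[in RHS](csecK x.2).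
rewrite -to_circleD tev_csec !pE -cosDpi; congr cos.
have na : pi = m%:~R * a by rewrite /a mulrC divfK.
by rewrite [X in _ + X = _]na; ring.
Qed.

Lemma lift2_tev_integrable p : vol.-integrable setT (EFin \o lift2 (tev p)).
Proof.
have [B _ HB] := tev_bound p.
by apply: (torus_integrable (measurable_lift2_tev p)) => x; exact: HB.
Qed.

Lemma torus_tmean p : \int[vol]_x lift2 (tev p) x = tmean p.
Proof.
elim: p => [|[[[c m] n] th] p IH].
  have -> : (fun x => lift2 (tev [::]) x) = (fun=> 0).
    by apply/funext => x; rewrite /lift2 /tev big_nil.
  by rewrite Rintegral_vol_cst /tmean big_nil.
have -> : (fun x => lift2 (tev ((c, m, n, th) :: p)) x) =
    (fun x => c * lift2 (tev [:: (1, m, n, th)]) x + lift2 (tev p) x).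
  by apply/funext => x; rewrite /lift2 !tev_cons /tev big_nil addr0 /= mul1r.
rewrite RintegralD//; last 2 first.
- have [B _ HB] := tev_bound (tscale c [:: (1, m, n, th)]).
  apply: (@torus_integrable _ B).
    by apply: measurable_funM => //; exact: measurable_lift2_tev.
  by move=> x; rewrite -tev_scale; exact: HB.
- exact: lift2_tev_integrable.
rewrite RintegralZl//; last exact: lift2_tev_integrable.
rewrite mono_mean IH /tmean big_cons /=.
by case: ifP => _ //; rewrite mulr0 add0r.
Qed.

(** With this, an identity between means up to divergences reduces to a pointwise ring identity. *)
Lemma tmean_ext p q : (forall x y, tev p x y = tev q x y) -> tmean p = tmean q.
Proof.
move=> pq; rewrite -!torus_tmean; apply: eq_Rintegral => x _.
exact: pq.
Qed.

Lemma tmean_ge0 p : (forall x y, 0 <= tev p x y) -> 0 <= tmean p.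
Proof.
by move=> p0; rewrite -torus_tmean; apply: Rintegral_ge0 => x _; exact: p0.
Qed.

Lemma grad_lift p (phi : torus R -> R) (x : torus R) : (forall x, phi x = lift2 (tev p) x) ->
  grad phi x = (lift2 (tev (tD1 p)) x, lift2 (tev (tD2 p)) x).
Proof.
move=> E; rewrite /grad; congr pair; rewrite derive1E.
  have -> : (fun h => phi (exp_torus x (h, 0))) =
      (fun z => tev p z (csec x.2)) \o (fun h => h + csec x.1).
    apply/funext => h; rewrite E /exp_torus /= -[in LHS](csecK x.1) -[in LHS](csecK x.2).
    by rewrite -!to_circleD lift2_tev addr0 addrC.
  have d0 : is_derive (0 : R) (1 : R) (fun h : R => h + csec x.1) 1.
    by apply: is_derive_eq; rewrite addr0.
  have d1 := is_derive_tev1 p (0 + csec x.1) (csec x.2).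
  have d2 : is_derive (0 : R) (1 : R) ((fun z => tev p z (csec x.2)) \o
      (fun h => h + csec x.1)) (tev (tD1 p) (0 + csec x.1) (csec x.2) * 1).
    exact: (@is_derive1_comp R (fun z => tev p z (csec x.2)) (fun h => h + csec x.1) 0 _ _ d1 d0).
  by rewrite (@derive_val _ _ _ _ _ _ _ d2) add0r mulr1.
have -> : (fun h => phi (exp_torus x (0, h))) =
    (fun z => tev p (csec x.1) z) \o (fun h => h + csec x.2).
  apply/funext => h; rewrite E /exp_torus /= -[in LHS](csecK x.1) -[in LHS](csecK x.2).
  by rewrite -!to_circleD lift2_tev addr0 addrC.
have d0 : is_derive (0 : R) (1 : R) (fun h : R => h + csec x.2) 1.
  by apply: is_derive_eq; rewrite addr0.
have d1 := is_derive_tev2 p (csec x.1) (0 + csec x.2).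
have d2 : is_derive (0 : R) (1 : R) ((fun z => tev p (csec x.1) z) \o
    (fun h => h + csec x.2)) (tev (tD2 p) (csec x.1) (0 + csec x.2) * 1).
  exact: (@is_derive1_comp R (fun z => tev p (csec x.1) z) (fun h => h + csec x.2) 0 _ _ d1 d0).
by rewrite (@derive_val _ _ _ _ _ _ _ d2) add0r mulr1.
Qed.

Definition tH1 p q : tpoly R := tadd (pdot p q) (tscale 4 (tmul p q)).

Lemma H1_dot_lift p q (phi psi : torus R -> R) :
  (forall x, phi x = lift2 (tev p) x) -> (forall x, psi x = lift2 (tev q) x) ->
  H1_dot vol phi psi = tmean (tH1 p q).
Proof.
move=> Ep Eq; rewrite -torus_tmean; apply: eq_Rintegral => x _.
rewrite (grad_lift x Ep) (grad_lift x Eq) Ep Eq /edot /lift2 /tH1 /pdot !tevE /=.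
by rewrite mulrA.
Qed.

Lemma H1_normsq_lift p (phi : torus R -> R) :
  (forall x, phi x = lift2 (tev p) x) -> H1_normsq vol phi = tmean (tH1 p p).
Proof.
move=> Ep; rewrite -torus_tmean; apply: eq_Rintegral => x _.
rewrite (grad_lift x Ep) Ep /enorm sqr_sqrtr ?addr_ge0 ?sqr_ge0//.
by rewrite /lift2 /tH1 /pdot !tevE /=; ring.
Qed.

End torus_facts.

(** * Bounds for the Hellinger-Kantorovich distance *)

Section eq_set_fun_integral.
Import HBNNSimple.

(* The library version is stated for measures; [exp_mu] and [Pr] work with bare
   set functions. *)
Lemma eq_set_fun_integral (R : realType) (d : measure_display)
  (T : measurableType d) (m1 m2 : set T -> \bar R) (D : set T) (f : T -> \bar R) :
  (forall A, measurable A -> m1 A = m2 A) ->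
  (\int[m1]_(x in D) f x = \int[m2]_(x in D) f x)%E.
Proof.
move=> m12.
have E (h : {nnsfun T >-> R}) : sintegral m1 h = sintegral m2 h.
  by apply: eq_fsbigr => r _; rewrite m12.
by rewrite /integral; congr (ereal_sup _ - ereal_sup _)%E;
  apply/seteqP; split=> _ [h hf <-]; exists h => //; rewrite E.
Qed.

End eq_set_fun_integral.

Section HK_bounds.
Variable R : realType.
Local Notation vol := (torus_vol R).
Local Open Scope ereal_scope.

(** The apex lies over every point of the torus, while [cone_base] picks one of them; the two
    domains of integration differ at most at the apex, where the integrand vanishes. *)
Lemma Pr_base (nu : set (cone R) -> \bar R) (A : set (torus R)) :
  Pr nu A = \int[nu]_(c in @cone_base R @^-1` A) (cone_radius c ^+ 2)%:E.
Proof.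
pose f c := (@cone_radius R c ^+ 2)%:E.
suff E : f \_ [set to_cone p | p in [set p : torus R * {nonneg R} | A p.1]] =
    f \_ (@cone_base R @^-1` A) by rewrite /Pr /integral E.
apply/funext => c; rewrite !patchE /f; case: ifPn => [|cA].
  rewrite inE => -[[y r] /= Ay <-]; case: ifPn => //.
  rewrite notin_setE /= => bA.
  have E : to_cone (y, r) = cone_pt y r%:num :> cone R.
    by rewrite /cone_pt; congr to_cone; congr pair; apply/val_inj; rewrite /= ger0_norm.
  rewrite E cone_radius_pt.
  have [r0|r0] := eqVneq (r%:num : R) 0%R; first by rewrite r0 normr0 expr0n.
  by case: bA; rewrite E cone_base_pt.
case: ifPn => // cA'; exfalso; move: cA; rewrite notin_setE; apply.
exists (cone_rep c); first by move: cA'; rewrite inE.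
by rewrite /to_cone reprK.
Qed.

Lemma measurable_cone_radius2 : measurable_fun setT
  (fun c : cone R => (cone_radius c ^+ 2)%:E).
Proof.
by apply/measurable_EFinP; apply: measurable_funX; exact: measurable_cone_radius.
Qed.

Let mbase (A : set (torus R)) : measurable A -> measurable (@cone_base R @^-1` A).
Proof. by move=> mA; rewrite -[X in measurable X]setTI; exact: measurable_cone_base. Qed.

Lemma Pr_pushforward (d : measure_display) (T : measurableType d)
  (m : {measure set T -> \bar R}) (F : T -> cone R) (A : set (torus R)) :
  measurable_fun setT F -> measurable A -> Pr (pushforward m F) A =
  \int[m]_(x in (@cone_base R \o F) @^-1` A) (cone_radius (F x) ^+ 2)%:E.
Proof.
move=> mF mA; rewrite Pr_base.
rewrite (@ge0_integral_pushforward _ _ _ _ _ _ mF m)//.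
- exact: mbase.
- by apply: measurable_funTS; exact: measurable_cone_radius2.
- by move=> c _; rewrite lee_fin sqr_ge0.
Qed.

Lemma Pr_cone_pt (P : torus R -> torus R) (r : torus R -> R) (A : set (torus R)) :
  measurable_fun setT P -> measurable_fun setT r -> measurable A ->
  Pr (pushforward vol (fun x => cone_pt (P x) (r x))) A =
  \int[vol]_(x in P @^-1` A) (r x ^+ 2)%:E.
Proof.
move=> mP mr mA.
have mF : measurable_fun setT (fun x => cone_pt (P x) (r x)).
  exact: (measurableT_comp (@measurable_cone_pt R) (measurable_fun_pair mP mr)).
rewrite (Pr_pushforward _ mF mA) integral_mkcond [RHS]integral_mkcond.
apply: eq_integral => x _; rewrite !patchE !cone_radius_pt.
(* A point of radius 0 forgets its base point, but carries no mass. *)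
have [r0|r0] := eqVneq (r x) 0%R.
  by rewrite r0 normr0 expr0n /= !if_same.
rewrite (real_normK (num_real (r x))); congr (if _ then _ else _).
by apply/idP/idP; rewrite !inE /= cone_base_pt.
Qed.

Lemma mass_radius_vol : mass_radius vol = 1%R.
Proof. by rewrite /mass_radius [X in fine X]torus_vol_setT sqrtr1. Qed.

Lemma mu_hat_vol (B : set (cone R)) :
  measurable [set x | B (cone_pt x 1)] ->
  mu_hat vol B = vol [set x | B (cone_pt x 1)].
Proof.
move=> mB; rewrite /mu_hat mass_radius_vol expr1n invr1 mul1e /pushforward.
transitivity (\int[vol]_x (\1_[set x | B (cone_pt x 1)] x)%:E); last first.
  by rewrite integral_indic// setIT.
apply: eq_integral => x _; rewrite /= diracE indicE.
congr ((nat_of_bool _)%:R%:E).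
by apply/idP/idP; rewrite !inE /xsection /= inE.
Qed.

Definition Texp (p : tpoly R) (s : R) (x : torus R) : torus R :=
  (to_circle (csec x.1 + lift2 (tkap p s) x * lift2 (tv1 p s) x),
   to_circle (csec x.2 + lift2 (tkap p s) x * lift2 (tv2 p s) x))%R.

Lemma measurable_Texp (p : tpoly R) (s : R) :
  measurable_fun setT (Texp p s) /\ measurable_fun setT (lift2 (trho p s)).
Proof.
have mc1 := @measurable_csec1 R; have mc2 := @measurable_csec2 R.
have mf : measurable_fun setT (lift2 (tf p s)).
  by apply: measurable_funM => //; exact: measurable_tev.
have mv1 : measurable_fun setT (lift2 (tv1 p s)).
  by apply: measurable_funM => //; exact: measurable_tev.
have mv2 : measurable_fun setT (lift2 (tv2 p s)).
  by apply: measurable_funM => //; exact: measurable_tev.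
have mk : measurable_fun setT (lift2 (tkap p s)).
  exact: measurable_pkap mf (measurable_enormT mv1 mv2).
split; last first.
  exact: measurable_prho mf (measurable_enormT mv1 mv2).
have m1 : measurable_fun setT (fun x : torus R =>
    csec x.1 + lift2 (tkap p s) x * lift2 (tv1 p s) x)%R.
  by apply: measurable_funD => //; exact: measurable_funM.
have m2 : measurable_fun setT (fun x : torus R =>
    csec x.2 + lift2 (tkap p s) x * lift2 (tv2 p s) x)%R.
  by apply: measurable_funD => //; exact: measurable_funM.
exact: (measurable_to_torus m1 m2).
Qed.

Lemma exp_mu_vol (p : tpoly R) (phi : torus R -> R) (s : R) (A : set (torus R)) :
  (forall x, phi x = lift2 (tev p) x) -> measurable A ->
  exp_mu vol (fun x => s * phi x)%R A =
  \int[vol]_(x in Texp p s @^-1` A) (lift2 (trho p s) x ^+ 2)%:E.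
Proof.
move=> Ep mA; pose P := Texp p s.
have [mP mr] := measurable_Texp p s.
rewrite -(Pr_cone_pt mP mr mA) /exp_mu /Pr; apply: eq_set_fun_integral => B mB.
set E := (fun c : cone R => _).
have EE x : E (cone_pt x 1) = cone_pt (P x) (lift2 (trho p s) x).
  have Es z : (fun x => s * phi x)%R z = lift2 (tev (tscale s p)) z.
    by rewrite Ep /lift2 tev_scale.
  rewrite /E /exp_cone cone_radius_pt cone_base_pt ?oner_eq0// normr1.
  rewrite (grad_lift x Es) /lift2 tD1_scale tD2_scale Ep -/(lift2 (tev p) x).
  have fE : (2 * 1 * (s * lift2 (tev p) x) = lift2 (tf p s) x)%R.
    by rewrite /lift2 /tf mulr1 mulrA.
  rewrite fE -/(lift2 (tv1 p s) x) -/(lift2 (tv2 p s) x).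
  rewrite expr1n !mul1r; congr cone_pt; rewrite /exp_torus /P /Texp /=.
  (* At a zero gradient the quotient in [exp_cone] is 0 / 0 = 0 while [pkap] is 1 / (1 + f); the
     difference disappears because both multiply a zero component. *)
  have K (a : R) : a = lift2 (tv1 p s) x \/ a = lift2 (tv2 p s) x ->
     (atan (enorm (lift2 (tv1 p s) x, lift2 (tv2 p s) x) / (1 + lift2 (tf p s) x)) /
      enorm (lift2 (tv1 p s) x, lift2 (tv2 p s) x) * a = lift2 (tkap p s) x * a)%R.
    rewrite /lift2 /tkap /pkap; case: ifPn => // /eqP n0 ha; suff -> : a = 0%R by rewrite !mulr0.
    have /eqP := n0; rewrite sqrtr_eq0 /=.
    case: ha => ->; rewrite -/(lift2 (tv1 p s) x) -/(lift2 (tv2 p s) x) => H;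
      apply/eqP; rewrite -sqrf_eq0 eq_le sqr_ge0 andbT; apply: le_trans H;
      by rewrite ?lerDl ?lerDr sqr_ge0.
  have K1 := K _ (or_introl erefl); have K2 := K _ (or_intror erefl).
  rewrite [X in (_ + to_circle X, _)%R](_ : _ = lift2 (tkap p s) x * lift2 (tv1 p s) x)%R; last first.
    exact: etrans K1.
  rewrite [X in (_, _ + to_circle X)%R](_ : _ = lift2 (tkap p s) x * lift2 (tv2 p s) x)%R; last first.
    exact: etrans K2.
  by rewrite (to_circleD (csec x.1)) (to_circleD (csec x.2)) !csecK.
have mF : measurable_fun setT (fun x => cone_pt (P x) (lift2 (trho p s) x)).
  exact: (measurableT_comp (@measurable_cone_pt R) (measurable_fun_pair mP mr)).
have SE : [set x | (E @^-1` B) (cone_pt x 1)] =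
    (fun x => cone_pt (P x) (lift2 (trho p s) x)) @^-1` B.
  by apply/seteqP; split=> x; rewrite /= EE.
have mS : measurable ((fun x => cone_pt (P x) (lift2 (trho p s) x)) @^-1` B).
  by rewrite -[X in measurable X]setTI; exact: mF.
by rewrite {1}/pushforward mu_hat_vol SE.
Qed.

End HK_bounds.

Section HK_approximation.
Variables (R : realType) (mu0 mu1 : set (torus R) -> \bar R).
Local Notation vol := (torus_vol R).
Variables (P0 P1 : torus R -> torus R) (r0 r1 c g0 g1 : torus R -> R) (B : R).
Hypotheses (mP0 : measurable_fun setT P0) (mP1 : measurable_fun setT P1).
Hypotheses (mr0 : measurable_fun setT r0) (mr1 : measurable_fun setT r1).
Hypotheses (mc : measurable_fun setT c).
Hypotheses (mg0 : measurable_fun setT g0) (mg1 : measurable_fun setT g1).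
Hypotheses (r00 : forall x, 0 <= r0 x) (r10 : forall x, 0 <= r1 x).
Hypotheses (r0B : forall x, r0 x <= B) (r1B : forall x, r1 x <= B).
Hypotheses (g00 : forall x, 0 <= g0 x) (g10 : forall x, 0 <= g1 x).
Hypotheses (g0B : forall x, g0 x <= B) (g1B : forall x, g1 x <= B).
Hypotheses (c1 : forall x, `|c x| <= 1).
Hypothesis mu0E : forall A, measurable A ->
  mu0 A = (\int[vol]_(x in P0 @^-1` A) (r0 x ^+ 2)%:E)%E.
Hypothesis mu1E : forall A, measurable A ->
  mu1 A = (\int[vol]_(x in P1 @^-1` A) (r1 x ^+ 2)%:E)%E.
(** Only a lower bound for the cosine is asked, because c is computed from a displacement in the
    plane, which is at least the distance on the torus. *)
Hypothesis c_le : forall x, c x <= cos (Num.min (dist_torus (P0 x) (P1 x)) pi).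
Hypothesis dual : forall u v, 0 <= cos (Num.min (dist_torus u v) pi) ->
  cos (Num.min (dist_torus u v) pi) ^+ 2 <= g0 u * g1 v.
Variable e : R.
Hypothesis gap_le : forall x,
  r0 x ^+ 2 * g0 (P0 x) + r1 x ^+ 2 * g1 (P1 x) - 2 * r0 x * r1 x * c x <= e.

Let B0 : 0 <= B. Proof. exact: le_trans (r00 point) (r0B _). Qed.

Let bd0 x : `|r0 x| <= B. Proof. by rewrite ger0_norm. Qed.
Let bd1 x : `|r1 x| <= B. Proof. by rewrite ger0_norm. Qed.

Let s0B x : `|r0 x ^+ 2| <= B ^+ 2. Proof. by rewrite normrX lerXn2r ?nnegrE. Qed.
Let s1B x : `|r1 x ^+ 2| <= B ^+ 2. Proof. by rewrite normrX lerXn2r ?nnegrE. Qed.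

Let ms0 : measurable_fun setT (fun x => r0 x ^+ 2). Proof. exact: measurable_funX. Qed.
Let ms1 : measurable_fun setT (fun x => r1 x ^+ 2). Proof. exact: measurable_funX. Qed.

Let xB x : `|2 * r0 x * r1 x * c x| <= 2 * B * B.
Proof.
rewrite !normrM -[leRHS]mulr1 ler_pM// ?mulr_ge0//.
by rewrite ler_pM// ?mulr_ge0// ger0_norm// ler_pM.
Qed.

Let mx : measurable_fun setT (fun x => 2 * r0 x * r1 x * c x).
Proof.
apply: measurable_funM => //; apply: measurable_funM => //.
exact: measurable_funM.
Qed.

Let w0B x : `|r0 x ^+ 2 * g0 (P0 x)| <= B ^+ 2 * B.
Proof. by rewrite normrM ler_pM// ger0_norm. Qed.
Let w1B x : `|r1 x ^+ 2 * g1 (P1 x)| <= B ^+ 2 * B.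
Proof. by rewrite normrM ler_pM// ger0_norm. Qed.

Let mw0 : measurable_fun setT (fun x => r0 x ^+ 2 * g0 (P0 x)).
Proof. by apply: measurable_funM => //; exact: (measurableT_comp mg0 mP0). Qed.
Let mw1 : measurable_fun setT (fun x => r1 x ^+ 2 * g1 (P1 x)).
Proof. by apply: measurable_funM => //; exact: (measurableT_comp mg1 mP1). Qed.

Let is0 := torus_integrable ms0 s0B.
Let is1 := torus_integrable ms1 s1B.
Let ix := torus_integrable mx xB.
Let iw0 := torus_integrable mw0 w0B.
Let iw1 := torus_integrable mw1 w1B.

Let U := \int[vol]_x (r0 x ^+ 2 + r1 x ^+ 2 - 2 * r0 x * r1 x * c x).

Let UE : U = \int[vol]_x (r0 x ^+ 2) + \int[vol]_x (r1 x ^+ 2) -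
  \int[vol]_x (2 * r0 x * r1 x * c x).
Proof.
rewrite /U RintegralB//; first by rewrite RintegralD.
exact: (integrableD measurableT is0 is1).
Qed.

Let F x : cone R * cone R := (cone_pt (P0 x) (r0 x), cone_pt (P1 x) (r1 x)).

Let mF : measurable_fun setT F.
Proof.
apply: measurable_fun_pair.
  exact: (measurableT_comp (@measurable_cone_pt R) (measurable_fun_pair mP0 mr0)).
exact: (measurableT_comp (@measurable_cone_pt R) (measurable_fun_pair mP1 mr1)).
Qed.

Let q : {measure set (cone R * cone R) -> \bar R} := pushm vol mF.

Let qE (f : cone R * cone R -> R) : measurable_fun setT f -> (forall p, 0 <= f p) ->
  (\int[q]_p (f p)%:E = \int[vol]_x (f (F x))%:E)%E.
Proof.
move=> mf f0; rewrite (@ge0_integral_pushforward _ _ _ _ _ _ mF vol)//.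
  by apply: measurable_funTS; exact/measurable_EFinP.
by move=> p _; rewrite lee_fin.
Qed.

Let mdist (d : measure_display) (T : measurableType d) (f g : T -> cone R) :
  measurable_fun setT f -> measurable_fun setT g ->
  measurable_fun setT (fun p => dist_cone (f p) (g p) ^+ 2).
Proof. by move=> mf mg; apply: measurable_funX; exact: measurable_dist_cone. Qed.

Let dist_apex (a : cone R) : dist_cone a (apex R) ^+ 2 = cone_radius a ^+ 2.
Proof.
have -> : apex R = cone_pt 0 0.
  by rewrite /cone_pt; congr to_cone; congr pair; apply/val_inj; rewrite /= normr0.
rewrite -{1}(cone_ptK a) dist_cone_pt_sqr ?cone_radius_ge0// /cone_gap.
by rewrite mulr0 mul0r subr0 addr0.
Qed.

Let plan_q : HK_plan mu0 mu1 q.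
Proof.
split=> [|A mA|A mA].
- exists (apex R, apex R).
  have E p : 1 + dist_cone2 p (apex R, apex R) ^+ 2 =
      1 + (cone_radius p.1 ^+ 2 + cone_radius p.2 ^+ 2).
    by rewrite /dist_cone2 /enorm sqr_sqrtr ?addr_ge0 ?sqr_ge0//= !dist_apex.
  have -> : (fun p => (1 + dist_cone2 p (apex R, apex R) ^+ 2)%:E) =
      (fun p => (1 + (cone_radius p.1 ^+ 2 + cone_radius p.2 ^+ 2))%:E).
    by apply/funext => p; rewrite E.
  have mh : measurable_fun setT (fun p : cone R * cone R =>
      1 + (cone_radius p.1 ^+ 2 + cone_radius p.2 ^+ 2)).
    apply: measurable_funD => //; apply: measurable_funD; apply: measurable_funX.
      exact: (measurableT_comp (@measurable_cone_radius R) measurable_fst).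
    exact: (measurableT_comp (@measurable_cone_radius R) measurable_snd).
  rewrite qE//; last by move=> p; rewrite !addr_ge0 ?sqr_ge0.
  have bd x : `|1 + (cone_radius (F x).1 ^+ 2 + cone_radius (F x).2 ^+ 2)| <= 1 + (B ^+ 2 + B ^+ 2).
    rewrite ger0_norm ?addr_ge0 ?sqr_ge0//= !cone_radius_pt -!normrX.
    by rewrite lerD2l lerD.
  by rewrite (torus_integralE (measurableT_comp mh mF) bd) ltry.
- rewrite mu0E//; exact: (Pr_cone_pt mP0 mr0 mA).
- rewrite mu1E//; exact: (Pr_cone_pt mP1 mr1 mA).
Qed.

Let cost_q : (\int[q]_p (dist_cone p.1 p.2 ^+ 2)%:E <= U%:E)%E.
Proof.
have mh : measurable_fun setT (fun p : cone R * cone R => dist_cone p.1 p.2 ^+ 2).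
  exact: (mdist measurable_fst measurable_snd).
have mu : measurable_fun setT
    (fun x => r0 x ^+ 2 + r1 x ^+ 2 - 2 * r0 x * r1 x * c x).
  by apply: measurable_funB => //; exact: measurable_funD.
have Ub x : `|r0 x ^+ 2 + r1 x ^+ 2 - 2 * r0 x * r1 x * c x| <=
    B ^+ 2 + B ^+ 2 + 2 * B * B.
  apply: le_trans (ler_normB _ _) _; rewrite lerD//.
  by apply: le_trans (ler_normD _ _) _; rewrite lerD.
rewrite qE//; last by move=> p; rewrite sqr_ge0.
rewrite /U -(torus_integralE mu Ub); apply: ge0_le_integral => //.
- by move=> x _; rewrite lee_fin sqr_ge0.
- by apply/measurable_EFinP; exact: (measurableT_comp mh mF).
- exact/measurable_EFinP.
- move=> x _; rewrite lee_fin dist_cone_pt_sqr// /cone_gap.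
  have H : 0 <= r0 x * r1 x * (cos (Num.min (dist_torus (P0 x) (P1 x)) pi) - c x).
    by rewrite mulr_ge0 ?mulr_ge0// subr_ge0.
  by move: H; set C := cos _; lra.
Qed.

(** For any plan, r^2 + r'^2 <= d^2 + g0 r^2 + g1 r'^2 holds pointwise, d being the cone distance.
    The integrals of all terms except d^2 depend on the marginals only, so they can be computed on
    the torus with the given parametrization. *)
Let plan_ge (q' : {measure set (cone R * cone R) -> \bar R}) :
  HK_plan mu0 mu1 q' -> ((U - e)%:E <= \int[q']_p (dist_cone p.1 p.2 ^+ 2)%:E)%E.
Proof.
case=> _ q0 q1.
have mb0 := measurableT_comp (@measurable_cone_base R)
  (@measurable_fst _ _ (cone R) (cone R)).
have mb1 := measurableT_comp (@measurable_cone_base R)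
  (@measurable_snd _ _ (cone R) (cone R)).
have mR0 := measurableT_comp (@measurable_cone_radius R)
  (@measurable_fst _ _ (cone R) (cone R)).
have mR1 := measurableT_comp (@measurable_cone_radius R)
  (@measurable_snd _ _ (cone R) (cone R)).
have mQ0 : measurable_fun setT (fun p : cone R * cone R => cone_radius p.1 ^+ 2).
  exact: measurable_funX.
have mQ1 : measurable_fun setT (fun p : cone R * cone R => cone_radius p.2 ^+ 2).
  exact: measurable_funX.
have Q0 (p : cone R * cone R) : 0 <= cone_radius p.1 ^+ 2 by exact: sqr_ge0.
have Q1 (p : cone R * cone R) : 0 <= cone_radius p.2 ^+ 2 by exact: sqr_ge0.
have S0 x : 0 <= r0 x ^+ 2 by exact: sqr_ge0.
have S1 x : 0 <= r1 x ^+ 2 by exact: sqr_ge0.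
have E0 A : measurable A ->
    (\int[q']_(p in (@cone_base R \o fst) @^-1` A) (cone_radius p.1 ^+ 2)%:E =
     \int[vol]_(x in P0 @^-1` A) (r0 x ^+ 2)%:E)%E.
  by move=> mA; rewrite -mu0E// -q0// (Pr_pushforward _ measurable_fst mA).
have E1 A : measurable A ->
    (\int[q']_(p in (@cone_base R \o snd) @^-1` A) (cone_radius p.2 ^+ 2)%:E =
     \int[vol]_(x in P1 @^-1` A) (r1 x ^+ 2)%:E)%E.
  by move=> mA; rewrite -mu1E// -q1// (Pr_pushforward _ measurable_snd mA).
have W0 := eq_weighted_integral mb0 mP0 mQ0 ms0 Q0 S0 E0.
have W1 := eq_weighted_integral mb1 mP1 mQ1 ms1 Q1 S1 E1.
have T0 : (\int[q']_p (cone_radius p.1 ^+ 2)%:E = (\int[vol]_x (r0 x ^+ 2))%:E)%E.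
  rewrite -(torus_integralE ms0 s0B).
  have := E0 setT measurableT; by rewrite !preimage_setT.
have T1 : (\int[q']_p (cone_radius p.2 ^+ 2)%:E = (\int[vol]_x (r1 x ^+ 2))%:E)%E.
  rewrite -(torus_integralE ms1 s1B).
  have := E1 setT measurableT; by rewrite !preimage_setT.
have mG0 : measurable_fun setT (fun x => (g0 x)%:E) by exact/measurable_EFinP.
have mG1 : measurable_fun setT (fun x => (g1 x)%:E) by exact/measurable_EFinP.
pose w0 (p : cone R * cone R) := g0 (cone_base p.1) * cone_radius p.1 ^+ 2.
pose w1 (p : cone R * cone R) := g1 (cone_base p.2) * cone_radius p.2 ^+ 2.
pose D (p : cone R * cone R) := dist_cone p.1 p.2 ^+ 2.
have X0 : (\int[q']_p (w0 p)%:E = (\int[vol]_x (r0 x ^+ 2 * g0 (P0 x)))%:E)%E.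
  rewrite -(torus_integralE mw0 w0B).
  transitivity (\int[vol]_x ((g0 (P0 x))%:E * (r0 x ^+ 2)%:E))%E.
    by rewrite -(W0 (EFin \o g0) mG0)// => x; rewrite lee_fin.
  by apply: eq_integral => x _; rewrite -EFinM mulrC.
have X1 : (\int[q']_p (w1 p)%:E = (\int[vol]_x (r1 x ^+ 2 * g1 (P1 x)))%:E)%E.
  rewrite -(torus_integralE mw1 w1B).
  transitivity (\int[vol]_x ((g1 (P1 x))%:E * (r1 x ^+ 2)%:E))%E.
    by rewrite -(W1 (EFin \o g1) mG1)// => x; rewrite lee_fin.
  by apply: eq_integral => x _; rewrite -EFinM mulrC.
have w00 p : 0 <= w0 p by rewrite mulr_ge0.
have w10 p : 0 <= w1 p by rewrite mulr_ge0.
have D0 p : 0 <= D p by rewrite sqr_ge0.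
have mw0' : measurable_fun setT w0.
  by apply: measurable_funM => //; exact: (measurableT_comp mg0 mb0).
have mw1' : measurable_fun setT w1.
  by apply: measurable_funM => //; exact: (measurableT_comp mg1 mb1).
have mD : measurable_fun setT D by exact: (mdist measurable_fst measurable_snd).
have le p : cone_radius p.1 ^+ 2 + cone_radius p.2 ^+ 2 <= D p + (w0 p + w1 p).
  rewrite /D dist_cone_sqr /cone_gap /w0 /w1.
  have := @dual (cone_base p.1) (cone_base p.2).
  have := cone_radius_ge0 p.1; have := cone_radius_ge0 p.2.
  have := g00 (cone_base p.1); have := g10 (cone_base p.2).
  move: (cone_radius p.1) (cone_radius p.2) (g0 _) (g1 _) (cos _) => r r' a b C.
  move=> b0 a0 r'0 rr0 ab.
  suff : 2 * r * r' * C <= a * r ^+ 2 + b * r' ^+ 2 by lra.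
  have nn : 0 <= a * r ^+ 2 + b * r' ^+ 2 by rewrite addr_ge0 ?mulr_ge0 ?sqr_ge0.
  (* For a negative cosine the left-hand side is nonpositive; the dual inequality enters only in the
     other case. *)
  have [C0|C0] := ltP C 0.
    by apply: le_trans nn; apply: mulr_ge0_le0; [rewrite !mulr_ge0 | exact: ltW].
  (* AM-GM: [2 r r' C <= a r^2 + b r'^2], since [C^2 <= a b] *)
  rewrite -ler_sqr ?nnegrE ?mulr_ge0//.
  have rr : 0 <= (r * r') ^+ 2 by rewrite sqr_ge0.
  have h := ler_wpM2l rr (ab C0).
  have := sqr_ge0 (a * r ^+ 2 - b * r' ^+ 2).
  by move: h; lra.
have mm (f g : cone R * cone R -> R) : measurable_fun setT f -> measurable_fun setT g ->
    (forall p, 0 <= f p) -> (forall p, 0 <= g p) ->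
    (\int[q']_p (f p + g p)%:E = \int[q']_p (f p)%:E + \int[q']_p (g p)%:E)%E.
  move=> mf mg f0 gg0; rewrite -ge0_integralD//.
  - by move=> p _; rewrite lee_fin.
  - exact/measurable_EFinP.
  - by move=> p _; rewrite lee_fin.
  - exact/measurable_EFinP.
have key : (\int[q']_p (cone_radius p.1 ^+ 2 + cone_radius p.2 ^+ 2)%:E <=
    \int[q']_p (D p + (w0 p + w1 p))%:E)%E.
  apply: ge0_le_integral => //.
  - by move=> p _; rewrite lee_fin addr_ge0.
  - by apply/measurable_EFinP; exact: measurable_funD.
  - by apply/measurable_EFinP; do 2 (apply: measurable_funD => //).
  - by move=> p _; rewrite lee_fin.
move: key; rewrite mm// mm//; last 2 first.
- exact: measurable_funD.
- by move=> p; rewrite addr_ge0.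
rewrite mm// T0 T1 X0 X1 -!EFinD -leeBlDr// -EFinB => key; apply: le_trans key.
rewrite lee_fin UE.
have : \int[vol]_x (r0 x ^+ 2 * g0 (P0 x) + r1 x ^+ 2 * g1 (P1 x) -
    2 * r0 x * r1 x * c x) <= e.
  rewrite -[leRHS](Rintegral_vol_cst e); apply: le_Rintegral => //.
  - exact: (integrableB measurableT (integrableD measurableT iw0 iw1) ix).
  - by apply: (@torus_integrable _ _ `|e|).
have iw := integrableD measurableT iw0 iw1.
rewrite RintegralB// RintegralD//; lra.
Qed.

(** The coupling of [P0], [r0] with [P1], [r1] costs at most U, and the dual pair [g0], [g1]
    certifies that no plan costs less than U - e. *)
Lemma HK_approx : exists2 h : R, (HK mu0 mu1 ^+ 2)%E = h%:E & U - e <= h <= U.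
Proof.
pose X := [set \int[q']_p (dist_cone p.1 p.2 ^+ 2)%:E | q' in [set q' | HK_plan mu0 mu1 q']]%E.
have up : (ereal_inf X <= U%:E)%E.
  by apply: (le_trans _ cost_q); apply: ereal_inf_lbound; exists q.
have lo : ((U - e)%:E <= ereal_inf X)%E.
  by apply: le_ereal_inf_tmp => _ [q' /plan_ge ? <-].
have nn : (0 <= ereal_inf X)%E.
  apply: le_ereal_inf_tmp => _ [q' _ <-]; apply: integral_ge0 => p _.
  by rewrite lee_fin sqr_ge0.
have [h hE] : exists h, ereal_inf X = h%:E.
  by case: (ereal_inf X) up nn => [h| |]//; exists h.
move: up lo nn; rewrite hE !lee_fin => up lo nn; exists h; last by rewrite lo up.
by rewrite /HK -/X hE poweR_EFin powR12_sqrt// -EFin_expe sqr_sqrtr.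
Qed.

End HK_approximation.

(** * Expansion of the Hellinger-Kantorovich distance *)

Section periodic.
Variable R : realType.

Definition biperiodic (F : R -> R -> R) := forall x y (m n : int),
  F (x + m%:~R * (2 * pi)) (y + n%:~R * (2 * pi)) = F x y.

Lemma lift2_circle F a b : biperiodic F ->
  lift2 F (to_circle a, to_circle b) = F a b.
Proof.
move=> pF; rewrite /lift2 /=.
have [m {2}->] := csec_shift (erefl (to_circle a)).
by have [n {2}->] := csec_shift (erefl (to_circle b)); rewrite pF.
Qed.

Lemma to_circle_csecD a b :
  to_circle (csec (to_circle a : circle R) + b) = to_circle (a + b).
Proof. by rewrite to_circleD csecK -to_circleD. Qed.

Lemma tkap_periodic p s : biperiodic (@tkap R p s).
Proof. by move=> x y m n; rewrite /tkap /tf /tv1 /tv2 !tev_periodic. Qed.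

Lemma trho_periodic p s : biperiodic (@trho R p s).
Proof. by move=> x y m n; rewrite /trho /tf /tv1 /tv2 !tev_periodic. Qed.

Lemma tv1_periodic p s : biperiodic (@tv1 R p s).
Proof. by move=> x y m n; rewrite /tv1 !tev_periodic. Qed.

Lemma tv2_periodic p s : biperiodic (@tv2 R p s).
Proof. by move=> x y m n; rewrite /tv2 !tev_periodic. Qed.

Lemma bpot_periodic phi psi s t k : biperiodic (@bpot R phi psi s t k).
Proof.
move=> x y m n; set x' := x + _; set y' := y + _.
have M1 : Sm1 phi psi s t x' y' = Sm1 phi psi s t x y + m%:~R * (2 * pi).
  by rewrite /Sm1 tev_periodic addrAC.
have M2 : Sm2 phi psi s t x' y' = Sm2 phi psi s t x y + n%:~R * (2 * pi).
  by rewrite /Sm2 tev_periodic addrAC.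
have P1 : Sp1 phi psi s t x' y' = Sp1 phi psi s t x y + m%:~R * (2 * pi).
  by rewrite /Sp1 M1 M2 tev_periodic addrAC.
have P2 : Sp2 phi psi s t x' y' = Sp2 phi psi s t x y + n%:~R * (2 * pi).
  by rewrite /Sp2 M1 M2 tev_periodic addrAC.
have E (a b c : R) : a + c - (b + c) = a - b by ring.
by rewrite /bpot /cpot P1 P2 tev_periodic /x' /y' !E.
Qed.

Definition tplan phi psi s t (x : torus R) : torus R :=
  Texp psi t (Tmap phi psi s t x).

Lemma tplanE phi psi s t x (X := csec x.1) (Y := csec x.2)
  (z1 := Tz1 phi psi s t X Y) (z2 := Tz2 phi psi s t X Y) :
  tplan phi psi s t x =
  (to_circle (X + z1 + tkap psi t (X + z1) (Y + z2) * tv1 psi t (X + z1) (Y + z2)),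
   to_circle (Y + z2 + tkap psi t (X + z1) (Y + z2) * tv2 psi t (X + z1) (Y + z2))).
Proof.
rewrite /tplan /Texp (lift2_circle _ _ (@tkap_periodic psi t)).
rewrite (lift2_circle _ _ (@tv1_periodic psi t)) (lift2_circle _ _ (@tv2_periodic psi t)).
by rewrite /= !to_circle_csecD.
Qed.

End periodic.

Section smallness.
Variables (R : realType) (phi psi : tpoly R).

Definition small_steps (s t : R) :=
  [/\ (forall x y, 2^-1 <= 1 + tf phi s x y) /\
      (forall x y, 2^-1 <= 1 + tf psi t x y),
      forall x y, 2^-1 <= 1 + s * t * tev (tD1 (pW1 phi psi)) x y,
      forall x y, 2^-1 <= 1 + s * t * tev (tD2 (pW2 phi psi)) x y,
      (forall x y, `|s * t * tev (pW1 phi psi) x y| <= 2 * pi) /\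
      (forall x y, `|s * t * tev (pW2 phi psi) x y| <= 2 * pi) &
      A_semiconvex phi psi s t].

Lemma small_steps_near : exists2 d, 0 < d <= 2^-1 &
  forall s t, 0 < s < d -> 0 < t < d -> small_steps s t.
Proof.
have [B1 b1 H1] := tev_bound phi; have [B2 b2 H2] := tev_bound psi.
have [B3 b3 H3] := tev_bound (tD1 (pW1 phi psi)).
have [B4 b4 H4] := tev_bound (tD2 (pW2 phi psi)).
have [B5 b5 H5] := tev_bound (pW1 phi psi).
have [B6 b6 H6] := tev_bound (pW2 phi psi).
pose q1 := tadd (tscale 2 (tmul phi phi))
      (tadd (tmul (tD1 phi) (tD1 phi)) (tmul (tD2 phi) (tD2 phi))).
pose q2 := tscale (-2) (tmul psi psi).
pose q3 := tsub (tscale 2^-1 (pD phi psi)) (pdot phi psi).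
have [C1 c1 K1] := tev_taylor2 phi; have [C2 c2 K2] := tev_taylor2 psi.
have [C3 c3 K3] := tev_taylor2 q1; have [C4 c4 K4] := tev_taylor2 q2.
have [C5 c5 K5] := tev_taylor2 q3.
(* M dominates four times each sup norm and each Taylor constant, while coefficients such as 2 s or
   s t are at most 2 / M; every perturbation is then at most 1/2. *)
pose M := 4 * (1 + (B1 + B2 + B3 + B4 + B5 + B6) + (C1 + C2 + C3 + C4 + C5)).
have M4 : 4 <= M by rewrite /M; lra.
have M0 : 0 < M by lra.
exists M^-1.
  by rewrite invr_gt0 M0/= lef_pV2 ?posrE//; lra.
move=> s t /andP[s0 sd] /andP[t0 td].
have small (a B : R) : `|a| <= 2 * M^-1 -> 0 <= B -> 4 * B <= M ->
    `|a * B| <= 2^-1.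
  move=> aM B0 BM; rewrite normrM (ger0_norm B0).
  apply: (@le_trans _ _ (2 * M^-1 * B)); first by rewrite ler_wpM2r.
  by rewrite -mulrA (mulrC M^-1) mulrA ler_pdivrMr//; lra.
have tM : t <= 1 by apply: (le_trans (ltW td)); rewrite invf_le1//; lra.
have sM : s <= 1 by apply: (le_trans (ltW sd)); rewrite invf_le1//; lra.
have st : `|s * t| <= 2 * M^-1.
  rewrite ger0_norm; last by rewrite mulr_ge0// ltW.
  have : s * t <= M^-1 * 1 by rewrite ler_pM// ltW.
  have : 0 < M^-1 by rewrite invr_gt0.
  lra.
have s2 : `|2 * s| <= 2 * M^-1 by rewrite ger0_norm; lra.
have t2 : `|2 * t| <= 2 * M^-1 by rewrite ger0_norm; lra.
have low (a u B : R) : `|a| <= 2 * M^-1 -> 0 <= B -> 4 * B <= M -> `|u| <= B ->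
    `|a * u| <= 2^-1.
  move=> aM B0 BM uB; apply: le_trans (small a B aM B0 BM).
  by rewrite !normrM (ger0_norm B0) ler_wpM2l.
have low' (a u B : R) : `|a| <= 2 * M^-1 -> 0 <= B -> 4 * B <= M -> `|u| <= B ->
    2^-1 <= 1 + a * u.
  by move=> aM B0 BM /(low a u B aM B0 BM); rewrite ler_norml => /andP[? _]; lra.
have pi1 : 2^-1 <= 2 * pi :> R by have := @pi_ge2 R; lra.
split.
- split=> x y; rewrite /tf.
    by apply: (low' _ _ B1) => //; rewrite /M; lra.
  by apply: (low' _ _ B2) => //; rewrite /M; lra.
- by move=> x y; apply: (low' _ _ B3) => //; rewrite /M; lra.
- by move=> x y; apply: (low' _ _ B4) => //; rewrite /M; lra.
- split=> x y; apply: le_trans pi1.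
    by apply: (low _ _ B5) => //; rewrite /M; lra.
  by apply: (low _ _ B6) => //; rewrite /M; lra.
- move=> x y h k; set Q := h ^+ 2 + k ^+ 2.
  have Q0 : 0 <= Q by rewrite addr_ge0 ?sqr_ge0.
  pose T p := tev p (x + h) (y + k) - tev p x y -
    (tev (tD1 p) x y * h + tev (tD2 p) x y * k).
  have E : T (pA phi psi s t) = - (2 * s) * T phi + 2 * t * T psi + s ^+ 2 * T q1
      + t ^+ 2 * T q2 + s * t * T q3.
    rewrite /T /pA -/q1 -/q2 -/q3 !(tev_add, tev_scale, tD1_add, tD1_scale, tD2_add, tD2_scale).
    ring.
  have tb (a C : R) p : `|a| <= 2 * M^-1 -> `|T p| <= C * Q ->
      - (2 * M^-1 * C * Q) <= a * T p.
    move=> aM TC; rewrite lerNl -mulNr; apply: le_trans (ler_norm _) _.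
    by rewrite normrM normrN -mulrA ler_pM.
  have ss : `|s ^+ 2| <= 2 * M^-1.
    rewrite ger0_norm ?sqr_ge0//.
    have : s * s <= M^-1 * 1 by rewrite ler_pM// ltW.
    have : 0 < M^-1 by rewrite invr_gt0.
    by rewrite expr2; lra.
  have tt : `|t ^+ 2| <= 2 * M^-1.
    rewrite ger0_norm ?sqr_ge0//.
    have : t * t <= M^-1 * 1 by rewrite ler_pM// ltW.
    have : 0 < M^-1 by rewrite invr_gt0.
    by rewrite expr2; lra.
  have s2' : `|- (2 * s)| <= 2 * M^-1 by rewrite normrN.
  have := tb _ _ _ s2' (K1 x y h k); have := tb _ _ _ t2 (K2 x y h k).
  have := tb _ _ _ ss (K3 x y h k); have := tb _ _ _ tt (K4 x y h k).
  have := tb _ _ _ st (K5 x y h k).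
  have : 2 * M^-1 * (C1 + C2 + C3 + C4 + C5) * Q <= 2^-1 * Q.
    rewrite ler_wpM2r// -mulrA (mulrC M^-1) mulrA ler_pdivrMr//.
    by rewrite /M; lra.
  have -> : tev (pA phi psi s t) (x + h) (y + k) = T (pA phi psi s t) +
      tev (pA phi psi s t) x y + (tev (tD1 (pA phi psi s t)) x y * h +
      tev (tD2 (pA phi psi s t)) x y * k) by rewrite /T; ring.
  rewrite E -/Q; set i := M^-1; lra.
Qed.

End smallness.

Section HK_steps.
Variables (R : realType) (phi psi : tpoly R) (F G : torus R -> R).
Hypotheses (FE : forall x, F x = lift2 (tev phi) x)
  (GE : forall x, G x = lift2 (tev psi) x).
Variables (s t k e : R).
Local Notation vol := (torus_vol R).
Hypothesis st : small_steps phi psi s t.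
Hypothesis hq_le : forall X Y, hq phi psi s t X Y <= 1.
Hypothesis cG_le : forall X Y,
  (cG1 phi psi s t (Sp1 phi psi s t X Y) (Sp2 phi psi s t X Y) X Y ^+ 2
   + cG2 phi psi s t (Sp1 phi psi s t X Y) (Sp2 phi psi s t X Y) X Y ^+ 2) / 2 <= k.

Let u1 X Y : R := X + tkap phi s X Y * tv1 phi s X Y.
Let u2 X Y : R := Y + tkap phi s X Y * tv2 phi s X Y.

Hypothesis gap_le : forall X Y,
  trho phi s X Y ^+ 2 * expR (tev (pA phi psi s t) (u1 X Y) (u2 X Y)) +
  Tlam2 phi psi s t X Y *
  trho psi t (X + Tz1 phi psi s t X Y) (Y + Tz2 phi psi s t X Y) ^+ 2 *
  expR (bpot phi psi s t k (u1 X Y + hx phi psi s t X Y) (u2 X Y + hy phi psi s t X Y))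
  - 2 * Tcos phi psi s t X Y <= e.

Let z1 := Tz1 phi psi s t.
Let z2 := Tz2 phi psi s t.
Let lam2 := Tlam2 phi psi s t.
Let r0 := lift2 (trho phi s).
Let r1 x := lift2 (Tlam phi psi s t) x * lift2 (trho psi t) (Tmap phi psi s t x).
Let c := lift2 (fun X Y => cos (Num.sqrt (hq phi psi s t X Y))).
Let g0 := lift2 (fun X Y => expR (tev (pA phi psi s t) X Y)).
Let g1 := lift2 (fun X Y => expR (bpot phi psi s t k X Y)).

Let J1 := let: And5 _ h _ _ _ := st in h.
Let J2 := let: And5 _ _ h _ _ := st in h.
Let W12 := let: And5 _ _ _ h _ := st in h.

Let lam2_gt0 X Y : 0 < lam2 X Y.
Proof.
rewrite mulr_gt0//; first by have := J1 X Y; lra.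
by have := J2 (X + z1 X Y) Y; rewrite /z1; lra.
Qed.

Let mz1 : measurable_fun setT (lift2 z1).
Proof. by apply: measurable_funM => //; exact: measurable_lift2_tev. Qed.

Let mX : measurable_fun setT (fun x : torus R => csec x.1 + lift2 z1 x).
Proof. by apply: measurable_funD => //; exact: measurable_csec1. Qed.

Let mz2 : measurable_fun setT (lift2 z2).
Proof.
apply: measurable_funM => //.
exact: (measurable_tev mX (@measurable_csec2 R)).
Qed.

Let mY : measurable_fun setT (fun x : torus R => csec x.2 + lift2 z2 x).
Proof. by apply: measurable_funD => //; exact: measurable_csec2. Qed.

Let mT : measurable_fun setT (Tmap phi psi s t).
Proof. exact: (measurable_to_torus mX mY). Qed.

Let mlam2 : measurable_fun setT (lift2 lam2).
Proof.
apply: measurable_funM; apply: measurable_funD => //; apply: measurable_funM => //.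
  exact: measurable_lift2_tev.
exact: (measurable_tev mX (@measurable_csec2 R)).
Qed.

Let mlam : measurable_fun setT (lift2 (Tlam phi psi s t)).
Proof. exact: (measurable_sqrtT mlam2). Qed.

Let mP1 : measurable_fun setT (tplan phi psi s t).
Proof. exact: (measurableT_comp (measurable_Texp psi t).1 mT). Qed.

Let mr1 : measurable_fun setT r1.
Proof.
apply: measurable_funM => //.
exact: (measurableT_comp (measurable_Texp psi t).2 mT).
Qed.

Let mtv (p : tpoly R) (v : R) (f g : torus R -> R) : measurable_fun setT f ->
  measurable_fun setT g ->
  [/\ measurable_fun setT (fun x => tkap p v (f x) (g x)),
      measurable_fun setT (fun x => tv1 p v (f x) (g x)) &
      measurable_fun setT (fun x => tv2 p v (f x) (g x))].
Proof.
move=> mf mg.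
have m0 : measurable_fun setT (fun x => tf p v (f x) (g x)).
  by apply: measurable_funM => //; exact: measurable_tev.
have m1 : measurable_fun setT (fun x => tv1 p v (f x) (g x)).
  by apply: measurable_funM => //; exact: measurable_tev.
have m2 : measurable_fun setT (fun x => tv2 p v (f x) (g x)).
  by apply: measurable_funM => //; exact: measurable_tev.
by split=> //; exact: measurable_pkap m0 (measurable_enormT m1 m2).
Qed.

Let mc : measurable_fun setT c.
Proof.
have [k0 v1 v2] := mtv phi s (@measurable_csec1 R) (@measurable_csec2 R).
have [kT w1 w2] := mtv psi t mX mY.
apply: measurable_cosT; apply: measurable_sqrtT.
apply: measurable_funD; apply: measurable_funX.
  apply: measurable_funB; last exact: measurable_funM.
  by apply: measurable_funD => //; exact: measurable_funM.
apply: measurable_funB; last exact: measurable_funM.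
by apply: measurable_funD => //; exact: measurable_funM.
Qed.

Let mg0 : measurable_fun setT g0.
Proof. by apply: measurable_expT; exact: measurable_lift2_tev. Qed.

Let mS (f g h : torus R -> R) p : measurable_fun setT f -> measurable_fun setT g ->
  measurable_fun setT h -> measurable_fun setT (fun x => h x - tev p (f x) (g x) / 2).
Proof.
move=> mf mg mh; apply: measurable_funB => //; apply: measurable_funM => //.
exact: measurable_tev.
Qed.

Let mg1 : measurable_fun setT g1.
Proof.
have c1 := @measurable_csec1 R; have c2 := @measurable_csec2 R.
have a1 := mS (tD1 (pA phi psi s t)) c1 c2 c1.
have a2 := mS (tD2 (pA phi psi s t)) c1 c2 c2.
have b1 := mS (tD1 (pA phi psi s t)) a1 a2 c1.
have b2 := mS (tD2 (pA phi psi s t)) a1 a2 c2.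
apply: measurable_expT; apply: measurable_funD => //; apply: measurable_funN.
apply: measurable_funD; first exact: (measurable_tev b1 b2).
have m1 := measurable_funX 2 (measurable_funB b1 c1).
have m2 := measurable_funX 2 (measurable_funB b2 c2).
have m3 := measurable_funD m1 m2.
apply: measurable_funD; first exact: m3.
by apply: measurable_funM => //; exact: (measurable_funX 2 m3).
Qed.

Let rho_sqr (p : tpoly R) (v X Y : R) : trho p v X Y ^+ 2 =
  (1 + tf p v X Y) ^+ 2 + (tv1 p v X Y ^+ 2 + tv2 p v X Y ^+ 2).
Proof.
rewrite /trho /prho sqr_sqrtr ?addr_ge0 ?sqr_ge0//; congr (_ + _).
by rewrite /enorm sqr_sqrtr ?addr_ge0 ?sqr_ge0.
Qed.

Let rho_ge0 (p : tpoly R) (v X Y : R) : 0 <= trho p v X Y.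
Proof. exact: sqrtr_ge0. Qed.

Lemma trho_le (p : tpoly R) (v : R) : exists2 B, 0 <= B & forall X Y, trho p v X Y <= B.
Proof.
pose r := tadd (tmul (tadd (tconst 1) (tscale (2 * v) p)) (tadd (tconst 1) (tscale (2 * v) p)))
  (tadd (tmul (tscale v (tD1 p)) (tscale v (tD1 p))) (tmul (tscale v (tD2 p)) (tscale v (tD2 p)))).
have [B B0 HB] := tev_bound r; exists (Num.sqrt B) => [|X Y]; first exact: sqrtr_ge0.
rewrite -[leLHS]ger0_norm// -sqrtr_sqr ler_wsqrtr// rho_sqr.
apply: le_trans (HB X Y); apply: le_trans (ler_norm _).
by rewrite /r !tevE /tf /tv1 /tv2 -!expr2.
Qed.

(** [HK_approx] is applied to [Texp], [tplan] and the pair (exp A, exp b). The bound 1 on [hq] keeps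
    the displacement below pi, where the cosine is decreasing and the minimum with pi is
    harmless. *)
Lemma HK_steps : exists2 h : R,
  (HK (exp_mu vol (fun x => s * F x)%R) (exp_mu vol (fun x => t * G x)%R) ^+ 2)%E = h%:E &
  let U := \int[vol]_x (lift2 (trho phi s) x ^+ 2 + lift2 lam2 x *
     lift2 (trho psi t) (Tmap phi psi s t x) ^+ 2 - 2 * lift2 (Tcos phi psi s t) x) in
  U - e <= h <= U.
Proof.
have [mP0 mr0] := measurable_Texp phi s.
have r1_sqr x : r1 x ^+ 2 = lift2 lam2 x * lift2 (trho psi t) (Tmap phi psi s t x) ^+ 2.
  by rewrite exprMn; congr (_ * _); rewrite /lift2 sqr_sqrtr// ltW.
have rT x : lift2 (trho psi t) (Tmap phi psi s t x) =
    trho psi t (csec x.1 + z1 (csec x.1) (csec x.2)) (csec x.2 + z2 (csec x.1) (csec x.2)).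
  by rewrite (lift2_circle _ _ (@trho_periodic R psi t)).
have rrc x : 2 * r0 x * r1 x * c x = 2 * lift2 (Tcos phi psi s t) x.
  by rewrite /r0 /r1 /c rT /lift2 /Tcos /z1 /z2; ring.
have [C0 C00 HC0] := trho_le phi s; have [C1 C10 HC1] := trho_le psi t.
have [C2 C20 HC2] : exists2 C, 0 <= C & forall x, lift2 (Tlam phi psi s t) x <= C.
  have [D1 D10 HD1] := tev_bound (tadd (tconst 1) (tscale (s * t) (tD1 (pW1 phi psi)))).
  have [D2 D20 HD2] := tev_bound (tadd (tconst 1) (tscale (s * t) (tD2 (pW2 phi psi)))).
  exists (Num.sqrt (D1 * D2)) => [|x]; first exact: sqrtr_ge0.
  rewrite /lift2 /Tlam ler_wsqrtr//; apply: le_trans (ler_norm _) _; rewrite normrM.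
  have := HD1 (csec x.1) (csec x.2).
  have := HD2 (csec x.1 + z1 (csec x.1) (csec x.2)) (csec x.2).
  by rewrite !tev_add !tev_scale !tev_const => h1 h2; exact: ler_pM.
have [C3 C30 HC3] := tev_bound (pA phi psi s t).
have bl X Y : bpot phi psi s t k X Y <= C3 + k.
  rewrite lerD2r /cpot; set P := tev _ _ _; set q := (X in nq X).
  have : `|P| <= C3 by exact: HC3.
  rewrite ler_norml => /andP[P0 _].
  have q0 : 0 <= q by rewrite addr_ge0 ?sqr_ge0.
  have : 0 <= nq q by rewrite /nq addr_ge0// mulr_ge0 ?sqr_ge0.
  by lra.
pose B := C0 + C2 * C1 + expR C3 + expR (C3 + k).
have e1 := expR_ge0 C3; have e2 := expR_ge0 (C3 + k).
have C21 : 0 <= C2 * C1 by rewrite mulr_ge0.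
have r0B x : r0 x <= B by apply: le_trans (HC0 _ _) _; rewrite /B; lra.
have r1B x : r1 x <= B.
  apply: (@le_trans _ _ (C2 * C1)); last by rewrite /B; lra.
  by rewrite ler_pM// ?HC1//; exact: sqrtr_ge0.
have g0B x : g0 x <= B.
  apply: (@le_trans _ _ (expR C3)); last by rewrite /B; lra.
  by rewrite ler_expR; apply: le_trans (ler_norm _) (HC3 _ _).
have g1B x : g1 x <= B.
  by apply: (@le_trans _ _ (expR (C3 + k))); [rewrite ler_expR | rewrite /B; lra].
have r00 x : 0 <= r0 x by exact: rho_ge0.
have r10 x : 0 <= r1 x by rewrite mulr_ge0 ?rho_ge0//; exact: sqrtr_ge0.
have g00 x : 0 <= g0 x by exact: expR_ge0.
have g10 x : 0 <= g1 x by exact: expR_ge0.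
have c1 x : `|c x| <= 1 by rewrite ler_norml cos_geN1 cos_le1.
have mu0E A : measurable A -> exp_mu vol (fun x => s * F x)%R A =
    (\int[vol]_(x in Texp phi s @^-1` A) (r0 x ^+ 2)%:E)%E.
  by move=> mA; rewrite (exp_mu_vol s FE mA).
have mu1E A : measurable A -> exp_mu vol (fun x => t * G x)%R A =
    (\int[vol]_(x in tplan phi psi s t @^-1` A) (r1 x ^+ 2)%:E)%E.
  move=> mA; rewrite (exp_mu_vol t GE mA).
  pose H := ((fun x => (lift2 (trho psi t) x ^+ 2)%:E) \_ (Texp psi t @^-1` A))%E.
  have mpre : measurable (Texp psi t @^-1` A).
    by rewrite -[X in measurable X]setTI; exact: (measurable_Texp psi t).1.
  have mH : measurable_fun setT H.
    apply/(measurable_restrictT _ mpre); apply: measurable_funTS.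
    by apply/measurable_EFinP; apply: measurable_funX; exact: (measurable_Texp psi t).2.
  have H0 x : (0 <= H x)%E.
    by rewrite /H patchE; case: ifP => // _; rewrite lee_fin sqr_ge0.
  rewrite integral_mkcond -/H -(torus_Tmap J1 J2 W12.1 W12.2 mH H0).
  rewrite [RHS]integral_mkcond; apply: eq_integral => x _; rewrite /H !patchE.
  have -> : (x \in tplan phi psi s t @^-1` A) = (Tmap phi psi s t x \in Texp psi t @^-1` A).
    by apply/idP/idP; rewrite !inE.
  case: ifP => _; last by rewrite mul0e.
  by rewrite -EFinM r1_sqr mulrC.
have c_le x : c x <= cos (Num.min (dist_torus (Texp phi s x) (tplan phi psi s t x)) pi).
  have d0 := dist_torus_ge0 (Texp phi s x) (tplan phi psi s t x).
  rewrite /c /lift2; set X := csec x.1; set Y := csec x.2.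
  have q1 : Num.sqrt (hq phi psi s t X Y) <= 1 by rewrite -sqrtr1 ler_wsqrtr.
  have dq : dist_torus (Texp phi s x) (tplan phi psi s t x) <= Num.sqrt (hq phi psi s t X Y).
    rewrite -[leLHS]ger0_norm// -sqrtr_sqr ler_wsqrtr//.
    have D (a b a' b' : R) : dist_torus (to_circle a, to_circle b)
        (to_circle a', to_circle b') ^+ 2 <= (a - a') ^+ 2 + (b - b') ^+ 2.
      exact: (dist_torus_sqr_le (a, b) (a', b')).
    rewrite tplanE; apply: le_trans (D _ _ _ _) _.
    rewrite /hq /hx /hy -/X -/Y /lift2 -/X -/Y le_eqVlt; apply/orP; left; apply/eqP.
    by ring.
  have p2 := @pi_ge2 R.
  rewrite min_l; last by lra.
  by rewrite leNgt ltr_cos ?in_itv/= -?leNgt //; apply/andP; split; lra.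
have dual u v : 0 <= cos (Num.min (dist_torus u v) pi) ->
    cos (Num.min (dist_torus u v) pi) ^+ 2 <= g0 u * g1 v.
  have d0 := dist_torus_ge0 u v.
  have p2 := @pi_ge2 R.
  have [dpi|dpi] := leP pi (dist_torus u v).
    by rewrite cospi; lra.
  move=> cd.
  (* A nonnegative cosine below pi means a distance of at most pi / 2, the range of
     [cos_le_gauss]. *)
  have d2 : dist_torus u v <= pi / 2.
    rewrite leNgt; apply/negP => d2; move: cd; rewrite leNgt => /negP; apply.
    have := @cos_gt0_pihalf R (dist_torus u v - pi).
    rewrite -[X in _ -> cos X < 0](subrK pi) cosDpi oppr_lt0; apply.
    by apply/andP; split; lra.
  have [t1 [E1 _ D1]] := dist0_min (csec u.1 - csec v.1).
  have [t2 [E2 _ D2]] := dist0_min (csec u.2 - csec v.2).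
  (* v is lifted to the point of the plane closest to the lift of u, so that the torus distance
     becomes the planar one used in [cpot]. *)
  have V : v = (to_circle (csec u.1 - t1), to_circle (csec u.2 - t2)).
    rewrite (to_circleB (csec u.1)) (to_circleB (csec u.2)) E1 E2.
    rewrite (to_circleB (csec u.1)) (to_circleB (csec u.2)) !csecK.
    by case: {+}v => a b /=; rewrite !subKr.
  rewrite {2}V /g0 /g1 (@lift2_circle _ (fun X Y => expR (bpot phi psi s t k X Y))); last first.
    by move=> X Y m n; rewrite bpot_periodic.
  apply: potentials_admissible => //.
  - by case: st.
  - rewrite /dist_torus !dist_circleE_sec D1 D2 /enorm sqr_sqrtr ?addr_ge0 ?sqr_ge0//=.
    by rewrite !real_normK ?num_real//; congr (_ ^+ 2 + _ ^+ 2); ring.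
  - by rewrite d0.
have EX X Y : X + Tz1 phi psi s t X Y +
    tkap psi t (X + Tz1 phi psi s t X Y) (Y + Tz2 phi psi s t X Y) *
    tv1 psi t (X + Tz1 phi psi s t X Y) (Y + Tz2 phi psi s t X Y) =
    u1 X Y + hx phi psi s t X Y by rewrite /u1 /hx; ring.
have EY X Y : Y + Tz2 phi psi s t X Y +
    tkap psi t (X + Tz1 phi psi s t X Y) (Y + Tz2 phi psi s t X Y) *
    tv2 psi t (X + Tz1 phi psi s t X Y) (Y + Tz2 phi psi s t X Y) =
    u2 X Y + hy phi psi s t X Y by rewrite /u2 /hy; ring.
have gap x : r0 x ^+ 2 * g0 (Texp phi s x) + r1 x ^+ 2 * g1 (tplan phi psi s t x) -
    2 * r0 x * r1 x * c x <= e.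
  rewrite rrc r1_sqr rT tplanE EX EY /g0 /g1 /Texp.
  rewrite (@lift2_circle _ (fun X Y => expR (tev (pA phi psi s t) X Y))); last first.
    by move=> X Y m n; rewrite tev_periodic.
  rewrite (@lift2_circle _ (fun X Y => expR (bpot phi psi s t k X Y))); last first.
    by move=> X Y m n; rewrite bpot_periodic.
  exact: gap_le.
have [h hE hU] := HK_approx mP0 mP1 mr0 mr1 mc mg0 mg1 r00 r10 r0B r1B g00 g10 g0B g1B
  c1 mu0E mu1E c_le dual gap.
exists h => //=; move: hU; set U := \int[_]_x _; set U' := \int[_]_x _.
suff -> : U = U' by [].
by apply: eq_Rintegral => x _; rewrite rrc r1_sqr.
Qed.

Variables (e' : R) (p q : tpoly R).
Hypothesis Tcos_near : forall X Y, `|Tcos phi psi s t X Y - (2^-1 + lam2 X Y / 2 +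
  lam2 X Y * tf psi t (X + z1 X Y) (Y + z2 X Y) + Tpoly phi psi s t X Y)| <= e'.
Hypothesis pE : forall X Y, tev p X Y = 2 * tf phi s X Y + (tf phi s X Y ^+ 2 +
  (tv1 phi s X Y ^+ 2 + tv2 phi s X Y ^+ 2)) - 2 * Tpoly phi psi s t X Y.
Hypothesis qE : forall X Y, tev q X Y = tf psi t X Y ^+ 2 +
  (tv1 psi t X Y ^+ 2 + tv2 psi t X Y ^+ 2).

(** At the displaced point the squared radius is 1 + 2 g + g^2 + |w|^2. Its part 1 + 2 g, multiplied
    by the Jacobian, cancels against the unexpanded terms of [Tcos]; the rest is the Jacobian times
    q at the displaced point, whose integral is exactly the mean of q. *)
Lemma cost_integral :
  `|\int[vol]_x (lift2 (trho phi s) x ^+ 2 + lift2 lam2 x *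
     lift2 (trho psi t) (Tmap phi psi s t x) ^+ 2 - 2 * lift2 (Tcos phi psi s t) x)
   - (tmean p + tmean q)| <= 2 * e'.
Proof.
set U := \int[vol]_x _.
have [mP0 mr0] := measurable_Texp phi s.
pose QT x := lift2 (tev q) (Tmap phi psi s t x).
have mQT : measurable_fun setT QT by exact: (measurableT_comp (measurable_lift2_tev q) mT).
have mpq : measurable_fun setT (fun x => lift2 (tev p) x + lift2 lam2 x * QT x).
  by apply: measurable_funD; [exact: measurable_lift2_tev | exact: measurable_funM].
have rT x : lift2 (trho psi t) (Tmap phi psi s t x) =
    trho psi t (csec x.1 + z1 (csec x.1) (csec x.2)) (csec x.2 + z2 (csec x.1) (csec x.2)).
  by rewrite (lift2_circle _ _ (@trho_periodic R psi t)).
have r1_sqr x : r1 x ^+ 2 = lift2 lam2 x * lift2 (trho psi t) (Tmap phi psi s t x) ^+ 2.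
  by rewrite exprMn; congr (_ * _); rewrite /lift2 sqr_sqrtr// ltW.
have rrc x : 2 * r0 x * r1 x * c x = 2 * lift2 (Tcos phi psi s t) x.
  by rewrite /r0 /r1 /c rT /lift2 /Tcos /z1 /z2; ring.
pose I x := lift2 (trho phi s) x ^+ 2 + lift2 lam2 x *
     lift2 (trho psi t) (Tmap phi psi s t x) ^+ 2 - 2 * lift2 (Tcos phi psi s t) x.
have mI : measurable_fun setT I.
  have -> : I = fun x => r0 x ^+ 2 + r1 x ^+ 2 - 2 * r0 x * r1 x * c x.
    by apply/funext => x; rewrite rrc r1_sqr.
  apply: measurable_funB.
    by apply: measurable_funD; exact: measurable_funX.
  by do 3 (apply: measurable_funM => //).
have IE x : `|I x - (lift2 (tev p) x + lift2 lam2 x * QT x)| <= 2 * e'.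
  rewrite /I rT !rho_sqr /QT (lift2_circle _ _ (tev_periodic q)) qE {3}/lift2 pE.
  move: (Tcos_near (csec x.1) (csec x.2)); rewrite /lift2 -/z1 -/z2.
  set X := csec x.1; set Y := csec x.2; set l := lam2 X Y; set T := Tcos _ _ _ _ _ _.
  set g := tf psi t _ _; set P := Tpoly _ _ _ _ _ _; rewrite !ler_norml.
  by move=> /andP[a b]; apply/andP; split; lra.
have [B B0 HB] : exists2 C, 0 <= C & forall x, `|lift2 lam2 x| <= C.
  have [D1 D10 HD1] := tev_bound (tadd (tconst 1) (tscale (s * t) (tD1 (pW1 phi psi)))).
  have [D2 D20 HD2] := tev_bound (tadd (tconst 1) (tscale (s * t) (tD2 (pW2 phi psi)))).
  exists (D1 * D2) => [|x]; first exact: mulr_ge0.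
  rewrite /lift2 normrM.
  have := HD1 (csec x.1) (csec x.2).
  have := HD2 (csec x.1 + z1 (csec x.1) (csec x.2)) (csec x.2).
  by rewrite !tev_add !tev_scale !tev_const => h1 h2; exact: ler_pM.
have [Bp Bp0 HBp] := tev_bound p; have [Bq Bq0 HBq] := tev_bound q.
have lqB x : `|lift2 lam2 x * QT x| <= B * Bq.
  by rewrite normrM; apply: ler_pM => //; exact: HBq.
have pqB x : `|lift2 (tev p) x + lift2 lam2 x * QT x| <= Bp + B * Bq.
  by apply: le_trans (ler_normD _ _) _; rewrite lerD//; exact: HBp.
have IB x : `|I x| <= 2 * e' + (Bp + B * Bq).
  rewrite -(subrK (lift2 (tev p) x + lift2 lam2 x * QT x) (I x)).
  by apply: le_trans (ler_normD _ _) _; rewrite lerD.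
have iI := torus_integrable mI IB.
have mlq : measurable_fun setT (fun x => lift2 lam2 x * QT x) by exact: measurable_funM.
have ilq := torus_integrable mlq lqB.
have ipq := torus_integrable mpq pqB.
have Q0 x : (0 <= (lift2 (tev q) x)%:E)%E.
  by rewrite lee_fin /lift2 qE !addr_ge0 ?sqr_ge0.
have mQ : measurable_fun setT (fun x => (lift2 (tev q) x)%:E).
  by apply/measurable_EFinP; exact: measurable_lift2_tev.
have E2 : \int[vol]_x (lift2 lam2 x * QT x) = tmean q.
  rewrite -torus_tmean /Rintegral -(torus_Tmap J1 J2 W12.1 W12.2 mQ Q0).
  by congr fine; apply: eq_integral => x _; rewrite -EFinM mulrC.
have E1 : tmean p + tmean q = \int[vol]_x (lift2 (tev p) x + lift2 lam2 x * QT x).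
  by rewrite RintegralD//; [rewrite E2 torus_tmean | exact: lift2_tev_integrable].
have [up lo] : U <= \int[vol]_x (lift2 (tev p) x + lift2 lam2 x * QT x + 2 * e') /\
    \int[vol]_x (lift2 (tev p) x + lift2 lam2 x * QT x - 2 * e') <= U.
  have m (a : R) : vol.-integrable setT (EFin \o (fun x => lift2 (tev p) x + lift2 lam2 x * QT x + a)).
    apply: (@torus_integrable _ _ (Bp + B * Bq + `|a|)).
      exact: measurable_funD.
    by move=> x; apply: le_trans (ler_normD _ _) _; rewrite lerD.
  split; apply: le_Rintegral => // x _; have := IE x; rewrite ler_norml => /andP[];
    rewrite /I; lra.
have ic (a : R) : vol.-integrable setT (EFin \o (fun=> a)).
  exact: (@torus_integrable _ _ `|a|).
move: up lo; rewrite RintegralD// RintegralB// !Rintegral_vol_cst -E1 => up lo.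
by rewrite ler_norml; apply/andP; split; lra.
Qed.

End HK_steps.

Section second_order.
Variables (R : realType) (phi psi : tpoly R).

Definition pWZ : tpoly R :=
  tadd (tmul (pW1 phi psi) (pZ1 phi psi)) (tmul (pW2 phi psi) (pZ2 phi psi)).
(* The coefficient of 2 s^2 t^2 in the expansion of the distance. *)
Definition Qsec : R :=
  tmean pWZ / 4 - tmean (tmul (pwedge phi psi) (pwedge phi psi)) / 6.

(* Up to divergences, which have mean 0, the quartic part of [Tpoly] is
   (W.Z) / 4 - wedge^2 / 6: this uses D = div W and W = Z / 2 + grad D / 4. *)
Lemma Tpoly_mean s t : exists2 p : tpoly R,
  forall x y, tev p x y = Tpoly phi psi s t x y &
  tmean p = 2 * s * tmean phi + s * t * tmean (tH1 phi psi) + s ^+ 2 * t ^+ 2 * Qsec.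
Proof.
pose w1 := pW1 phi psi; pose w2 := pW2 phi psi; pose D := pD phi psi.
pose z1 := pZ1 phi psi; pose z2 := pZ2 phi psi; pose om := pwedge phi psi.
pose div (f : tpoly R) := tadd (tD1 (tmul f w1)) (tD2 (tmul f w2)).
pose pd := tadd (tmul (tD1 phi) (tD1 psi)) (tmul (tD2 phi) (tD2 psi)).
pose wz := tadd (tmul w1 z1) (tmul w2 z2).
have w1E x y : tev w1 x y = 2^-1 * tev z1 x y + 4^-1 * tev (tD1 D) x y.
  by rewrite /w1 /pW1 tev_add !tev_scale.
have w2E x y : tev w2 x y = 2^-1 * tev z2 x y + 4^-1 * tev (tD2 D) x y.
  by rewrite /w2 /pW2 tev_add !tev_scale.
have DE x y : tev D x y = tev (tD1 w1) x y + tev (tD2 w2) x y by rewrite -pW_div.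
have z1E x y : tev z1 x y =
    tev (tD1 (tD1 psi)) x y * tev (tD1 phi) x y + tev (tD2 (tD1 psi)) x y * tev (tD2 phi) x y
    - (tev (tD1 (tD1 phi)) x y * tev (tD1 psi) x y + tev (tD2 (tD1 phi)) x y * tev (tD2 psi) x y).
  by rewrite /z1 /pZ1 !tevE.
have z2E x y : tev z2 x y =
    tev (tD2 (tD1 psi)) x y * tev (tD1 phi) x y + tev (tD2 (tD2 psi)) x y * tev (tD2 phi) x y
    - (tev (tD2 (tD1 phi)) x y * tev (tD1 psi) x y + tev (tD2 (tD2 phi)) x y * tev (tD2 psi) x y).
  by rewrite /z2 /pZ2 !tevE.
have omE x y : tev om x y = tev (tD1 phi) x y * tev (tD2 psi) x y -
    tev (tD2 phi) x y * tev (tD1 psi) x y by rewrite /om /pwedge !tevE.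
have -> : Qsec = tmean wz / 4 - tmean (tmul om om) / 6 by [].
have TE x y : Tpoly phi psi s t x y =
  let D := tev D x y in
  let w1 := tev w1 x y in let w2 := tev w2 x y in
  let p := tev phi x y in let p1 := tev (tD1 phi) x y in
  let p2 := tev (tD2 phi) x y in
  let q := tev psi x y in let q1 := tev (tD1 psi) x y in
  let q2 := tev (tD2 psi) x y in
  let q11 := tev (tD1 (tD1 psi)) x y in let q12 := tev (tD2 (tD1 psi)) x y in
  let q22 := tev (tD2 (tD2 psi)) x y in
  2 * s * p + s * t * (4 * p * q + (p1 * q1 + p2 * q2))
  + s ^+ 2 * t * (D * p + (w1 * p1 + w2 * p2))
  - s * t ^+ 2 * (D * q + (w1 * q1 + w2 * q2))
  + s ^+ 2 * t ^+ 2 * (2 * (D * p * q + p * (w1 * q1 + w2 * q2)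
      + q * (w1 * p1 + w2 * p2))
    + (p1 * (q11 * w1 + q12 * w2) + p2 * (q12 * w1 + q22 * w2)
       + D * (p1 * q1 + p2 * q2) / 2)
    - D ^+ 2 / 8 - (w1 ^+ 2 + w2 ^+ 2) / 2 - (p1 * q2 - p2 * q1) ^+ 2 / 6) by [].
have -> : tH1 phi psi = tadd pd (tscale 4 (tmul phi psi)) by [].
move: TE w1E w2E DE z1E z2E omE; rewrite /wz {}/wz.
move: w1 w2 D z1 z2 om @div => w1 w2 D z1 z2 om div TE w1E w2E DE z1E z2E omE.
exists (tadd (tscale (2 * s) phi) (tadd (tscale (s * t) (tadd pd (tscale 4 (tmul phi psi))))
  (tadd (tscale (s ^+ 2 * t) (div phi)) (tadd (tscale (- (s * t ^+ 2)) (div psi))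
  (tscale (s ^+ 2 * t ^+ 2) (tadd (tadd (tscale 2 (div (tmul phi psi))) (tscale 2^-1 (div pd)))
    (tadd (tscale 4^-1 (tadd (tmul w1 z1) (tmul w2 z2)))
      (tadd (tscale (- 8^-1) (div D)) (tscale (- 6^-1) (tmul om om)))))))))).
  move=> x y; rewrite TE /div /pd !tevE /= !tD12 omE.
  move: (w1E x y) (w2E x y) (DE x y) (z1E x y) (z2E x y).
  move: (tev w1 x y) (tev w2 x y) (tev z1 x y) (tev z2 x y) (tev D x y) (tev (tD1 D) x y)
   (tev (tD2 D) x y) (tev (tD1 w1) x y) (tev (tD2 w2) x y) => a1 a2 b1 b2 d d1 d2 a11 a22.
  move: (tev phi x y) (tev (tD1 phi) x y) (tev (tD2 phi) x y) (tev psi x y)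
    (tev (tD1 psi) x y) (tev (tD2 psi) x y) (tev (tD1 (tD1 phi)) x y)
    (tev (tD2 (tD1 phi)) x y) (tev (tD2 (tD2 phi)) x y)(tev (tD1 (tD1 psi)) x y)
    (tev (tD2 (tD1 psi)) x y) (tev (tD2 (tD2 psi)) x y) =>
    p p1 p2 q q1 q2 p11 p12 p22 q11 q12 q22 E1 E2 E3 E4 E5.
  have D1 : d1 = 4 * a1 - 2 * b1 by rewrite E1; field.
  have D2 : d2 = 4 * a2 - 2 * b2 by rewrite E2; field.
  have A : a11 = d - a22 by rewrite E3; ring.
  clear E1 E2 E3; subst d1 d2 a11 b1 b2.
  by field.
by rewrite /div !tmeanE; field.
Qed.

End second_order.

Section HK_expansion.
Variables (R : realType) (phi psi : tpoly R) (F G : torus R -> R).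
Hypotheses (FE : forall x, F x = lift2 (tev phi) x)
  (GE : forall x, G x = lift2 (tev psi) x).
Local Notation vol := (torus_vol R).

Lemma HK_expansion : exists2 d : R, 0 < d & exists C : R,
  forall s t, 0 < s < d -> 0 < t < d -> exists2 h : R,
  (HK (exp_mu vol (fun x => s * F x)%R) (exp_mu vol (fun x => t * G x)%R) ^+ 2)%E = h%:E &
  `|s ^+ 2 * tmean (tH1 phi phi) - 2 * s * t * tmean (tH1 phi psi)
     + t ^+ 2 * tmean (tH1 psi psi) - h - 2 * s ^+ 2 * t ^+ 2 * Qsec phi psi|
  <= C * (s + t) ^+ 5.
Proof.
have [d /andP[d0 d2] Hd] := small_steps_near phi psi.
(* The point (x, y) belongs to the index and is unconstrained, which makes all constants uniform on
   the torus; d <= 1/2 keeps s + t below 1. *)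
pose dom (i : R * R * R * R) : Prop := 0 < i.1.1.1 < d /\ 0 < i.1.1.2 < d.
have S01 i : dom i -> 0 <= i.1.1.1 + i.1.1.2 <= 1.
  by case=> /andP[a1 a2] /andP[b1 b2]; apply/andP; split; lra.
pose S := @Scale R _ dom (fun i => i.1.1.1 + i.1.1.2) S01.
pose s_ (i : sidx S) : R := i.1.1.1; pose t_ (i : sidx S) : R := i.1.1.2.
pose x_ (i : sidx S) : R := i.1.2; pose y_ (i : sidx S) : R := i.2.
have os : ordO 1 s_.
  exists 1 => i [/andP[a1 a2] /andP[b1 b2]]; rewrite mul1r expr1 /s_ /=.
  by rewrite ger0_norm ?(ltW a1)// lerDl ltW.
have ot : ordO 1 t_.
  exists 1 => i [/andP[a1 a2] /andP[b1 b2]]; rewrite mul1r expr1 /t_ /=.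
  by rewrite ger0_norm ?(ltW b1)// lerDr ltW.
have small i : @sdom R S i -> small_steps phi psi (s_ i) (t_ i).
  by case=> a b; exact: Hd.
have f_ge i X Y : @sdom R S i -> 2^-1 <= 1 + tf phi (s_ i) X Y.
  by move=> /small[[h _] _ _ _ _]; exact: h.
have g_ge i X Y : @sdom R S i -> 2^-1 <= 1 + tf psi (t_ i) X Y.
  by move=> /small[[_ h] _ _ _ _]; exact: h.
have l1_ge i X Y : @sdom R S i -> 2^-1 <= 1 + s_ i * t_ i * tev (tD1 (pW1 phi psi)) X Y.
  by move=> /small[_ h _ _ _]; exact: h.
have l2_ge i X Y : @sdom R S i -> 2^-1 <= 1 + s_ i * t_ i * tev (tD2 (pW2 phi psi)) X Y.
  by move=> /small[_ _ h _ _]; exact: h.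
have [C1 C10 H1] := ord_ge0 (ord_Tcos x_ y_ os ot f_ge g_ge l1_ge l2_ge).
have [C2 C20 H2] := ord_ge0 (ord_hq x_ y_ os ot f_ge g_ge).
have [C3 C30 H3] := ord_ge0 (ord_cG_Sp phi psi os ot x_ y_).
have [C4 C40 H4] := ord_ge0 (ord_cG0 x_ y_ os ot f_ge g_ge).
pose k_ (i : sidx S) := C3 * (s_ i + t_ i) ^+ 6.
pose a1 i := x_ i + tkap phi (s_ i) (x_ i) (y_ i) * tv1 phi (s_ i) (x_ i) (y_ i).
pose a2 i := y_ i + tkap phi (s_ i) (x_ i) (y_ i) * tv2 phi (s_ i) (x_ i) (y_ i).
pose b i := bpot phi psi (s_ i) (t_ i) (k_ i)
  (a1 i + hx phi psi (s_ i) (t_ i) (x_ i) (y_ i))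
  (a2 i + hy phi psi (s_ i) (t_ i) (x_ i) (y_ i)).
have cG_le i X Y : @sdom R S i -> (cG1 phi psi (s_ i) (t_ i)
     (Sp1 phi psi (s_ i) (t_ i) X Y) (Sp2 phi psi (s_ i) (t_ i) X Y) X Y ^+ 2
   + cG2 phi psi (s_ i) (t_ i) (Sp1 phi psi (s_ i) (t_ i) X Y)
     (Sp2 phi psi (s_ i) (t_ i) X Y) X Y ^+ 2) / 2 <= k_ i.
  move=> Di; apply: le_trans (ler_norm _) _.
  exact: (H3 (s_ i, t_ i, X, Y) Di).
(* Admissibility of the dual pair bounds the sum below by 0; near-criticality of the first endpoint
   ([ord_cG0]) and strong convexity bound it above. *)
have ob : ordO 6 (fun i => b i + tev (pA phi psi (s_ i) (t_ i)) (a1 i) (a2 i)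
    + nq (hq phi psi (s_ i) (t_ i) (x_ i) (y_ i))).
  exists (C4 + C3) => i Di.
  have [_ _ _ _ conv] := small i Di.
  set h1 := hx phi psi (s_ i) (t_ i) (x_ i) (y_ i).
  set h2 := hy phi psi (s_ i) (t_ i) (x_ i) (y_ i).
  have cE : tev (pA phi psi (s_ i) (t_ i)) (a1 i) (a2 i) + nq (hq phi psi (s_ i) (t_ i) (x_ i) (y_ i))
      = cpot phi psi (s_ i) (t_ i) (a1 i) (a2 i) (a1 i + h1) (a2 i + h2).
    by rewrite /cpot /hq -/h1 -/h2; congr (_ + nq _); ring.
  rewrite -addrA cE.
  have low := bpot_le (a1 i) (a2 i) conv (cG_le i (a1 i + h1) (a2 i + h2) Di).
  have := cpot_convex (Sp1 phi psi (s_ i) (t_ i) (a1 i + h1) (a2 i + h2))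
    (Sp2 phi psi (s_ i) (t_ i) (a1 i + h1) (a2 i + h2)) (a1 i) (a2 i)
    (a1 i + h1) (a2 i + h2) conv.
  have := H4 i Di; rewrite ler_norml -/(a1 i) -/(a2 i) -/h1 -/h2 => /andP[_].
  set g := (_ / 2); move=> g_le up.
  have k0 : 0 <= C3 * seps i ^+ 6 by rewrite mulr_ge0// exprn_ge0//; case/andP: (S01 i Di).
  have c0 : 0 <= C4 * seps i ^+ 6 by rewrite mulr_ge0// exprn_ge0//; case/andP: (S01 i Di).
  have kE : k_ i = C3 * seps i ^+ 6 by [].
  rewrite ler_norml mulrDl -kE; rewrite -kE in k0.
  move: low up; rewrite /b -/h1 -/h2 /bpot => low up.
  by apply/andP; split; lra.
have [C5 C50 H5] := ord_ge0 (ord_gap os ot f_ge g_ge l1_ge l2_ge ob).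
(* Forces (s + t)(1 + C2) <= 1, so that [hq], which is at most C2 (s + t)^2, stays below 1. *)
pose d' := Num.min d (2 * (1 + C2))^-1.
have C21 : 0 < 1 + C2 by lra.
exists d'; first by rewrite lt_min d0 invr_gt0 mulr_gt0.
exists (2 * C1 + C5) => s t /andP[s0]; rewrite lt_min => /andP[sd sC] /andP[t0].
rewrite lt_min => /andP[td tC].
have Di X Y : @sdom R S (s, t, X, Y) by split; rewrite /= ?s0 ?t0.
have st : small_steps phi psi s t := small _ (Di 0 0).
have hq_le X Y : hq phi psi s t X Y <= 1.
  apply: le_trans (ler_norm _) _; apply: le_trans (H2 _ (Di X Y)) _; rewrite /= /seps /=.
  have st1 : (s + t) * (1 + C2) <= 1.
    rewrite -ler_pdivlMr// div1r; move: sC tC; rewrite invfM; lra.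
  have C2st : 0 <= s * C2 /\ 0 <= t * C2 by split; rewrite mulr_ge0// ltW.
  apply: (@le_trans _ _ (C2 * (s + t))); last by move: C2st => []; lra.
  by rewrite ler_wpM2l// expr2 ler_piMl//; lra.
pose k := C3 * (s + t) ^+ 6; pose e := C5 * (s + t) ^+ 5.
have c_le X Y : (cG1 phi psi s t (Sp1 phi psi s t X Y) (Sp2 phi psi s t X Y) X Y ^+ 2
   + cG2 phi psi s t (Sp1 phi psi s t X Y) (Sp2 phi psi s t X Y) X Y ^+ 2) / 2 <= k.
  exact: (cG_le _ X Y (Di 0 0)).
have gap_le X Y := le_trans (ler_norm _) (H5 _ (Di X Y)).
have [h hE /= hU] := HK_steps (e := e) FE GE st hq_le c_le gap_le.
exists h => //.
have [p pE pM] := Tpoly_mean phi psi s t.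
pose p2 := tsub (tadd (tscale (4 * s) phi) (tscale (s ^+ 2) (tH1 phi phi))) (tscale 2 p).
pose q2 := tscale (t ^+ 2) (tH1 psi psi).
have p2E X Y : tev p2 X Y = 2 * tf phi s X Y + (tf phi s X Y ^+ 2 +
  (tv1 phi s X Y ^+ 2 + tv2 phi s X Y ^+ 2)) - 2 * Tpoly phi psi s t X Y.
  by rewrite /p2 /tH1 /pdot !tevE pE /tf /tv1 /tv2; ring.
have q2E X Y : tev q2 X Y = tf psi t X Y ^+ 2 +
  (tv1 psi t X Y ^+ 2 + tv2 psi t X Y ^+ 2).
  by rewrite /q2 /tH1 /pdot !tevE /tf /tv1 /tv2; ring.
have near X Y := H1 _ (Di X Y).
have := cost_integral (e' := C1 * (s + t) ^+ 5) st near p2E q2E.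
rewrite /p2 /q2 !(tmean_sub, tmean_add (tscale (4 * s) phi), tmean_scale) pM.
move: hU; set U := \int[_]_x _; move: U => U /andP[]; rewrite /e => hU1 hU2.
rewrite !ler_norml => /andP[a3 b3].
by apply/andP; split; lra.
Qed.

End HK_expansion.

(** * The sectional curvature *)

Section sectional.
Variables (R : realType) (phi psi : tpoly R) (F G : torus R -> R).
Hypotheses (FE : forall x, F x = lift2 (tev phi) x)
  (GE : forall x, G x = lift2 (tev psi) x).
Local Notation vol := (torus_vol R).

Lemma H1_normsq_diff (s t : R) : H1_normsq vol (fun x => s * F x - t * G x) =
  s ^+ 2 * tmean (tH1 phi phi) - 2 * s * t * tmean (tH1 phi psi)
  + t ^+ 2 * tmean (tH1 psi psi).
Proof.
rewrite (@H1_normsq_lift _ (tsub (tscale s phi) (tscale t psi))); last first.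
  by move=> x; rewrite FE GE /lift2 tev_sub !tev_scale.
transitivity (tmean (tadd (tscale (s ^+ 2) (tH1 phi phi))
    (tadd (tscale (- (2 * s * t)) (tH1 phi psi)) (tscale (t ^+ 2) (tH1 psi psi))))).
  by apply: tmean_ext => x y; rewrite /tH1 /pdot !tevE; ring.
by rewrite !tmeanE; ring.
Qed.

(** If the ratios s / t and t / s are at most B, then (s + t)^4 <= (1 + B)^4 s^2 t^2, and the error
    of order five divided by s^2 t^2 is O(s + t). When the Gram determinant is 0, quotient and limit
    are both 0, since x / 0 = 0. *)
Lemma lim_star_Sec :
  lim_star (Sec_quotient vol F G) (6 * Qsec phi psi / Gram vol F G).
Proof.
have [d d0 [C HC]] := HK_expansion FE GE.
move=> s t s0 t0 s_cvg t_cvg [B HB].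
set La := Gram vol F G; set Q := Qsec phi psi.
have nd : \forall j \near \oo, s j < d /\ t j < d.
  by near=> j; split; near: j; [exact: (cvgr_lt 0) | exact: (cvgr_lt 0)].
pose K := `|3 / La| * (`|C| * (1 + B) ^+ 4).
have main : \forall j \near \oo, exists2 r : R, Sec_quotient vol F G (s j) (t j) = r%:E &
    `|r - 6 * Q / La| <= K * (s j + t j).
  near=> j.
  have [sd td] : s j < d /\ t j < d by near: j; exact: nd.
  have sj := s0 j; have tj := t0 j; move: (HB j) sj tj sd td.
  move: (s j) (t j) => u v uvB u0 v0 ud vd.
  have [||h hE] := HC u v; [by rewrite u0 | by rewrite v0 |].
  set N := (_ + _ * _ : R); rewrite -/Q => hN.
  exists (3 / (La * u ^+ 2 * v ^+ 2) * (N - h)).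
    by rewrite /Sec_quotient hE H1_normsq_diff -EFinB -EFinM.
  have -> : 3 / (La * u ^+ 2 * v ^+ 2) * (N - h) - 6 * Q / La =
      3 / La * (u ^+ 2 * v ^+ 2)^-1 * (N - h - 2 * u ^+ 2 * v ^+ 2 * Q).
    have uv : (u ^+ 2 * v ^+ 2)^-1 * (u ^+ 2 * v ^+ 2) = 1.
      by rewrite mulVf// mulf_neq0// expf_neq0// gt_eqF.
    rewrite -(mulrA La) invfM; move: uv; set I := (_ * _)^-1 => uv.
    transitivity (3 / La * I * (N - h) - 6 * Q / La * (I * (u ^+ 2 * v ^+ 2))).
      by rewrite uv; ring.
    by ring.
  have B0 : 0 <= u / v /\ 0 <= v / u by split; rewrite divr_ge0// ltW.
  have uB : u <= B * v by rewrite -ler_pdivrMr//; lra.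
  have vB : v <= B * u by rewrite -ler_pdivrMr//; lra.
  have -> : K * (u + v) = `|3 / La| * (`|C| * (1 + B) ^+ 4 * (u + v)) by rewrite mulrA.
  rewrite normrM (normrM (3 / La)) -(mulrA `|3 / La|) ler_wpM2l//.
  have i0 : 0 < u ^+ 2 * v ^+ 2 by rewrite mulr_gt0// exprn_gt0.
  rewrite gtr0_norm ?invr_gt0// mulrC ler_pdivrMr//; apply: le_trans hN _.
  apply: (@le_trans _ _ (`|C| * (u + v) ^+ 5)).
    by rewrite ler_wpM2r ?ler_norm// exprn_ge0// addr_ge0// ltW.
  have uv0 : 0 <= u + v by lra.
  have e1 : u + v <= (1 + B) * u by lra.
  have e2 : u + v <= (1 + B) * v by lra.
  have -> : `|C| * (1 + B) ^+ 4 * (u + v) * (u ^+ 2 * v ^+ 2) =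
    `|C| * ((u + v) * ((1 + B) * u * ((1 + B) * v)) ^+ 2) by ring.
  have -> : (u + v) ^+ 5 = (u + v) * ((u + v) * (u + v)) ^+ 2 by ring.
  rewrite ler_wpM2l// ler_wpM2l// lerXn2r ?nnegrE ?mulr_ge0//; try lra.
  by rewrite ler_pM.
apply/fine_cvgP; split.
  near=> j; have [r -> _] : exists2 r : R, Sec_quotient vol F G (s j) (t j) = r%:E &
    `|r - 6 * Q / La| <= K * (s j + t j) by near: j; exact: main.
  by [].
apply/cvgrPdist_le => e e0; near=> j.
have [r /= -> rK] : exists2 r : R, Sec_quotient vol F G (s j) (t j) = r%:E &
    `|r - 6 * Q / La| <= K * (s j + t j) by near: j; exact: main.
rewrite distrC; apply: le_trans rK _ => /=; apply: le_trans (ler_norm _) _.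
near: j; have st : (fun j => K * (s j + t j)) @ \oo --> 0.
  by rewrite -[X in _ --> X](mulr0 K) -[X in K * X]addr0; apply: cvgMr; exact: cvgD.
by move/cvgr0Pnorm_le : st; apply.
Unshelve. all: by end_near.
Qed.

Lemma Sec_lift : Sec_exists vol F G /\ Sec vol F G = 6 * Qsec phi psi / Gram vol F G.
Proof.
split; first by eexists; exact: lim_star_Sec.
apply: xget_unique; first exact: lim_star_Sec.
(* The sequences s = t = 1 / (n + 1) already determine the limit, so [xget] returns it. *)
move=> a La; have h0 : (fun n => n.+1%:R^-1) @ \oo --> (0 : R) by exact: cvg_harmonic.
have hp n : 0 < n.+1%:R^-1 :> R by rewrite invr_gt0.
have hB : exists B : R, forall j : nat, j.+1%:R^-1 / j.+1%:R^-1 + j.+1%:R^-1 / j.+1%:R^-1 <= B.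
  by exists 2 => j; rewrite divff ?invr_eq0 ?pnatr_eq0.
have c1 := La _ _ hp hp h0 h0 hB; have c2 := lim_star_Sec hp hp h0 h0 hB.
have E : a%:E = (6 * Qsec phi psi / Gram vol F G)%:E by exact: (cvg_unique (@ereal_hausdorff R) c1 c2).
by case: E.
Qed.

Lemma Gram_lift : Gram vol F G = tmean (tH1 phi phi) * tmean (tH1 psi psi)
  - tmean (tH1 phi psi) ^+ 2.
Proof. by rewrite /Gram (H1_normsq_lift FE) (H1_normsq_lift GE) (H1_dot_lift FE GE). Qed.

End sectional.

(** * Lower bounds for the curvature of two Laplace eigenfunctions *)

Section test_field.
Variables (R : realType) (phi psi V1 V2 : tpoly R).

Definition tdiv (p q : tpoly R) : tpoly R := tadd (tD1 p) (tD2 q).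
Definition tsqr (p : tpoly R) : tpoly R := tmul p p.

Lemma tev_div p q x y : tev (tdiv p q) x y = tev (tD1 p) x y + tev (tD2 q) x y.
Proof. by rewrite /tdiv tev_add. Qed.

Lemma tev_sqr p x y : tev (tsqr p) x y = tev p x y ^+ 2.
Proof. by rewrite /tsqr tev_mul. Qed.

Lemma tmean_div p q : tmean (tdiv p q) = 0.
Proof. by rewrite /tdiv tmean_add tmeanD1 tmeanD2 addr0. Qed.

(* W minimizes <|W|^2> + <(div W)^2> / 4 - <Z.W>. *)
Lemma test_field_bound :
  tmean (tadd (tmul (pZ1 phi psi) V1) (tmul (pZ2 phi psi) V2))
  - tmean (tadd (tsqr V1) (tsqr V2)) - tmean (tsqr (tdiv V1 V2)) / 4
  <= tmean (pWZ phi psi) / 2.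
Proof.
rewrite /pWZ.
pose z1 := pZ1 phi psi; pose z2 := pZ2 phi psi.
pose w1 := pW1 phi psi; pose w2 := pW2 phi psi; pose D := pD phi psi.
have w1E x y : tev w1 x y = 2^-1 * tev z1 x y + 4^-1 * tev (tD1 D) x y.
  by rewrite /w1 /pW1 tev_add !tev_scale.
have w2E x y : tev w2 x y = 2^-1 * tev z2 x y + 4^-1 * tev (tD2 D) x y.
  by rewrite /w2 /pW2 tev_add !tev_scale.
have DE x y : tev D x y = tev (tD1 w1) x y + tev (tD2 w2) x y by rewrite -pW_div.
rewrite -/z1 -/z2 -/w1 -/w2.
move: w1 w2 D z1 z2 w1E w2E DE => w1 w2 D z1 z2 w1E w2E DE.
(* The quadratic part of the functional at W - V. By the equation for W, its mean is the difference
   of the two sides up to divergences. *)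
pose T := tadd (tadd (tsqr (tsub w1 V1)) (tsqr (tsub w2 V2)))
  (tscale 4^-1 (tsqr (tsub D (tdiv V1 V2)))).
have T0 : 0 <= tmean T.
  apply: tmean_ge0 => x y; rewrite /T /tsqr !tevE -!expr2.
  by rewrite !addr_ge0 ?sqr_ge0// mulr_ge0 ?sqr_ge0// invr_ge0.
have TE : tmean T = tmean (tadd (tadd (tscale 2^-1 (tadd (tmul w1 z1) (tmul w2 z2)))
   (tscale (-1) (tadd (tmul z1 V1) (tmul z2 V2))))
   (tadd (tadd (tadd (tsqr V1) (tsqr V2)) (tscale 4^-1 (tsqr (tdiv V1 V2))))
    (tadd (tscale 4^-1 (tdiv (tmul D w1) (tmul D w2)))
      (tscale (- 2^-1) (tdiv (tmul D V1) (tmul D V2)))))).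
  apply: tmean_ext => x y; rewrite /T /tsqr /tdiv !tevE.
  move: (w1E x y) (w2E x y) (DE x y).
  move: (tev w1 x y) (tev w2 x y) (tev z1 x y) (tev z2 x y) (tev D x y)
   (tev (tD1 D) x y) (tev (tD2 D) x y) (tev (tD1 w1) x y) (tev (tD2 w2) x y)
   (tev V1 x y) (tev V2 x y) (tev (tD1 V1) x y) (tev (tD2 V2) x y) =>
   a1 a2 b1 b2 d d1 d2 a11 a22 v1 v2 v11 v22 E1 E2 E3.
  have -> : b1 = 2 * a1 - 2^-1 * d1 by rewrite E1; field.
  have -> : b2 = 2 * a2 - 2^-1 * d2 by rewrite E2; field.
  by rewrite E3; field.
move: T0; rewrite TE !(tmean_add (tadd _ _), tmean_add (tscale _ _), tmean_scale, tmean_div).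
by lra.
Qed.

End test_field.

Section eigenfunctions.
Variables (R : realType) (phi psi : tpoly R) (A B P Q : R).
Hypotheses (A0 : 0 <= A) (B0 : 0 <= B) (P0 : 0 <= P) (Q0 : 0 <= Q).
Hypothesis phi11 : forall x y, tev (tD1 (tD1 phi)) x y = - A * tev phi x y.
Hypothesis phi22 : forall x y, tev (tD2 (tD2 phi)) x y = - B * tev phi x y.
Hypothesis psi11 : forall x y, tev (tD1 (tD1 psi)) x y = - P * tev psi x y.
Hypothesis psi22 : forall x y, tev (tD2 (tD2 psi)) x y = - Q * tev psi x y.

Let K := A + B.
Let L := P + Q.
Hypothesis L1 : 1 <= L.

Let ext1 (c : R) (p q : tpoly R) : (forall x y, tev p x y = c * tev q x y) ->
  (forall x y, tev (tD1 p) x y = c * tev (tD1 q) x y) /\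
  (forall x y, tev (tD2 p) x y = c * tev (tD2 q) x y).
Proof.
move=> E; split=> x y.
  by rewrite -tD1_scale; apply: tD1_ext => u v; rewrite tev_scale E.
by rewrite -tD2_scale; apply: tD2_ext => u v; rewrite tev_scale E.
Qed.

Let phi112 := (ext1 phi11).2.
Let phi122 : forall x y, tev (tD2 (tD2 (tD1 phi))) x y = - B * tev (tD1 phi) x y.
Proof. by move=> x y; rewrite -!tD12 (ext1 phi22).1. Qed.
Let psi112 := (ext1 psi11).2.
Let psi122 : forall x y, tev (tD2 (tD2 (tD1 psi))) x y = - Q * tev (tD1 psi) x y.
Proof. by move=> x y; rewrite -!tD12 (ext1 psi22).1. Qed.
Let phi1112 : forall x y, tev (tD2 (tD1 (tD1 (tD1 phi)))) x y = - A * tev (tD2 (tD1 phi)) x y.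
Proof. by move=> x y; rewrite (ext1 (ext1 phi11).1).2. Qed.
Let psi1112 : forall x y, tev (tD2 (tD1 (tD1 (tD1 psi)))) x y = - P * tev (tD2 (tD1 psi)) x y.
Proof. by move=> x y; rewrite (ext1 (ext1 psi11).1).2. Qed.
Let phi1222 := (ext1 phi122).2.
Let psi1222 := (ext1 psi122).2.
Let phi111 := (ext1 phi11).1.
Let psi111 := (ext1 psi11).1.
Let phi222 := (ext1 phi22).2.
Let psi222 := (ext1 psi22).2.

Let eig := (phi1112, psi1112, phi1222, psi1222, phi111, psi111, phi222, psi222,
  phi112, phi122, psi112, psi122, phi11, phi22, psi11, psi22).

(* The curl of Z. *)
Definition pcurl : tpoly R := tscale 2 (tadd (tscale (B - A) (tmul phi (tD2 (tD1 psi))))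
  (tscale (P - Q) (tmul (tD2 (tD1 phi)) psi))).

Definition plap (p : tpoly R) : tpoly R := tadd (tD1 (tD1 p)) (tD2 (tD2 p)).

(** The defect of p from being an eigenfunction for the eigenvalue - L. For a slow phi and a fast
    psi, products of their derivatives are nearly such eigenfunctions. *)
Definition perr (p : tpoly R) : tpoly R := tadd (plap p) (tscale L p).

Lemma grad_mean p : tmean (tadd (tsqr (tD1 p)) (tsqr (tD2 p))) =
  L * tmean (tsqr p) - tmean (tmul p (perr p)).
Proof.
transitivity (tmean (tadd (tdiv (tmul p (tD1 p)) (tmul p (tD2 p)))
   (tsub (tscale L (tsqr p)) (tmul p (perr p))))).
  apply: tmean_ext => x y; rewrite /tsqr /tdiv /perr /plap !tevE; ring.
by rewrite tmean_add tmean_div tmean_sub tmean_scale add0r.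
Qed.

Lemma mean_mul_ge p q (a : R) : 0 < a -> - tmean (tmul p q) <=
  2^-1 * (a * tmean (tsqr p) + a^-1 * tmean (tsqr q)).
Proof.
move=> a0; rewrite -subr_ge0.
have -> : 2^-1 * (a * tmean (tsqr p) + a^-1 * tmean (tsqr q)) - - tmean (tmul p q) =
    tmean (tscale (2 * a)^-1 (tsqr (tadd (tscale a p) q))).
  transitivity (tmean (tadd (tscale (2^-1 * a) (tsqr p))
      (tadd (tscale (2^-1 * a^-1) (tsqr q)) (tmul p q)))).
    by rewrite (tmean_add (tscale _ _)) (tmean_add (tscale _ _)) !tmean_scale; ring.
  by apply: tmean_ext => x y; rewrite /tsqr !tevE; field; rewrite gt_eqF.
apply: tmean_ge0 => x y; rewrite tev_scale tev_sqr mulr_ge0 ?sqr_ge0//.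
by rewrite invr_ge0 mulr_ge0// ltW.
Qed.

(** The test field is c times the rotated gradient of curl Z. It is divergence free, and c = 1 / (2
    L) maximizes c - c^2 L, with value 1 / (4 L); half of this is given up to absorb the defect
    [perr] by Young's inequality. *)
Lemma curl_bound : 8^-1 * (tmean (tsqr pcurl) / L - tmean (tsqr (perr pcurl)) / L ^+ 3)
  <= tmean (pWZ phi psi) / 2.
Proof.
pose c := (2 * L)^-1; have L0 : 0 < L by exact: lt_le_trans L1.
pose V1 := tscale c (tD2 pcurl); pose V2 := tscale (- c) (tD1 pcurl).
have := test_field_bound phi psi V1 V2.
have zero o : tmean (tsqr (tdiv (tscale c (tD2 o)) (tscale (- c) (tD1 o)))) = 0.
  rewrite -[RHS](tmean_const 0); apply: tmean_ext => x y.
  rewrite tev_sqr tev_div tD1_scale tD2_scale tD12 tev_const.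
  by rewrite mulNr subrr expr0n.
have grad o : tmean (tadd (tsqr (tscale c (tD2 o))) (tsqr (tscale (- c) (tD1 o)))) =
    c ^+ 2 * (L * tmean (tsqr o) - tmean (tmul o (perr o))).
  rewrite -grad_mean -tmean_scale; apply: tmean_ext => x y.
  by rewrite /tsqr !tevE; ring.
have curl z1 z2 o : (forall x y, tev o x y = tev (tD1 z2) x y - tev (tD2 z1) x y) ->
   tmean (tadd (tmul z1 (tscale c (tD2 o))) (tmul z2 (tscale (- c) (tD1 o)))) =
    c * tmean (tsqr o).
  move=> E; transitivity (tmean (tadd (tscale c (tdiv (tscale (-1) (tmul z2 o))
     (tmul z1 o))) (tscale c (tsqr o)))).
    by apply: tmean_ext => x y; rewrite /tdiv /tsqr !tevE E; ring.
  by rewrite (tmean_add (tscale _ _)) !tmean_scale tmean_div mulr0 add0r.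
rewrite zero grad curl => [|x y]; last first.
  by rewrite /pcurl /pZ1 /pZ2 !tevE !tD12 !eig; ring.
have := mean_mul_ge pcurl (perr pcurl) L0.
move: (tmean (tsqr pcurl)) (tmean (tmul pcurl (perr pcurl))) (tmean (tsqr (perr pcurl))).
move=> o oe ee h1 h2.
apply: le_trans h2; rewrite mul0r subr0.
have h3 := ler_wpM2l (sqr_ge0 c) h1.
apply: (@le_trans _ _ (c * o - (c ^+ 2 * (L * o) + c ^+ 2 * (2^-1 * (L * o + L^-1 * ee))))).
  have fE (l : R) : 0 < l -> 8^-1 * (o / l - ee / l ^+ 3) = (2 * l)^-1 * o -
      ((2 * l)^-1 ^+ 2 * (l * o) + (2 * l)^-1 ^+ 2 * (2^-1 * (l * o + l^-1 * ee))).
    by move=> l0; field; rewrite gt_eqF.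
  by rewrite (fE L L0).
by move: h3; move: (c ^+ 2) => c2; lra.
Qed.

Let Lge0 : 0 <= L. Proof. exact: le_trans L1. Qed.

(** Here div Z = (K - L) (grad phi . grad psi). The factor c = 2 / L of the test field maximizes c L
    - c^2 L^2 / 4, with value 1; 1/8 of it and part of the term 6 / L absorb the defect by Young's
    inequality. *)
Lemma dot_bound :
  tmean (tsqr (pdot phi psi)) * (7 / 8 - 2 * K / L - 6 / L)
    - 11 * tmean (tsqr (perr (pdot phi psi))) / L ^+ 2
  <= tmean (pWZ phi psi) / 2.
Proof.
pose c := 2 / L; have L0 : 0 < L by exact: lt_le_trans L1.
pose de := pdot phi psi.
pose V1 := tscale c (tD1 de); pose V2 := tscale c (tD2 de).
have := test_field_bound phi psi V1 V2.
have div o : tmean (tsqr (tdiv (tscale c (tD1 o)) (tscale c (tD2 o)))) =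
    c ^+ 2 * (tmean (tsqr (perr o)) + L ^+ 2 * tmean (tsqr o) - 2 * L * tmean (tmul o (perr o))).
  transitivity (tmean (tscale (c ^+ 2) (tadd (tsqr (perr o)) (tadd (tscale (L ^+ 2) (tsqr o))
      (tscale (- (2 * L)) (tmul o (perr o))))))).
    by apply: tmean_ext => x y; rewrite /tsqr /tdiv /perr /plap !tevE; ring.
  by rewrite tmean_scale (tmean_add (tsqr _)) (tmean_add (tscale _ _)) !tmean_scale; ring.
have grad o : tmean (tadd (tsqr (tscale c (tD1 o))) (tsqr (tscale c (tD2 o)))) =
    c ^+ 2 * (L * tmean (tsqr o) - tmean (tmul o (perr o))).
  rewrite -grad_mean -tmean_scale; apply: tmean_ext => x y.
  by rewrite /tsqr !tevE; ring.
have divZ z1 z2 o : (forall x y, tev (tD1 z1) x y + tev (tD2 z2) x y = (K - L) * tev o x y) ->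
   tmean (tadd (tmul z1 (tscale c (tD1 o))) (tmul z2 (tscale c (tD2 o)))) =
    c * (L - K) * tmean (tsqr o).
  move=> E; transitivity (tmean (tadd (tscale c (tdiv (tmul z1 o) (tmul z2 o)))
     (tscale (c * (L - K)) (tsqr o)))).
    apply: tmean_ext => x y; have := E x y; rewrite /tdiv /tsqr !tevE.
    move: (tev o x y) (tev (tD1 z1) x y) (tev (tD2 z2) x y) => v a b E'.
    have -> : a = (K - L) * v - b by rewrite -E'; ring.
    by ring.
  by rewrite (tmean_add (tscale _ _)) !tmean_scale tmean_div mulr0 add0r.
rewrite div grad divZ => [|x y]; last first.
  by rewrite /de /pdot /pZ1 /pZ2 !tevE !tD12 !eig /K /L; ring.
have La : 0 < L / 8 by rewrite divr_gt0.
have h1 := mean_mul_ge de (perr de) La.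
have h2 := mean_mul_ge de (perr de) ltr01.
have d0 : 0 <= tmean (tsqr de) by apply: tmean_ge0 => x y; rewrite tev_sqr sqr_ge0.
have e0 : 0 <= tmean (tsqr (perr de)) by apply: tmean_ge0 => x y; rewrite tev_sqr sqr_ge0.
rewrite -/de; move: h1 h2 d0 e0.
move: (tmean (tsqr de)) (tmean (tmul de (perr de))) (tmean (tsqr (perr de))).
move=> o oe ee h1 h2 o0 ee0 h3.
apply: le_trans h3.
pose i := L^-1; have Li : L * i = 1 by rewrite mulfV// gt_eqF.
have i0 : 0 < i by rewrite invr_gt0.
have i1 : i <= 1 by rewrite invf_le1.
have cE : c = 2 * i by [].
have := ler_wpM2l (ltW i0) h1; have := ler_wpM2l (sqr_ge0 i) h2.
have iE : (L / 8)^-1 = 8 * i by rewrite invfM invrK mulrC.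
have L2 : (L ^+ 2)^-1 = i ^+ 2 by rewrite exprVn.
rewrite iE L2 invr1 cE -/i.
have -> : i * - oe = - (i * oe) by rewrite mulrN.
have -> : i * (2^-1 * (L / 8 * o + 8 * i * ee)) = o / 16 + 4 * (i ^+ 2 * ee).
  transitivity ((L * i) * o / 16 + 4 * (i ^+ 2 * ee)); first by field.
  by rewrite Li mul1r.
have -> : (2 * i) * (L - K) * o = 2 * o - 2 * (K * i * o).
  transitivity (2 * (L * i) * o - 2 * (K * i * o)); first by ring.
  by rewrite Li mulr1.
have -> : (2 * i) ^+ 2 * (L * o - oe) = 4 * (i * o) - 4 * (i ^+ 2 * oe).
  transitivity (4 * ((L * i) * (i * o)) - 4 * (i ^+ 2 * oe)); first by ring.
  by rewrite Li mul1r.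
have -> : (2 * i) ^+ 2 * (ee + L ^+ 2 * o - 2 * L * oe) / 4 =
   i ^+ 2 * ee + o - 2 * (i * oe).
  transitivity (i ^+ 2 * ee + (L * i) ^+ 2 * o - 2 * ((L * i) * (i * oe))); first by field.
  by rewrite Li expr1n !mul1r.
have -> : o * (7 / 8 - 2 * K * i - 6 * i) = 7 / 8 * o - 2 * (K * i * o) - 6 * (i * o) by ring.
have -> : 11 * ee * i ^+ 2 = 11 * (i ^+ 2 * ee) by ring.
have : i ^+ 2 * o <= i * o by rewrite ler_wpM2r// expr2 ler_piMl// ltW.
have : 0 <= i ^+ 2 * ee by rewrite mulr_ge0 ?sqr_ge0.
have -> : i ^+ 2 * - oe = - (i ^+ 2 * oe) by rewrite mulrN.
rewrite !mul1r.
have -> : i ^+ 2 * (2^-1 * (o + ee)) = 2^-1 * (i ^+ 2 * o + i ^+ 2 * ee) by ring.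
have : 0 <= i * o by rewrite mulr_ge0// ltW.
move: (i ^+ 2 * o) (i ^+ 2 * ee) (i * o) (i ^+ 2 * oe) (i * oe) (K * i * o) => a1 a2 a3 a4 a5 a6.
lra.
Qed.

Lemma plap_add p q x y :
  tev (plap (tadd p q)) x y = tev (plap p) x y + tev (plap q) x y.
Proof.
rewrite /plap !(tev_add (tD1 _)).
rewrite (@tD1_ext _ _ (tadd (tD1 p) (tD1 q))); last by move=> u v; rewrite !tevE.
rewrite (@tD2_ext _ _ (tadd (tD2 p) (tD2 q))); last by move=> u v; rewrite !tevE.
by rewrite !tevE; ring.
Qed.

Lemma plap_scale a p x y : tev (plap (tscale a p)) x y = a * tev (plap p) x y.
Proof.
rewrite /plap !(tev_add (tD1 _)).
rewrite (@tD1_ext _ _ (tscale a (tD1 p))); last by move=> u v; rewrite !tevE.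
rewrite (@tD2_ext _ _ (tscale a (tD2 p))); last by move=> u v; rewrite !tevE.
by rewrite !tevE; ring.
Qed.

Lemma plap_mul p q x y : tev (plap (tmul p q)) x y =
  tev (plap p) x y * tev q x y + tev p x y * tev (plap q) x y
  + 2 * (tev (tD1 p) x y * tev (tD1 q) x y + tev (tD2 p) x y * tev (tD2 q) x y).
Proof.
rewrite /plap !(tev_add (tD1 _)).
rewrite (@tD1_ext _ _ (tadd (tmul (tD1 p) q) (tmul p (tD1 q)))); last first.
  by move=> u v; rewrite !tevE.
rewrite (@tD2_ext _ _ (tadd (tmul (tD2 p) q) (tmul p (tD2 q)))); last first.
  by move=> u v; rewrite !tevE.
by rewrite !tevE; ring.
Qed.

Lemma tmean_le p (c : R) : (forall x y, tev p x y <= c) -> tmean p <= c.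
Proof.
move=> pc; rewrite -subr_ge0 -[X in X - _]tmean_const -tmean_sub.
by apply: tmean_ge0 => x y; rewrite tev_sub tev_const subr_ge0.
Qed.

Hypothesis KL : K <= L.
Hypothesis phi_le : forall x y, [/\ tev phi x y ^+ 2 <= 4,
  tev (tD1 phi) x y ^+ 2 <= 4 * A, tev (tD2 phi) x y ^+ 2 <= 4 * B &
  tev (tD2 (tD1 phi)) x y ^+ 2 <= 4 * (A * B)].
Hypothesis psi_le : forall x y, [/\ tev psi x y ^+ 2 <= 4,
  tev (tD1 psi) x y ^+ 2 <= 4 * P, tev (tD2 psi) x y ^+ 2 <= 4 * Q &
  tev (tD2 (tD1 psi)) x y ^+ 2 <= 4 * (P * Q)].

Let sqr_mul_le (u v a b : R) : u ^+ 2 <= a -> v ^+ 2 <= b -> (u * v) ^+ 2 <= a * b.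
Proof. by move=> ua vb; rewrite exprMn ler_pM ?sqr_ge0. Qed.

Let sum3_le (u v w : R) : (u + v + w) ^+ 2 <= 3 * (u ^+ 2 + v ^+ 2 + w ^+ 2).
Proof.
by have := sqr_ge0 (u - v); have := sqr_ge0 (u - w); have := sqr_ge0 (v - w); lra.
Qed.

Let sum2_le (u v : R) : (u + v) ^+ 2 <= 2 * (u ^+ 2 + v ^+ 2).
Proof. by have := sqr_ge0 (u - v); lra. Qed.

Let K0 : 0 <= K. Proof. exact: addr_ge0. Qed.
Let KL0 : 0 <= K * L. Proof. exact: mulr_ge0. Qed.

Let APBQ : 0 <= A * P + B * Q <= K * L.
Proof.
have := mulr_ge0 A0 P0; have := mulr_ge0 A0 Q0; have := mulr_ge0 B0 P0.
by have := mulr_ge0 B0 Q0; rewrite /K /L => h1 h2 h3 h4; apply/andP; split; lra.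
Qed.

Let AQBP : 0 <= A * Q + B * P <= K * L.
Proof.
have := mulr_ge0 A0 P0; have := mulr_ge0 A0 Q0; have := mulr_ge0 B0 P0.
by have := mulr_ge0 B0 Q0; rewrite /K /L => h1 h2 h3 h4; apply/andP; split; lra.
Qed.

Let AB4 : A * B <= K ^+ 2 / 4.
Proof. by have := sqr_ge0 (A - B); rewrite /K; lra. Qed.

Let PQ4 : P * Q <= L ^+ 2 / 4.
Proof. by have := sqr_ge0 (P - Q); rewrite /L; lra. Qed.

(** Adding L cancels the Laplacian on psi, and each of the three remaining terms has size at most K
    L up to a constant; 336 = 3 (32 + 64 + 16) collects their squares. *)
Lemma perr_dot_le : tmean (tsqr (perr (pdot phi psi))) <= 336 * (K * L) ^+ 2.
Proof.
apply: tmean_le => x y; rewrite tev_sqr.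
have [f f1 f2 f12] := phi_le x y; have [g g1 g2 g12] := psi_le x y.
have -> : tev (perr (pdot phi psi)) x y =
    - K * (tev (tD1 phi) x y * tev (tD1 psi) x y + tev (tD2 phi) x y * tev (tD2 psi) x y)
    + 2 * (A * P + B * Q) * (tev phi x y * tev psi x y)
    + 4 * (tev (tD2 (tD1 phi)) x y * tev (tD2 (tD1 psi)) x y).
  rewrite /perr /pdot (tev_add (plap _)) plap_add !plap_mul !tevE /plap.
  by rewrite !tD12 !eig /K /L; ring.
apply: le_trans (sum3_le _ _ _) _; rewrite !exprMn.
have e1 := sqr_mul_le f1 g1; have e2 := sqr_mul_le f2 g2.
have e3 := sqr_mul_le f g; have e4 := sqr_mul_le f12 g12.
have [/andP[s0 s1]] := APBQ.
have X1 : (- K) ^+ 2 * (tev (tD1 phi) x y * tev (tD1 psi) x y +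
    tev (tD2 phi) x y * tev (tD2 psi) x y) ^+ 2 <= 32 * (K * L) ^+ 2.
  apply: (@le_trans _ _ (K ^+ 2 * (32 * (K * L)))).
    rewrite sqrrN ler_wpM2l ?sqr_ge0//; apply: le_trans (sum2_le _ _) _; lra.
  have -> : K ^+ 2 * (32 * (K * L)) = 32 * (K * L) * (K * K) by ring.
  have -> : 32 * (K * L) ^+ 2 = 32 * (K * L) * (K * L) by ring.
  by rewrite ler_wpM2l ?mulr_ge0// ler_wpM2l.
have X2 : (A * P + B * Q) ^+ 2 * (tev phi x y ^+ 2 * tev psi x y ^+ 2) <= (K * L) ^+ 2 * 16.
  rewrite -exprMn; apply: ler_pM; rewrite ?sqr_ge0//; last lra.
  by rewrite lerXn2r ?nnegrE.
have X3 : tev (tD2 (tD1 phi)) x y ^+ 2 * tev (tD2 (tD1 psi)) x y ^+ 2 <= (K * L) ^+ 2.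
  rewrite -exprMn; apply: le_trans e4 _.
  have -> : (K * L) ^+ 2 = 4 * (K ^+ 2 / 4) * (4 * (L ^+ 2 / 4)) by field.
  by apply: ler_pM; rewrite ?mulr_ge0// ler_wpM2l.
move: X1 X2 X3; rewrite exprMn -!mulrA; lra.
Qed.

(** The same cancellation; 3264 = 3 (64 + 16 * 64), the two mixed terms being estimated together. *)
Lemma perr_curl_le : tmean (tsqr (perr pcurl)) <= 3264 * (K * L) ^+ 3.
Proof.
apply: tmean_le => x y; rewrite tev_sqr.
have [f f1 f2 f12] := phi_le x y; have [g g1 g2 g12] := psi_le x y.
pose a := B - A; pose b := P - Q.
have -> : tev (perr pcurl) x y =
    - (2 * K) * (a * (tev phi x y * tev (tD2 (tD1 psi)) x y)
      + b * (tev (tD2 (tD1 phi)) x y * tev psi x y))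
    + - 4 * (a * P + b * B) * (tev (tD1 phi) x y * tev (tD2 psi) x y)
    + - 4 * (a * Q + b * A) * (tev (tD2 phi) x y * tev (tD1 psi) x y).
  rewrite /perr /pcurl (tev_add (plap _)) plap_scale plap_add !plap_scale !plap_mul.
  rewrite !tevE /plap.
  by rewrite !tD12 !eig /K /L /a /b; ring.
apply: le_trans (sum3_le _ _ _) _.
have e1 := sqr_mul_le f g12; have e2 := sqr_mul_le f12 g.
have e3 := sqr_mul_le f1 g2; have e4 := sqr_mul_le f2 g1.
have [/andP[s0 s1]] := AQBP.
have aK : a ^+ 2 <= K ^+ 2.
  by rewrite /a /K; have := mulr_ge0 A0 B0; rewrite !expr2; lra.
have bL : b ^+ 2 <= L ^+ 2.
  by rewrite /b /L; have := mulr_ge0 P0 Q0; rewrite !expr2; lra.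
have c2 (u v p q : R) : 0 <= p <= L -> 0 <= q <= K -> u ^+ 2 <= K ^+ 2 -> v ^+ 2 <= L ^+ 2 ->
    (u * p + v * q) ^+ 2 <= 4 * (K * L) ^+ 2.
  move=> /andP[p0 pL] /andP[q0 qK] uK vL; apply: le_trans (sum2_le _ _) _.
  have : (u * p) ^+ 2 <= (K * L) ^+ 2.
    by rewrite !exprMn; apply: ler_pM; rewrite ?sqr_ge0// lerXn2r ?nnegrE.
  have : (v * q) ^+ 2 <= (K * L) ^+ 2.
    by rewrite !exprMn mulrC; apply: ler_pM; rewrite ?sqr_ge0// lerXn2r ?nnegrE.
  by lra.
have rA : 0 <= A <= K by rewrite A0 lerDl.
have rB : 0 <= B <= K by rewrite B0 lerDr.
have rP : 0 <= P <= L by rewrite P0 lerDl.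
have rQ : 0 <= Q <= L by rewrite Q0 lerDr.
have X2 := ler_pM (sqr_ge0 _) (sqr_ge0 _) (c2 a b P B rP rB aK bL) e3.
have X3 := ler_pM (sqr_ge0 _) (sqr_ge0 _) (c2 a b Q A rQ rA aK bL) e4.
set U := a * _ + b * _; set V := a * P + _ in X2 *; set V' := a * Q + _ in X3 *.
have U2 : U ^+ 2 <= 16 * (K * L) ^+ 2.
  apply: le_trans (sum2_le _ _) _.
  have := ler_pM (sqr_ge0 _) (sqr_ge0 _) aK e1.
  have := ler_pM (sqr_ge0 _) (sqr_ge0 _) bL e2.
  rewrite -!exprMn.
  have : K ^+ 2 * (4 * (4 * (P * Q))) <= K ^+ 2 * (4 * L ^+ 2).
    by rewrite ler_wpM2l ?sqr_ge0//; have := PQ4; lra.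
  have : L ^+ 2 * (4 * (A * B) * 4) <= L ^+ 2 * (4 * K ^+ 2).
    by rewrite ler_wpM2l ?sqr_ge0//; have := AB4; lra.
  have -> : (K * L) ^+ 2 = K ^+ 2 * L ^+ 2 by ring.
  lra.
have X1 : (2 * K) ^+ 2 * U ^+ 2 <= 64 * (K * L) ^+ 3.
  apply: (@le_trans _ _ ((2 * K) ^+ 2 * (16 * (K * L) ^+ 2))).
    by rewrite ler_wpM2l ?sqr_ge0.
  have -> : (2 * K) ^+ 2 * (16 * (K * L) ^+ 2) = 64 * (K * L) ^+ 2 * (K * K) by ring.
  have -> : 64 * (K * L) ^+ 3 = 64 * (K * L) ^+ 2 * (K * L) by ring.
  by rewrite ler_wpM2l ?mulr_ge0 ?sqr_ge0// ler_wpM2l.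
have X4 : 4 * (K * L) ^+ 2 * (4 * A * (4 * Q)) + 4 * (K * L) ^+ 2 * (4 * B * (4 * P)) <=
    64 * (K * L) ^+ 3.
  have -> : 64 * (K * L) ^+ 3 = 64 * (K * L) ^+ 2 * (K * L) by ring.
  have -> : 4 * (K * L) ^+ 2 * (4 * A * (4 * Q)) + 4 * (K * L) ^+ 2 * (4 * B * (4 * P)) =
    64 * (K * L) ^+ 2 * (A * Q + B * P) by ring.
  by rewrite ler_wpM2l// mulr_ge0// sqr_ge0.
move: X1 X2 X3 X4.
have -> : (- (2 * K) * U) ^+ 2 = (2 * K) ^+ 2 * U ^+ 2 by ring.
have E (v w : R) : (- 4 * v * w) ^+ 2 = 16 * (v ^+ 2 * w ^+ 2) by ring.
rewrite !E; lra.
Qed.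

End eigenfunctions.

(** * Fourier modes *)

Section separated.
Variable R : realType.
Implicit Types p q r : tpoly R.

Definition xonly p := all (fun u => u.1.2 == 0) p.
Definition tswap p : tpoly R := [seq (u.1.1.1, u.1.2, u.1.1.2, u.2) | u <- p].

Lemma tev_swap p x y : tev (tswap p) x y = tev p y x.
Proof.
by rewrite /tev big_map; apply: eq_bigr => u _; rewrite /tang /= [X in X + _]addrC.
Qed.

Lemma xonly_add p q : xonly p -> xonly q -> xonly (tadd p q).
Proof. by rewrite /xonly all_cat => -> ->. Qed.

Lemma xonly_scale a p : xonly p -> xonly (tscale a p).
Proof. by rewrite /xonly all_map. Qed.

Lemma xonly_mul p q : xonly p -> xonly q -> xonly (tmul p q).
Proof.
move=> /allP hp /allP hq; rewrite /xonly all_cat; apply/andP; split;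
  apply/allP => _ /allpairsP[[u v] [/= up vq ->]] /=;
  by rewrite (eqP (hp _ up)) (eqP (hq _ vq)).
Qed.

(** Frequencies of p and of the swapped q lie on different axes, so a term of the product is
    constant only if both factors are. *)
Lemma tmean_sep p q : xonly p -> xonly q ->
  tmean (tmul p (tswap q)) = tmean p * tmean q.
Proof.
move=> /allP hp /allP hq.
have M r : tmean r = \sum_(u <- r) if (u.1.1.2 == 0) && (u.1.2 == 0)
    then u.1.1.1 * cos u.2 else 0 by rewrite /tmean big_mkcond.
rewrite !M /tmul big_cat !big_allpairs_dep/= -big_split/= mulr_suml.
rewrite [LHS]big_seq [RHS]big_seq; apply: eq_bigr => u up.
rewrite -big_split/= big_map mulr_sumr.
rewrite [LHS]big_seq [RHS]big_seq; apply: eq_bigr => v vq /=.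
rewrite (eqP (hp _ up)) (eqP (hq _ vq)) eqxx !andbT !(addr0, subr0, oppr0, add0r, sub0r, oppr_eq0).
case: (u.1.1.2 == 0); case: (v.1.1.2 == 0); rewrite /= ?(mul0r, mulr0, addr0)//.
by rewrite cosD cosB; field.
Qed.

Lemma sep_mean p q r : xonly p -> xonly q ->
  (forall x y, tev r x y = tev p x y * tev q y x) -> tmean r = tmean p * tmean q.
Proof.
move=> hp hq E; rewrite -tmean_sep//; apply: tmean_ext => x y.
by rewrite tev_mul tev_swap E.
Qed.

End separated.

Section modes.
Variable R : realType.
Implicit Types (i j : int) (x y : R).

Definition fco i : R := if i == 0 then 1 else Num.sqrt 2.
(** As sin z = cos (z - pi / 2), one formula covers the three cases of [fourier1]. *)
Definition fph i : R := if i < 0 then - (pi / 2) else 0.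
Definition fmode i x : R := fco i * cos (i%:~R * x + fph i).
Definition fmode' i x : R := - (fco i * i%:~R * sin (i%:~R * x + fph i)).
Definition tmode i : tpoly R := [:: (fco i, i, 0, fph i)].
Definition tC i : tpoly R := [:: ((i != 0)%:R, i + i, 0, fph i + fph i)].
Definition tS i : tpoly R := [:: ((i != 0)%:R, i + i, 0, fph i + fph i - pi / 2)].
Definition tfour (k : int * int) : tpoly R := tmul (tmode k.1) (tswap (tmode k.2)).

Let tev1 c i t x y : tev [:: (c, i, 0, t)] x y = c * cos (i%:~R * x + t) :> R.
Proof. by rewrite /tev big_seq1 /tang /= mul0r addr0. Qed.

Lemma tev_mode i x y : tev (tmode i) x y = fmode i x.
Proof. exact: tev1. Qed.

Lemma tev_mode' i x y : tev (tD1 (tmode i)) x y = fmode' i x.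
Proof.
rewrite /tD1 /= tev1 /fmode' addrA cosDpihalf.
by rewrite mulrN.
Qed.

Lemma tD2_mode i x y : tev (tD2 (tmode i)) x y = 0.
Proof. by rewrite /tD2 /= tev1 /= mulr0 mul0r. Qed.

Let swapD1 (p : tpoly R) x y : tev (tD1 (tswap p)) x y = tev (tD2 p) y x :> R.
Proof.
by rewrite -tev_swap /tD1 /tD2 /tswap -!map_comp.
Qed.

Let swapD2 (p : tpoly R) x y : tev (tD2 (tswap p)) x y = tev (tD1 p) y x :> R.
Proof.
by rewrite -tev_swap /tD1 /tD2 /tswap -!map_comp.
Qed.

Lemma tev_four k x y : tev (tfour k) x y = fmode k.1 x * fmode k.2 y.
Proof. by rewrite tev_mul tev_swap !tev_mode. Qed.

Lemma tfour1 k x y : tev (tD1 (tfour k)) x y = fmode' k.1 x * fmode k.2 y.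
Proof.
by rewrite tD1_mul swapD1 tD2_mode tev_mode' tev_swap tev_mode mulr0 addr0.
Qed.

Lemma tfour2 k x y : tev (tD2 (tfour k)) x y = fmode k.1 x * fmode' k.2 y.
Proof.
by rewrite tD2_mul swapD2 tD2_mode tev_mode' tev_mode mul0r add0r.
Qed.

Let four_D1 k x y : tev (tD1 (tfour k)) x y =
  tev (tmul (tD1 (tmode k.1)) (tswap (tmode k.2))) x y.
Proof. by rewrite tfour1 tev_mul tev_mode' tev_swap tev_mode. Qed.

Let four_D2 k x y : tev (tD2 (tfour k)) x y =
  tev (tmul (tmode k.1) (tswap (tD1 (tmode k.2)))) x y.
Proof. by rewrite tfour2 tev_mul tev_mode tev_swap tev_mode'. Qed.

Let mode11 i x y : tev (tD1 (tD1 (tmode i))) x y = - i%:~R ^+ 2 * fmode i x.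
Proof.
rewrite /tD1 /= tev1 /fmode !addrA cosDpihalf sinDpihalf; ring.
Qed.

Lemma tfour12 k x y : tev (tD2 (tD1 (tfour k))) x y = fmode' k.1 x * fmode' k.2 y.
Proof.
rewrite (@tD2_ext _ _ _ (four_D1 k)) tD2_mul swapD2 !tev_mode'.
by rewrite -tD12 /tD2 /tD1 /= tev1 /= !mulr0 !mul0r add0r.
Qed.

Lemma tfour11 k x y :
  tev (tD1 (tD1 (tfour k))) x y = - k.1%:~R ^+ 2 * tev (tfour k) x y.
Proof.
rewrite (@tD1_ext _ _ _ (four_D1 k)) tD1_mul swapD1 tD2_mode mulr0 addr0.
by rewrite mode11 tev_swap tev_mode tev_four; ring.
Qed.

Lemma tfour22 k x y :
  tev (tD2 (tD2 (tfour k))) x y = - k.2%:~R ^+ 2 * tev (tfour k) x y.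
Proof.
rewrite (@tD2_ext _ _ _ (four_D2 k)) tD2_mul swapD2 tD2_mode mul0r add0r.
by rewrite mode11 tev_mode tev_four; ring.
Qed.

Lemma fourier1E i (x : circle R) : fourier1 i x = fmode i (csec x).
Proof.
have [m E] := rep_shift x.
have <- : fmode i (circle_rep x) = fmode i (csec x).
  rewrite -!(tev_mode i _ 0) E -(tev_periodic (tmode i) (csec x) 0 m 0).
  by rewrite mul0r addr0.
rewrite /fourier1 /fmode /fco /fph.
have [i0|i0|->] := ltgtP i 0.
- by rewrite cosBpihalf.
- by rewrite addr0.
- by rewrite mul0r addr0 cos0 mulr1.
Qed.

Lemma fourier_lift k (x : torus R) : fourier k x = lift2 (tev (tfour k)) x.
Proof. by rewrite /fourier !fourier1E /lift2 tev_four. Qed.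

(** [mC] and [mS] are the double-angle parts: squares of a mode and of its derivative are 1 + mC and
    i^2 (1 - mC), and their product is - i mS. The boolean factor removes them for the constant
    mode. *)
Definition mC i x : R := (i != 0)%:R * cos (2 * (i%:~R * x + fph i)).
Definition mS i x : R := (i != 0)%:R * sin (2 * (i%:~R * x + fph i)).

Lemma tev_C i x y : tev (tC i) x y = mC i x.
Proof. by rewrite tev1 /mC intrD; congr (_ * cos _); ring. Qed.

Lemma tev_S i x y : tev (tS i) x y = mS i x.
Proof.
rewrite tev1 /mS intrD addrA cosBpihalf; congr (_ * sin _); ring.
Qed.

Let co2 i : i != 0 -> fco i ^+ 2 = 2 :> R.
Proof. by move=> i0; rewrite /fco (negbTE i0) sqr_sqrtr. Qed.

Lemma fmode_sqr i x : fmode i x ^+ 2 = 1 + mC i x.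
Proof.
rewrite /fmode /mC; have [->|i0] := eqVneq i 0.
  by rewrite /fco /fph eqxx ltxx mul0r addr0 cos0 mul0r addr0 mulr1 expr1n.
by rewrite exprMn co2// mul1r mulr_natl cos_mulr2n; ring.
Qed.

Lemma fmode'_sqr i x : fmode' i x ^+ 2 = i%:~R ^+ 2 * (1 - mC i x).
Proof.
rewrite /fmode' /mC sqrrN; have [->|i0] := eqVneq i 0.
  by rewrite mulr0 mul0r expr0n mul0r.
rewrite !exprMn co2// mul1r mulr_natl cos_mulr2n.
by rewrite sin2cos2; ring.
Qed.

Lemma fmode_fmode' i x : fmode i x * fmode' i x = - i%:~R * mS i x.
Proof.
rewrite /fmode' /fmode /mS; have [->|i0] := eqVneq i 0.
  by rewrite !(mulr0, mul0r, oppr0).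
rewrite mul1r mulr_natl sin_mulr2n.
transitivity (- (fco i ^+ 2 * i%:~R * (cos (i%:~R * x + fph i) * sin (i%:~R * x + fph i)))).
  by ring.
by rewrite co2//; ring.
Qed.

Lemma tmean_C i : tmean (tC i) = 0.
Proof.
rewrite /tmean big_mkcond big_seq1 /=; case: ifP => // /andP[/eqP i0 _].
by rewrite (_ : i = 0) ?eqxx ?mul0r//; lia.
Qed.

(** [muC] and [sgS] are the correlations of doubled modes; only the resonance |i| = |j| can make
    them nonzero. *)
Definition muC i j : R := tmean (tmul (tC i) (tC j)).
Definition sgS i j : R := tmean (tmul (tS i) (tS j)).

Lemma muC_le i j : `|muC i j| <= 2^-1.
Proof.
rewrite /muC /tmean big_mkcond /tmul /= big_cons big_seq1 /=.
set a := cos _; set b := cos _.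
have a1 : `|a| <= 1 by rewrite ler_norml cos_geN1 cos_le1.
have b1 : `|b| <= 1 by rewrite ler_norml cos_geN1 cos_le1.
have h (c : R) (u v : bool) : `|c| <= 1 -> `|u%:R * v%:R / 2 * c| <= 2^-1.
  move=> c1; case: u; case: v; rewrite ?(mul0r, mulr0, mul1r, normr0)//.
  by rewrite normrM ger0_norm// ler_piMr.
have [->|i0] := eqVneq i 0.
  by rewrite !mul0r !if_same addr0 normr0.
case: ifP => [/andP[/eqP ij _]|_]; case: ifP => [/andP[/eqP ij' _]|_].
- by exfalso; move/eqP: i0; apply; lia.
- by rewrite addr0; exact: (h a true).
- by rewrite add0r; exact: (h b true).
- by rewrite addr0 normr0.
Qed.

Let sep_conds i j : `|i| != `|j| ->
  (((i + i + (j + j)) == 0) = false) * (((i + i - (j + j)) == 0) = false).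
Proof. by move=> ij; split; apply/negbTE; apply/eqP => h; move/eqP: ij; apply; lia. Qed.

Lemma muC_eq0 i j : `|i| != `|j| -> muC i j = 0.
Proof.
move=> /sep_conds[h1 h2]; rewrite /muC /tmean big_mkcond /tmul /= big_cons big_seq1 /=.
by rewrite h1 h2 addr0.
Qed.

Lemma sgS_eq0 i j : `|i| != `|j| -> sgS i j = 0.
Proof.
move=> /sep_conds[h1 h2]; rewrite /sgS /tmean big_mkcond /tmul /= big_cons big_seq1 /=.
by rewrite h1 h2 addr0.
Qed.

Definition tG (a b : R) i j : tpoly R :=
  tmul (tadd (tconst 1) (tscale a (tC i))) (tadd (tconst 1) (tscale b (tC j))).

Lemma xonly_G a b i j : xonly (tG a b i j).
Proof. by apply: xonly_mul; apply: xonly_add => //; exact: xonly_scale. Qed.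

Lemma tmean_G a b i j : tmean (tG a b i j) = 1 + a * b * muC i j.
Proof.
transitivity (tmean (tadd (tadd (tconst 1) (tscale a (tC i)))
   (tadd (tscale b (tC j)) (tscale (a * b) (tmul (tC i) (tC j)))))).
  by apply: tmean_ext => x y; rewrite /tG !tevE; ring.
rewrite (tmean_add (tadd (tconst 1) (tscale a (tC i)))) (tmean_add (tconst 1)).
by rewrite (tmean_add (tscale b (tC j))) !tmean_scale tmean_const !tmean_C /muC; ring.
Qed.

Section products.
Variables k l : int * int.
Let mu := muC k.1 l.1.
Let mu' := muC k.2 l.2.
Let sg := sgS k.1 l.1 * sgS k.2 l.2.
Let c (i : int) : R := i%:~R.

Definition tE (a b a' b' : R) : tpoly R :=
  tmul (tG a b k.1 l.1) (tswap (tG a' b' k.2 l.2)).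
Definition tX : tpoly R :=
  tmul (tmul (tS k.1) (tS l.1)) (tswap (tmul (tS k.2) (tS l.2))).

Lemma tmean_E a b a' b' : tmean (tE a b a' b') = (1 + a * b * mu) * (1 + a' * b' * mu').
Proof. by rewrite tmean_sep ?xonly_G// !tmean_G. Qed.

Lemma tmean_X : tmean tX = sg.
Proof. by rewrite tmean_sep// xonly_mul. Qed.

Let tevEX a b a' b' x y :
  tev (tE a b a' b') x y = (1 + a * mC k.1 x) * (1 + b * mC l.1 x)
    * ((1 + a' * mC k.2 y) * (1 + b' * mC l.2 y)).
Proof. by rewrite /tE tev_mul tev_swap /tG !tevE !tev_C. Qed.

Let tevX x y : tev tX x y = mS k.1 x * mS l.1 x * (mS k.2 y * mS l.2 y).
Proof. by rewrite /tX tev_mul tev_swap !tev_mul !tev_S. Qed.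

Let mean3 (p1 p2 p3 : tpoly R) (a b d : R) : tmean (tadd (tscale a p1) (tadd (tscale b p2) (tscale d p3))) =
  a * tmean p1 + b * tmean p2 + d * tmean p3.
Proof.
by rewrite (tmean_add (tscale _ _)) (tmean_add (tscale _ _)) !tmean_scale addrA.
Qed.

Let tev3 (p1 p2 p3 : tpoly R) (a b d x y : R) :
  tev (tadd (tscale a p1) (tadd (tscale b p2) (tscale d p3))) x y =
  a * tev p1 x y + b * tev p2 x y + d * tev p3 x y.
Proof.
by rewrite (tev_add (tscale _ _)) (tev_add (tscale _ _)) !tev_scale addrA.
Qed.

Let tev_dot (p q : tpoly R) x y : tev (pdot p q) x y =
  tev (tD1 p) x y * tev (tD1 q) x y + tev (tD2 p) x y * tev (tD2 q) x y.
Proof. by rewrite /pdot !tevE. Qed.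

Let tev_wedge (p q : tpoly R) x y : tev (pwedge p q) x y =
  tev (tD1 p) x y * tev (tD2 q) x y - tev (tD2 p) x y * tev (tD1 q) x y.
Proof. by rewrite /pwedge !tevE. Qed.

Let tev_curl (p q : tpoly R) (A B P Q : R) x y : tev (pcurl p q A B P Q) x y =
  2 * ((B - A) * (tev p x y * tev (tD2 (tD1 q)) x y)
    + (P - Q) * (tev (tD2 (tD1 p)) x y * tev q x y)).
Proof. by rewrite /pcurl !tevE. Qed.

(** Every term of the expanded square separates into a function of x and one of y. Squares of modes
    give factors 1 + mC or 1 - mC, hence the correlations [mu] and [mu']; the mixed term gives [mS]
    four times, hence [sg]. The same holds for the wedge product and the curl. *)
Lemma mean_dot : tmean (tsqr (pdot (tfour k) (tfour l))) =
  (c k.1 ^+ 2 * c l.1 ^+ 2 + c k.2 ^+ 2 * c l.2 ^+ 2) * ((1 + mu) * (1 + mu'))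
  + 2 * (c k.1 * c k.2 * c l.1 * c l.2) * sg.
Proof.
transitivity (tmean (tadd (tscale (c k.1 ^+ 2 * c l.1 ^+ 2) (tE (-1) (-1) 1 1))
  (tadd (tscale (c k.2 ^+ 2 * c l.2 ^+ 2) (tE 1 1 (-1) (-1)))
   (tscale (2 * (c k.1 * c k.2 * c l.1 * c l.2)) tX)))).
  apply: tmean_ext => x y; rewrite tev3 !tevEX tevX tev_sqr tev_dot !tfour1 !tfour2.
  transitivity (fmode' k.1 x ^+ 2 * fmode' l.1 x ^+ 2 * (fmode k.2 y ^+ 2 * fmode l.2 y ^+ 2) +
    fmode k.1 x ^+ 2 * fmode l.1 x ^+ 2 * (fmode' k.2 y ^+ 2 * fmode' l.2 y ^+ 2) +
    2 * ((fmode k.1 x * fmode' k.1 x) * (fmode l.1 x * fmode' l.1 x) *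
     ((fmode k.2 y * fmode' k.2 y) * (fmode l.2 y * fmode' l.2 y)))); first by ring.
  by rewrite !fmode_sqr !fmode'_sqr !fmode_fmode' /c; ring.
by rewrite mean3 !tmean_E tmean_X; ring.
Qed.

Lemma mean_wedge : tmean (tsqr (pwedge (tfour k) (tfour l))) =
  (c k.1 ^+ 2 * c l.2 ^+ 2 + c k.2 ^+ 2 * c l.1 ^+ 2) * ((1 - mu) * (1 - mu'))
  - 2 * (c k.1 * c k.2 * c l.1 * c l.2) * sg.
Proof.
transitivity (tmean (tadd (tscale (c k.1 ^+ 2 * c l.2 ^+ 2) (tE (-1) 1 1 (-1)))
  (tadd (tscale (c k.2 ^+ 2 * c l.1 ^+ 2) (tE 1 (-1) (-1) 1))
   (tscale (- (2 * (c k.1 * c k.2 * c l.1 * c l.2))) tX)))).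
  apply: tmean_ext => x y; rewrite tev3 !tevEX tevX tev_sqr tev_wedge !tfour1 !tfour2.
  transitivity (fmode' k.1 x ^+ 2 * fmode l.1 x ^+ 2 * (fmode k.2 y ^+ 2 * fmode' l.2 y ^+ 2) +
    fmode k.1 x ^+ 2 * fmode' l.1 x ^+ 2 * (fmode' k.2 y ^+ 2 * fmode l.2 y ^+ 2) -
    2 * ((fmode k.1 x * fmode' k.1 x) * (fmode l.1 x * fmode' l.1 x) *
     ((fmode k.2 y * fmode' k.2 y) * (fmode l.2 y * fmode' l.2 y)))); first by ring.
  by rewrite !fmode_sqr !fmode'_sqr !fmode_fmode' /c; ring.
by rewrite mean3 !tmean_E tmean_X; ring.
Qed.

Lemma mean_curl (A B P Q : R) : tmean (tsqr (pcurl (tfour k) (tfour l) A B P Q)) =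
  4 * (((B - A) ^+ 2 * (c l.1 ^+ 2 * c l.2 ^+ 2) + (P - Q) ^+ 2 * (c k.1 ^+ 2 * c k.2 ^+ 2))
    * ((1 - mu) * (1 - mu'))
    + 2 * (B - A) * (P - Q) * (c k.1 * c k.2 * c l.1 * c l.2) * sg).
Proof.
transitivity (tmean (tadd (tscale (4 * ((B - A) ^+ 2 * (c l.1 ^+ 2 * c l.2 ^+ 2))) (tE 1 (-1) 1 (-1)))
  (tadd (tscale (4 * ((P - Q) ^+ 2 * (c k.1 ^+ 2 * c k.2 ^+ 2))) (tE (-1) 1 (-1) 1))
   (tscale (8 * (B - A) * (P - Q) * (c k.1 * c k.2 * c l.1 * c l.2)) tX)))).
  apply: tmean_ext => x y; rewrite tev3 !tevEX tevX tev_sqr tev_curl !tfour12 !tev_four.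
  transitivity (4 * (B - A) ^+ 2 * (fmode k.1 x ^+ 2 * fmode' l.1 x ^+ 2 * (fmode k.2 y ^+ 2 * fmode' l.2 y ^+ 2)) +
    4 * (P - Q) ^+ 2 * (fmode' k.1 x ^+ 2 * fmode l.1 x ^+ 2 * (fmode' k.2 y ^+ 2 * fmode l.2 y ^+ 2)) +
    8 * (B - A) * (P - Q) * ((fmode k.1 x * fmode' k.1 x) * (fmode l.1 x * fmode' l.1 x) *
     ((fmode k.2 y * fmode' k.2 y) * (fmode l.2 y * fmode' l.2 y)))); first by ring.
  by rewrite !fmode_sqr !fmode'_sqr !fmode_fmode' /c; ring.
by rewrite mean3 !tmean_E tmean_X; ring.
Qed.

End products.

Lemma tfour_sqr_le k x y (A := k.1%:~R ^+ 2 : R) (B := k.2%:~R ^+ 2 : R) :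
  [/\ tev (tfour k) x y ^+ 2 <= 4, tev (tD1 (tfour k)) x y ^+ 2 <= 4 * A,
      tev (tD2 (tfour k)) x y ^+ 2 <= 4 * B &
      tev (tD2 (tD1 (tfour k))) x y ^+ 2 <= 4 * (A * B)].
Proof.
have C i z : -1 <= mC i z <= 1.
  rewrite /mC; case: (i != 0); rewrite ?mul1r ?mul0r ?cos_geN1 ?cos_le1//.
  by apply/andP; split; lra.
have f2 i z : fmode i z ^+ 2 <= 2.
  by rewrite fmode_sqr; have /andP[_] := C i z; lra.
have f2' i z : fmode' i z ^+ 2 <= 2 * i%:~R ^+ 2.
  rewrite fmode'_sqr mulrC ler_wpM2r ?sqr_ge0//.
  by have /andP[] := C i z; lra.
rewrite tev_four tfour1 tfour2 tfour12 /A /B.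
have m (u v a b : R) : u ^+ 2 <= a -> v ^+ 2 <= b -> (u * v) ^+ 2 <= a * b.
  by move=> ua vb; rewrite exprMn ler_pM ?sqr_ge0.
split.
- by have := m _ _ _ _ (f2 k.1 x) (f2 k.2 y); lra.
- by have := m _ _ _ _ (f2' k.1 x) (f2 k.2 y); lra.
- by have := m _ _ _ _ (f2 k.1 x) (f2' k.2 y); lra.
- by have := m _ _ _ _ (f2' k.1 x) (f2' k.2 y); lra.
Qed.

End modes.

(** * Products in H^1 of Fourier modes *)

Section eigen_norms.
Variable R : realType.
Implicit Types p q : tpoly R.

Lemma tH1_eigen p q (a : R) : (forall x y, tev (plap q) x y = - a * tev q x y) ->
  tmean (tH1 p q) = (a + 4) * tmean (tmul p q).
Proof.
move=> E; transitivity (tmean (tadd (tdiv (tmul p (tD1 q)) (tmul p (tD2 q)))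
    (tscale (a + 4) (tmul p q)))).
  apply: tmean_ext => x y; have := E x y.
  rewrite /plap (tev_add (tD1 (tD1 q))) /tH1 /pdot /tdiv !tevE.
  by move=> /(canRL (addrK _)) ->; ring.
by rewrite tmean_add tmean_div tmean_scale add0r.
Qed.

Lemma tH1_sym p q : tmean (tH1 p q) = tmean (tH1 q p).
Proof. by apply: tmean_ext => x y; rewrite /tH1 /pdot !tevE; ring. Qed.

Lemma plap_four k x y : tev (plap (tfour R k)) x y =
  - (k.1%:~R ^+ 2 + k.2%:~R ^+ 2) * tev (tfour R k) x y.
Proof. by rewrite /plap (tev_add (tD1 _)) tfour11 tfour22; ring. Qed.

Lemma tmean_four_sqr k : tmean (tsqr (tfour R k)) = 1.
Proof.
have x1 i : xonly (tadd (tconst 1) (tC R i)) by [].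
have m1 i : tmean (tadd (tconst 1) (tC R i)) = 1.
  by rewrite (tmean_add (tconst 1)) tmean_const tmean_C addr0.
rewrite (sep_mean (x1 k.1) (x1 k.2)) ?m1 ?mulr1// => x y.
by rewrite tev_sqr tev_four exprMn !fmode_sqr (tev_add (tconst 1) (tC R k.1))
  (tev_add (tconst 1) (tC R k.2)) !tev_const !tev_C.
Qed.

Lemma tH1_four k : tmean (tH1 (tfour R k) (tfour R k)) =
  k.1%:~R ^+ 2 + k.2%:~R ^+ 2 + 4.
Proof. by rewrite (tH1_eigen _ (plap_four k)) tmean_four_sqr mulr1. Qed.

(** The symmetric H^1 product is (a + 4) times the mean of the product for either eigenvalue a; two
    different values force that mean to vanish. *)
Lemma tH1_four_orth k l :
  k.1%:~R ^+ 2 + k.2%:~R ^+ 2 <> l.1%:~R ^+ 2 + l.2%:~R ^+ 2 :> R ->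
  tmean (tH1 (tfour R k) (tfour R l)) = 0.
Proof.
move=> kl; have := tH1_sym (tfour R k) (tfour R l).
rewrite (tH1_eigen _ (plap_four k)) (tH1_eigen _ (plap_four l)).
have -> : tmean (tmul (tfour R l) (tfour R k)) = tmean (tmul (tfour R k) (tfour R l)).
  by apply: tmean_ext => x y; rewrite !tev_mul mulrC.
set m := tmean _ => /eqP; rewrite -subr_eq0 -mulrBl mulf_eq0 => /orP[/eqP h|/eqP ->].
  by exfalso; apply: kl; move: h; lra.
by rewrite mulr0.
Qed.

End eigen_norms.

(** * Curvature of a fixed mode against a mode of high frequency *)

Section lower_bound.
Variables (R : realType) (k l : int * int).
Let c (i : int) : R := i%:~R.
Let A := c k.1 ^+ 2.
Let B := c k.2 ^+ 2.
Let P := c l.1 ^+ 2.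
Let Q := c l.2 ^+ 2.
Let K := A + B.
Let L := P + Q.
Local Notation phi := (tfour R k).
Local Notation psi := (tfour R l).
Hypotheses (A1 : 100 <= A) (B1 : 100 <= B).
(** [L1] absorbs the terms 2 K / L and 6 / L of [dot_bound] and separates the frequencies, [L2]
    absorbs the defect of the curl, and [L3] that of grad phi . grad psi. *)
Hypotheses (L1 : 16 * K + 48 <= L) (L2 : 2448 * (K * K) <= L)
  (L3 : 400 * (300 * K) <= L).

Let A0 : 0 <= A. Proof. exact: sqr_ge0. Qed.
Let B0 : 0 <= B. Proof. exact: sqr_ge0. Qed.
Let P0 : 0 <= P. Proof. exact: sqr_ge0. Qed.
Let Q0 : 0 <= Q. Proof. exact: sqr_ge0. Qed.
Let K200 : 200 <= K. Proof. by move: A1 B1; rewrite /K; lra. Qed.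
Let KL : K <= L. Proof. by move: L1 K200; lra. Qed.
Let Lpos : 0 < L. Proof. by move: KL K200; lra. Qed.
Let Lge1 : 1 <= L. Proof. by move: KL K200; lra. Qed.

(** Resonance in both variables at once would give L = K, against [L1]. *)
Let sg0 : sgS R k.1 l.1 * sgS R k.2 l.2 = 0.
Proof.
have [e1|/sgS_eq0 -> //] := eqVneq `|k.1| `|l.1|; last by rewrite mul0r.
have [e2|/sgS_eq0 -> //] := eqVneq `|k.2| `|l.2|; last by rewrite mulr0.
exfalso; have E (i j : int) : `|i| = `|j| -> c i ^+ 2 = c j ^+ 2.
  by move=> ij; rewrite -(real_normK (num_real (c i))) -(real_normK (num_real (c j)))
    /c -!intr_norm ij.
have : L = K by rewrite /L /K /A /B /P /Q (E _ _ e1) (E _ _ e2).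
by move: L1 K200; lra.
Qed.

Let mu := muC R k.1 l.1.
Let mu' := muC R k.2 l.2.

Let wedge_le : tmean (tsqr (pwedge phi psi)) <= 9 / 4 * (K * L).
Proof.
rewrite mean_wedge sg0 mulr0 subr0 -/(c _) -/A -/B -/P -/Q -/mu -/mu'.
have h1 := muC_le R k.1 l.1; have h2 := muC_le R k.2 l.2.
move: h1 h2; rewrite !ler_norml -/mu -/mu' => /andP[a1 a2] /andP[b1 b2].
have : (1 - mu) * (1 - mu') <= 3 / 2 * (3 / 2) by apply: ler_pM; lra.
have : 0 <= (1 - mu) * (1 - mu') by apply: mulr_ge0; lra.
move: (_ * _) => m m0 m1.
have AQ : 0 <= A * Q + B * P <= K * L.
  have := mulr_ge0 A0 P0; have := mulr_ge0 A0 Q0; have := mulr_ge0 B0 P0.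
  have := mulr_ge0 B0 Q0; rewrite /K /L => g1 g2 g3 g4; apply/andP; split; lra.
case/andP: AQ => q0 q1; rewrite mulrC; apply: ler_pM => //; lra.
Qed.

Let curl_ge : (B - A) ^+ 2 * (P * Q) + (P - Q) ^+ 2 * (A * B) <=
  tmean (tsqr (pcurl phi psi A B P Q)).
Proof.
rewrite mean_curl sg0 mulr0 addr0 -/(c _) -/A -/B -/P -/Q -/mu -/mu'.
have h1 := muC_le R k.1 l.1; have h2 := muC_le R k.2 l.2.
move: h1 h2; rewrite !ler_norml -/mu -/mu' => /andP[a1 a2] /andP[b1 b2].
have : 2^-1 * 2^-1 <= (1 - mu) * (1 - mu') by apply: ler_pM; lra.
move: ((1 - mu) * _) => m m1.
have gen (u : R) : 0 <= u -> u <= 4 * (u * m).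
  by move=> u0; have := ler_wpM2l u0 m1; lra.
by apply: gen; rewrite addr_ge0// mulr_ge0 ?sqr_ge0// mulr_ge0.
Qed.

(** 13/4 = 9/4 + 1/2 + 1/2: the first part pays for the squared wedge product, the second for the
    defect (3/8) 3264 K^3 = 1224 K^3 <= K L / 2, and the third remains. *)
Let Qsec_curl : 13 / 4 * (K * L) * L <=
    3 / 8 * ((B - A) ^+ 2 * (P * Q) + (P - Q) ^+ 2 * (A * B)) ->
  K * L / 8 <= 6 * Qsec phi psi.
Proof.
move=> h; rewrite /Qsec.
have b1 := curl_bound (@tfour11 R k) (@tfour22 R k) (@tfour11 R l) (@tfour22 R l) Lge1.
have b2 := perr_curl_le A0 B0 P0 Q0 (@tfour11 R k) (@tfour22 R k) (@tfour11 R l)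
  (@tfour22 R l) Lge1 KL (tfour_sqr_le k) (tfour_sqr_le l).
have b3 := wedge_le; have b4 := curl_ge.
move: b1 b2 b3 b4; rewrite -/(c _) -/A -/B -/P -/Q -/L -/K -/(tsqr (pwedge phi psi)).
move: (tmean (tsqr (pcurl phi psi A B P Q))) (tmean (tsqr (perr P Q (pcurl phi psi A B P Q))))
  (tmean (tsqr (pwedge phi psi))) (tmean (pWZ phi psi)) => o e w z b1 b2 b3 b4.
have e1 : e / L ^+ 3 <= 3264 * K ^+ 3.
  by rewrite ler_pdivrMr ?exprn_gt0// -mulrA -exprMn.
have o1 : 13 / 4 * (K * L) <= 3 / 8 * (o / L).
  rewrite [leRHS]mulrA ler_pdivlMr//; apply: le_trans h _.
  by rewrite ler_wpM2l.
have k3 : 2448 * K ^+ 3 <= K * L.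
  have := ler_wpM2l (le_trans ler01 (le_trans (ler1n R 200) K200)) L2.
  by rewrite mulrCA !exprS expr0 mulr1.
have kl : 0 <= K * L by rewrite mulr_ge0 ?addr_ge0.
move: b1 e1 o1 k3 kl b3; move: (e / L ^+ 3) (o / L) (K ^+ 3) (K * L) => e' o' k3 kl.
lra.
Qed.

(** If |P - Q| >= L / 2, the term (P - Q)^2 A B of the curl is large because A B >= 50 K. Otherwise
    P Q >= (3/16) L^2, and if |B - A| >= K / 2 the term (B - A)^2 P Q is large because K >= 200. In
    the remaining case the curl may be small and the gradient field takes over. *)
Lemma Qsec_four_ge : K * L / 8 <= 6 * Qsec phi psi.
Proof.
pose a := B - A; pose b := P - Q.
have [b2|b2] := leP (L ^+ 2 / 4) (b ^+ 2).
  apply: Qsec_curl; rewrite -/a -/b.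
  have AB : 50 * K <= A * B.
    have : 0 <= (A - 100) * (B - 100) by rewrite mulr_ge0 ?subr_ge0.
    by move: A1 B1; rewrite /K; lra.
  have : L ^+ 2 / 4 * (50 * K) <= b ^+ 2 * (A * B).
    apply: ler_pM => //; first by rewrite divr_ge0// sqr_ge0.
    by move: K200; lra.
  have : 0 <= a ^+ 2 * (P * Q) by rewrite mulr_ge0 ?sqr_ge0// mulr_ge0.
  have : 0 <= L ^+ 2 * K by rewrite mulr_ge0 ?sqr_ge0 ?addr_ge0.
  move: (a ^+ 2 * _) (b ^+ 2 * _) => u v.
  have -> : 13 / 4 * (K * L) * L = 13 / 4 * (L ^+ 2 * K) by ring.
  have -> : L ^+ 2 / 4 * (50 * K) = 50 / 4 * (L ^+ 2 * K) by field.
  by move: (L ^+ 2 * K) => x; lra.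
have PQE : P * Q = (L ^+ 2 - b ^+ 2) / 4 by rewrite /L /b; field.
have [a2|a2] := leP (K ^+ 2 / 4) (a ^+ 2).
  apply: Qsec_curl; rewrite -/a -/b.
  have PQ : 3 / 16 * L ^+ 2 <= P * Q by rewrite PQE; lra.
  have : K ^+ 2 / 4 * (3 / 16 * L ^+ 2) <= a ^+ 2 * (P * Q).
    apply: ler_pM => //; first by rewrite divr_ge0// sqr_ge0.
    by rewrite mulr_ge0// sqr_ge0.
  have : 0 <= b ^+ 2 * (A * B) by rewrite mulr_ge0 ?sqr_ge0// mulr_ge0.
  have : 200 * (L ^+ 2 * K) <= K * (L ^+ 2 * K).
    by rewrite ler_wpM2r// mulr_ge0 ?sqr_ge0 ?addr_ge0.
  have : 0 <= L ^+ 2 * K by rewrite mulr_ge0 ?sqr_ge0 ?addr_ge0.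
  move: (a ^+ 2 * _) (b ^+ 2 * _) => u v.
  have -> : 13 / 4 * (K * L) * L = 13 / 4 * (L ^+ 2 * K) by ring.
  have -> : K ^+ 2 / 4 * (3 / 16 * L ^+ 2) = 3 / 64 * (K * (L ^+ 2 * K)) by field.
  by move: (K * (L ^+ 2 * K)) (L ^+ 2 * K) => x x'; lra.
have Kp : 0 < K by move: K200; lra.
have sq (x y : R) : 0 < y -> x ^+ 2 < y ^+ 2 / 4 -> - (y / 2) < x < y / 2.
  move=> y0; have -> : y ^+ 2 / 4 = (y / 2) ^+ 2 by field.
  rewrite -real_ltr_norml ?num_real// -(real_normK (num_real x)).
  by rewrite ltr_pXn2r// nnegrE divr_ge0// ltW.
have /andP[b3 b4] := sq _ _ Lpos b2; have /andP[a3 a4] := sq _ _ Kp a2.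
have nAP (i j : int) : c i ^+ 2 < c j ^+ 2 -> `|i| != `|j|.
  move=> ij; apply/eqP => E; move: ij.
  by rewrite -(real_normK (num_real (c i))) -(real_normK (num_real (c j)))
    /c -!intr_norm E ltxx.
(* Here P and Q both exceed L / 4, hence A and B, so that there is no resonance and the means are
   explicit. *)
have mu0 : mu = 0.
  by apply: muC_eq0; apply: nAP; rewrite -/A -/P; move: b3 b4 L1 A0 B0; rewrite /b /L /K; lra.
have mu'0 : mu' = 0.
  by apply: muC_eq0; apply: nAP; rewrite -/B -/Q; move: b3 b4 L1 A0 B0; rewrite /b /L /K; lra.
have dE : tmean (tsqr (pdot phi psi)) = A * P + B * Q.
  by rewrite mean_dot sg0 -/mu -/mu' mu0 mu'0 -/(c _) -/A -/B -/P -/Q; ring.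
have wE : tmean (tsqr (pwedge phi psi)) = A * Q + B * P.
  by rewrite mean_wedge sg0 -/mu -/mu' mu0 mu'0 -/(c _) -/A -/B -/P -/Q; ring.
have b1' := dot_bound (@tfour11 R k) (@tfour22 R k) (@tfour11 R l) (@tfour22 R l) Lge1.
have b2' := perr_dot_le A0 B0 P0 Q0 (@tfour11 R k) (@tfour22 R k) (@tfour11 R l)
  (@tfour22 R l) Lge1 KL (tfour_sqr_le k) (tfour_sqr_le l).
move: b1' b2'; rewrite dE -/(c _) -/A -/B -/P -/Q -/L -/K /Qsec -/(tsqr (pwedge phi psi)) wE.
move: (tmean (tsqr (perr P Q (pdot phi psi)))) (tmean (pWZ phi psi)) => e z b1' b2'.
have dd : A * P + B * Q = (K * L - a * b) / 2 by rewrite /K /L /a /b; field.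
have ww : A * Q + B * P = (K * L + a * b) / 2 by rewrite /K /L /a /b; field.
have ab : - (K * L / 4) <= a * b <= K * L / 4.
  rewrite -ler_norml normrM.
  have -> : K * L / 4 = K / 2 * (L / 2) by field.
  by apply: ler_pM => //; rewrite ler_norml; apply/andP; split; lra.
have e1 : e / L ^+ 2 <= 336 * K ^+ 2.
  by rewrite ler_pdivrMr ?exprn_gt0// -mulrA -exprMn.
have k2 : 400 * 300 * K ^+ 2 <= K * L.
  have := ler_wpM2l (ltW Kp) L3.
  have -> : K * (400 * (300 * K)) = 400 * 300 * K ^+ 2 by ring.
  by [].
have dL : 3 / 4 <= 7 / 8 - 2 * K / L - 6 / L.
  have : (2 * K + 6) / L <= 8^-1.
    by rewrite ler_pdivrMr//; move: L1; lra.
  by rewrite mulrDl; lra.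
have d0 : 0 <= A * P + B * Q by rewrite addr_ge0// mulr_ge0.
(* With x = a b and |x| <= K L / 4, the main part (9/8)(K L - x) - (K L + x) / 2 is at least (7/32)
   K L. The defect 33 * 336 K^2 is below (3/32) K L by [L3], which leaves K L / 8. *)
have := ler_wpM2l d0 dL.
move: b1' ab e1 k2 => + /andP[].
rewrite -(mulrA 11) dd ww; move: (7 / 8 - 2 * K / L - 6 / L) (e / L ^+ 2) => w e'.
by move: (K ^+ 2) (K * L) (a * b) => k2 kl ab; lra.
Qed.

(** The modes are H^1 orthogonal, so the Gram determinant is (K + 4)(L + 4) <= 4 K L, and K L / 8
    over 4 K L is 1/32. *)
Lemma Sec_four_ge : 32^-1 <= Sec (torus_vol R) (@fourier R k) (@fourier R l).
Proof.
have [_ ->] := Sec_lift (@fourier_lift R k) (@fourier_lift R l).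
rewrite (Gram_lift (@fourier_lift R k) (@fourier_lift R l)) !tH1_four tH1_four_orth; last first.
  by rewrite -/(c _) -/A -/B -/P -/Q -/K -/L => E; move: L1 K200; rewrite -E; lra.
rewrite expr0n subr0 -/(c _) -/A -/B -/P -/Q -/K -/L.
have G0 : 0 < (K + 4) * (L + 4) by move: K200 Lpos => ? ?; rewrite mulr_gt0//; lra.
rewrite ler_pdivlMr//; apply: le_trans Qsec_four_ge.
have : (K + 4) * (L + 4) <= (2 * K) * (2 * L).
  by apply: ler_pM; move: K200 KL; lra.
by move: ((K + 4) * _) => G; lra.
Qed.

End lower_bound.

(** * Divergence of the sum *)

Section lattice_sum.
Variables (R : realType) (S : int * int -> R) (k : int * int).
Let N (l : int * int) : R := enorm (l.1%:~R, l.2%:~R).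
Let Ball (L : R) : set (int * int) := [set l | N l <= L /\ l != k].

Let finite_ball L : finite_set (Ball L).
Proof.
pose n := Num.bound `|L|.
pose s := [seq (Posz m : int) | m <- iota 0 n] ++ [seq (- Posz m : int) | m <- iota 0 n].
apply: (@sub_finite_set _ _ ([set` s] `*` [set` s])); last exact: finite_setX.
have mem (i : int) : `|i%:~R : R| <= L -> i \in s.
  move=> iL; have i_lt : (`|i| < n)%N.
    rewrite -(ltr_nat R) natr_absz intr_norm.
    exact: le_lt_trans iL (le_lt_trans (ler_norm L) (archi_boundP (normr_ge0 L))).
  rewrite mem_cat; case: (leP 0 i) => i0; apply/orP; [left|right];
    apply/mapP; exists `|i|%N; rewrite ?mem_iota//; lia.
move=> [i j] [ijL _]; split=> /=; apply: mem; apply: le_trans ijL.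
  by rewrite -sqrtr_sqr ler_wsqrtr//= lerDl sqr_ge0.
by rewrite -sqrtr_sqr ler_wsqrtr//= lerDr sqr_ge0.
Qed.

Let le_bound (x : R) : x <= (Num.bound `|x|)%:R.
Proof. exact: le_trans (ler_norm x) (ltW (archi_boundP (normr_ge0 x))). Qed.

(** The finitely many l of norm below r contribute a constant [S0] of unknown sign; each of the
    others adds at least c. *)
Lemma lattice_sum_infty (c r : R) : 0 < c -> (forall l, r <= N l -> c <= S l) ->
  (\sum_(l \in Ball L) S l)%:E @[L --> +oo%R] --> +oo%E.
Proof.
move=> c0 cS; apply/cvgeyPge => T.
pose C : set (int * int) := [set l | N l < r /\ l != k].
pose S0 := \sum_(l \in C) S l.
pose n := Num.bound `|(T - S0) / c|.
(* The points (M + m, 0) have norm at least r and differ from k, since M exceeds |k.1|; n of them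
   suffice to pass T. *)
pose M := (Num.bound `|r|%R + `|k.1|.+1)%N.
pose g (m : nat) : int * int := ((M + m)%:Z, 0).
have Ng m : N (g m) = (M + m)%:R.
  by rewrite /N /enorm /= expr0n addr0 sqrtr_sqr pmulrn ger0_norm.
have rM : r <= M%:R.
  by apply: le_trans (le_bound r) _; rewrite ler_nat leq_addr.
near=> L.
have Lr : r <= L by near: L; apply: nbhs_pinfty_ge; exact: num_real.
have LM : (M + n)%:R <= L by near: L; apply: nbhs_pinfty_ge; exact: num_real.
rewrite lee_fin (fsbigID [set l | N l < r])//.
have -> : Ball L `&` [set l | N l < r] = C.
  apply/seteqP; split=> [l [[_ lk] lr]|l [lr lk]]; first by split.
  by split=> //; split=> //; apply: (ltW (lt_le_trans lr Lr)).
rewrite -/S0; set D := Ball L `&` _.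
have fD : finite_set D by exact: finite_setIl.
rewrite (fsbigID (g @` `I_n) D)//.
have -> : D `&` (g @` `I_n) = g @` `I_n.
  apply/setIidPr => _ [m /= mn <-]; split; last first.
    by rewrite /= Ng; apply/negP; rewrite -leNgt; apply: le_trans rM _; rewrite ler_nat leq_addr.
  split; first by rewrite Ng; apply: le_trans LM; rewrite ler_nat leq_add2l ltnW.
  by apply/eqP => E; have := congr1 fst E; rewrite /g /M /=; lia.
rewrite fsbig_image; last by move=> u v _ _ []; lia.
rewrite -fsbig_ord.
have lo : n%:R * c <= \sum_(m < n) S (g m).
  rewrite mulr_natl -[X in _ *+ X]card_ord -sumr_const; apply: ler_sum => m _.
  by apply: cS; rewrite Ng; apply: le_trans rM _; rewrite ler_nat leq_addr.
have : 0 <= \sum_(l \in D `&` ~` (g @` `I_n)) S l.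
  apply: fsumr_ge0 => l [[_ /negP lr] _]; apply: le_trans (ltW c0) (cS _ _).
  by rewrite leNgt.
have : T - S0 <= n%:R * c.
  by rewrite -ler_pdivrMr//; exact: le_bound.
move=> h1 h2.
suff : T <= S0 + (\sum_(m < n) S (g m) + \sum_(l \in D `&` ~` (g @` `I_n)) S l) by [].
by lra.
Unshelve. all: by end_near.
Qed.

End lattice_sum.

Lemma Sec_sum_infty (R : realType) (k : int * int) :
  (10 <= `|k.1|)%N -> (10 <= `|k.2|)%N ->
  (Sec_sum (torus_vol R) k L)%:E @[L --> +oo%R] --> +oo%E.
Proof.
move=> k1 k2; pose K : R := k.1%:~R ^+ 2 + k.2%:~R ^+ 2.
have big (i : int) : (10 <= `|i|)%N -> 100 <= i%:~R ^+ 2 :> R.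
  move=> i10; rewrite -(real_normK (num_real _)) -intr_norm -natr_absz.
  have -> : 100 = 10%:R ^+ 2 :> R by rewrite -natrX.
  by rewrite lerXn2r ?nnegrE// ler_nat.
have K0 : 0 <= K by rewrite addr_ge0 ?sqr_ge0.
pose L0 := (16 * K + 48) + 2448 * (K * K) + 400 * (300 * K).
have KK : 0 <= K * K by rewrite mulr_ge0.
apply: (@lattice_sum_infty _ _ _ 32^-1 (Num.sqrt L0)); first by rewrite invr_gt0.
move=> l lL.
have {}lL : L0 <= l.1%:~R ^+ 2 + l.2%:~R ^+ 2.
  rewrite -[leRHS]sqr_sqrtr ?addr_ge0 ?sqr_ge0// -[leLHS]sqr_sqrtr; last by rewrite /L0; lra.
  by rewrite lerXn2r ?nnegrE ?sqrtr_ge0.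
apply: Sec_four_ge; rewrite ?big// -/K; apply: le_trans lL; rewrite /L0; lra.
Qed.

Theorem corollary6p17 (R : realType) :
  exists N : nat, forall i j : int, (N <= `|i|)%N -> (N <= `|j|)%N ->
    [/\ forall l : int * int, l != (i, j) ->
          Sec_exists (torus_vol R) (@fourier R (i, j)) (@fourier R l),
        cvg ((Sec_sum (torus_vol R) (i, j) L)%:E @[L --> +oo%R])
      & Ric (torus_vol R) (i, j) = +oo%E].
Proof.
exists 10%N => i j i10 j10.
have inf := @Sec_sum_infty R (i, j) i10 j10.
split=> [l _||].
- by have [] := Sec_lift (@fourier_lift R (i, j)) (@fourier_lift R l).
- by apply/cvg_ex; exists +oo%E.
rewrite /Ric (cvg_lim _ inf)// gt0_muley// lte_fin.
(* The factor in front is i^2 + j^2 + 4 > 0, so the product with +oo is +oo. *)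
rewrite (H1_normsq_lift (@fourier_lift R (i, j))) tH1_four /=.
by have := sqr_ge0 (i%:~R : R); have := sqr_ge0 (j%:~R : R); lra.
Qed.
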